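(* Let $X$ be a compact metrizable abelian group and $T:X\to X$ a continuous group automorphism, and suppose $(X,T)$ satisfies the descending chain condition. Then $(X,T)$ has dense periodic measures, i.e. the finitely supported measures in $\mathcal{M}_T(X)$ are weak-* dense in $\mathcal{M}_T(X)$. Moreover, if $T$ is ergodic with respect to the Haar measure on $X$, then $(X,T)$ has dense ergodic periodic measures, i.e. the finitely supported ergodic measures in $\mathcal{M}_T(X)$ are weak-* dense in $\mathcal{M}_T(X)$.
   Context: $\mathcal{M}_T(X)$ denotes the set of $T$-invariant Borel probability measures on $X$ with the weak-* topology. $(X,T)$ satisfies the descending chain condition (dcc) if every non-increasing chain $X\ge X_1\ge X_2\ge\cdots$ of closed subgroups with $TX_k=X_k$ for all $k$ stabilizes, i.e. there is $K$ with $X_k=X_K$ for all $k\ge K$. *)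

(* Defs.v *)
From HB Require Import structures.
From mathcomp Require Import all_boot all_order all_algebra.
From mathcomp Require Import all_classical all_reals all_analysis.
Set Implicit Arguments. Unset Strict Implicit. Unset Printing Implicit Defensive.
Import Order.TTheory GRing.Theory Num.Theory.
Import numFieldNormedType.Exports.
Local Open Scope classical_set_scope.
Local Open Scope ring_scope.

(* Pointed copy of the carrier of X (point = 0), needed by g_sigma_algebraType. *)
Definition pt (X : topologicalZmodType) : Type := X.
HB.instance Definition _ (X : topologicalZmodType) := Choice.on (pt X).
HB.instance Definition _ (X : topologicalZmodType) := isPointed.Build (pt X) 0.
Notation borel X := (g_sigma_algebraType (@open X : set (set (pt X)))).

Definition metrizable (R : realType) (X : topologicalZmodType) : Prop :=
  exists d : X -> X -> R,
    [/\ (forall x y, 0 <= d x y),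
        (forall x y, d x y = 0 <-> x = y),
        (forall x y, d x y = d y x),
        (forall x y z, d x z <= d x y + d y z) &
        (forall A : set X, open A <->
           (forall x, A x -> exists2 e : R, 0 < e & [set y | d x y < e] `<=` A))].

Definition cont_automorphism (X : topologicalZmodType) (T : X -> X) : Prop :=
  [/\ {morph T : x y / x + y}, bijective T & continuous T].

Definition is_subgroup (X : zmodType) (A : set X) : Prop :=
  A 0 /\ (forall x y, A x -> A y -> A (x - y)).

Definition dcc (X : topologicalZmodType) (T : X -> X) : Prop :=
  forall Xs : nat -> set X,
    (forall k, is_subgroup (Xs k)) ->
    (forall k, closed (Xs k)) ->
    (forall k, T @` Xs k = Xs k) ->
    (forall k, Xs k.+1 `<=` Xs k) ->
    exists K, forall k, (K <= k)%N -> Xs k = Xs K.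

Definition invariant (R : realType) (X : topologicalZmodType) (T : X -> X)
    (mu : probability (borel X) R) : Prop :=
  forall A : set (borel X), measurable A -> mu (T @^-1` A) = mu A.

Definition finitely_supported (R : realType) (X : topologicalZmodType)
    (mu : probability (borel X) R) : Prop :=
  exists S : set X, finite_set S /\ mu S = 1%E.

Definition ergodic (R : realType) (X : topologicalZmodType) (T : X -> X)
    (mu : probability (borel X) R) : Prop :=
  forall A : set (borel X), measurable A -> T @^-1` A = A ->
    mu A = 0%E \/ mu A = 1%E.

Definition haar (R : realType) (X : topologicalZmodType)
    (m : probability (borel X) R) : Prop :=
  forall (x : X) (A : set (borel X)), measurable A ->
    m ((fun y : X => x + y) @^-1` A) = m A.

(* The measures satisfying P are weak-* dense in M_T(X): every basic weak-*
   neighbourhood (given by finitely many continuous functions and eps > 0)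
   of every mu in M_T(X) contains some nu in M_T(X) satisfying P. *)
Definition weak_star_dense_in_MT (R : realType) (X : topologicalZmodType)
    (T : X -> X) (P : probability (borel X) R -> Prop) : Prop :=
  forall mu : probability (borel X) R, invariant T mu ->
  forall (n : nat) (f : 'I_n -> X -> R), (forall i, continuous (f i)) ->
  forall eps : R, 0 < eps ->
  exists nu : probability (borel X) R,
    [/\ invariant T nu, P nu &
        forall i, (`| \int[mu]_x (f i x)%:E - \int[nu]_x (f i x)%:E | < eps%:E)%E].

(* Main.v *)
(** Every orbit average [x |-> N^-1 \sum_(t < N) f_i (T^t x)], [N] large, is close to the average of
    the [f_i] over a periodic orbit; cutting [X] into the level cells of these averages turns an
    invariant measure into nearby convex combinations of measures on periodic orbits.

    The descending chain condition gives a closed invariant subgroup [Y] on which all [T^m - 1],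
    [m > 0], are onto, such that every point is [y + v] with [y] in [Y] and [(T^q - 1)^K v = 0].

    On [Y] orbits can be glued: for blocks of length [b] separated by gaps that are a small proportion
    of [b], a periodic point of [Y] shadows most of the prescribed orbit blocks most of the time.
    A Kronecker-type theorem (Fejer kernels, and duality for compact subgroups) reduces this to showing
    that in the dual of [Y], with [tau] dual to [T], a relation [\sum_j tau^(j b') beta_j = (tau^N - 1) c]
    between blocks with bounded coefficients forces every [beta_j] to vanish.  The dual is finitely
    generated over [Z[tau, tau^-1]] by the chain condition, and [tau^m - 1] is injective on it.  The
    partial sums of the relation form a finite-dimensional linear system; bounds on its eigenmodes show
    that inside a gap the state stays small for a long time, so that by pigeonhole it is killed by some
    nonzero [h (tau^q)], with [h] having coefficients in [{-1, 0, 1}].  The roots of [h] have modulus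
    strictly between 1/2 and 2, so for a suitable fixed [q] all eigenvalues involved have modulus one;
    by Kronecker's theorem one of them is a root of unity, which is excluded.

    For the unipotent component [v], van der Corput's inequality shows that averages of characters
    depend continuously on [v] in the closed subgroup generated by its orbit, where torsion points, which
    are periodic, are dense.  The two components are coupled by a matching of the blocks
    along the orbit of the periodic twin of [v] with those of [v].

    If Haar measure is ergodic, [T^m - 1] is onto for every [m > 0], so one can take [Y = X], and gluing
    typical orbit blocks in the right proportions yields a single periodic orbit.  *)

Require Import Defs.
From HB Require Import structures.
From mathcomp Require Import all_boot all_order all_fingroup all_algebra all_solvable all_field.
From mathcomp Require Import boolp reals complex ring lra zify.
Set Implicit Arguments. Unset Strict Implicit. Unset Printing Implicit Defensive.
Import Order.TTheory GRing.Theory Num.Theory.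
Local Open Scope ring_scope.

(** * Lattices and linear recurrences *)

(** Eigenvalues of modulus one are the obstacle. They leave no hope of shadowing all coordinates
    across bounded gaps, so most coordinates are shadowed, the gaps grow with the blocks, and the
    period [N] is found in a window of bounded size instead of being prescribed: [tau ^ N - 1] may
    be nearly singular on such eigenvalues. Gaps proportional to [b] suffice because states are
    bounded by a polynomial in the length, while the pigeonhole offers [2 ^ w] combinations. The
    order of the constants is strict: the twin of [v] is periodic for the [b']-th iterate, so its
    period [P] is known only after [b'], and the lower bound for [b'] must not involve [P]. States
    lie in a finitely generated group that [tau] does not preserve; hence linear pencils instead of
    matrices, and coordinates modulo torsion. Characters and Haar measure have a common source:
    groups [(Z/l)^d] approximate [X] up to any neighbourhood of 0, and ultralimits of their
    characters, respectively of counting frequencies, yield the objects on [X]. On bare groups,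
    averaging along [h + j h0] replaces integration. *)

Lemma minP (P : nat -> Prop) : (exists n, P n) -> exists2 n, P n & forall m, P m -> (n <= m)%N.
Proof.
move=> [n Pn]; have ex : exists n, `[< P n >] by exists n; apply/asboolP.
by case: (ex_minnP ex) => m /asboolP Pm mP; exists m => // k Pk; apply: mP; apply/asboolP.
Qed.

Lemma maxP (P : nat -> Prop) b : (exists n, P n) -> (forall m, P m -> (m <= b)%N) ->
  exists2 n, P n & forall m, P m -> (m <= n)%N.
Proof.
move=> [n Pn] bP; have ex : exists n, `[< P n >] by exists n; apply/asboolP.
have bd : forall i, `[< P i >] -> (i <= b)%N by move=> i /asboolP /bP.
by case: (ex_maxnP ex bd) => m /asboolP Pm mP; exists m => // k Pk; apply: mP; apply/asboolP.
Qed.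

Definition subgrp (A : zmodType) (L : A -> Prop) := L 0 /\ forall x y, L x -> L y -> L (x - y).

Lemma subgrpN (A : zmodType) (L : A -> Prop) x : subgrp L -> L x -> L (- x).
Proof. by case=> L0 LB Lx; rewrite -sub0r; apply: LB. Qed.

Lemma subgrpD (A : zmodType) (L : A -> Prop) x y : subgrp L -> L x -> L y -> L (x + y).
Proof. by move=> sL Lx Ly; rewrite -[y]opprK; apply: (proj2 sL) => //; apply: subgrpN. Qed.

Lemma subgrp_sum (A : zmodType) (L : A -> Prop) (I : Type) (r : seq I) (P : pred I) (F : I -> A) :
  subgrp L -> (forall i, P i -> L (F i)) -> L (\sum_(i <- r | P i) F i).
Proof.
move=> sL LF; elim/big_rec : _ => [|i x Pi Lx]; first exact: (proj1 sL).
by apply: subgrpD => //; apply: LF.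
Qed.

Lemma subgrpMn (A : zmodType) (L : A -> Prop) x n : subgrp L -> L x -> L (x *+ n).
Proof.
move=> sL Lx; elim: n => [|n IH]; first by rewrite mulr0n; exact: (proj1 sL).
by rewrite mulrS; apply: subgrpD.
Qed.

Lemma subgrpMz (A : zmodType) (L : A -> Prop) x n : subgrp L -> L x -> L (x *~ n).
Proof.
move=> sL Lx; case: n => n; first by rewrite -pmulrn; apply: subgrpMn.
by rewrite NegzE mulrNz -pmulrn; apply: subgrpN => //; apply: subgrpMn.
Qed.

Lemma subgrp_int (I : int -> Prop) : subgrp I -> exists2 g, I g & forall x, I x -> (g %| x)%Z.
Proof.
move=> sI; have [nz|z] := pselect (exists n : nat, (0 < n)%N /\ I n%:Z); last first.
  exists 0; first exact: (proj1 sI).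
  move=> x Ix; have [->|x0] := eqVneq x 0; first exact: dvdz0.
  exfalso; apply: z; exists (absz x); split; first by rewrite absz_gt0.
  by rewrite abszE; case: (ger0P x) => _ //; apply: subgrpN.
have [g [g0 Ig] gmin] := minP nz.
exists g%:Z => // x Ix; apply/dvdz_mod0P.
have Im : I (x %% g)%Z.
  have -> : (x %% g)%Z = x - g%:Z *~ (x %/ g)%Z by rewrite /modz -mulrzl mulrC intz mulrC.
  by apply: (proj2 sI) => //; apply: subgrpMz.
have m0 : 0 <= (x %% g)%Z by rewrite modz_ge0 // eqz_nat -lt0n.
have mg : (x %% g)%Z < g%:Z by rewrite ltz_pmod.
move: m0 mg Im; case: (x %% g)%Z => // k _; rewrite ltz_nat => kg Ik.
case: (posnP k) => [->//|k0].
by have := gmin k (conj k0 Ik); rewrite leqNgt kg.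
Qed.

(** Induction on [s]: the first coordinates of [L] form an ideal of the integers, generated by that
    of [w], and the vectors of [L] with first coordinate 0 form a lattice in one dimension less. *)
Lemma fg_subgroup s (L : 'rV[int]_s -> Prop) : subgrp L ->
  exists m (g : 'I_m -> 'rV[int]_s), (forall i, L (g i)) /\
    forall v, L v -> exists c : 'I_m -> int, v = \sum_i g i *~ c i.
Proof.
elim: s L => [|s IH] L sL.
  exists 0%N, (fun=> 0); split=> [[]//|v _]; exists (fun=> 0).
  by rewrite big_ord0; apply/rowP; case.
pose J x := exists2 v : 'rV[int]_(1 + s), L v & v 0 0 = x.
have sJ : subgrp J.
  split; first by exists 0; rewrite ?mxE //; exact: (proj1 sL).
  move=> x y [v Lv <-] [w Lw <-]; exists (v - w); last by rewrite !mxE.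
  exact: (proj2 sL).
have [g [w Lw wg] gP] := subgrp_int sJ.
pose K (v : 'rV[int]_s) := L (row_mx (0 : 'M_1) v).
have sK : subgrp K.
  split; first by rewrite /K row_mx0; exact: (proj1 sL).
  move=> x y Kx Ky; rewrite /K.
  have -> : row_mx (0 : 'M_1) (x - y) = row_mx 0 x - row_mx 0 y.
    by rewrite opp_row_mx add_row_mx subr0.
  exact: (proj2 sL).
have [m [h [Kh hP]]] := IH K sK.
exists m.+1, (fun i => if unlift ord0 i is Some j then row_mx (0 : 'M_1) (h j) else w).
split=> [i|v Lv].
  by case: unliftP => [j _|_] //; apply: Kh.
have Jv : J (v 0 0) by exists v.
case/dvdzP: (gP _ Jv) => q vq.
pose u : 'rV[int]_(1 + s) := v - w *~ q.
have rE : row_mx (0 : 'M_1) (rsubmx u) = u.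
  rewrite -[RHS](@hsubmxK _ 1 1 s); congr row_mx.
  apply/matrixP => i j; rewrite !ord1 mxE [RHS]mxE.
  have -> : lshift s (0 : 'I_1) = 0 by exact/val_inj.
  by rewrite /u mxE [(- (w *~ q)) 0 0]mxE -scaler_int mxE intz wg vq subrr.
have Kr : K (rsubmx u).
  by rewrite /K rE; apply: (proj2 sL) => //; apply: subgrpMz.
have [c cP] := hP _ Kr.
exists (fun i => if unlift ord0 i is Some j then c j else q).
rewrite big_ord_recl unlift_none.
under eq_bigr => i _ do rewrite liftK.
have -> : \sum_(i < m) row_mx (0 : 'M_1) (h i) *~ c i = row_mx 0 (\sum_i h i *~ c i).
  under eq_bigr => i _ do rewrite -scaler_int scale_row_mx scaler0 scaler_int.
  elim/big_rec2 : _ => [|i y1 y2 _ ->]; first by rewrite row_mx0.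
  by rewrite add_row_mx addr0.
by rewrite -cP rE /u addrC subrK.
Qed.

(** Take a matrix of maximal rank among those whose row space lies in [V]: a vector of [V] outside
    its row space could be added and would raise the rank. *)
Lemma subspace_mx (F : fieldType) n (V : 'rV[F]_n -> Prop) :
  V 0 -> (forall a u v, V u -> V v -> V (u + a *: v)) ->
  exists M : 'M[F]_n, forall v, V v <-> (v <= M)%MS.
Proof.
move=> V0 VD.
pose P k := exists2 M : 'M[F]_n, (forall v : 'rV_n, (v <= M)%MS -> V v) & \rank M = k.
have exP : exists k, P k by exists 0%N, 0; rewrite ?mxrank0 // => v; rewrite submx0 => /eqP->.
have bP : forall k, P k -> (k <= n)%N by move=> k [M _ <-]; exact: rank_leq_row.
have [k [M MV rM] kmax] := maxP exP bP.
exists M => v; split; last exact: MV.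
move=> Vv; apply: contrapT => /negP nvM.
have : P (\rank (M + v)%MS).
  exists (M + v)%MS => // u /sub_addsmxP [[a b] /= ->].
  rewrite [b]mx11_scalar mul_scalar_mx; apply: VD => //; apply: MV; exact: submxMl.
move/kmax; rewrite -rM leqNgt; move/negP; apply.
rewrite ltnNge; apply: contra nvM => le.
have := mxrank_leqif_sup (addsmxSl M v) => -[le1 e].
have : (M + v <= M)%MS by rewrite -e eqn_leq le1.
by rewrite addsmx_sub => /andP[].
Qed.

(** * Scalar recurrences with periodic or vanishing boundary conditions *)

Section scalar_bounds.
Implicit Types (mu F : algC) (z f : nat -> algC).

Lemma rec_iter mu z f : (forall t, z t.+1 = mu * z t + f t) ->
  forall N t, z (t + N)%N = mu ^+ N * z t + \sum_(i < N) mu ^+ (N.-1 - i) * f (t + i)%N.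
Proof.
move=> zE; elim=> [|N IH] t; first by rewrite addn0 expr0 mul1r big_ord0 addr0.
rewrite addnS zE IH big_ord_recr /= subnn expr0 mul1r mulrDr mulrA -exprS addrA mulr_sumr.
congr (_ + _ + _); apply: eq_bigr => i _; rewrite mulrA -exprS; congr (_ ^+ _ * _).
by have := ltn_ord i; lia.
Qed.

(** Going once around the period expresses [z t * (mu ^+ N - 1)] as a sum of [N] terms. Off the unit
    circle [mu ^+ N - 1] is comparable with the largest power of [mu] in that sum, on it the
    hypothesis bounds it below; so [C] does not depend on [N]. *)
Lemma scalar_per mu (eta : algC) : 0 < eta -> exists2 C : algC, 0 <= C &
  forall N z f F, (0 < N)%N -> (`|mu| = 1 -> eta <= `|mu ^+ N - 1|) ->
  (forall t, z (t + N)%N = z t) -> (forall t, z t.+1 = mu * z t + f t) ->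
  (forall t, `|f t| <= F) -> forall t, `|z t| <= C * F * N%:R.
Proof.
move=> eta0.
have key N z f F : (forall t, z (t + N)%N = z t) -> (forall t, z t.+1 = mu * z t + f t) ->
  (forall t, `|f t| <= F) -> forall t,
  `|z t| * `|mu ^+ N - 1| <= \sum_(i < N) `|mu| ^+ (N.-1 - i) * F.
  move=> zN zE fF t; rewrite -normrM.
  have -> : z t * (mu ^+ N - 1) = - \sum_(i < N) mu ^+ (N.-1 - i) * f (t + i)%N.
    have := rec_iter zE N t; rewrite zN; set S := \sum_(_ < _) _ => E.
    by apply/eqP; rewrite -subr_eq0 opprK mulrBr mulr1 [z t * _]mulrC addrAC -E subrr.
  rewrite normrN; apply: le_trans (ler_norm_sum _ _ _) _.
  apply: ler_sum => i _; rewrite normrM normrX; apply: ler_wpM2l => //.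
  exact: exprn_ge0.
have sumN N (x F : algC) : (forall i : 'I_N, `|mu| ^+ (N.-1 - i) <= x) -> 0 <= F ->
    \sum_(i < N) `|mu| ^+ (N.-1 - i) * F <= x * F * N%:R.
  move=> h F0; apply: le_trans (_ : \sum_(i < N) x * F <= _).
    by apply: ler_sum => i _; apply: ler_wpM2r.
  by rewrite sumr_const card_ord mulr_natr.
have F0 (f : nat -> algC) F : (forall t, `|f t| <= F) -> 0 <= F.
  by move=> /(_ 0%N); apply: le_trans.
have rmu : `|mu| \is Num.real by rewrite normr_real.
case: (real_ltgtP rmu (real1 _)) => mu1; last first.
- exists eta^-1; first by rewrite invr_ge0 ltW.
  move=> N z f F N0 /(_ mu1) h zN zE fF t.
  have := key _ _ _ _ zN zE fF t => k.
  rewrite -mulrA ler_pdivlMl // mulrC.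
  apply: le_trans (_ : `|z t| * `|mu ^+ N - 1| <= _); first exact: ler_wpM2l.
  apply: le_trans k _; rewrite mu1.
  have := sumN N 1 F; rewrite mu1 mul1r; apply; last exact: F0 fF.
  by move=> i; rewrite expr1n.
- exists (`|mu| - 1)^-1; first by rewrite invr_ge0 subr_ge0 ltW.
  move=> N z f F N0 _ zN zE fF t.
  have := key _ _ _ _ zN zE fF t => k.
  have Np : 0 < `|mu| ^+ N.-1 by rewrite exprn_gt0 // (lt_trans _ mu1).
  rewrite -mulrA ler_pdivlMl ?subr_gt0 //.
  rewrite -(ler_pM2l Np) mulrA.
  apply: le_trans (_ : `|z t| * `|mu ^+ N - 1| <= _).
    rewrite mulrC; apply: ler_wpM2l => //.
    have h : `|mu| ^+ N - 1 <= `|mu ^+ N - 1|.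
      by rewrite -normrX -[X in _ - X](normr1 algC); apply: lerB_dist.
    apply: le_trans h; rewrite mulrBr mulr1 -exprSr prednK //.
    rewrite lerD2l lerN2; apply: exprn_ege1; exact: ltW.
  apply: le_trans k _; rewrite mulrA; apply: sumN; last exact: F0 fF.
  move=> i; apply: ler_weXn2l; [exact: ltW | lia].
- exists (1 - `|mu|)^-1; first by rewrite invr_ge0 subr_ge0 ltW.
  move=> N z f F N0 _ zN zE fF t.
  have := key _ _ _ _ zN zE fF t => k.
  rewrite -mulrA ler_pdivlMl ?subr_gt0 // mulrC.
  apply: le_trans (_ : `|z t| * `|mu ^+ N - 1| <= _).
    apply: ler_wpM2l => //.
    have h : 1 - `|mu| ^+ N <= `|mu ^+ N - 1|.
      by rewrite -normrX distrC -[X in X - _](normr1 algC); apply: lerB_dist.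
    apply: le_trans h; rewrite lerD2l lerN2.
    by apply: ler_iXnr => //; exact: ltW.
  apply: le_trans k _; have := sumN N 1 F; rewrite mul1r; apply; last exact: F0 fF.
  by move=> i; apply: exprn_ile1 => //; rewrite ltW.
Qed.

Lemma bern_up (x : algC) a : 0 <= x -> x <= 1 -> (1 + x) ^+ a <= 1 + (2 ^+ a - 1) * x.
Proof.
move=> x0 x1; elim: a => [|a IH]; first by rewrite !expr0 subrr mul0r addr0.
rewrite exprS; apply: le_trans (_ : (1 + x) * (1 + (2 ^+ a - 1) * x) <= _).
  by apply: ler_wpM2l => //; rewrite addr_ge0.
rewrite exprS.
have -> : (1 + x) * (1 + (2 ^+ a - 1) * x) = 1 + (2 ^+ a) * x + (2 ^+ a - 1) * (x * x) by ring.
have -> : 1 + (2 * 2 ^+ a - 1) * x = 1 + 2 ^+ a * x + (2 ^+ a - 1) * x by ring.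
rewrite lerD2l; apply: ler_wpM2l; first by rewrite subr_ge0 exprn_ege1 // ler1n.
by rewrite ler_piMr.
Qed.

(** The equation is solved in the direction that does not expand: backwards from [n] if [mu] has
    modulus at least 1, where the forcing terms simply add up, and forwards from 0 otherwise, where
    the contraction has to beat the decay of the weight. *)
Lemma scalar_end mu a : exists2 C : algC, 0 <= C &
  forall n z f F, z 0%N = 0 -> (forall t, (n <= t)%N -> z t = 0) ->
  (forall t, z t.+1 = mu * z t + f t) ->
  (forall t, `|f t| <= F * (n - t).+1%:R ^+ a) ->
  forall t, `|z t| <= C * F * (n - t).+1%:R ^+ a.+1.
Proof.
have rmu : `|mu| \is Num.real by rewrite normr_real.
have F0 n (f : nat -> algC) F : (forall t, `|f t| <= F * (n - t).+1%:R ^+ a) -> 0 <= F.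
  move=> /(_ 0%N) h; have := le_trans (normr_ge0 _) h.
  by rewrite pmulr_lge0 // exprn_gt0 // ltr0n.
case: (real_leP (real1 _) rmu) => mu1.
- exists 1 => // n z f F z0 zn zE fF t; rewrite mul1r.
  have Fp := F0 _ _ _ fF.
  have mu0 : mu != 0 by rewrite -normr_gt0 (lt_le_trans ltr01).
  have step s : `|z s| <= `|z s.+1| + `|f s|.
    have -> : z s = mu^-1 * (z s.+1 - f s) by rewrite zE addrK mulKf.
    rewrite normrM normfV; apply: le_trans (_ : 1 * `|z s.+1 - f s| <= _).
      by apply: ler_wpM2r => //; rewrite invf_le1 // (lt_le_trans ltr01).
    by rewrite mul1r; exact: ler_normB.
  have main k : forall s, (n - s)%N = k -> `|z s| <= F * k%:R * k.+1%:R ^+ a.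
    elim: k => [|k IH] s sk.
      by rewrite zn ?normr0 ?mulr0 ?mul0r //; lia.
    apply: le_trans (step s) _.
    apply: le_trans (lerD (IH s.+1 _) (fF s)) _; first lia.
    rewrite sk [in X in _ <= X]mulrSr mulrDr mulr1 mulrDl lerD2r.
    apply: ler_wpM2l; first by rewrite mulr_ge0.
    by apply: lerXn2r; rewrite ?nnegrE // ler_nat; lia.
  apply: le_trans (main _ t erefl) _.
  rewrite exprS mulrA; apply: ler_wpM2r; first by rewrite exprn_ge0.
  by apply: ler_wpM2l => //; rewrite ler_nat; lia.
- pose nu := (1 + `|mu|) / 2.
  have mu0 : 0 <= `|mu| by [].
  have d0 : 0 < 1 - `|mu| by rewrite subr_gt0.
  (* With the offset [s] the weight loses at most a factor [1 + s^-1] per step, so for [s] large the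
     contraction wins: the modulus of [mu] times [q] is at most [nu < 1]. *)
  have [s s0 sP] : exists2 s : nat, (0 < s)%N & 2 * 2 ^+ a <= s%:R * (1 - `|mu|).
    have r0 : 0 <= 2 * 2 ^+ a / (1 - `|mu|) :> algC.
      by rewrite divr_ge0 ?mulr_ge0 ?exprn_ge0 // ltW.
    exists (Num.bound (2 * 2 ^+ a / (1 - `|mu|))).+1 => //.
    have := archi_boundP r0; rewrite ltr_pdivrMr // => /ltW h; apply: le_trans h _.
    by apply: ler_wpM2r; [exact: ltW | rewrite ler_nat].
  pose q : algC := (1 + s%:R^-1) ^+ a.
  have s0' : 0 < s%:R :> algC by rewrite ltr0n.
  have si0 : 0 <= s%:R^-1 :> algC by rewrite invr_ge0.
  have q2 : q <= 2 ^+ a.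
    apply: lerXn2r; rewrite ?nnegrE ?addr_ge0 //.
    by rewrite -[2]/(1 + 1) lerD2l invf_le1 // ler1n.
  have qb : `|mu| * q <= nu.
    apply: le_trans (_ : `|mu| * (1 + (2 ^+ a - 1) * s%:R^-1) <= _).
      by apply: ler_wpM2l => //; apply: bern_up => //; rewrite invf_le1 // ler1n.
    apply: le_trans (_ : `|mu| + 2 ^+ a * s%:R^-1 <= _).
      rewrite mulrDr mulr1 lerD2l; apply: le_trans (_ : 1 * ((2 ^+ a - 1) * s%:R^-1) <= _).
        apply: ler_wpM2r; last exact: ltW.
        by rewrite mulr_ge0 // subr_ge0 exprn_ege1 // ler1n.
      by rewrite mul1r; apply: ler_wpM2r => //; rewrite gerBl.
    rewrite -lerBrDl /nu.
    have -> : (1 + `|mu|) / 2 - `|mu| = (1 - `|mu|) / 2 by field.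
    by rewrite ler_pdivrMr // mulrAC ler_pdivlMr // mulrC [X in _ <= X]mulrC.
  pose C0 := 2 * 2 ^+ a / (1 - `|mu|).
  have C00 : 0 <= C0 by rewrite divr_ge0 ?mulr_ge0 ?exprn_ge0 // ltW.
  exists (C0 * (1 + s%:R) ^+ a); first by rewrite mulr_ge0 // exprn_ge0 // addr_ge0.
  move=> n z f F z0 zn zE fF t.
  have Fp := F0 _ _ _ fF.
  have main t' : (t' <= n)%N -> `|z t'| <= C0 * F * ((n - t').+1%:R + s%:R) ^+ a.
    elim: t' => [|t' IH] tn; first by rewrite z0 normr0; apply: mulr_ge0; [exact: mulr_ge0 | rewrite exprn_ge0 // addr_ge0].
    rewrite zE; apply: le_trans (ler_normD _ _) _; rewrite normrM.
    have {}IH := IH (ltnW tn).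
    pose w : algC := (n - t'.+1).+1%:R + s%:R.
    have w0 : 0 <= w by rewrite addr_ge0.
    have ww : (n - t').+1%:R + s%:R <= (1 + s%:R^-1) * w.
      rewrite mulrDl mul1r /w -(subnSK tn).
      rewrite -[_.+2%:R]natr1 -addrA [1 + _]addrC addrA lerD2l.
      by rewrite mulrC ler_pdivlMr // mul1r lerDr.
    have wa : ((n - t').+1%:R + s%:R) ^+ a <= q * w ^+ a.
      by rewrite /q -exprMn; apply: lerXn2r; rewrite ?nnegrE ?addr_ge0 ?mulr_ge0 ?addr_ge0.
    have fa : `|f t'| <= F * (2 ^+ a * w ^+ a).
      apply: le_trans (fF t') _; apply: ler_wpM2l => //.
      apply: le_trans (_ : q * w ^+ a <= _).
        apply: le_trans wa; apply: lerXn2r; rewrite ?nnegrE ?addr_ge0 //.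
        by rewrite lerDl.
      by apply: ler_wpM2r => //; rewrite exprn_ge0.
    apply: le_trans (_ : `|mu| * (C0 * F * (q * w ^+ a)) + F * (2 ^+ a * w ^+ a) <= _).
      apply: lerD => //; apply: ler_wpM2l => //; apply: le_trans IH _.
      by apply: ler_wpM2l => //; rewrite mulr_ge0.
    have -> : `|mu| * (C0 * F * (q * w ^+ a)) + F * (2 ^+ a * w ^+ a) =
       (C0 * (`|mu| * q) + 2 ^+ a) * F * w ^+ a by ring.
    rewrite -/w; apply: ler_wpM2r; first exact: exprn_ge0.
    apply: ler_wpM2r => //.
    apply: le_trans (_ : C0 * nu + 2 ^+ a <= _); first by rewrite lerD2r; apply: ler_wpM2l.
    rewrite -lerBrDl.
    have -> : C0 - C0 * nu = 2 ^+ a; last by [].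
    rewrite /C0 /nu; field; exact: lt0r_neq0.
  case: (leqP t n) => tn; last first.
    rewrite zn 1?ltnW // normr0; apply: mulr_ge0; last exact: exprn_ge0.
    by rewrite mulr_ge0 // mulr_ge0 // exprn_ge0 // addr_ge0.
  apply: le_trans (main _ tn) _.
  rewrite [leRHS](_ : _ = C0 * F * ((1 + s%:R) ^+ a * (n - t).+1%:R ^+ a.+1)); last by ring.
  apply: ler_wpM2l; first exact: mulr_ge0.
  apply: le_trans (_ : (1 + s%:R) ^+ a * (n - t).+1%:R ^+ a <= _).
    rewrite -exprMn; apply: lerXn2r; rewrite ?nnegrE ?mulr_ge0 ?addr_ge0 //.
    rewrite mulrDl mul1r lerD2l -{1}[s%:R]mulr1; apply: ler_wpM2l => //.
    by rewrite ler1n.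
  apply: ler_wpM2l; first by rewrite exprn_ge0 // addr_ge0.
  by rewrite exprS ler_peMl ?exprn_ge0 // ler1n.
Qed.

(** If each of the [(size ls).+1] lengths failed at some root, two of them would fail at the same
    [x], and then [x ^+ (P * (j - i))] would be closer to 1 than [2 * eta], with [j - i] at most
    [size ls]. *)
Lemma good_period (ls : seq algC) P : (0 < P)%N ->
  (forall x, x \in ls -> `|x| = 1 /\ forall k, (0 < k)%N -> x ^+ k != 1) ->
  exists2 eta : algC, 0 < eta & forall N1, exists2 i, (i <= size ls)%N &
    forall x, x \in ls -> eta <= `|x ^+ (P * (N1 + i)) - 1|.
Proof.
move=> P0 lsP.
have [eta eta0 etaP] : exists2 eta : algC, 0 < eta &
   forall x k, x \in ls -> (0 < k <= size ls)%N -> 2 * eta <= `|x ^+ (P * k) - 1|.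
  (* Each factor is halved so as to lie between 0 and 1; the product is then a lower bound for all
     of them. *)
  pose m : algC := \prod_(x <- ls) \prod_(k < (size ls).+1 | (0 < k)%N) (`|x ^+ (P * k) - 1| / 2).
  have pos x (k : nat) : x \in ls -> (0 < k)%N -> 0 < `|x ^+ (P * k) - 1| / 2.
    move=> xl k0; rewrite divr_gt0 // normr_gt0 subr_eq0.
    by apply: (proj2 (lsP x xl)); rewrite muln_gt0 P0.
  have le1 x (k : nat) : x \in ls -> `|x ^+ (P * k) - 1| / 2 <= 1.
    move=> xl; rewrite ler_pdivrMr // mul1r; apply: le_trans (ler_normB _ _) _.
    by rewrite normrX (proj1 (lsP x xl)) expr1n normr1.
  have pge (I : eqType) (r : seq I) (Q : pred I) (G : I -> algC) :
      (forall i, i \in r -> Q i -> 0 < G i <= 1) -> 0 < \prod_(i <- r | Q i) G i <= 1 /\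
      forall i, i \in r -> Q i -> \prod_(i <- r | Q i) G i <= G i.
    elim: r => [|j r IH] GP; first by rewrite big_nil ltr01 lexx; split.
    have [|/andP[h1 h2] h3] := IH; first by move=> i ir; apply: GP; rewrite inE ir orbT.
    have GPj := GP j (mem_head _ _).
    rewrite big_cons; case: ifPn => Qj.
      have /andP[g0 g1] := GPj Qj; split.
        by rewrite mulr_gt0 //= mulr_ile1 // ltW.
      move=> i; rewrite inE => /predU1P [-> _|ir Qi]; first by rewrite ler_piMr // ltW.
      apply: le_trans (h3 i ir Qi); rewrite ler_piMl // ltW //.
    split; first by rewrite h1.
    by move=> i; rewrite inE => /predU1P [->|]; [rewrite (negbTE Qj) | exact: h3].
  have in1 x : x \in ls -> 0 < \prod_(k < (size ls).+1 | (0 < k)%N) (`|x ^+ (P * k) - 1| / 2) <= 1 /\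
     forall k : 'I_(size ls).+1, (0 < k)%N ->
     \prod_(k < (size ls).+1 | (0 < k)%N) (`|x ^+ (P * k) - 1| / 2) <= `|x ^+ (P * k) - 1| / 2.
    move=> xl.
    have [|h1 h2] := pge _ (index_enum 'I_(size ls).+1) (fun k => (0 < k)%N)
       (fun k : 'I__ => `|x ^+ (P * k) - 1| / 2).
      by move=> k _ k0; rewrite pos // le1.
    by split => // k k0; apply: h2 => //; exact: mem_index_enum.
  have [|/andP[m0 _] mle] := pge _ ls xpredT
      (fun x => \prod_(k < (size ls).+1 | (0 < k)%N) (`|x ^+ (P * k) - 1| / 2)).
    by move=> x xl _; exact: (proj1 (in1 x xl)).
  exists m => // x k xl /andP[k0 ks].
  rewrite mulrC -ler_pdivlMr //.
  apply: le_trans (mle x xl isT) _.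
  exact: (proj2 (in1 x xl) (Ordinal (ks : (k < (size ls).+1)%N)) k0).
exists eta => // N1.
apply: contrapT => H.
have bad (i : 'I_(size ls).+1) : exists j : 'I_(size ls), `|ls`_j ^+ (P * (N1 + i)) - 1| < eta.
  apply: contrapT => nb; apply: H; exists i; first by rewrite -ltnS.
  move=> x xl; have xi : (index x ls < size ls)%N by rewrite index_mem.
  have rl : `|x ^+ (P * (N1 + i)) - 1| \is Num.real by rewrite normr_real.
  case: (real_leP (gtr0_real eta0) rl) => // lt.
  by exfalso; apply: nb; exists (Ordinal xi); rewrite /= nth_index.
have [h hP] := choice bad.
have [i [j [ij hij]]] : exists i j : 'I_(size ls).+1, (i < j)%N /\ h i = h j.
  apply: contrapT => nh.
  have inj : injective h.
    move=> i j hij; apply/val_inj; case: (ltngtP i j) => // lt.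
      by exfalso; apply: nh; exists i, j.
    by exfalso; apply: nh; exists j, i.
  by have := leq_card h inj; rewrite !card_ord ltnn.
have := hP i; have := hP j; rewrite hij => hj hi.
have xl : ls`_(h j) \in ls by rewrite mem_nth.
have := etaP _ (j - i)%N xl; have jn := ltn_ord j.
rewrite subn_gt0 ij /= => /(_ ltac:(lia)); apply/negP; rewrite -real_ltNge ?normr_real ?realM ?gtr0_real //.
have -> : `|ls`_(h j) ^+ (P * (j - i)) - 1| = `|ls`_(h j) ^+ (P * (N1 + j)) - ls`_(h j) ^+ (P * (N1 + i))|.
  have -> : (P * (N1 + j) = P * (N1 + i) + P * (j - i))%N by rewrite -mulnDr; congr (_ * _)%N; lia.
  by rewrite exprD -{2}[_ ^+ (P * (N1 + i))]mulr1 -mulrBr normrM normrX (proj1 (lsP _ xl)) expr1n mul1r.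
have -> : forall a b : algC, a - b = (a - 1) - (b - 1) by move=> *; ring.
apply: le_lt_trans (ler_normB _ _) _.
by rewrite mulr_natl mulr2n; apply: ltrD.
Qed.

End scalar_bounds.

Lemma mx_row_bound (K : numFieldType) m n (M : 'M[K]_(m, n)) : exists2 C : K, 0 <= C &
  forall (u : 'rV_m) (F : K), 0 <= F -> (forall j, `|u 0 j| <= F) -> forall j, `|(u *m M) 0 j| <= C * F.
Proof.
exists (\sum_j \sum_i `|M i j|); first by do 2![apply: sumr_ge0 => ? _].
move=> u F F0 uF j; rewrite mxE; apply: le_trans (ler_norm_sum _ _ _) _.
apply: le_trans (_ : \sum_i `|M i j| * F <= _).
  by apply: ler_sum => i _; rewrite normrM mulrC; apply: ler_wpM2l.
rewrite -mulr_suml; apply: ler_wpM2r => //.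
by rewrite [leRHS](bigD1 j) //= lerDl; do 2![apply: sumr_ge0 => ? _].
Qed.

(** * Linear systems, by triangularization *)

Section triangular.
Variables (Md : Type) (Z : Md -> (nat -> algC) -> Prop) (g : Md -> nat -> algC) (Eg : algC -> Prop).
Hypothesis g1 : forall m t, 1 <= g m t.
Hypothesis Z0 : forall m, Z m (fun=> 0).
Hypothesis Zlin : forall m a z z', Z m z -> Z m z' -> Z m (fun t => a * z t + z' t).
Hypothesis scal : forall mu, Eg mu -> forall a, exists2 C : algC, 0 <= C &
  forall m z f F, Z m z -> (forall t, z t.+1 = mu * z t + f t) ->
    (forall t, `|f t| <= F * g m t ^+ a) -> forall t, `|z t| <= C * F * g m t ^+ a.+1.

Lemma Zsum m (I : Type) (r : seq I) (P : pred I) (a : I -> algC) (z : I -> nat -> algC) :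
  (forall i, Z m (z i)) -> Z m (fun t => \sum_(i <- r | P i) a i * z i t).
Proof.
move=> Zz; elim: r => [|i r IH].
  by rewrite (_ : (fun t => _) = fun=> 0) //; apply/funext => t; rewrite big_nil.
case Pi: (P i).
  rewrite (_ : (fun t => _) = fun t => a i * z i t + \sum_(i <- r | P i) a i * z i t).
    exact: Zlin.
  by apply/funext => t; rewrite big_cons Pi.
rewrite (_ : (fun t => _) = fun t => \sum_(i <- r | P i) a i * z i t) //.
by apply/funext => t; rewrite big_cons Pi.
Qed.

(** One proof serves both boundary conditions: [Z m] is the class of admissible solutions and [g m]
    the weight. Coordinates are bounded from the last one down; each solves a scalar equation driven
    by the later ones and costs one more power of the weight. *)
Lemma triang_bound n (U : 'M[algC]_n) : is_trig_mx U -> (forall i, Eg (U i i)) ->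
  exists2 C : algC, 0 <= C & forall m (y k : nat -> 'rV_n) (F : algC), 0 <= F ->
    (forall j, Z m (fun t => y t 0 j)) -> (forall t, y t.+1 = y t *m U + k t) ->
    (forall t j, `|k t 0 j| <= F) -> forall t j, `|y t 0 j| <= C * F * g m t ^+ n.
Proof.
move=> /is_trig_mxP trU Ed.
suff main d : (d <= n)%N -> exists2 C : algC, 0 <= C & forall m (y k : nat -> 'rV_n) (F : algC), 0 <= F ->
    (forall j, Z m (fun t => y t 0 j)) -> (forall t, y t.+1 = y t *m U + k t) ->
    (forall t j, `|k t 0 j| <= F) ->
    forall t (j : 'I_n), (n - d <= j)%N -> `|y t 0 j| <= C * F * g m t ^+ d.
  have [C C0 CP] := main n (leqnn _); exists C => // m y k F F0 Zy yE kF t j.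
  by apply: (CP m y k) => //; rewrite subnn.
elim: d => [|d IH] dn.
  exists 0 => // m y k F _ _ _ _ t j; rewrite subn0 => nj.
  by have := ltn_ord j; rewrite ltnNge nj.
have [C C0 CP] := IH (ltnW dn).
have jn : (n - d.+1 < n)%N by rewrite ltn_subrL /= (leq_trans _ dn).
pose j0 := Ordinal jn.
have [C1 C10 C1P] := scal (Ed j0) d.
pose S := \sum_i `|U i j0|.
have S0 : 0 <= S by apply: sumr_ge0.
exists (C + C1 * (S * C + 1)).
  by rewrite addr_ge0 // mulr_ge0 // addr_ge0 // mulr_ge0.
move=> m y k F F0 Zy yE kF t j nj.
have gp a t' : 0 <= g m t' ^+ a by rewrite exprn_ge0 // (le_trans _ (g1 m t')).
have gS t' : g m t' ^+ d <= g m t' ^+ d.+1.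
  by rewrite exprS ler_peMl.
have IHy t' (i : 'I_n) : (n - d <= i)%N -> `|y t' 0 i| <= C * F * g m t' ^+ d.
  exact: (CP m y k).
case: (leqP (n - d) j) => [nd|jd].
  apply: le_trans (IHy t j nd) _.
  apply: le_trans (_ : C * F * g m t ^+ d.+1 <= _).
    by apply: ler_wpM2l => //; apply: mulr_ge0.
  apply: ler_wpM2r => //; apply: ler_wpM2r => //.
  by rewrite lerDl mulr_ge0 // addr_ge0 // mulr_ge0.
have -> : j = j0 by apply/val_inj => /=; lia.
pose f t := \sum_(i : 'I_n | (j0 < i)%N) y t 0 i * U i j0 + k t 0 j0.
have zE t' : y t'.+1 0 j0 = U j0 j0 * y t' 0 j0 + f t'.
  rewrite yE !mxE addrA; congr (_ + _).
  rewrite (bigD1 j0) //= mulrC; congr (_ + _).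
  rewrite (bigID (fun i : 'I_n => (j0 < i)%N)) /= [X in _ + X]big1 ?addr0.
    apply: eq_bigl => i; rewrite andb_idl // => ij.
    by apply: contraTneq ij => ->; rewrite ltnn.
  move=> i /andP[ij]; rewrite -leqNgt leq_eqVlt => /orP[/eqP e|lt]; last by rewrite trU ?mulr0.
  by rewrite (_ : i = j0) ?eqxx // in ij; apply/val_inj.
have fF t' : `|f t'| <= ((S * C + 1) * F) * g m t' ^+ d.
  apply: le_trans (ler_normD _ _) _.
  have -> : (S * C + 1) * F * g m t' ^+ d = S * (C * F * g m t' ^+ d) + F * g m t' ^+ d by ring.
  apply: lerD.
    apply: le_trans (ler_norm_sum _ _ _) _.
    apply: le_trans (_ : \sum_(i : 'I_n | (j0 < i)%N) `|U i j0| * (C * F * g m t' ^+ d) <= _).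
      apply: ler_sum => i ij; rewrite normrM mulrC; apply: ler_wpM2l => //.
      by apply: IHy; move: ij => /=; lia.
    rewrite -mulr_suml; apply: ler_wpM2r; first by rewrite mulr_ge0 // mulr_ge0.
    rewrite /S [leRHS](bigID (fun i : 'I_n => (j0 < i)%N)) /= lerDl; exact: sumr_ge0.
  apply: le_trans (kF t' j0) _; rewrite ler_peMr // exprn_ege1 //.
apply: le_trans (C1P m (fun t => y t 0 j0) f _ (Zy j0) zE fF t) _.
apply: ler_wpM2r => //; rewrite mulrA; apply: ler_wpM2r => //.
by rewrite lerDr.
Qed.

Lemma linrec_bound n (U : 'M[algC]_n) : (forall x, eigenvalue U x -> Eg x) ->
  exists2 C : algC, 0 <= C & forall m (y k : nat -> 'rV_n) (F : algC), 0 <= F ->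
    (forall j, Z m (fun t => y t 0 j)) -> (forall t, y t.+1 = y t *m U + k t) ->
    (forall t j, `|k t 0 j| <= F) -> forall t j, `|y t 0 j| <= C * F * g m t ^+ n.
Proof.
move=> EU; have [n0|n0] := posnP n.
  by exists 0 => // m y k F _ _ _ _ t j; exfalso; have := leq_ltn_trans (leq0n j) (ltn_ord j); rewrite n0.
have [P Pu trP] := Schur U n0.
have Pun : P \in unitmx by exact: unitarymx_unit.
pose T := P *m U *m invmx P.
have trT : is_trig_mx T by move: trP; rewrite /similar_to /conjmx pinvmxE.
have ET i : Eg (T i i).
  apply: EU.
  have : eigenvalue T (T i i).
    rewrite eigenvalue_root_char char_poly_trig //.
    rewrite -(big_map (fun i => T i i) xpredT (fun a => 'X - a%:P)) root_prod_XsubC.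
    by apply/mapP; exists i; rewrite // mem_index_enum.
  case/eigenvalueP => v vT v0; apply/eigenvalueP; exists (v *m P).
    by rewrite scalemxAl -vT /T !mulmxA mulmxKV.
  by apply: contraNneq v0 => vP; rewrite -(mulmxK Pun v) vP mul0mx.
have [C C0 CP] := triang_bound trT ET.
have [C1 C10 C1P] := mx_row_bound (invmx P).
have [C2 C20 C2P] := mx_row_bound P.
exists (C2 * (C * C1)); first by rewrite mulr_ge0 // mulr_ge0.
move=> m y k F F0 Zy yE kF t j.
have g0 t' : 0 <= g m t' ^+ n by rewrite exprn_ge0 // (le_trans _ (g1 m t')).
have -> : y t = (y t *m invmx P) *m P by rewrite mulmxKV.
have -> : C2 * (C * C1) * F * g m t ^+ n = C2 * (C * (C1 * F) * g m t ^+ n) by ring.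
apply: C2P; first by rewrite !mulr_ge0.
apply: (CP m (fun t => y t *m invmx P) (fun t => k t *m invmx P) (C1 * F)); first by rewrite mulr_ge0.
- move=> i; rewrite (_ : (fun t => _) = fun t => \sum_j invmx P j i * y t 0 j); first exact: Zsum.
  by apply/funext => t'; rewrite mxE; apply: eq_bigr => l _; rewrite mulrC.
- by move=> t'; rewrite yE mulmxDl /T !mulmxA mulmxKV.
- by move=> t'; apply: C1P.
Qed.

End triangular.

(** * Linear pencils driven by a bounded forcing *)

Section pencil.
Variables (p r : nat) (A0 B0 : 'M[rat]_(p, r)).
Hypothesis freeA : row_free A0.
Let A' := pinvmx A0.
Let Tm := B0 *m A'.
Hypothesis NP : forall (v : 'rV[rat]_p) n, (0 < n)%N ->
  (forall k, v *m Tm ^+ k *m B0 = v *m Tm ^+ k.+1 *m A0) -> v *m Tm ^+ n = v -> v = 0.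

Let AA' : A0 *m A' = 1%:M. Proof. exact: mulmxVp. Qed.

Definition driven (al : nat -> 'rV[rat]_p) (k : nat -> 'rV[rat]_r) (F : rat) :=
  [/\ 0 <= F, forall t, al t.+1 *m A0 = al t *m B0 + k t & forall t j, `|k t 0 j| <= F].

(** The linear functionals of the state that the forcing alone controls, without any boundary
    condition. *)
Definition bndfun (y : 'rV[rat]_p) := exists2 C : rat, 0 <= C &
  forall al k F, driven al k F -> forall t, `|(al t *m y^T) 0 0| <= C * F.

Lemma driven_next al k F : driven al k F -> forall t, al t.+1 = al t *m Tm + k t *m A'.
Proof. by case=> _ E _ t; rewrite /Tm mulmxA -mulmxDl -E -mulmxA AA' mulmx1. Qed.

(** The right-hand side of the equation must fall in the row space of [A0], which bounds at once the
    functionals given by [B0 *m (1 - A' *m A0)]. Evaluating a bounded functional on the next state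
    shows that these functionals are stable under [Tm]. On their common kernel the pencil is
    therefore the honest linear map [Tm]. *)
Lemma bndfun_mx : exists O : 'M[rat]_p, (exists2 C : rat, 0 <= C &
    forall al k F, driven al k F -> forall t j, `|(al t *m O) 0 j| <= C * F) /\
  forall v : 'rV[rat]_p, v *m O = 0 -> v *m Tm *m O = 0 /\ v *m B0 = v *m Tm *m A0.
Proof.
have [||O' OP] := @subspace_mx rat p bndfun.
- by exists 0 => // al k F _ t; rewrite trmx0 mulmx0 mxE normr0 mul0r.
- move=> a u v [C C0 CP] [D D0 DP]; exists (C + `|a| * D).
    by rewrite addr_ge0 // mulr_ge0.
  move=> al k F dr t; rewrite linearD linearZ /= mulmxDr -scalemxAr mxE [X in `|_ + X|]mxE.
  apply: le_trans (ler_normD _ _) _; rewrite normrM mulrDl.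
  apply: lerD; first exact: CP dr t.
  by rewrite -mulrA; apply: ler_wpM2l => //; apply: DP dr t.
exists O'^T.
have sub1 : ((B0 *m (1%:M - A' *m A0))^T <= O')%MS.
  apply/row_subP => i; apply/OP.
  have [C C0 CP] := mx_row_bound (1%:M - A' *m A0).
  exists C => // al k F dr t; have [F0 E kF] := dr.
  have -> : (al t *m (row i (B0 *m (1%:M - A' *m A0))^T)^T) 0 0 = - (k t *m (1%:M - A' *m A0)) 0 i.
    have -> : - (k t *m (1%:M - A' *m A0)) 0 i = (al t *m (B0 *m (1%:M - A' *m A0))) 0 i.
      have -> : al t *m (B0 *m (1%:M - A' *m A0)) = - (k t *m (1%:M - A' *m A0)).
        rewrite mulmxA; have -> : al t *m B0 = al t.+1 *m A0 - k t by rewrite E addrK.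
        rewrite mulmxBl mulmxBr mulmx1 mulmxA -[_ *m A0 *m A']mulmxA AA' mulmx1 subrr.
        by rewrite sub0r.
      by rewrite [RHS]mxE.
    by rewrite tr_row trmxK !mxE; apply: eq_bigr => j _; rewrite !mxE.
  by rewrite normrN; apply: CP => // j; apply: kF.
have sub2 : (O' *m Tm^T <= O')%MS.
  apply/row_subP => i; apply/OP.
  have [C C0 CP] : bndfun (row i O') by apply/OP; exact: row_sub.
  have [D D0 DP] := mx_row_bound (A' *m (row i O')^T).
  exists (C + D); first exact: addr_ge0.
  move=> al k F dr t; have [F0 E kF] := dr.
  have -> : al t *m (row i (O' *m Tm^T))^T = al t.+1 *m (row i O')^T - k t *m (A' *m (row i O')^T).
    by rewrite row_mul trmx_mul trmxK (driven_next dr) mulmxDl -!mulmxA addrK.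
  rewrite mxE [X in `|_ + X|]mxE mulrDl; apply: le_trans (ler_normB _ _) _.
  by apply: lerD; [exact: CP dr _ | apply: DP].
split.
  have cj j : bndfun (row j O') by apply/OP; exact: row_sub.
  have [c cP] := choice (fun j => let: ex_intro2 C C0 CP := cj j in ex_intro (fun C => 0 <= C /\ _) C (conj C0 CP)).
  exists (\sum_j c j); first by apply: sumr_ge0 => j _; case: (cP j).
  move=> al k F dr t j; have [F0 _ _] := dr.
  have -> : (al t *m O'^T) 0 j = (al t *m (row j O')^T) 0 0.
    by rewrite !mxE; apply: eq_bigr => i _; rewrite !mxE.
  apply: le_trans (proj2 (cP j) _ _ _ dr t) _; apply: ler_wpM2r => //.
  by rewrite (bigD1 j) //= lerDl sumr_ge0 // => i _; case: (cP i).
move=> v vO.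
have [X XE] := submxP sub1; have [X2 XE2] := submxP sub2.
split.
  have -> : v *m Tm *m O'^T = v *m (O' *m Tm^T)^T by rewrite trmx_mul trmxK -[LHS]mulmxA.
  by rewrite XE2 trmx_mul mulmxA vO mul0mx.
have h : v *m (B0 *m (1%:M - A' *m A0)) = 0.
  by rewrite -[B0 *m _]trmxK XE trmx_mul mulmxA vO mul0mx.
by apply/eqP; rewrite -subr_eq0 -h /Tm mulmxBr mulmx1 mulmxBr !mulmxA.
Qed.

(** The state splits into a part read off from bounded functionals and a part in [kermx O]. The
    latter obeys a recursion by the matrix [U] of [Tm] on that kernel, and [NP] says that [U] has no
    eigenvalue that is a root of unity. *)
Lemma pencil_bound : exists d (U : 'M[rat]_d),
  (forall x : algC, eigenvalue (map_mx ratr U) x -> forall n, (0 < n)%N -> x ^+ n != 1) /\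
  forall (Md : Type) (Z : Md -> (nat -> algC) -> Prop) (g : Md -> nat -> algC),
  (forall m t, 1 <= g m t) -> (forall m, Z m (fun=> 0)) ->
  (forall m a z z', Z m z -> Z m z' -> Z m (fun t => a * z t + z' t)) ->
  (forall mu, eigenvalue (map_mx ratr U) mu -> forall a, exists2 C : algC, 0 <= C &
    forall m z f (F : algC), Z m z -> (forall t, z t.+1 = mu * z t + f t) ->
    (forall t, `|f t| <= F * g m t ^+ a) -> forall t, `|z t| <= C * F * g m t ^+ a.+1) ->
  exists2 C : algC, 0 <= C & forall m al k F, driven al k F ->
    (forall j, Z m (fun t => ratr (al t 0 j))) ->
    forall t j, `|ratr (al t 0 j)| <= C * ratr F * g m t ^+ d.
Proof.
have [O [[C0 C00 C0P] OP]] := bndfun_mx.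
pose K := row_base (kermx O).
have Kfree : row_free K by exact: row_base_free.
have KO : K *m O = 0 by apply/eqP; rewrite -sub_kermx eq_row_base.
have KP (v : 'rV_p) : (v <= K)%MS <-> v *m O = 0.
  by rewrite eq_row_base sub_kermx; split => [/eqP|->].
have KT : (K *m Tm <= K)%MS.
  apply/row_subP => i; rewrite row_mul; apply/KP.
  by apply: (proj1 (OP _ _)); rewrite -row_mul KO row0.
pose U := K *m Tm *m pinvmx K.
have UE : U *m K = K *m Tm by rewrite /U mulmxKpV.
have UE' n : U ^+ n *m K = K *m Tm ^+ n.
  elim: n => [|n IH]; first by rewrite !expr0 mul1mx mulmx1.
  by rewrite !exprSr -!mulmxE -[LHS]mulmxA UE mulmxA IH -mulmxA.
exists (\rank (kermx O)), U.
have Ufix n (v : 'rV_(\rank (kermx O))) : (0 < n)%N -> v *m U ^+ n = v -> v = 0.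
  move=> n0 vU; have : v *m K = 0.
    apply: (NP n0) => [k|]; last by rewrite -mulmxA -UE' mulmxA vU.
    have xk : v *m K *m Tm ^+ k *m O = 0.
      by rewrite -[v *m K *m _]mulmxA -UE' -mulmxA -[_ *m K *m O]mulmxA KO !mulmx0.
    by rewrite (proj2 (OP _ xk)) exprSr -mulmxE !mulmxA.
  by move=> vK; rewrite -[v]mulmx1 -(mulmxVp Kfree) mulmxA vK mul0mx.
split.
  move=> x /eigenvalueP [v vU v0] n n0; apply: contraNneq v0 => xn.
  have vUn k : v *m map_mx ratr (U ^+ k) = x ^+ k *: v.
    elim: k => [|k IH]; first by rewrite !expr0 map_mx1 mulmx1 scale1r.
    by rewrite !exprSr -!mulmxE map_mxM mulmxA IH -scalemxAl vU scalerA.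
  (* Injectivity of [U ^+ n - 1] is a rank condition, so it passes from the rationals to [algC]. *)
  have fr : row_free (map_mx (ratr : rat -> algC) (U ^+ n - 1%:M)).
    rewrite row_free_map; apply: inj_row_free => w.
    by rewrite mulmxBr mulmx1 => /eqP; rewrite subr_eq0 => /eqP /(Ufix _ _ n0).
  apply/eqP; apply: (row_free_inj fr) => /=.
  by rewrite mul0mx map_mxB map_mx1 mulmxBr mulmx1 vUn xn scale1r subrr.
move=> Md Z g g1 Z0 Zlin scal.
have [C1 C10 C1P] := linrec_bound g1 Z0 Zlin scal (fun x h => h).
(* [v *m Q] depends only on [v *m O], and [v - v *m Q] lies in the kernel; [N1] gives the
   coordinates of the latter in the basis [K]. *)
pose Q := O *m pinvmx O.
have QO : Q *m O = O by rewrite /Q mulmxKpV ?submx_refl.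
have [N1 N1E] : exists N1, N1 = (1%:M - Q) *m pinvmx K by eexists.
pose k2 al k (t : nat) : 'rV[rat]_(\rank (kermx O)) :=
  (al t *m Q *m Tm + k t *m A' - al t.+1 *m Q) *m pinvmx K.
have wK (v : 'rV_p) : v *m N1 *m K = v - v *m Q.
  rewrite N1E mulmxA mulmxKpV; first by rewrite mulmxBr mulmx1.
  by apply/KP; rewrite mulmxBr mulmx1 mulmxBl -mulmxA QO subrr.
have yE al k F : driven al k F -> forall t, al t.+1 *m N1 = (al t *m N1) *m U + k2 al k t.
  move=> dr t.
  have -> : al t *m N1 *m U = (al t *m N1 *m K) *m Tm *m pinvmx K by rewrite /U !mulmxA.
  rewrite wK /k2 -mulmxDl N1E [LHS]mulmxA; congr (_ *m _).
  by rewrite mulmxBr mulmx1 {1}(driven_next dr) [(al t - _) *m Tm]mulmxBl !addrA subrK.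
have [D1 D10 D1P] := mx_row_bound (pinvmx O *m Tm *m pinvmx K).
have [D2 D20 D2P] := mx_row_bound (A' *m pinvmx K).
have [D3 D30 D3P] := mx_row_bound (pinvmx O *m pinvmx K).
have [D4 D40 D4P] := mx_row_bound (pinvmx O).
pose E1 := D1 * C0 + D2 + D3 * C0.
have E10 : 0 <= E1 by rewrite !addr_ge0 ?mulr_ge0.
have k2F al k F : driven al k F -> forall t j, `|k2 al k t 0 j| <= E1 * F.
  move=> dr t j; have [F0 _ kF] := dr.
  have -> : k2 al k t = al t *m O *m (pinvmx O *m Tm *m pinvmx K) + k t *m (A' *m pinvmx K)
     - al t.+1 *m O *m (pinvmx O *m pinvmx K).
    by rewrite /k2 /Q !mulmxBl !mulmxDl !mulmxA.
  rewrite mxE [X in `|_ + X|]mxE [X in `|X - _|]mxE.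
  apply: le_trans (ler_normB _ _) _; apply: le_trans (lerD (ler_normD _ _) (lexx _)) _.
  rewrite /E1 !mulrDl -!mulrA; apply: lerD; first apply: lerD.
  - apply: D1P; [exact: mulr_ge0 | exact: C0P dr t].
  - by apply: D2P.
  - apply: D3P; [exact: mulr_ge0 | exact: C0P dr _].
have [D5 D50 D5P] := mx_row_bound (map_mx (ratr : rat -> algC) K).
pose rr : rat -> algC := ratr.
have rr0 (x : rat) : 0 <= x -> 0 <= rr x by move=> x0; rewrite /rr ler0q.
exists (D5 * (C1 * rr E1) + rr (D4 * C0)).
  apply: addr_ge0; last by apply: rr0; exact: mulr_ge0.
  by apply: mulr_ge0 => //; apply: mulr_ge0 => //; exact: rr0.
move=> m al k F dr Zal t j; have [F0 _ kF] := dr.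
have g0 t' a : 1 <= g m t' ^+ a by rewrite exprn_ege1.
have yb t' i : `|rr ((al t' *m N1) 0 i)| <= C1 * rr (E1 * F) * g m t' ^+ (\rank (kermx O)).
  have := C1P m (fun t => map_mx rr (al t *m N1)) (fun t => map_mx rr (k2 al k t)) (rr (E1 * F)).
  move=> /(_ _ _ _ _ t' i); rewrite [X in `|X|]mxE; apply.
  - by rewrite rr0 // mulr_ge0.
  - move=> i'; rewrite (_ : (fun t => _) = fun t => \sum_j rr (N1 j i') * rr (al t 0 j)).
      exact: Zsum.
    apply/funext => t2; rewrite !mxE /rr rmorph_sum; apply: eq_bigr => l _.
    by rewrite rmorphM mulrC.
  - by move=> t2; rewrite (yE _ _ _ dr) map_mxD map_mxM.
  - move=> t2 i'; rewrite mxE /rr -ratr_norm ler_rat; exact: k2F dr _ _.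
have -> : al t = al t *m O *m pinvmx O + al t *m N1 *m K by rewrite wK /Q !mulmxA addrC subrK.
rewrite mxE raddfD /=; apply: le_trans (ler_normD _ _) _.
rewrite [leRHS]mulrAC !mulrDl addrC; apply: lerD.
  have -> : ratr ((al t *m N1 *m K) 0 j) = (map_mx rr (al t *m N1) *m map_mx rr K) 0 j.
    by rewrite /rr -map_mxM [RHS]mxE.
  have -> : D5 * (C1 * rr E1) * g m t ^+ \rank (kermx O) * ratr F =
     D5 * (C1 * rr (E1 * F) * g m t ^+ \rank (kermx O)).
    have -> : rr (E1 * F) = rr E1 * rr F by exact: rmorphM.
    rewrite -/(rr F); move: (rr E1) (rr F) (g m t ^+ _) => a b c.
    by rewrite -!mulrA; do 3!congr (_ * _); rewrite mulrC.
  apply: D5P; last first.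
    move=> i; have -> : map_mx rr (al t *m N1) 0 i = rr ((al t *m N1) 0 i) by rewrite mxE.
    exact: yb.
  apply: mulr_ge0; last exact: le_trans (g0 t _).
  by apply: mulr_ge0 => //; apply: rr0; exact: mulr_ge0.
apply: le_trans (_ : rr (D4 * C0) * ratr F <= _).
  rewrite -ratr_norm /rr -rmorphM ler_rat -mulrA; apply: D4P; first exact: mulr_ge0.
  exact: C0P dr t.
rewrite mulrAC; apply: ler_peMr => //.
apply: mulr_ge0; last exact: rr0.
by apply: rr0; exact: mulr_ge0.
Qed.

End pencil.

(** * Relations between blocks in a group with an ergodic automorphism *)

Definition zcomb (A : zmodType) s (E : 'I_s -> A) (v : 'rV[int]_s) := \sum_k E k *~ v 0 k.

Lemma zcomb_sub (A : zmodType) s (E : 'I_s -> A) : {morph zcomb E : u v / u - v}.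
Proof. by move=> u v; rewrite /zcomb -sumrB; apply: eq_bigr => k _; rewrite !mxE mulrzBr. Qed.

HB.instance Definition _ (A : zmodType) s (E : 'I_s -> A) :=
  GRing.isZmodMorphism.Build 'rV[int]_s A (zcomb E) (zcomb_sub E).

Lemma iter_sub (A : zmodType) (f : {additive A -> A}) n : {morph iter n f : u v / u - v}.
Proof. by move=> u v; elim: n => //= n ->; rewrite raddfB. Qed.

HB.instance Definition _ (A : zmodType) (f : {additive A -> A}) n :=
  GRing.isZmodMorphism.Build A A (iter n f) (iter_sub f n).

Definition torsion (A : zmodType) (x : A) := exists2 n, (0 < n)%N & x *+ n = 0.

Lemma torsion_subgrp (A : zmodType) : subgrp (@torsion A).
Proof.
split; first by exists 1%N.
move=> x y [n n0 xn] [m m0 ym]; exists (n * m)%N; first by rewrite muln_gt0 n0.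
by rewrite mulrnBl mulrnA xn mul0rn mulnC mulrnA ym mul0rn subrr.
Qed.

Lemma torsionMn (A : zmodType) (x : A) n : (0 < n)%N -> torsion (x *+ n) -> torsion x.
Proof. by move=> n0 [m m0 xm]; exists (n * m)%N; rewrite ?muln_gt0 ?n0 // mulrnA. Qed.

Lemma torsionMz (A : zmodType) (x : A) n : n != 0 -> torsion (x *~ n) -> torsion x.
Proof.
case: n => n n0; first by rewrite -pmulrn; apply: torsionMn; rewrite lt0n.
rewrite NegzE mulrNz -pmulrn => /(subgrpN (@torsion_subgrp A)); rewrite opprK.
exact: torsionMn.
Qed.

Lemma int_multiple m n (M : 'M[rat]_(m, n)) : exists2 d : nat, (0 < d)%N &
  exists Mz : 'M[int]_(m, n), d%:R *: M = map_mx intr Mz.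
Proof.
pose d := (\prod_i \prod_j `|denq (M i j)|)%N.
have d0 : (0 < d)%N by do 2![apply: prodn_gt0 => ?]; rewrite absz_gt0 denq_neq0.
exists d => //.
have dv i j : (`|denq (M i j)| %| d)%N.
  rewrite /d (bigD1 i) //= (bigD1 j) //= -mulnA; exact: dvdn_mulr.
exists (\matrix_(i, j) (numq (M i j) * (d %/ `|denq (M i j)|)%N%:Z)).
apply/matrixP => i j; rewrite !mxE.
have dz : (denq (M i j))%:~R != 0 :> rat by rewrite intr_eq0 denq_neq0.
rewrite -{1}[M i j]divq_num_den mulrCA rmorphM /=; congr (_ * _).
apply: (mulIf dz); rewrite divfK //.
have -> : denq (M i j) = `|denq (M i j)|%N%:Z by rewrite gez0_abs // ltW // denq_gt0.
by rewrite -!pmulrn -natrM absz_nat divnK.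
Qed.

(** [ka] gives coordinates modulo torsion: [cokermx M] kills exactly the rational span of the
    vectors with torsion image, and the factor [d] keeps the values integral. The last clause is the
    finiteness of the torsion subgroup in the form in which it is used, a pigeonhole. *)
Lemma coords (A : zmodType) r (ga : 'I_r -> A) (L : A -> Prop) :
  (forall x, L x <-> exists v, x = zcomb ga v) ->
  exists ka : A -> 'rV[rat]_r, [/\
    forall x y, L x -> L y -> ka (x - y) = ka x - ka y,
    forall x, L x -> (ka x = 0 <-> torsion x),
    forall x, L x -> exists w : 'rV[int]_r, ka x = map_mx intr w &
    exists B, forall f : nat -> A, (forall i, (i <= B)%N -> L (f i) /\ torsion (f i)) ->
      exists i j, (i < j <= B)%N /\ f i = f j].
Proof.
move=> LP; pose K v := torsion (zcomb ga v).
have sK : subgrp K.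
  split; first by rewrite /K raddf0; exact: (proj1 (@torsion_subgrp A)).
  by move=> x y Kx Ky; rewrite /K raddfB; apply: (proj2 (@torsion_subgrp A)).
pose V (q : 'rV[rat]_r) := exists2 n : nat, (0 < n)%N & exists2 w, n%:R *: q = map_mx intr w & K w.
have [||M MP] := @subspace_mx rat r V.
- exists 1%N => //; exists 0; last exact: (proj1 sK).
  by rewrite scaler0 map_mx0.
- move=> a u v [n n0 [w nw Kw]] [n' n'0 [w' nw' Kw']].
  have da : (denq a)%:~R != 0 :> rat by rewrite intr_eq0 denq_neq0.
  have dE : denq a = `|denq a|%N%:Z by rewrite gez0_abs // ltW // denq_gt0.
  exists (`|denq a| * n * n')%N; first by rewrite !muln_gt0 n0 n'0 absz_gt0 denq_neq0.
  exists (w *~ (`|denq a| * n')%N%:Z + w' *~ (numq a * n%:Z)); last first.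
    by apply: subgrpD => //; apply: subgrpMz.
  rewrite scalerDr raddfD /=; congr (_ + _).
    rewrite raddfMz /= -nw -scaler_int !scalerA; congr (_ *: _).
    by rewrite -pmulrn -!natrM; congr (_%:R); lia.
  rewrite raddfMz /= -nw' -scaler_int !scalerA; congr (_ *: _).
  have aE : a * (denq a)%:~R = (numq a)%:~R by rewrite -{1}[a]divq_num_den divfK.
  have dE' : `|denq a|%:R = (denq a)%:~R :> rat by rewrite pmulrn -dE.
  by rewrite !natrM rmorphM /= -[n%:~R]pmulrn -aE dE'; ring.
have VK v : V (map_mx intr v) <-> K v.
  split=> [[n n0 [w nw Kw]]|Kv]; last by exists 1%N => //; exists v; rewrite ?scale1r.
  have : K (v *+ n).
    suff -> : v *+ n = w by [].
    apply/rowP => j; apply: (@intr_inj rat).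
    have := congr1 (fun M : 'rV_r => M 0 j) nw; rewrite -scaler_nat !mxE => <-.
    by rewrite rmorphM /= rmorph_nat.
  by rewrite /K raddfMn /=; apply: torsionMn.
have [d d0 [Cz CE]] := int_multiple (cokermx M).
have ex x : exists v, L x -> x = zcomb ga v.
  have [/LP [v ->]|nL] := pselect (L x); first by exists v.
  by exists 0.
have [rep repP] := choice ex.
pose ka x : 'rV[rat]_r := map_mx intr (rep x) *m (d%:R *: cokermx M).
have ker v : K v -> map_mx intr v *m (d%:R *: cokermx M) = 0.
  move=> /VK /MP; rewrite submxE => /eqP h.
  by rewrite -scalemxAr h scaler0.
exists ka; split.
- move=> x y Lx Ly.
  have Lxy : L (x - y).
    by apply/LP; exists (rep x - rep y); rewrite raddfB; congr (_ - _); exact: repP.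
  apply/eqP; rewrite -subr_eq0 /ka -mulmxBl -mulmxBl -!map_mxB; apply/eqP; apply: ker.
  rewrite /K !zcomb_sub -!repP // subrr.
  exact: (proj1 (@torsion_subgrp A)).
- move=> x Lx; split; last first.
    by move=> tx; apply: ker; rewrite /K -(repP _ Lx).
  rewrite /ka -scalemxAr => /eqP; rewrite scaler_eq0 pnatr_eq0 eqn0Ngt d0 /= => h.
  have : (map_mx intr (rep x) <= M)%MS by rewrite submxE.
  by move=> /MP /VK; rewrite /K -(repP _ Lx).
- by move=> x Lx; exists (rep x *m Cz); rewrite /ka CE map_mxM.
(* The vectors with torsion image form a finitely generated lattice; as [n] kills the image of every
   generator, a torsion element is coded by coefficients modulo [n]. *)
have [m [g [Kg gP]]] := fg_subgroup sK.
have [o oP] := choice (fun i => let: ex_intro2 n n0 h := Kg i in ex_intro (fun n => (0 < n)%N /\ _) n (conj n0 h)).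
pose n := (\prod_i o i)%N.
have n0 : (0 < n)%N by apply: prodn_gt0 => i; case: (oP i).
have kn i : zcomb ga (g i) *+ n = 0.
  by rewrite /n (bigD1 i) //= mulrnA (proj2 (oP i)) mul0rn.
exists #|{ffun 'I_m -> 'I_n}| => f fP.
have code x : exists c : {ffun 'I_m -> 'I_n}, L x -> torsion x -> x = \sum_i zcomb ga (g i) *+ c i.
  have [[Lx tx]|nx] := pselect (L x /\ torsion x); last first.
    by exists [ffun=> Ordinal n0] => Lx tx; case: nx.
  have Kx : K (rep x) by rewrite /K -(repP _ Lx).
  have [c cE] := gP _ Kx.
  have cm i : (`|(c i %% n)%Z| < n)%N.
    by rewrite -ltz_nat gez0_abs ?ltz_pmod ?modz_ge0 // eqz_nat -lt0n.
  exists [ffun i => Ordinal (cm i)] => _ _.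
  rewrite {1}(repP _ Lx) cE raddf_sum; apply: eq_bigr => i _.
  rewrite ffunE raddfMz /= pmulrn gez0_abs ?modz_ge0 ?eqz_nat -?lt0n //.
  by rewrite {1}(divz_eq (c i) n) mulrzDr [_ * n%:Z]mulrC mulrzA -pmulrn kn mul0rz add0r.
have [h hP] := choice code.
apply: contrapT => nc.
have inj : injective (fun i : 'I_#|{ffun 'I_m -> 'I_n}|.+1 => h (f i)).
  move=> i j /= hij.
  have [Li ti] := fP i (ltn_ord i : (i <= _)%N).
  have [Lj tj] := fP j (ltn_ord j : (j <= _)%N).
  have fij : f i = f j by rewrite (hP _ Li ti) (hP _ Lj tj) hij.
  apply/val_inj; case: (ltngtP i j) => // lt; exfalso; apply: nc.
    by exists i, j; rewrite lt -ltnS ltn_ord.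
  by exists j, i; rewrite lt -ltnS ltn_ord.
by have := leq_card _ inj; rewrite card_ord ltnn.
Qed.

(** * Windows of coefficients: uniform bounds for the position of states *)

Section windows.
Variables (A : zmodType) (tau tau' : {additive A -> A}).
Hypotheses (tauK : cancel tau tau') (tau'K : cancel tau' tau).
Variables (s : nat) (E : 'I_s -> A).
Local Notation Ev := (zcomb E).

(** Coefficients occupy the exponents from 0 to [n - 1]; windows elsewhere are expressed by moving
    the element first, so that [win n (iter h tau x)] means exponents from [- h] to [n - h - 1]. *)
Definition win n x := exists v : nat -> 'rV[int]_s, x = \sum_(i < n) iter i tau (Ev (v i)).

Lemma win_subgrp n : subgrp (win n).
Proof.
split; first by exists (fun=> 0); rewrite big1 // => i _; rewrite !raddf0.
move=> x y [u ->] [v ->]; exists (fun i => u i - v i); rewrite -sumrB.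
by apply: eq_bigr => i _; rewrite !raddfB.
Qed.

Lemma win1 n k v : (k < n)%N -> win n (iter k tau (Ev v)).
Proof.
move=> kn; exists (fun i => if i == k then v else 0).
rewrite (bigD1 (Ordinal kn)) //= eqxx big1 ?addr0 // => i ik.
by rewrite ifN ?raddf0 //; apply: contraNneq ik => ik; apply/eqP/val_inj.
Qed.

Lemma win_ind n (P : A -> Prop) : subgrp P ->
  (forall k v, (k < n)%N -> P (iter k tau (Ev v))) -> forall x, win n x -> P x.
Proof. by move=> sP h x [v ->]; apply: subgrp_sum => // i _; apply: h. Qed.

Lemma win_le m n x : (m <= n)%N -> win m x -> win n x.
Proof.
move=> mn; apply: win_ind; first exact: win_subgrp.
by move=> k v km; apply: win1; apply: leq_trans mn.
Qed.

Lemma win_shift n k x : win n x -> win (n + k) (iter k tau x).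
Proof.
apply: (win_ind (P := fun x => win (n + k) (iter k tau x))).
  have [h0 hB] := win_subgrp (n + k).
  by split=> [|u v hu hv]; [rewrite raddf0 | rewrite raddfB; apply: hB].
by move=> j v jn; rewrite -iterD; apply: win1; rewrite addnC ltn_add2r.
Qed.

Lemma win_fg n : exists r (ga : 'I_r -> A), forall x, win n x <-> exists v, x = zcomb ga v.
Proof.
elim: n => [|n [r [ga IH]]].
  exists 0%N, (fun=> 0) => x; split=> [[v ->]|[v ->]].
    by exists 0; rewrite big_ord0 raddf0.
  by rewrite /zcomb big_ord0; exact: (proj1 (win_subgrp 0)).
exists (r + s)%N, (fun k => match split k with inl a => ga a | inr b => iter n tau (E b) end) => x.
have zE (v : 'rV_r) (w : 'rV_s) : zcomb (fun k => match split k with inl a => ga a | inr b => iter n tau (E b) end) (row_mx v w) = zcomb ga v + iter n tau (Ev w).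
  rewrite /zcomb big_split_ord /=; congr (_ + _).
    by apply: eq_bigr => i _; rewrite row_mxEl (unsplitK (inl _ i)).
  rewrite raddf_sum; apply: eq_bigr => i _.
  by rewrite row_mxEr (unsplitK (inr _ i)) raddfMz.
split=> [[v ->]|[v ->]].
  rewrite big_ord_recr /=.
  have : win n (\sum_(i < n) iter i tau (Ev (v i))) by exists v.
  by move=> /IH [w ->]; exists (row_mx w (v n)); rewrite zE.
rewrite -(hsubmxK v) zE; apply: (subgrpD (win_subgrp _)); last exact: win1.
by apply: (@win_le n) => //; apply/IH; exists (lsubmx v).
Qed.

(** As in Hilbert's basis theorem: the leading coefficients [v] whose top term falls back into the
    lower window form an increasing chain of subgroups of [Z^s], whose union is finitely generated,
    so the chain stops. *)
Lemma lam_stab : exists D, forall n v, win n (iter n tau (Ev v)) -> win D (iter D tau (Ev v)).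
Proof.
pose La n v := win n (iter n tau (Ev v)).
have mono n k v : La n v -> La (n + k)%N v by rewrite /La addnC iterD addnC; exact: win_shift.
have sLa n : subgrp (La n).
  have [h0 hB] := win_subgrp n.
  by split=> [|u v Lu Lv]; rewrite /La ?raddf0 // !raddfB; apply: hB.
have sU : subgrp (fun v => exists n, La n v).
  split; first by exists 0%N; exact: (proj1 (sLa _)).
  move=> u v [n Ln] [m Lm]; exists (n + m)%N; apply: (proj2 (sLa _)); first exact: mono.
  by rewrite addnC; exact: mono.
have [m [g [gU gP]]] := fg_subgroup sU.
have [o oP] := choice gU.
exists (\sum_i o i)%N => n v Lv.
have [c ->] := gP v (ex_intro _ n Lv).
rewrite -/(La (\sum_i o i)%N _); apply: subgrp_sum => // i _; apply: subgrpMz => //.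
by rewrite (bigD1 i) //=; apply: mono.
Qed.

(** An element supported both on nonnegative exponents and on negative ones is supported on the last
    [D] negative ones, with [D] uniform. The top term of the window [[0, K)] is removed with
    [lam_stab], [K] times. *)
Lemma state_win : exists D, forall K n z, win K z -> win n (iter n tau z) -> win D (iter D tau z).
Proof.
have [D DP] := lam_stab; exists D => K n z wK wn.
have : win (D + K) (iter D tau z) by rewrite addnC; exact: win_shift.
elim: {wK} K => [|K IH]; first by rewrite addn0.
rewrite addnS => -[v vE]; apply: IH.
rewrite vE big_ord_recr /=; apply: (subgrpD (win_subgrp _)).
  by apply: subgrp_sum; [exact: win_subgrp | move=> i _; exact: win1].
suff /DP h : win (n + (D + K)) (iter (n + (D + K)) tau (Ev (v (D + K)%N))).
  by rewrite [X in iter X]addnC iterD; exact: win_shift.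
rewrite iterD.
have -> : iter (D + K) tau (Ev (v (D + K)%N)) = iter D tau z - \sum_(i < D + K) iter i tau (Ev (v i)).
  by rewrite vE big_ord_recr /= [_ + iter _ _ _]addrC addrK.
rewrite raddfB; apply: (proj2 (win_subgrp _)).
  rewrite /= -iterD [X in iter X]addnC iterD addnA; apply: (@win_le (n + D)); first exact: leq_addr.
  exact: win_shift.
rewrite raddf_sum; apply: subgrp_sum; first exact: win_subgrp.
by move=> i _; rewrite /= -iterD; apply: win1; rewrite ltn_add2l.
Qed.

Hypothesis gen : forall x, exists h n, win n (iter h tau x).

(** Some two-sided window contains [c]. Adding or subtracting [iter N tau c - c] trims its lower
    end, and in a second round its upper end, in steps of [N], which brings [c] under
    [state_win]. *)
Lemma cyc_state : exists D, forall N c, (0 < N)%N -> win N (iter N tau c - c) -> win D (iter D tau c).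
Proof.
have [D DP] := state_win; exists D => N c N0 wB.
have [h [n0 w0]] := gen c.
have [K wK] : exists K, win K c.
  suff H k : forall h' n1, (h' <= k * N)%N -> win n1 (iter h' tau c) -> exists K, win K c.
    by apply: (H h h n0) => //; rewrite leq_pmulr.
  elim: k => [|k IH] h' n1; first by rewrite mul0n leqn0 => /eqP-> /=; exists n1.
  case: (leqP h' (k * N)) => [le _ w|lt le w]; first exact: IH le w.
  have [h'N|Nh'] := leqP h' N.
    have w' : win (n1 + (N - h')) (iter N tau c) by rewrite -(subnK h'N) iterD addnK; exact: win_shift.
    exists (n1 + N)%N; have -> : c = iter N tau c - (iter N tau c - c) by rewrite opprB addrC subrK.
    apply: (proj2 (win_subgrp _)).
      by apply: win_le w'; rewrite leq_add2l leq_subr.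
    by apply: win_le wB; rewrite leq_addl.
  apply: (IH (h' - N)%N (n1 + (h' - N) + N)%N); first by rewrite mulSn in le; lia.
  have -> : iter (h' - N) tau c = iter h' tau c - iter (h' - N) tau (iter N tau c - c).
    by rewrite raddfB /= -iterD subnK ?(ltnW Nh') // opprB addrC subrK.
  apply: (proj2 (win_subgrp _)); first by apply: win_le w; lia.
  by apply: (@win_le (N + (h' - N))); [lia | exact: win_shift].
suff H k : forall j n, (j <= k * N)%N -> win (n + j) (iter n tau c) -> exists n', win n' (iter n' tau c).
  have [||n' wn'] := H n0 n0 h; first by rewrite leq_pmulr.
    by apply: win_le w0; rewrite leq_addl.
  exact: DP wK wn'.
elim: k => [|k IH] j n; first by rewrite mul0n leqn0 => /eqP->; rewrite addn0; exists n.
case: (leqP j (k * N)) => [le _|lt le] w; first exact: IH le w.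
have w2 : win (n + maxn j N) (iter (n + N) tau c).
  rewrite iterD; have -> : iter N tau c = c + (iter N tau c - c) by rewrite addrC subrK.
  rewrite raddfD; apply: (subgrpD (win_subgrp _)).
    by apply: win_le w; rewrite leq_add2l leq_maxl.
  apply: (@win_le (N + n)); first by rewrite addnC leq_add2l leq_maxr.
  exact: win_shift.
apply: (IH (j - N)%N (n + N)%N); first by rewrite mulSn in le; lia.
by apply: win_le w2; rewrite maxnE; lia.
Qed.

End windows.

(** * Spectra of powers, and integer polynomials with all roots on the unit circle *)

Lemma trig_exp (F : comNzRingType) n (T : 'M[F]_n) : is_trig_mx T ->
  forall k, is_trig_mx (T ^+ k) /\ forall i, (T ^+ k) i i = T i i ^+ k.
Proof.
move=> /is_trig_mxP trT; elim=> [|k [/is_trig_mxP IH1 IH2]].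
  split; last by move=> i; rewrite !expr0 mxE eqxx.
  by apply/is_trig_mxP => i j ij; rewrite expr0 mxE -val_eqE ltn_eqF.
split.
  apply/is_trig_mxP => i j ij; rewrite exprS -mulmxE mxE big1 // => l _.
  case: (ltnP i l) => [il|li]; first by rewrite trT ?mul0r.
  by rewrite IH1 ?mulr0 // (leq_ltn_trans li).
move=> i; rewrite !exprS -mulmxE mxE (bigD1 i) //= IH2 big1 ?addr0 // => l li.
case: (ltngtP i l) => [il|il|/val_inj e]; first by rewrite trT ?mul0r.
  by rewrite IH1 ?mulr0.
by rewrite e eqxx in li.
Qed.

Lemma triangularize n (T : 'M[algC]_n) : exists P T', [/\ P \in unitmx, is_trig_mx T' &
  T = invmx P *m T' *m P].
Proof.
case: n T => [|n] T.
  by exists 1%:M, T; split; rewrite ?unitmx1 //; [apply/is_trig_mxP => -[] | apply/matrixP => -[]].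
have [//|P Pu trP] := Schur T _.
have Pun : P \in unitmx by exact: unitarymx_unit.
exists P, (P *m T *m invmx P); split=> //; last by rewrite !mulmxA mulVmx // mul1mx mulmxKV.
by move: trP; rewrite /similar_to /conjmx pinvmxE.
Qed.

Lemma conj_exp n (P T : 'M[algC]_n) k : P \in unitmx ->
  (invmx P *m T *m P) ^+ k = invmx P *m T ^+ k *m P.
Proof.
move=> Pu; elim: k => [|k IH]; first by rewrite !expr0 mulmx1 mulVmx.
by rewrite !exprSr IH -!mulmxE !mulmxA mulmxK.
Qed.

Lemma eigenvalue_sim n (P T : 'M[algC]_n) x : P \in unitmx ->
  eigenvalue (invmx P *m T *m P) x -> eigenvalue T x.
Proof.
move=> Pu /eigenvalueP [v vT v0]; apply/eigenvalueP; exists (v *m invmx P).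
  by rewrite scalemxAl -vT !mulmxA mulmxK.
by apply: contraNneq v0 => h; rewrite -(mulmxKV Pu v) h mul0mx.
Qed.

Lemma eigenvalue_trig n (T : 'M[algC]_n) x : is_trig_mx T ->
  eigenvalue T x = [exists i, T i i == x].
Proof.
move=> trT; rewrite eigenvalue_root_char char_poly_trig //.
rewrite -(big_map (fun i => T i i) xpredT (fun a => 'X - a%:P)) root_prod_XsubC.
apply/mapP/existsP => [[i _ ->]|[i /eqP <-]]; first by exists i.
by exists i; rewrite // mem_index_enum.
Qed.

Lemma eigenvalue_sim_iff n (P T : 'M[algC]_n) x : P \in unitmx ->
  eigenvalue (invmx P *m T *m P) x = eigenvalue T x.
Proof.
move=> Pu; apply/idP/idP; first exact: eigenvalue_sim.
move=> h; apply: (@eigenvalue_sim _ (invmx P)); first by rewrite unitmx_inv.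
by rewrite invmxK !mulmxA mulmxV // mul1mx mulmxK.
Qed.

Lemma eigenvalue_exp n (T : 'M[algC]_n) k x : eigenvalue (T ^+ k) x ->
  exists2 y, eigenvalue T y & y ^+ k = x.
Proof.
have [P [T' [Pu trT' ->]]] := triangularize T.
rewrite conj_exp // eigenvalue_sim_iff //.
have [tr dg] := trig_exp trT' k.
rewrite eigenvalue_trig // => /existsP [i /eqP <-]; exists (T' i i); last by rewrite dg.
by rewrite eigenvalue_sim_iff // eigenvalue_trig //; apply/existsP; exists i.
Qed.

(** Pigeonhole on the powers of [t]: real and imaginary parts are sorted into cells of side 1/2, and
    two powers with the same cells are at distance less than 1. *)
Lemma dirichlet_unit n (t : 'I_n -> algC) : (forall i, `|t i| = 1) ->
  exists2 m, (0 < m)%N & forall i, `|t i ^+ m - 1| < 1.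
Proof.
move=> t1.
pose fl (x : algC) := Num.floor (2 * x).
(* For [x] in [[-1, 1]] the integer part of [2 * x] runs from -2 to 2, hence the shift by 2 and the
   five values. *)
pose cd (x : algC) : 'I_5 := inord (absz (fl x + 2)).
have flb x : x \is Num.real -> `|x| <= 1 -> 0 <= fl x + 2 <= 4.
  move=> xr; rewrite real_ler_norml ?real1 // => /andP[x1 x2].
  have r2 : 2 * x \is Num.real by rewrite realM.
  have h1 : (-2)%:~R <= (2 * x : algC).
    by rewrite (_ : (-2)%:~R = 2 * (-1)) ?ler_pM2l // mulrN1.
  have h2 : 2 * x < 3%:~R :> algC.
    apply: le_lt_trans (_ : 2 * x <= 2 * 1) _; first by rewrite ler_pM2l.
    by rewrite mulr1 ltr_nat.
  have := real_floor_ge_int (-2) r2; rewrite h1 -/(fl x).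
  have := real_floor_lt_int 3 r2; rewrite h2 -/(fl x); lia.
have cdP x y : x \is Num.real -> y \is Num.real -> `|x| <= 1 -> `|y| <= 1 ->
    cd x = cd y -> `|x - y| < 2^-1.
  move=> xr yr x1 y1 /(congr1 val); rewrite /= !inordK; last 2 first.
  - by have := flb y yr y1; lia.
  - by have := flb x xr x1; lia.
  move=> e; have {}e : fl x = fl y.
    by have := flb x xr x1; have := flb y yr y1; lia.
  have xr2 : 2 * x \is Num.real by rewrite realM.
  have yr2 : 2 * y \is Num.real by rewrite realM.
  have hx1 := real_floor_le xr2; have hx2 := real_floorD1_gt xr2.
  have hy1 := real_floor_le yr2; have hy2 := real_floorD1_gt yr2.
  rewrite -/(fl _) e rmorphD /= in hx1 hx2; rewrite -/(fl y) rmorphD /= in hy1 hy2.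
  have -> : x - y = 2^-1 * (2 * x - 2 * y) by field.
  rewrite normrM ger0_norm ?invr_ge0 // -[ltRHS]mulr1 ltr_pM2l ?invr_gt0 //.
  rewrite real_ltr_norml ?realB //; apply/andP; split.
    rewrite ltrBDl addrC -ltrBrDl opprK; apply: lt_le_trans hy2 _; rewrite addrC [X in _ <= X]addrC lerD2l //.
  rewrite ltrBlDr addrC; apply: lt_le_trans hx2 _; by rewrite lerD2r.
pose code (k : nat) : {ffun 'I_n -> 'I_5 * 'I_5} := [ffun i => (cd ('Re (t i ^+ k)), cd ('Im (t i ^+ k)))].
have [i [j [ij cij]]] : exists i j : 'I_(#|{ffun 'I_n -> 'I_5 * 'I_5}|.+1), (i < j)%N /\ code i = code j.
  apply: contrapT => nh.
  have inj : injective (fun i : 'I_(#|{ffun 'I_n -> 'I_5 * 'I_5}|.+1) => code i).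
    move=> i j /= hij; apply/val_inj; case: (ltngtP i j) => // lt.
      by exfalso; apply: nh; exists i, j.
    by exfalso; apply: nh; exists j, i.
  by have := leq_card _ inj; rewrite !card_ord ltnn.
exists (j - i)%N; first by rewrite subn_gt0.
move=> l; have := congr1 (fun f : {ffun 'I_n -> 'I_5 * 'I_5} => f l) cij; rewrite !ffunE => -[cR cI].
have tk k : `|t l ^+ k| = 1 by rewrite normrX t1 expr1n.
have rb k : `|'Re (t l ^+ k)| <= 1 by rewrite -(tk k) leif_normC_Re_Creal.
have ib k : `|'Im (t l ^+ k)| <= 1.
  rewrite -(tk k) -normrN -ReMil; apply: le_trans (_ : `|'i * t l ^+ k| <= _).
    exact: leif_normC_Re_Creal.
  by rewrite normrM normCi mul1r.
have -> : `|t l ^+ (j - i) - 1| = `|t l ^+ j - t l ^+ i|.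
  rewrite -{2}(subnK (ltnW ij)) exprD -{2}[t l ^+ i]mul1r -mulrBl normrM tk mulr1 //.
rewrite [t l ^+ j]Crect [t l ^+ i]Crect opprD addrACA -mulrBr.
apply: le_lt_trans (ler_normD _ _) _; rewrite normrM normCi mul1r.
rewrite -[1]/(1%:R) (_ : 1%:R = 2^-1 + 2^-1 :> algC); last by field.
by apply: ltrD; apply: cdP; rewrite ?Creal_Re ?Creal_Im.
Qed.

(** For the companion matrix [T], the determinant of [T ^+ m - 1] is an integer and the product of
    the [x ^+ m - 1] over the roots; [m] from Dirichlet makes every factor smaller than 1, so one of
    them is 0. *)
Lemma kronecker_roots (p : {poly int}) : p \is monic -> (1 < size p)%N ->
  (forall x : algC, root (map_poly intr p) x -> `|x| = 1) ->
  exists x m, [/\ root (map_poly intr p) x, (0 < m)%N & x ^+ m = 1 :> algC].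
Proof.
move=> pm sp p1.
pose T : 'M[int]_((size p).-1) := companionmx p.
have chT : char_poly (map_mx intr T) = map_poly intr p :> {poly algC}.
  by rewrite -map_char_poly companionmxK.
have ev (x : algC) : eigenvalue (map_mx intr T) x = root (map_poly intr p) x.
  by rewrite eigenvalue_root_char chT.
have TX k : (map_mx intr T : 'M[algC]_((size p).-1)) ^+ k = map_mx intr (T ^+ k).
  elim: k => [|k IH]; first by rewrite !expr0 map_mx1.
  by rewrite !exprS -!mulmxE IH map_mxM.
have [P [T' [Pu trT' TE]]] := triangularize (map_mx intr T).
have T'e i : eigenvalue (map_mx intr T) (T' i i).
  by rewrite TE eigenvalue_sim_iff // eigenvalue_trig //; apply/existsP; exists i.
have [m m0 mP] := @dirichlet_unit _ (fun i => T' i i) (fun i => p1 _ (etrans (esym (ev _)) (T'e i))).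
have dE : \det ((map_mx intr T : 'M[algC]_((size p).-1)) ^+ m - 1%:M) = \prod_i (T' i i ^+ m - 1).
  rewrite TE; have [tr dg] := trig_exp trT' m.
  rewrite conj_exp // -[1%:M](mulVmx Pu) -{2}[invmx P]mulmx1 -mulmxBl -mulmxBr.
  rewrite !det_mulmx mulrAC -det_mulmx mulVmx // det1 mul1r det_trig.
    by apply: eq_bigr => i _; rewrite !mxE eqxx dg.
  apply/is_trig_mxP => i j ij; rewrite !mxE -val_eqE (ltn_eqF ij) subr0.
  by move/is_trig_mxP: tr => ->.
have d0 : \det (T ^+ m - 1%:M) = 0.
  have : `|(\det (T ^+ m - 1%:M))%:~R : algC| < 1.
    rewrite -det_map_mx map_mxB map_mx1 -TX dE normr_prod.
    have n0 : (0 < (size p).-1)%N by rewrite -subn1 subn_gt0.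
    rewrite (bigD1 (Ordinal n0)) //=.
    apply: le_lt_trans (mP (Ordinal n0)); rewrite ler_piMr //.
    by apply: prodr_ile1 => i _; rewrite normr_ge0 ltW.
  rewrite -intr_norm -[1]/(1%:~R) ltr_int; lia.
have : \prod_i (T' i i ^+ m - 1) == 0.
  by rewrite -dE TX -(map_mx1 (intr : int -> algC)) -map_mxB det_map_mx d0.
move=> /prodf_eq0 [i _]; rewrite subr_eq0 => /eqP im.
by exists (T' i i), m; rewrite -ev.
Qed.

(** At a root the constant term, or the leading term, is dominated by the other terms; with
    coefficients at most 1 these are compared with a geometric series of ratio 1/2, or of ratio at
    least 2. *)
Lemma small_poly_roots (h : {poly int}) (x : algC) : h != 0 -> `|h`_0| = 1 -> `|lead_coef h| = 1 ->
  (forall i, `|h`_i| <= 1) -> root (map_poly intr h) x -> 2^-1 < `|x| < 2.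
Proof.
move=> h0 hc hl hb /rootP.
have geo (y : algC) n : 0 <= y -> (1 - y) * \sum_(i < n) y ^+ i = 1 - y ^+ n.
  by move=> y0; rewrite -[RHS]opprB subrX1 -mulNr opprB.
rewrite horner_coef size_map_inj_poly //; last exact: intr_inj.
under eq_bigr => i _ do rewrite coef_map.
case E: (size h) (h0) => [|d]; first by move/eqP: E; rewrite size_poly_eq0 => ->.
move=> _ S0.
have cb i : `|(h`_i)%:~R : algC| <= 1 by rewrite -intr_norm -[1]/(1%:~R) ler_int.
have hd : `|(h`_d)%:~R : algC| = 1 by rewrite -intr_norm; move: hl; rewrite lead_coefE E /= => ->.
have h00 : `|(h`_0)%:~R : algC| = 1 by rewrite -intr_norm hc.
have xr : `|x| \is Num.real by rewrite normr_real.
have r2 : (2^-1 : algC) \is Num.real by rewrite realV realn.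
apply/andP; split; rewrite real_ltNge ?realn //; apply/negP => hx.
- have e : (h`_0)%:~R = - \sum_(i < d) (h`_(lift ord0 i))%:~R * x ^+ (lift ord0 i).
    by move: S0; rewrite big_ord_recl expr0 mulr1 => /eqP; rewrite addr_eq0 => /eqP.
  have : 1 <= \sum_(i < d) 2^-1 ^+ i.+1 :> algC.
    apply: le_trans (_ : `|(h`_0)%:~R| <= _); first by rewrite h00.
    rewrite e normrN; apply: le_trans (ler_norm_sum _ _ _) _.
    apply: ler_sum => i _; rewrite normrM normrX -[leRHS]mul1r.
    by apply: ler_pM => //; rewrite ?exprn_ge0 //; apply: lerXn2r; rewrite ?nnegrE // invr_ge0.
  under eq_bigr => i _ do rewrite exprS.
  rewrite -mulr_sumr; have := @geo 2^-1 d; rewrite invr_ge0 ler0n => /(_ isT).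
  have -> : 1 - 2^-1 = 2^-1 :> algC by field.
  move=> ->; rewrite lerDl oppr_ge0; apply/negP; rewrite -real_ltNge ?realX ?realV ?realn ?real0 //.
  by rewrite exprn_gt0 // invr_gt0.
- have e : (h`_d)%:~R * x ^+ d = - \sum_(i < d) (h`_i)%:~R * x ^+ i.
    by move: S0; rewrite big_ord_recr /= => /eqP; rewrite addrC addr_eq0 => /eqP.
  have le1 : `|x| ^+ d <= \sum_(i < d) `|x| ^+ i.
    apply: le_trans (_ : `|(h`_d)%:~R * x ^+ d| <= _); first by rewrite normrM hd mul1r normrX.
    rewrite e normrN; apply: le_trans (ler_norm_sum _ _ _) _.
    by apply: ler_sum => i _; rewrite normrM normrX -[leRHS]mul1r ler_wpM2r ?exprn_ge0.
  have x1 : 1 <= `|x| - 1 by rewrite lerBrDl.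
  have : `|x| ^+ d <= (`|x| - 1) * \sum_(i < d) `|x| ^+ i.
    by apply: le_trans le1 _; rewrite ler_peMl // sumr_ge0 // => i _; rewrite exprn_ge0.
  have := geo `|x| d (normr_ge0 _) => g.
  have -> : (`|x| - 1) * \sum_(i < d) `|x| ^+ i = `|x| ^+ d - 1.
    by rewrite -[RHS]opprB -g -mulNr opprB.
  by rewrite lerDl oppr_ge0 ler10.
Qed.

(** * Integer polynomials acting through an endomorphism *)

Section poly_action.
Variables (A : zmodType) (f : {additive A -> A}).
Implicit Types (p q : {poly int}) (c : A).

Definition pact p c := \sum_(i < size p) iter i f c *~ p`_i.

Lemma pact_wide n p c : (size p <= n)%N -> pact p c = \sum_(i < n) iter i f c *~ p`_i.
Proof.
move=> pn; rewrite /pact (big_ord_widen n (fun i => iter i f c *~ p`_i)) // big_mkcond /=.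
apply: eq_bigr => i _; case: ltnP => // le; by rewrite nth_default.
Qed.

Lemma pact_sub p q c : pact (p - q) c = pact p c - pact q c.
Proof.
pose n := maxn (size p) (size q).
rewrite (@pact_wide n (p - q)); last by rewrite (leq_trans (size_polyD _ _)) // size_polyN.
rewrite (@pact_wide n p) ?leq_maxl // (@pact_wide n q) ?leq_maxr // -sumrB.
by apply: eq_bigr => i _; rewrite coefB mulrzBr.
Qed.

Lemma pact0 c : pact 0 c = 0.
Proof. by rewrite /pact size_poly0 big_ord0. Qed.

Lemma pactD p q c : pact (p + q) c = pact p c + pact q c.
Proof. by rewrite -{1}[q]opprK pact_sub -[- q]sub0r pact_sub pact0 sub0r opprK. Qed.

Lemma pactZ a p c : pact (a *: p) c = pact p c *~ a.
Proof.
rewrite (@pact_wide (size p)) ?size_scale_leq // [in RHS]/pact mulrz_suml; apply: eq_bigr => i _.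
by rewrite coefZ mulrC mulrzA.
Qed.

Lemma pact_cons p a c : pact (p * 'X + a%:P) c = f (pact p c) + c *~ a.
Proof.
rewrite (@pact_wide (size p).+1) ?size_MXaddC; last by case: ifP.
rewrite big_ord_recl addrC; congr (_ + _); last by rewrite coefD coefMX coefC /= add0r.
rewrite raddf_sum; apply: eq_bigr => i _.
by rewrite coefD coefMX coefC /= addr0 raddfMz.
Qed.

Lemma pact_is_sub p : {morph pact p : x y / x - y}.
Proof. by move=> x y; rewrite /pact -sumrB; apply: eq_bigr => i _; rewrite raddfB mulrzBl. Qed.

HB.instance Definition _ p := GRing.isZmodMorphism.Build A A (pact p) (pact_is_sub p).

Lemma pactM p q c : pact (p * q) c = pact p (pact q c).
Proof.
elim/poly_ind: p => [|p a IH]; first by rewrite mul0r !pact0.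
rewrite pact_cons -IH mulrDl mul_polyC pactD pactZ; congr (_ + _).
by rewrite mulrAC -[p * q * 'X]addr0 -(polyC0 int) pact_cons mulr0z addr0.
Qed.

Lemma pactXn n c : pact 'X^n c = iter n f c.
Proof.
elim: n => [|n IH].
  by rewrite expr0 /pact size_poly1 big_ord1 /= coef1 mulr1z.
by rewrite exprSr -[_ * 'X]addr0 -(polyC0 int) pact_cons IH mulr0z addr0.
Qed.

Lemma torsion_raddf (g : {additive A -> A}) c : torsion c -> torsion (g c).
Proof. by case=> n n0 h; exists n => //; rewrite -raddfMn h raddf0. Qed.

End poly_action.

(** [T] has finitely many eigenvalues, so one power pushes all moduli other than 1 out of the
    annulus to which [small_poly_roots] confines the roots of [h]. *)
Lemma spectral_gap n (T : 'M[algC]_n) : exists2 q, (0 < q)%N &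
  forall x, eigenvalue T x -> `|x| = 1 \/ 2 <= `|x| ^+ q \/ `|x| ^+ q <= 2^-1.
Proof.
have one (x : algC) : exists q0 : nat, forall q, (q0 <= q)%N ->
    `|x| = 1 \/ 2 <= `|x| ^+ q \/ `|x| ^+ q <= 2^-1.
  have xr : `|x| \is Num.real by rewrite normr_real.
  have big (y : algC) : 1 < y -> exists q0 : nat, forall q, (q0 <= q)%N -> 2 <= y ^+ q.
    move=> y1; have d0 : 0 < y - 1 by rewrite subr_gt0.
    exists (Num.bound (y - 1)^-1) => q qq.
    have h : (y - 1)^-1 < q%:R.
      apply: lt_le_trans (archi_boundP _) _; first by rewrite invr_ge0 ltW.
      by rewrite ler_nat.
    have : 1 + (y - 1) *+ q <= y ^+ q.
      elim: {qq h} q => [|k IH]; first by rewrite mulr0n addr0 expr0.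
      rewrite exprS mulrSr addrA; apply: le_trans (_ : y ^+ k + (y - 1) <= _); first by rewrite lerD2r.
      have -> : y * y ^+ k = y ^+ k + (y - 1) * y ^+ k by ring.
      rewrite lerD2l ler_peMr; [by []|exact: ltW|].
      by rewrite exprn_ege1 // ltW.
    apply: le_trans; rewrite -[2]/(1 + 1) lerD2l -mulr_natl.
    by move: h; rewrite -(ltr_pM2r d0) mulVf ?gt_eqF // => /ltW.
  case: (real_ltgtP xr (real1 _)) => x1; last by exists 0%N => q _; left.
    have [->|x0] := eqVneq x 0.
      exists 1%N => q q1; right; right; rewrite normr0 expr0n eqn0Ngt q1 /= invr_ge0.
      exact: ler0n.
    have xp : 0 < `|x| by rewrite normr_gt0.
    have [|q0 h] := big `|x|^-1; first by rewrite invf_gt1.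
    exists q0 => q /h h2; right; right.
    rewrite -[`|x| ^+ q]invrK lef_pV2 ?posrE ?invr_gt0 ?exprn_gt0 ?ltr0n //.
    by rewrite -exprVn.
  by have [q0 h] := big _ x1; exists q0 => q /h; right; left.
have [rs rsE] := closed_field_poly_normal (char_poly T).
have [qq qqP] := choice one.
exists (\sum_(x <- rs) qq x).+1%N => // x; rewrite eigenvalue_root_char rsE.
rewrite (monicP (char_poly_monic _)) scale1r root_prod_XsubC => xrs.
by apply: qqP; rewrite (big_rem x) //= -addnS leq_addr.
Qed.

(** The polynomials that kill [c] modulo torsion are the multiples of one primitive [p]. Its roots
    are roots of both [h] and [chi], hence on the unit circle, and its leading coefficient is a
    unit, so some root is a root of unity. Cancelling the common factor with ['X^m - 1] gives a
    smaller annihilator, because [sg ^ m - 1] is injective modulo torsion. *)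
Lemma no_small_relation (A : zmodType) (sg : {additive A -> A}) c (h chi : {poly int}) :
  ~ torsion c -> (forall y, torsion (sg y) -> torsion y) ->
  (forall n y, (0 < n)%N -> torsion (iter n sg y - y) -> torsion y) ->
  h != 0 -> (forall i, `|h`_i| <= 1) -> torsion (pact sg h c) -> torsion (pact sg chi c) ->
  (forall x : algC, root (map_poly intr chi) x -> `|x| = 1 \/ 2 <= `|x| \/ `|x| <= 2^-1) -> False.
Proof.
move=> nt sgt sge h0 hb hc chic chiP.
pose K f := torsion (pact sg f c).
have [|f0s [f0 [f00 Kf0 sf0]] f0min] := @minP (fun n => exists f, [/\ f != 0, K f & size f = n]).
  by exists (size h), h.
have div g : K g -> f0 %| g.
  move=> Kg; have e := Pdiv.Idomain.divp_eq g f0.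
  have Kr : K (g %% f0).
    have -> : g %% f0 = lead_coef f0 ^+ scalp g f0 *: g - (g %/ f0) * f0 by rewrite e addrC addKr.
    rewrite /K pact_sub pactZ pactM; apply: (proj2 (@torsion_subgrp A)).
      by apply: subgrpMz => //; exact: torsion_subgrp.
    exact: torsion_raddf.
  apply: contrapT; rewrite /dvdp => /negP nz.
  have := f0min (size (g %% f0)) (ex_intro _ (g %% f0) (And3 nz Kr erefl)).
  by rewrite leqNgt -sf0 ltn_modp f00.
(* By Gauss's lemma, divisibility by the primitive part over the rationals is divisibility over the
   integers. *)
pose p := zprimitive f0.
have p0 : p != 0 by rewrite zprimitive_eq0.
have Kp : K p.
  move: Kf0; rewrite {1}(zpolyEprim f0) /K pactZ; apply: torsionMz.
  by rewrite zcontents_eq0.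
have sp : size p = f0s by rewrite size_zprimitive.
have pdiv g : K g -> exists r, g = p * r by move=> /div /dvdpP_int [r ->]; exists r.
have sp1 : (1 < size p)%N.
  rewrite ltnNge; apply/negP => /size1_polyC pE.
  apply: nt; move: Kp; rewrite /K pE -alg_polyC pactZ -(expr0 'X) pactXn /=.
  by apply: torsionMz; move: p0; rewrite {1}pE polyC_eq0.
(* The largest power of ['X] dividing [h] is removed, which is harmless as [sg] is injective modulo
   torsion; then the constant term is 1 or -1. *)
have [k hk kmin] : exists2 k, h`_k != 0 & forall m, h`_m != 0 -> (k <= m)%N.
  by apply: minP; exists (size h).-1; rewrite -lead_coefE lead_coef_eq0.
pose h' := drop_poly k h.
have hE : h = h' * 'X^k.
  rewrite -[LHS](poly_take_drop k) (_ : take_poly k h = 0) ?add0r //.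
  apply/polyP => i; rewrite coef_take_poly coef0; case: ltnP => // ik.
  by apply/eqP; apply: contraTT ik => /kmin; rewrite leqNgt.
have h'0 : h' != 0 by apply: contraNneq h0 => e; rewrite hE e mul0r.
have Kh' : K h'.
  have : torsion (iter k sg (pact sg h' c)) by rewrite -pactXn -pactM mulrC -hE.
  by elim: (k) => // n IH /sgt.
have int1 (x : int) : x != 0 -> `|x| <= 1 -> `|x| = 1 by lia.
have h'b i : `|h'`_i| <= 1 by rewrite coef_drop_poly.
have h'c : `|h'`_0| = 1 by apply: int1 => //; rewrite coef_drop_poly add0n.
have h'l : `|lead_coef h'| = 1 by apply: int1; rewrite ?lead_coef_eq0 // lead_coefE.
have [r1 E1] := pdiv _ Kh'.
have [r2 E2] := pdiv _ chic.
have rootp (x : algC) : root (map_poly intr p) x -> `|x| = 1.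
  move=> px.
  have hx : root (map_poly intr h') x by rewrite E1 rmorphM rootM px.
  have cx : root (map_poly intr chi) x by rewrite E2 rmorphM rootM px.
  have := small_poly_roots h'0 h'c h'l h'b hx => /andP[l1 l2].
  case: (chiP x cx) => [//|[l3|l3]].
    by have := lt_le_trans l2 l3; rewrite ltxx.
  by have := lt_le_trans l1 l3; rewrite ltxx.
have pl : `|lead_coef p| = 1.
  have : (absz (lead_coef h') == 1)%N by apply/eqP; move: (h'l); lia.
  by rewrite E1 lead_coefM abszM muln_eq1 => /andP[/eqP + _]; rewrite -abszE => ->.
have [x [m [px m0 xm]]] : exists x m, [/\ root (map_poly intr p) x, (0 < m)%N & x ^+ m = 1 :> algC].
  have lp : lead_coef p = 1 \/ lead_coef p = -1 by lia.
  case: lp => lp; first by apply: kronecker_roots => //; rewrite monicE lp.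
  have [||y|x [m [px m0 xm]]] := @kronecker_roots (- p).
  - by rewrite monicE lead_coefN lp opprK.
  - by rewrite size_polyN.
  - by rewrite rmorphN rootN; exact: rootp.
  by exists x, m; split=> //; rewrite rmorphN rootN in px.
(* The common root only shows that [p] and ['X^m - 1] are not coprime over [algC]; coprimality does
   not depend on the field, so their gcd over the rationals is not constant, and [u] is its integral
   multiple. *)
pose pQ : {poly rat} := map_poly intr p.
pose uQ : {poly rat} := map_poly intr ('X^m - 1 : {poly int}).
have [u [a a0 uE]] := rat_poly_scale (gcdp pQ uQ).
have a1 : (a%:~R)^-1 != 0 :> rat by rewrite invr_eq0 intr_eq0.
have up : u %| p.
  rewrite -dvdp_rat_int -(dvdpZl _ _ a1) -uE; exact: dvdp_gcdl.
have uX : u %| 'X^m - 1.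
  rewrite -dvdp_rat_int -(dvdpZl _ _ a1) -uE; exact: dvdp_gcdr.
have su : (1 < size u)%N.
  have sg1 : size (gcdp pQ uQ) = size u.
    by rewrite uE size_scale // size_map_inj_poly //; exact: intr_inj.
  have pQ0 : pQ != 0 by rewrite map_poly_eq0_id0 ?intr_eq0 ?lead_coef_eq0.
  rewrite -sg1 ltn_neqAle size_poly_gt0 gcdp_eq0 negb_and pQ0 andbT eq_sym.
  apply/negP; rewrite -/(coprimep pQ uQ) => cop.
  have : coprimep (map_poly (ratr : rat -> algC) pQ) (map_poly ratr uQ) by rewrite coprimep_map.
  have mm (g : {poly int}) : map_poly (ratr : rat -> algC) (map_poly intr g) = map_poly intr g.
    by rewrite -map_poly_comp; apply: eq_map_poly => z /=; rewrite ratr_int.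
  rewrite /pQ /uQ !mm => /coprimep_root /(_ px); apply/negP; rewrite negbK.
  by rewrite rmorphB rmorph1 /= map_polyXn !hornerE ?hornerXn xm subrr.
have [v vE] := dvdpP_int up.
have [w wE] := dvdpP_int uX.
have v0 : v != 0 by apply: contraNneq p0 => e; rewrite vE e mulr0.
have nv : ~ K v.
  move=> Kv; have := f0min (size v) (ex_intro _ v (And3 v0 Kv erefl)).
  rewrite -sp leqNgt vE size_mul ?zprimitive_eq0 //; last by rewrite -size_poly_gt0 (leq_trans _ su).
  by rewrite size_zprimitive; move: su; case: (size u) => [|[|n]] //= _; rewrite addSn ltnS leq_addl.
apply: nv; apply: (sge m) => //.
have -> : iter m sg (pact sg v c) - pact sg v c = pact sg ('X^m - 1) (pact sg v c).
  by rewrite pact_sub pactXn; congr (_ - _); rewrite -(expr0 'X) pactXn.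
rewrite wE -pactM -mulrA [w * v]mulrC mulrA -vE mulrC pactM.
exact: torsion_raddf.
Qed.

Lemma Cayley_Hamilton_sum n (S : 'M[rat]_n) :
  \sum_(i < size (char_poly S)) (char_poly S)`_i *: S ^+ i = 0.
Proof.
case: n S => [|n] S; first by apply/matrixP => -[].
have e : char_poly S = \sum_(i < size (char_poly S)) (char_poly S)`_i *: 'X^i.
  by rewrite -poly_def coefK.
rewrite -[RHS](Cayley_Hamilton S) [in RHS]e linear_sum.
by apply: eq_bigr => i _; rewrite linearZ rmorphXn /= horner_mx_X.
Qed.

Section additive_on.
Variables (A : zmodType) (L : A -> Prop) (r : nat) (ka : A -> 'rV[rat]_r).
Hypotheses (sL : subgrp L) (kaB : forall x y, L x -> L y -> ka (x - y) = ka x - ka y).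

Lemma kao0 : ka 0 = 0.
Proof. by have := kaB (proj1 sL) (proj1 sL); rewrite !subrr. Qed.

Lemma kaoN x : L x -> ka (- x) = - ka x.
Proof. by move=> Lx; rewrite -sub0r kaB ?kao0 ?sub0r //; exact: (proj1 sL). Qed.

Lemma kaoD x y : L x -> L y -> ka (x + y) = ka x + ka y.
Proof.
by move=> Lx Ly; rewrite -{1}[y]opprK kaB ?kaoN ?opprK //; apply: subgrpN.
Qed.

Lemma kaoMz x n : L x -> ka (x *~ n) = ka x *~ n.
Proof.
move=> Lx; have h k : ka (x *+ k) = ka x *+ k.
  elim: k => [|k IH]; first by rewrite !mulr0n kao0.
  by rewrite !mulrS kaoD ?IH //; apply: subgrpMn.
case: n => n; first by rewrite -!pmulrn.
by rewrite NegzE !mulrNz -!pmulrn kaoN ?h //; apply: subgrpMn.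
Qed.

Lemma kao_sum (I : Type) (s : seq I) (F : I -> A) : (forall i, L (F i)) ->
  ka (\sum_(i <- s) F i) = \sum_(i <- s) ka (F i).
Proof.
move=> LF; elim: s => [|i s IH]; first by rewrite !big_nil kao0.
by rewrite !big_cons kaoD ?IH //; apply: subgrp_sum.
Qed.

Lemma qspan : exists M : 'M[rat]_r, forall v,
  (exists2 n : nat, (0 < n)%N & exists2 y, L y & n%:R *: v = ka y) <-> (v <= M)%MS.
Proof.
pose V v := exists2 n : nat, (0 < n)%N & exists2 y, L y & n%:R *: v = ka y.
apply: (@subspace_mx rat r V).
  by exists 1%N => //; exists 0; rewrite ?kao0 ?scaler0 //; exact: (proj1 sL).
move=> a u v [n n0 [y Ly nu]] [n' n'0 [y' Ly' nv]].
have da : (denq a)%:~R != 0 :> rat by rewrite intr_eq0 denq_neq0.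
have dE : denq a = `|denq a|%N%:Z by rewrite gez0_abs // ltW // denq_gt0.
have aE : a * (denq a)%:~R = (numq a)%:~R by rewrite -{1}[a]divq_num_den divfK.
have dE' : `|denq a|%:R = (denq a)%:~R :> rat by rewrite pmulrn -dE.
exists (`|denq a| * n * n')%N; first by rewrite !muln_gt0 n0 n'0 absz_gt0 denq_neq0.
exists (y *~ (`|denq a| * n')%N%:Z + y' *~ (numq a * n%:Z)).
  by apply: subgrpD => //; apply: subgrpMz.
rewrite kaoD ?kaoMz //; last 2 first; [exact: subgrpMz | exact: subgrpMz|].
rewrite -nu -nv -!scaler_int !scalerA scalerDr scalerA; congr (_ *: _ + _ *: _).
  by rewrite -pmulrn -!natrM; congr (_%:R); lia.
by rewrite !natrM rmorphM /= -[n%:~R]pmulrn -aE dE'; ring.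
Qed.

End additive_on.

(** * The pencil of states and the pigeonhole inside a gap *)

Section state_space.
Variables (A : zmodType) (tau tau' : {additive A -> A}).
Hypotheses (tauK : cancel tau tau') (tau'K : cancel tau' tau).
Hypothesis erg : forall n x, (0 < n)%N -> iter n tau x = x -> x = 0.
Variables (L : A -> Prop) (r : nat) (ka : A -> 'rV[rat]_r).
Hypotheses (sL : subgrp L) (kaB : forall x y, L x -> L y -> ka (x - y) = ka x - ka y).
Hypothesis ka0 : forall x, L x -> (ka x = 0 <-> torsion x).
Hypothesis kaZ : forall x, L x -> exists w : 'rV[int]_r, ka x = map_mx intr w.
Variable B0 : nat.
Hypothesis torfin : forall f : nat -> A, (forall i, (i <= B0)%N -> L (f i) /\ torsion (f i)) ->
      exists i j, (i < j <= B0)%N /\ f i = f j.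

Let P y := L y /\ L (tau' y).

Lemma P_subgrp : subgrp P.
Proof.
have [h0 hB] := sL; split; first by split; rewrite ?raddf0.
by move=> x y [Lx Lx'] [Ly Ly']; split; rewrite ?raddfB; apply: hB.
Qed.

Lemma iter_tauK n : cancel (iter n tau) (iter n tau').
Proof. by elim: n => // n IH x; rewrite iterSr /= tauK IH. Qed.

Lemma iter_tau'K n : cancel (iter n tau') (iter n tau).
Proof. by elim: n => // n IH x; rewrite iterSr /= tau'K IH. Qed.

Lemma erg' n x : (0 < n)%N -> iter n tau' x = x -> x = 0.
Proof. by move=> n0 h; apply: (erg n0); rewrite -{1}h iter_tau'K. Qed.

Lemma ergt n x : (0 < n)%N -> torsion (iter n tau' x - x) -> torsion x.
Proof.
move=> n0 [m m0]; rewrite mulrnBl -raddfMn => /eqP; rewrite subr_eq0 => /eqP h.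
by exists m => //; apply: (erg' n0).
Qed.

(** [tau'] does not preserve [L], so on coordinates it is only a linear relation: the span of the
    pairs [(ka y, ka (tau' y))], with basis the rows of [row_mx M1 M2]. [M1] is row free because
    [tau'] maps torsion to torsion. *)
Lemma pencil_exists : exists p (M1 M2 : 'M[rat]_(p, r)) (al : A -> 'rV[rat]_p),
  [/\ row_free M1, al 0 = 0,
    forall y, P y -> ka y = al y *m M1 /\ ka (tau' y) = al y *m M2 &
    forall v : 'rV[rat]_p, exists2 n : nat, (0 < n)%N & exists y,
      [/\ P y, n%:R *: (v *m M1) = ka y & n%:R *: (v *m M2) = ka (tau' y)]].
Proof.
pose kk y := row_mx (ka y) (ka (tau' y)).
have kkB x y : P x -> P y -> kk (x - y) = kk x - kk y.
  move=> [Lx Lx'] [Ly Ly']; rewrite /kk kaB // raddfB kaB //.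
  by rewrite opp_row_mx add_row_mx.
have [M MP] := qspan P_subgrp kkB.
pose Rb := row_base M.
have Rf : row_free Rb by exact: row_base_free.
have spl : Rb = row_mx (lsubmx Rb) (rsubmx Rb) by rewrite hsubmxK.
have vP (v : 'rV_(\rank M)) : exists2 n : nat, (0 < n)%N & exists y,
      [/\ P y, n%:R *: (v *m lsubmx Rb) = ka y & n%:R *: (v *m rsubmx Rb) = ka (tau' y)].
  have : (v *m Rb <= M)%MS by rewrite -(eq_row_base M) submxMl.
  move=> /MP [n n0 [y Py]]; rewrite {1}spl mul_mx_row scale_row_mx => /eq_row_mx [h1 h2].
  by exists n => //; exists y.
exists (\rank M), (lsubmx Rb), (rsubmx Rb), (fun y => kk y *m pinvmx Rb); split=> //.
- apply: inj_row_free => v v0.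
  have [n n0 [y [[Ly Ly'] h1 h2]]] := vP v.
  move: h1; rewrite v0 scaler0 => /esym /ka0 -/(_ Ly) ty.
  have h3 : ka (tau' y) = 0 by apply/ka0 => //; exact: torsion_raddf.
  move: h2; rewrite h3 => /eqP; rewrite scaler_eq0 pnatr_eq0 eqn0Ngt n0 /= => /eqP v1.
  by apply: (row_free_inj Rf); rewrite mul0mx spl mul_mx_row v0 v1 row_mx0.
- by rewrite /kk raddf0 (kao0 sL kaB) row_mx0 mul0mx.
- move=> y Py; have h : (kk y <= Rb)%MS.
    by rewrite eq_row_base; apply/MP; exists 1%N => //; exists y => //; rewrite scale1r.
  have := mulmxKpV h; rewrite {2}spl mul_mx_row => /eq_row_mx [-> ->]; split=> //.
Qed.

(** A trajectory of the pencil with period [n] lifts, after clearing denominators, to elements that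
    follow a [tau']-orbit up to torsion. Its starting point is then fixed by [tau' ^ n] up to
    torsion, hence is torsion. *)
Lemma pencil_erg p (M1 M2 : 'M[rat]_(p, r)) : row_free M1 ->
  (forall v : 'rV[rat]_p, exists2 n : nat, (0 < n)%N & exists y,
      [/\ P y, n%:R *: (v *m M1) = ka y & n%:R *: (v *m M2) = ka (tau' y)]) ->
  forall (v : 'rV[rat]_p) n, (0 < n)%N ->
  (forall k, v *m (M2 *m pinvmx M1) ^+ k *m M2 = v *m (M2 *m pinvmx M1) ^+ k.+1 *m M1) ->
  v *m (M2 *m pinvmx M1) ^+ n = v -> v = 0.
Proof.
move=> fr vP v n n0; set T := M2 *m pinvmx M1 => hT vn.
have [N N0 [y yP]] : exists2 N : nat, (0 < N)%N & exists y : nat -> A, forall k, (k <= n)%N ->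
    [/\ P (y k), N%:R *: (v *m T ^+ k *m M1) = ka (y k) &
        N%:R *: (v *m T ^+ k *m M2) = ka (tau' (y k))].
  have [nn nnP] := choice (fun k => let: ex_intro2 a b c := vP (v *m T ^+ k) in
    ex_intro (fun a => (0 < a)%N /\ exists y, [/\ P y, a%:R *: (v *m T ^+ k *m M1) = ka y &
        a%:R *: (v *m T ^+ k *m M2) = ka (tau' y)]) a (conj b c)).
  have [y yP] := choice (fun k => proj2 (nnP k)).
  pose N := (\prod_(i < n.+1) nn i)%N.
  exists N; first by apply: prodn_gt0 => i; case: (nnP i).
  exists (fun k => y k *~ (N %/ nn k)%N%:Z) => k kn; have [[Lk Lk'] h1 h2] := yP k.
  have NE : N = (N %/ nn k * nn k)%N.
    by rewrite divnK // /N (bigD1 (Ordinal (kn : (k < n.+1)%N))) //= dvdn_mulr.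
  split; first by apply: subgrpMz; [exact: P_subgrp | exact: (conj Lk Lk')].
    by rewrite (kaoMz sL kaB) // -h1 -scaler_int scalerA -pmulrn -natrM -NE.
  by rewrite raddfMz (kaoMz sL kaB) // -h2 -scaler_int scalerA -pmulrn -natrM -NE.
have tk k : (k <= n)%N -> torsion (iter k tau' (y 0%N) - y k).
  elim: k => [|k IH] kn; first by rewrite subrr; exact: (proj1 (@torsion_subgrp A)).
  have [[Lk Lk'] h1 h2] := yP k (ltnW kn).
  have [[Lk1 Lk1'] h3 h4] := yP k.+1 kn.
  have -> : iter k.+1 tau' (y 0%N) - y k.+1 = tau' (iter k tau' (y 0%N) - y k) + (tau' (y k) - y k.+1).
    by rewrite raddfB /= addrA subrK.
  apply: (subgrpD (@torsion_subgrp A)); first by apply: torsion_raddf; apply: IH; exact: ltnW.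
  apply/ka0; first exact: (proj2 sL).
  by rewrite kaB // -h2 -h3 hT subrr.
have [[L0 L0'] h1 h2] := yP 0%N isT.
have [[Ln Ln'] h3 h4] := yP n (leqnn n).
have t0 : torsion (y 0%N).
  apply: (ergt n0).
  have -> : iter n tau' (y 0%N) - y 0%N = (iter n tau' (y 0%N) - y n) + (y n - y 0%N).
    by rewrite addrA subrK.
  apply: (subgrpD (@torsion_subgrp A)); first exact: tk.
  apply/ka0; first exact: (proj2 sL).
  by rewrite kaB // -h3 -h1 vn expr0 mulmx1 subrr.
move/ka0: t0 => /(_ L0); rewrite -h1 expr0 mulmx1 => /eqP.
rewrite scaler_eq0 pnatr_eq0 eqn0Ngt N0 /= => /eqP v0.
by apply: (row_free_inj fr); rewrite mul0mx.
Qed.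

Lemma kaZ_or x : exists w : 'rV[int]_r, L x -> ka x = map_mx intr w.
Proof.
have [/kaZ [w wE]|nL] := pselect (L x); first by exists w.
by exists 0 => Lx.
Qed.

(** The [2 ^ w] sums of distinct states taken every [q] steps have integral coordinates bounded by
    [w * Pb], so two of them agree modulo torsion; their difference is the polynomial [h], and the
    characteristic polynomial of [T ^+ q] plays [chi] in [no_small_relation]. *)
Lemma gap_lemma : exists q B1, [/\ (0 < q)%N & forall g w Pb c, (B1 <= g)%N -> (q * w <= g)%N ->
  ((2 * w * Pb).+1 ^ r < 2 ^ w)%N -> (forall k, (k <= g)%N -> L (iter k tau' c)) ->
  (forall k j, (k <= g)%N -> `|ka (iter k tau' c) 0 j| <= Pb%:R) -> c = 0].
Proof.
have [p [M1 [M2 [al [fr al0 alP vP]]]]] := pencil_exists.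
have [T TE] : exists T, T = M2 *m pinvmx M1 by eexists.
have [q q0 qP] := spectral_gap (map_mx ratr T).
(* [B0.+1] leaves room for the pigeonhole on torsion elements, [q * p.+1] for the [p.+1] terms of
   Cayley-Hamilton. *)
exists q, (maxn B0.+1 (q * p.+1)); split=> // g w Pb c.
rewrite geq_max => /andP[Bg pg] qw card Lc bc.
apply: contrapT => c0.
(* A torsion [c] is excluded separately: its iterates in the gap are torsion elements of [L], so two
   coincide and [c] is periodic. *)
have nt : ~ torsion c.
  move=> tc; have [|i [j [/andP[ij _] e]]] := torfin (f := fun i => iter i tau' c).
    move=> i iB; split; last exact: torsion_raddf.
    by apply: Lc; apply: leq_trans iB (ltnW Bg).
  apply: c0; have jE : j = (i + (j - i))%N by rewrite subnKC // ltnW.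
  have := congr1 (iter i tau) e; rewrite iter_tau'K {1}jE iterD iter_tau'K => /esym.
  by apply: erg'; rewrite subn_gt0.
have Pc k : (k < g)%N -> P (iter k tau' c).
  by move=> kg; split; [apply: Lc; exact: ltnW | exact: (Lc k.+1)].
pose a := al c.
have kak k : (k < g)%N -> ka (iter k tau' c) = a *m T ^+ k *m M1.
  elim: k => [|k IH] kg; first by rewrite expr0 mulmx1; exact: (proj1 (alP _ (Pc 0%N kg))).
  have h := proj1 (alP _ (Pc _ (ltnW kg))).
  have alk : al (iter k tau' c) = a *m T ^+ k.
    by apply: (row_free_inj fr); rewrite /= -h IH // ltnW.
  have e1 : ka (iter k.+1 tau' c) = al (iter k tau' c) *m M2 := proj2 (alP _ (Pc _ (ltnW kg))).
  have e2 : ka (iter k.+1 tau' c) = al (iter k.+1 tau' c) *m M1 := proj1 (alP _ (Pc _ kg)).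
  rewrite e2; congr (_ *m M1).
  have -> : al (iter k.+1 tau' c) = al (iter k.+1 tau' c) *m M1 *m pinvmx M1.
    by rewrite -mulmxA mulmxVp // mulmx1.
  by rewrite -e2 e1 alk exprSr -mulmxE [X in _ = _ *m (_ *m X)]TE !mulmxA.
pose sg := iter q tau'.
have sgE k : iter k sg c = iter (k * q) tau' c by rewrite iterM.
have Lsg k : (k * q <= g)%N -> L (iter k sg c) by move=> kg; rewrite sgE; apply: Lc.
have lt_g (n k : nat) : (q * n <= g)%N -> (k < n)%N -> (k * q < g)%N.
  by move=> qn kn; apply: leq_trans qn; rewrite mulnC ltn_pmul2l.
have kills (f : {poly int}) : (q * size f <= g)%N ->
    a *m (\sum_(i < size f) (f`_i)%:~R *: (T ^+ q) ^+ i) = 0 -> torsion (pact sg f c).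
  move=> sf f0.
  have Li (i : 'I_(size f)) : L (iter i sg c) by apply: Lsg; apply: ltnW; exact: lt_g sf (ltn_ord i).
  apply/ka0; first by apply: subgrp_sum => // i _; apply: subgrpMz.
  rewrite (kao_sum sL kaB); last by move=> i; apply: subgrpMz.
  transitivity (a *m (\sum_(i < size f) (f`_i)%:~R *: (T ^+ q) ^+ i) *m M1); last by rewrite f0 mul0mx.
  rewrite mulmx_sumr mulmx_suml; apply: eq_bigr => i _.
  rewrite (kaoMz sL kaB) // sgE kak; last exact: lt_g sf (ltn_ord i).
  by rewrite -scalemxAr -scalemxAl scaler_int -exprM mulnC.
(* An integral multiple of the characteristic polynomial: by Cayley-Hamilton it kills [c] modulo
   torsion. *)
have [chz [d d0 chE]] := rat_poly_scale (char_poly (T ^+ q)).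
have dq : d%:~R != 0 :> rat by rewrite intr_eq0.
have chz' : map_poly intr chz = d%:~R *: char_poly (T ^+ q) by rewrite chE scalerA divff // scale1r.
have schz : size chz = p.+1.
  by rewrite -(size_map_inj_poly (f := intr : int -> rat)) ?chz' ?size_scale ?size_char_poly //; exact: intr_inj.
have chK : torsion (pact sg chz c).
  apply: kills; first by rewrite schz.
  have -> : \sum_(i < size chz) (chz`_i)%:~R *: (T ^+ q) ^+ i =
      d%:~R *: \sum_(i < size (char_poly (T ^+ q))) (char_poly (T ^+ q))`_i *: (T ^+ q) ^+ i.
    rewrite schz size_char_poly scaler_sumr; apply: eq_bigr => i _.
    by rewrite scalerA -coefZ -chz' coef_map.
  by rewrite Cayley_Hamilton_sum scaler0 mulmx0.
have Lw k : (k < w)%N -> L (iter k sg c) by move=> kw; apply: Lsg; apply: ltnW; exact: lt_g qw kw.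
have [hh hhP] := choice (fun k : nat => kaZ_or (iter k sg c)).
pose Wz (e : {ffun 'I_w -> bool}) : 'rV[int]_r := \sum_(k < w) hh k *+ e k.
have hb (k : 'I_w) j : `|hh k 0 j| <= Pb%:Z.
  have h := hhP k (Lw _ (ltn_ord k)).
  have := bc (k * q)%N j (ltnW (lt_g _ _ qw (ltn_ord k))).
  by rewrite -sgE h mxE -intr_norm pmulrn ler_int.
have Wb e j : `|Wz e 0 j| <= (w * Pb)%N%:Z.
  rewrite /Wz summxE; apply: le_trans (ler_norm_sum _ _ _) _.
  apply: le_trans (_ : \sum_(k < w) Pb%:Z <= _); last by rewrite sumr_const card_ord; lia.
  apply: ler_sum => k _; case: (e k); first by rewrite mulr1n; exact: hb.
  by rewrite mulr0n mxE normr0.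
pose code (e : {ffun 'I_w -> bool}) : {ffun 'I_r -> 'I_((2 * w * Pb).+1)} :=
  [ffun j => inord (absz (Wz e 0 j + (w * Pb)%N%:Z))].
have [e1 [e2 [e12 ce]]] : exists e1 e2, e1 != e2 /\ code e1 = code e2.
  apply: contrapT => nh; have inj : injective code.
    move=> e1 e2 ce; apply: contrapT => /eqP ne; apply: nh; by exists e1, e2.
  have := leq_card _ inj; rewrite !card_ffun card_bool !card_ord; move: card; lia.
have Wee : Wz e1 = Wz e2.
  apply/rowP => j; have := congr1 (fun f : {ffun 'I_r -> _} => val (f j)) ce.
  rewrite !ffunE /= !inordK; have := Wb e1 j; have := Wb e2 j; lia.
(* Differences of two 0-1 vectors have entries in -1, 0, 1; the value 0 outside ['I_w] is only a
   default. *)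
pose h := \poly_(k < w) (if insub k is Some i then (e1 i : int) - (e2 i : int) else 0).
have hE (i : 'I_w) : h`_i = (e1 i : int) - (e2 i : int).
  by rewrite coef_poly ltn_ord valK.
have h0 : h != 0.
  apply: contraNneq e12 => e; apply/eqP/ffunP => i.
  by have := hE i; rewrite e coef0; case: (e1 i); case: (e2 i).
have hs : (size h <= w)%N by exact: size_poly.
have hb1 i : `|h`_i| <= 1.
  rewrite coef_poly; case: ltnP => // iw; rewrite insubT /=.
  by case: (e1 _); case: (e2 _).
have hK : torsion (pact sg h c).
  have Lx (e : {ffun 'I_w -> bool}) : L (\sum_(k < w) iter k sg c *~ e k).
    by apply: subgrp_sum => // k _; apply: subgrpMz => //; exact: Lw.
  have kax (e : {ffun 'I_w -> bool}) : ka (\sum_(k < w) iter k sg c *~ e k) = map_mx intr (Wz e).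
    have Lk' (k : 'I_w) : L (iter k sg c *~ e k) by apply: subgrpMz => //; exact: Lw.
    rewrite (kao_sum sL kaB) // /Wz raddf_sum; apply: eq_bigr => k _.
    rewrite (kaoMz sL kaB); last exact: Lw.
    by rewrite (hhP k (Lw _ (ltn_ord k))) raddfMn /= -pmulrn.
  rewrite (pact_wide _ _ hs).
  have -> : \sum_(i < w) iter i sg c *~ h`_i =
     \sum_(k < w) iter k sg c *~ e1 k - \sum_(k < w) iter k sg c *~ e2 k.
    by rewrite -sumrB; apply: eq_bigr => i _; rewrite hE mulrzBr.
  apply/ka0; first exact: (proj2 sL).
  by rewrite kaB // !kax Wee subrr.
apply: (no_small_relation nt _ _ h0 hb1 hK chK).
- move=> y [n n0]; rewrite /= -raddfMn => h1; exists n => //.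
  by rewrite -[LHS](iter_tau'K q) h1 raddf0.
- by move=> n y n0; rewrite -iterM; apply: ergt; rewrite muln_gt0 n0.
move=> x rx.
have mTq : map_mx (ratr : rat -> algC) (T ^+ q) = map_mx ratr T ^+ q.
  elim: (q) => [|k IH]; first by rewrite !expr0 map_mx1.
  by rewrite !exprS -!mulmxE map_mxM IH.
have : eigenvalue (map_mx (ratr : rat -> algC) T ^+ q) x.
  rewrite -mTq eigenvalue_root_char -map_char_poly.
  have : root (map_poly (ratr : rat -> algC) (map_poly intr chz)) x.
    by rewrite -map_poly_comp (eq_map_poly (g := intr)) // => z /=; rewrite ratr_int.
  by rewrite chz' linearZ /= rootZ // fmorph_eq0.
move=> /eigenvalue_exp [y /qP yP <-]; rewrite normrX.
by case: yP => [->|[?|?]]; [left; rewrite expr1n | right; left | right; right].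
Qed.

End state_space.

Lemma poly_lt_exp2 (d : nat) : exists n0, forall n, (n0 <= n)%N -> (n ^ d < 2 ^ n)%N.
Proof.
have sq k n : (2 ^ k <= n)%N -> (k ^ 2 < n * 4)%N.
  move=> h; have : (k ^ 2 < 2 ^ k * 4)%N; last lia.
  elim: k {h} => // k IH; rewrite expnS.
  by case: k IH => [|[|[|k]]] // IH; move: IH; rewrite !expnS; nia.
have [m mP] : exists m, forall k, (m <= k)%N -> (k.+1 * d < 2 ^ k)%N.
  exists (8 * d + 8)%N => k km; have := sq k (2 ^ k)%N (leqnn _).
  rewrite -mulnn; nia.
exists (2 ^ m)%N => n mn; have n0 : (0 < n)%N by rewrite (leq_trans _ mn) // expn_gt0.
have /andP[l1 l2] := trunc_log_bounds (isT : (1 < 2)%N) n0; set k := trunc_log 2 n in l1 l2.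
have km : (m <= k)%N by rewrite -ltnS -(@ltn_exp2l 2) //; exact: leq_ltn_trans mn l2.
apply: leq_ltn_trans (_ : (2 ^ k.+1) ^ d < _)%N.
  by case: d {mP} => // d; rewrite leq_exp2r // ltnW.
by rewrite -expnM ltn_exp2l // (leq_trans (mP k km)).
Qed.

(** Makes the pigeonhole of [gap_lemma] succeed: the states are polynomial in a length [n] which is
    at most a multiple of the gap. *)
Lemma asym (Q C d r : nat) : exists w0, forall w n, (w0 <= w)%N -> (n <= Q * w)%N ->
  ((2 * w * (C * n ^ d)).+1 ^ r < 2 ^ w)%N.
Proof.
pose C' := (2 * C * Q ^ d).+1.
have [n0 h] := poly_lt_exp2 (d.+2 * r).
exists (maxn n0 C'.+1) => w n; rewrite geq_max => /andP[nw Cw] nQ.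
apply: leq_ltn_trans (h w nw); rewrite expnM.
case: r {h} => // r; rewrite leq_exp2r //.
have w0 : (0 < w ^ d.+1)%N by rewrite expn_gt0 (leq_trans _ Cw).
apply: leq_trans (_ : C' * w ^ d.+1 <= _)%N; last first.
  by rewrite [(w ^ d.+2)%N]expnS leq_mul2r ltnW ?orbT.
have nd : (n ^ d <= Q ^ d * w ^ d)%N.
  by rewrite -expnMn; case: (d) => // e; rewrite leq_exp2r.
rewrite /C' mulSn -addn1 addnC; apply: leq_add => [//|]; rewrite [(w ^ d.+1)%N]expnS.
apply: leq_trans (_ : 2 * w * (C * (Q ^ d * w ^ d)) <= _)%N.
  by rewrite !leq_mul2l nd !orbT.
apply: eq_leq; change (2 * w * (C * (Q ^ d * w ^ d)) = 2 * C * Q ^ d * (w * w ^ d))%N.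
by move: (Q ^ d)%N (w ^ d)%N => a b; rewrite !mulnA; congr (_ * _)%N; lia.
Qed.

(** In a gap of length [g] the pigeonhole uses [w = g %/ q] states. *)
Lemma gap_quot q B w g n Q : (0 < q)%N -> (B + q * w.+1 < g)%N -> (n <= Q * g.+1)%N ->
  [/\ (B <= g)%N, (q * (g %/ q) <= g)%N, (w <= g %/ q)%N & (n <= 2 * Q * q * (g %/ q))%N].
Proof.
move=> q0 big nQ; have w1 : (w.+1 <= g %/ q)%N.
  rewrite leq_divRL // mulnC; apply: ltnW; apply: leq_ltn_trans big; exact: leq_addl.
split; last 1 first.
- apply: leq_trans nQ _; rewrite -mulnA [(2 * Q)%N]mulnC -mulnA leq_mul2l; apply/orP; right.
  have := ltn_ceil g q0; rewrite mulSn [(q * _)%N]mulnC.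
  have : (1 * q <= g %/ q * q)%N by rewrite leq_mul2r (leq_trans _ w1) ?orbT.
  by move: (g %/ q * q)%N => a; lia.
- by apply: ltnW; apply: leq_ltn_trans big; exact: leq_addr.
- by rewrite mulnC leq_trunc_div.
- exact: ltnW.
Qed.

Section mode_bound.
Variables (A : zmodType) (tau tau' : {additive A -> A}).
Hypothesis tau'K : cancel tau' tau.
Hypothesis erg : forall n x, (0 < n)%N -> iter n tau x = x -> x = 0.
Variables (L : A -> Prop) (r : nat) (ka : A -> 'rV[rat]_r).
Hypotheses (sL : subgrp L) (kaB : forall x y, L x -> L y -> ka (x - y) = ka x - ka y).
Hypothesis ka0 : forall x, L x -> (ka x = 0 <-> torsion x).

(** The caller does not see the coordinates [al] of the pencil, so the boundary condition is
    required of every function of the state that vanishes at 0; periodicity and vanishing at the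
    ends both pass to such functions. *)
Lemma mode_bound : exists d n (U : 'M[rat]_n),
  (forall x : algC, eigenvalue (map_mx ratr U) x -> forall k, (0 < k)%N -> x ^+ k != 1) /\
  forall (Md : Type) (Z : Md -> (nat -> algC) -> Prop) (g : Md -> nat -> nat),
  (forall m t, (0 < g m t)%N) -> (forall m, Z m (fun=> 0)) ->
  (forall m a z z', Z m z -> Z m z' -> Z m (fun t => a * z t + z' t)) ->
  (forall mu, eigenvalue (map_mx ratr U) mu -> forall a, exists2 C : algC, 0 <= C &
    forall m z f (F : algC), Z m z -> (forall t, z t.+1 = mu * z t + f t) ->
    (forall t, `|f t| <= F * (g m t)%:R ^+ a) -> forall t, `|z t| <= C * F * (g m t)%:R ^+ a.+1) ->
  forall K : nat, exists C : nat, forall m (y phi : nat -> A),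
    (forall t, L (y t) /\ L (tau' (y t))) -> (forall t, L (phi t)) ->
    (forall t, y t.+1 = tau' (y t) + phi t) -> (forall t j, `|ka (phi t) 0 j| <= K%:R) ->
    (forall h : A -> rat, h 0 = 0 -> Z m (fun t => ratr (h (y t)))) ->
    forall t j, `|ka (y t) 0 j| <= (C * g m t ^ d)%N%:R.
Proof.
have [p [M1 [M2 [al [fr al0 alP vP]]]]] := pencil_exists tau' sL kaB ka0.
have NP := pencil_erg tau'K erg sL kaB ka0 fr vP.
have [d [U [Uroot UP]]] := pencil_bound fr NP.
exists d, d, U; split=> // Md Z g g1 Z0 Zlin Zsc K.
have [|C C0 CP] := UP Md Z (fun m t => (g m t)%:R) _ Z0 Zlin Zsc.
  by move=> m t; rewrite ler1n.
pose S : algC := \sum_(j < r) \sum_(i < p) `|ratr (M1 i j)|.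
have S0 : 0 <= S by apply: sumr_ge0 => j _; apply: sumr_ge0.
have [Cn CnP] : exists Cn : nat, C * K%:R * S <= Cn%:R.
  exists (Num.bound (C * K%:R * S)); apply: ltW; apply: archi_boundP.
  by rewrite !mulr_ge0 ?ler0n.
exists Cn => m y phi yP phiL yS phib Zy t j.
have dr : driven M1 M2 (fun t => al (y t)) (fun t => ka (phi t)) K%:R.
  split=> //.
  move=> u; have [L1 L2] := yP u.
  rewrite -(proj1 (alP _ (yP u.+1))) yS (kaoD sL kaB) //.
  by rewrite (proj2 (alP _ (yP u))).
have := CP m _ _ _ dr (fun i => Zy (fun x => al x 0 i) _) t; rewrite ratr_nat => b.
rewrite -(ler_rat algC) ratr_norm ratr_nat natrM natrX.
apply: le_trans (_ : C * K%:R * S * (g m t)%:R ^+ d <= _); last first.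
  by apply: ler_wpM2r => //; rewrite exprn_ge0 // ler0n.
rewrite (proj1 (alP _ (yP t))) mxE rmorph_sum; apply: le_trans (ler_norm_sum _ _ _) _.
apply: le_trans (_ : \sum_(i < p) C * K%:R * (g m t)%:R ^+ d * `|ratr (M1 i j)| <= _).
  apply: ler_sum => i _; rewrite rmorphM normrM; apply: ler_wpM2r => //.
  by apply: b => k; rewrite al0 mxE.
rewrite -mulr_sumr [leRHS]mulrAC; apply: ler_wpM2l.
  by rewrite !mulr_ge0 ?exprn_ge0 ?ler0n.
rewrite /S (bigD1 j) //= lerDl; apply: sumr_ge0 => k _; exact: sumr_ge0.
Qed.

(** For periodic solutions the eigenvalues of modulus one require a good length, which [good_period]
    finds among the multiples of [P] in every window of size [P * h]. Solutions vanishing at both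
    ends need no choice, and their bound depends only on the distance to the end. *)
Lemma periodic_end_bounds : exists d h, (forall K P : nat, (0 < P)%N -> exists C : nat, forall N1, exists N,
    [/\ (P %| N)%N, (N1 < N <= N1 + P * h)%N & forall y phi : nat -> A,
    (forall t, L (y t) /\ L (tau' (y t))) -> (forall t, L (phi t)) ->
    (forall t, y t.+1 = tau' (y t) + phi t) -> (forall t j, `|ka (phi t) 0 j| <= K%:R) ->
    (forall t, y (t + N)%N = y t) ->
    forall t j, `|ka (y t) 0 j| <= (C * N ^ d)%N%:R]) /\
  (forall K : nat, exists C : nat, forall n (y phi : nat -> A),
    (forall t, L (y t) /\ L (tau' (y t))) -> (forall t, L (phi t)) ->
    (forall t, y t.+1 = tau' (y t) + phi t) -> (forall t j, `|ka (phi t) 0 j| <= K%:R) ->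
    y 0%N = 0 -> (forall t, (n <= t)%N -> y t = 0) ->
    forall t j, `|ka (y t) 0 j| <= (C * (n - t).+1 ^ d)%N%:R).
Proof.
have [d [n [U [Uroot UP]]]] := mode_bound.
have [rs rsE] := closed_field_poly_normal (char_poly (map_mx (ratr : rat -> algC) U)).
have rsP x : eigenvalue (map_mx ratr U) x = (x \in rs).
  by rewrite eigenvalue_root_char rsE (monicP (char_poly_monic _)) scale1r root_prod_XsubC.
pose ls := [seq x <- rs | `|x| == 1].
exists d, (size ls).+1; split=> [K P P0|K].
  have [x|eta eta0 good] := @good_period ls P P0.
    rewrite mem_filter => /andP[/eqP x1 xr]; split=> // k k0.
    by apply: Uroot; rewrite ?rsP.
  pose okN N := (0 < N)%N /\ forall x, x \in ls -> eta <= `|x ^+ N - 1|.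
  pose Md := {N : nat | okN N}.
  have [||||C CP] := UP Md (fun m z => forall t, z (t + sval m)%N = z t) (fun m _ => sval m) _ _ _ _ K.
  - by move=> [N [N0 ?]] t.
  - by [].
  - by move=> m a z z' hz hz' t; rewrite hz hz'.
  - move=> mu muU a; have [C C0 CP] := scalar_per mu eta0; exists C => //.
    move=> [N [N0 Ng]] z f F /= zN zS fb t; rewrite exprSr -!mulrA [_ * (_ * N%:R)]mulrA mulrA.
    apply: CP zN zS fb _ => // mu1; apply: Ng.
    by rewrite mem_filter mu1 eqxx -rsP.
  exists C => N1; have [i il ig] := good (N1 %/ P).+1.
  set N := (P * ((N1 %/ P).+1 + i))%N in ig.
  have N0 : (0 < N)%N by rewrite muln_gt0 P0 addSn.
  exists N; split; first exact: dvdn_mulr.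
    have := divn_eq N1 P; have := ltn_pmod N1 P0; rewrite /N.
    move: (N1 %/ P)%N (N1 %% P)%N => a b hb hN; apply/andP; split; first by nia.
    have h : (P * i.+1 <= P * (size ls).+1)%N by rewrite leq_mul2l ltnS il orbT.
    by rewrite hN addSnnS mulnDr [(P * a)%N]mulnC -addnA leq_add2l (leq_trans h) // leq_addl.
  move=> y phi yL phiL yS phib yN t j.
  by apply: (CP (exist okN N (conj N0 ig))) yL phiL yS phib _ t j => f f0 u /=; rewrite yN.
have [||||C CP] := UP nat (fun m z => z 0%N = 0 /\ forall t, (m <= t)%N -> z t = 0) (fun m t => (m - t).+1) _ _ _ _ K.
- by [].
- by [].
- move=> m a z z' [hz hz1] [hz' hz1']; rewrite hz hz' mulr0 addr0; split=> // t mt.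
  by rewrite hz1 // hz1' // mulr0 addr0.
- move=> mu muU a; have [C C0 CP] := scalar_end mu a; exists C => //.
  by move=> m z f F [z0 z1] zS fb t; apply: CP z0 z1 zS fb t.
exists C => m y phi yL phiL yS phib y0 y1 t j.
apply: CP yL phiL yS phib _ t j => f f0; rewrite y0 f0 raddf0; split=> // u mu.
by rewrite y1 // f0 raddf0.
Qed.

End mode_bound.

(** * Vanishing of the blocks of a relation *)

Section block_rigidity.
Variables (A : zmodType) (tau tau' : {additive A -> A}).
Hypotheses (tauK : cancel tau tau') (tau'K : cancel tau' tau).
Hypothesis erg : forall n x, (0 < n)%N -> iter n tau x = x -> x = 0.
Variables (s : nat) (E : 'I_s -> A).
Local Notation Ev := (zcomb E).
Hypothesis gen : forall x, exists h n, win tau E n (iter h tau x).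

(** The partial sum at time [t] seen from time [t], that is, pulled back by [tau ^ t]; it moves by
    [tau'] alone where the coefficients vanish. *)
Fixpoint state (v : nat -> 'rV[int]_s) c t :=
  if t is t.+1 then tau' (state v c t + Ev (v t)) else c.

Lemma state_sum v c t : iter t tau (state v c t) = c + \sum_(i < t) iter i tau (Ev (v i)).
Proof.
elim: t => [|t IH]; first by rewrite big_ord0 addr0.
by rewrite iterSr /= tau'K raddfD /= IH big_ord_recr /= addrA.
Qed.

Lemma state_shift v c t n : state v c (t + n) = state (fun i => v (t + i)%N) (state v c t) n.
Proof. by elim: n => [|n IH]; rewrite ?addn0 // addnS /= IH. Qed.

Lemma state_ext v v' c n : (forall i, (i < n)%N -> v i = v' i) -> state v c n = state v' c n.
Proof. by elim: n => //= n IH h; rewrite IH ?h // => i il; apply: h; exact: ltnW. Qed.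

Lemma state_zero c v n : (forall i, (i < n)%N -> v i = 0) -> state v c n = iter n tau' c.
Proof.
by elim: n => //= n IH h; rewrite IH ?h ?raddf0 ?addr0 // => i il; apply: h; exact: ltnW.
Qed.

Lemma win_up D1 D2 x : (D1 <= D2)%N -> win tau E D1 (iter D1 tau x) -> win tau E D2 (iter D2 tau x).
Proof.
move=> /subnKC <- h; rewrite addnC iterD addnC; exact: win_shift.
Qed.

(** The final gap, a fixed proportion of [N], gives [c = 0]. Then blocks are peeled off from the
    last one, the gap before it forcing the state to vanish where it starts. [b0] is chosen before
    [P]: the bound for periodic solutions, which depends on [P], matters only for the final gap and
    hence for [N0]. *)
Lemma block_rigidity K Q : exists b0, forall b b', (b0 <= b')%N -> (b < b')%N -> (b' <= Q * (b' - b))%N ->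
  forall P, (0 < P)%N -> exists N0 h, forall N1, (N0 <= N1)%N -> exists N,
  [/\ (P %| N)%N, (N1 < N <= N1 + h)%N & forall M (v : nat -> 'rV[int]_s) (c : A), (N <= Q * (N - M * b'))%N ->
    (forall t k, `|v t 0 k| <= K%:Z) ->
    (forall t, ~~ ((t < M * b') && (t %% b' < b))%N -> v t = 0) ->
    \sum_(i < N) iter i tau (Ev (v i)) = iter N tau c - c ->
    forall j, (j < M)%N -> \sum_(i < b) iter i tau (Ev (v (j * b' + i)%N)) = 0].
Proof.
have [D1 D1P] := cyc_state gen.
have [D2 D2P] := state_win tau E.
pose D := maxn D1 D2.
have cycD N c : (0 < N)%N -> win tau E N (iter N tau c - c) -> win tau E D (iter D tau c).
  by move=> N0 h; apply: (@win_up D1); rewrite ?leq_maxl //; exact: D1P h.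
have stD k n z : win tau E k z -> win tau E n (iter n tau z) -> win tau E D (iter D tau z).
  by move=> h1 h2; apply: (@win_up D2); rewrite ?leq_maxr //; exact: D2P h1 h2.
have [r [ga gaP]] := win_fg tau E D.+1.
have [ka [kaB ka0 kaZ [B0 torfin]]] := coords gaP.
pose L := win tau E D.+1.
have sL : subgrp L by exact: win_subgrp.
have [q [B1 [q0 gap]]] := gap_lemma tau'K erg sL kaB ka0 kaZ torfin.
have [d [h0 [per en]]] := periodic_end_bounds tau'K erg sL kaB ka0.
(* The forcing is one term of the relation at a time, so coefficients bounded by [K] bound it
   uniformly. *)
have [F FP] : exists F : nat, forall v : 'rV[int]_s, (forall k, `|v 0 k| <= K%:Z) ->
    forall j, `|ka (iter D tau (Ev v)) 0 j| <= F%:R.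
  pose G : rat := \sum_(j < r) \sum_(k < s) `|ka (iter D tau (E k)) 0 j|.
  have G0 j : 0 <= \sum_(k < s) `|ka (iter D tau (E k)) 0 j| by apply: sumr_ge0.
  exists (Num.bound (G * K%:R)) => v vK j; apply: le_trans (ltW (archi_boundP _)); last first.
    by rewrite mulr_ge0 ?ler0n //; apply: sumr_ge0.
  have LE k : L (iter D tau (E k)).
    have -> : E k = Ev (delta_mx 0 k).
      rewrite /zcomb (bigD1 k) //= mxE !eqxx mulr1z big1 ?addr0 // => i ik.
      by rewrite mxE eqxx (negbTE ik) mulr0z.
    exact: win1.
  rewrite /zcomb raddf_sum /=; under eq_bigr do rewrite raddfMz /=.
  rewrite (kao_sum sL kaB); last by move=> k; apply: subgrpMz.
  rewrite summxE; apply: le_trans (ler_norm_sum _ _ _) _.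
  apply: le_trans (_ : \sum_(k < s) `|ka (iter D tau (E k)) 0 j| * K%:R <= _).
    apply: ler_sum => k _; rewrite (kaoMz sL kaB) // -scaler_int mxE normrM mulrC.
    apply: ler_wpM2l => //; rewrite -intr_norm.
    by rewrite -[K%:R]/(K%:Z%:~R) ler_int.
  rewrite -mulr_suml ler_wpM2r ?ler0n // /G (bigD1 j) //= lerDl.
  by apply: sumr_ge0 => k _.
have [C2 C2P] := en F.
(* [2 ^ d] because in the gap before the last block the distance to the end is at most [2 * b']. *)
have [w0 w0P] := asym (2 * Q * q) (C2 * 2 ^ d) d r.
exists (Q * (B1 + q * w0.+1)).+1 => b b' bb' bltb bQ P P0.
have b'0 : (0 < b')%N by apply: leq_ltn_trans bltb.
have [C1 C1P] := per F P P0.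
have [w1 w1P] := asym (2 * Q * q) C1 d r.
exists (Q * (B1.+1 + q * w1.+1)).+1, (P * h0)%N => N1 N01.
have [N [PN Nb NP]] := C1P N1; exists N; split=> // M v c MN vK vz sumv.
have N0 : (0 < N)%N by case/andP: Nb => + _; exact: leq_ltn_trans.
have MNlt : (M * b' < N)%N.
  rewrite ltnNge; apply/negP => le; move: MN; have -> : (N - M * b' = 0)%N by apply/eqP; rewrite subn_eq0.
  by rewrite muln0 leqNgt N0.
have vK0 t k : `|v t 0 k| <= K%:Z by exact: vK.
(* The coefficients are continued with period [N], so that the states are periodic too; they stay
   small through the final gap, which starts at [M * b']. *)
have c0 : c = 0.
  pose vN t := v (t %% N)%N.
  pose st := state vN c.
  have stN t : st (t + N)%N = st t.
    have h : st N = c.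
      apply: (can_inj (iter_tauK tauK N)); rewrite [LHS]state_sum.
      rewrite -[RHS](subrK c) -sumv addrC; congr (_ + _).
      by apply: eq_bigr => i _; rewrite /vN modn_small.
    rewrite addnC /st state_shift -/st h.
    by apply: state_ext => i _; rewrite /vN modnDl.
  have stD' t : win tau E D (iter D tau (st t)).
    apply: (cycD N) => //; rewrite -{1}stN /st state_shift state_sum addrC addKr.
    by exists (fun i => vN (t + i)%N).
  have stS t : iter D.+1 tau (st t.+1) = iter D tau (st t) + iter D tau (Ev (vN t)).
    by rewrite iterSr [st _]/= tau'K raddfD.
  have stL t : L (iter D.+1 tau (st t)).
    rewrite -stN -(prednK N0) addnS stS; apply: (subgrpD sL).
      by apply: win_le (stD' _).
    exact: win1.
  pose y t := iter D.+1 tau (st t).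
  have tauy t : tau' (y t) = iter D tau (st t) by rewrite /y /= tauK.
  have yS t : y t.+1 = tau' (y t) + iter D tau (Ev (vN t)).
    by rewrite tauy /y stS.
  have yb : forall t j, `|ka (y t) 0 j| <= (C1 * N ^ d)%N%:R.
    apply: (NP y (fun t => iter D tau (Ev (vN t)))) => //.
    - by move=> t; split; [exact: stL | rewrite tauy; apply: win_le (stD' _)].
    - by move=> t; exact: win1.
    - by move=> t j; apply: FP => k; exact: vK.
    - by move=> t; rewrite /y stN.
  have yk k : (k < N - M * b')%N -> iter k tau' (y (M * b')%N) = y (M * b' + k)%N.
    elim: k => [|k IH] kN; first by rewrite addn0.
    rewrite addnS yS -IH 1?ltnW // /vN modn_small; last by move: kN; lia.
    by rewrite vz ?raddf0 ?addr0 // negb_and -leqNgt leq_addr.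
  have yM0 : y (M * b')%N = 0.
    pose g := (N - M * b').-1.
    have gE : g.+1 = (N - M * b')%N by rewrite prednK // subn_gt0.
    have Ng : (N <= Q * g.+1)%N by rewrite gE.
    have big : (B1.+1 + q * w1.+1 < g.+1)%N.
      have h : (Q * (B1.+1 + q * w1.+1) < Q * g.+1)%N.
        by apply: leq_trans Ng; case/andP: Nb => N1N _; exact: ltn_trans N01 N1N.
      by move: h; rewrite ltn_mul2l => /andP[].
    have big' : (B1 + q * w1.+1 < g)%N by rewrite -ltnS -addSn.
    have [k1 k2 k3 k4] := gap_quot q0 big' Ng.
    apply: (gap g (g %/ q)%N (C1 * N ^ d)%N) => //; first exact: w1P.
    - move=> k kg; rewrite yk; last by rewrite -gE.
      exact: stL.
    - by move=> k j kg; rewrite yk ?yb // -gE.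
  have stM : st (M * b')%N = 0.
    by apply: (can_inj (iter_tauK tauK D.+1)); rewrite raddf0.
  have : st N = 0.
    rewrite -(subnKC (ltnW MNlt)) /st state_shift -/st stM state_zero ?raddf0 // => i iN.
    by rewrite /vN modn_small ?vz ?negb_and -?leqNgt ?leq_addr //; move: iN; lia.
  by rewrite -[N]add0n stN.
move: sumv; rewrite c0 raddf0 subrr => sumv {c c0}.
have sumM : \sum_(i < M * b') iter i tau (Ev (v i)) = 0.
  rewrite -[RHS]sumv [LHS](big_ord_widen N (fun i => iter i tau (Ev (v i)))) 1?ltnW //.
  rewrite [LHS]big_mkcond.
  apply: eq_bigr => i _ /=; case: ltnP => // le.
  by rewrite vz ?raddf0 // negb_and -leqNgt le.
(* From here on the relation is a plain vanishing sum: [N] and its choice are forgotten before the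
   induction on the number of blocks. *)
move: v vK vz sumM {sumv vK0}; clear N NP PN Nb MN MNlt N0.
elim: M => [|M IH] v vK vz sumM j; first by [].
pose st := state v 0.
pose n := (M * b' + b)%N.
have st0 t : (n <= t)%N -> st t = 0.
  have h k : st (n + k)%N = iter k tau' (st n).
    rewrite /st state_shift state_zero // => i _; apply: vz.
    rewrite negb_and -!leqNgt /n; case: (leqP (M.+1 * b') (n + i)) => //= h.
    rewrite -addnA modnMDl modn_small ?leq_addr //; move: h; rewrite /n mulSn; lia.
  have stn : st n = 0.
    have e : (M.+1 * b' = n + (b' - b))%N by rewrite /n mulSn; lia.
    have : st (M.+1 * b')%N = 0.
      apply: (can_inj (iter_tauK tauK (M.+1 * b'))).
      by rewrite [LHS]state_sum sumM addr0 raddf0.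
    rewrite e h => /(congr1 (iter (b' - b) tau)).
    by rewrite iter_tau'K // raddf0.
  by move=> nt; rewrite -(subnKC nt) h stn raddf0.
have stD' t : win tau E D (iter D tau (st t)).
  apply: (stD n t).
    have [tn|nt] := ltnP t n; last by rewrite st0 //; exact: (proj1 (win_subgrp _ _ _)).
    have e : iter (n - t) tau (st n) = st t + \sum_(i < n - t) iter i tau (Ev (v (t + i)%N)).
      by rewrite -{2}(subnKC (ltnW tn)) /st state_shift state_sum.
    move: e; rewrite st0 // raddf0 => /esym /eqP; rewrite addr_eq0 => /eqP ->.
    apply: (subgrpN (win_subgrp _ _ _)); apply: (@win_le _ _ _ _ (n - t)); first exact: leq_subr.
    by exists (fun i => v (t + i)%N).
  by rewrite [X in win _ _ _ X]state_sum add0r; exists v.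
have stS t : iter D.+1 tau (st t.+1) = iter D tau (st t) + iter D tau (Ev (v t)).
  by rewrite iterSr [st _]/= tau'K raddfD.
pose y t := iter D.+1 tau (st t).
have tauy t : tau' (y t) = iter D tau (st t) by rewrite /y /= tauK.
have yS t : y t.+1 = tau' (y t) + iter D tau (Ev (v t)).
  by rewrite tauy /y stS.
have yL t : L (y t).
  case: t => [|t]; first by rewrite /y raddf0; exact: (proj1 sL).
  rewrite yS tauy; apply: (subgrpD sL); first by apply: win_le (stD' _).
  exact: win1.
have yb : forall t j, `|ka (y t) 0 j| <= (C2 * (n - t).+1 ^ d)%N%:R.
  apply: (C2P n y (fun t => iter D tau (Ev (v t)))) => //.
  - by move=> t; split=> //; rewrite tauy; apply: win_le (stD' _).
  - by move=> t; exact: win1.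
  - by move=> t i; apply: FP => k; exact: vK.
  - by rewrite /y raddf0.
  - by move=> t nt; rewrite /y st0 // raddf0.
(* The gap just before block [M] kills the state at its start; for [M = 0] the initial state is
   already 0. *)
have stM : st (M * b')%N = 0.
  case: (posnP M) => [->|M0]; first by [].
  pose g := (b' - b)%N.
  have gM : (g <= M * b')%N by rewrite (leq_trans (leq_subr _ _)) // leq_pmull.
  have yk k : (k <= g)%N -> iter k tau' (y (M * b' - g)%N) = y (M * b' - g + k)%N.
    elim: k => [|k IHk] kN; first by rewrite addn0.
    rewrite addnS yS -IHk 1?ltnW // vz ?raddf0 ?addr0 // negb_and -!leqNgt; apply/orP; right.
    have e : (M * b' - g + k = M.-1 * b' + (b + k))%N.
      case: (M) M0 gM => // M' _; rewrite /= mulSn /g; move: bltb; lia.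
    by rewrite e modnMDl modn_small ?leq_addr //; move: kN; rewrite /g; lia.
  have big : (B1 + q * w0.+1 < g)%N.
    have h : (Q * (B1 + q * w0.+1) < Q * g)%N by apply: leq_trans bb' _.
    by move: h; rewrite ltn_mul2l => /andP[].
  have yg : y (M * b' - g)%N = 0.
    have bQ' : (b' <= Q * g.+1)%N by apply: leq_trans bQ _; rewrite leq_mul2l leqnSn orbT.
    have [k1 k2 k3 k4] := gap_quot q0 big bQ'.
    apply: (gap g (g %/ q)%N (C2 * 2 ^ d * b' ^ d)%N) => //; first exact: w0P.
    - by move=> k kg; rewrite yk.
    - move=> k i kg; rewrite yk //; apply: le_trans (yb _ _) _.
      rewrite ler_nat -mulnA leq_mul2l -expnMn; apply/orP; right.
      have : ((n - (M * b' - g + k)).+1 <= 2 * b')%N by rewrite /n; move: gM bltb; rewrite /g; lia.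
      by case: (d) => // d'; rewrite leq_exp2r.
  have := yk g (leqnn _); rewrite yg raddf0 subnK // => /esym yM.
  by apply: (can_inj (iter_tauK tauK D.+1)); rewrite raddf0.
have sumM' : \sum_(i < M * b') iter i tau (Ev (v i)) = 0.
  by have := state_sum v 0 (M * b'); rewrite -/st stM raddf0 add0r => <-.
rewrite ltnS leq_eqVlt => /orP[/eqP ->|jM].
  have : st n = 0 by rewrite st0.
  rewrite /n /st state_shift -/st stM => e.
  by have := state_sum (fun i => v (M * b' + i)%N) 0 b; rewrite e raddf0 add0r.
pose v' t := if (t < M * b')%N then v t else 0.
have := IH v' _ _ _ j jM; rewrite /v'.
have bj i : (i < b)%N -> (j * b' + i < M * b')%N.
  by move=> ib; apply: leq_trans (_ : j.+1 * b' <= _)%N; rewrite ?leq_mul2r ?jM ?orbT // mulSn addnC ltn_add2r (ltn_trans ib).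
move=> h; rewrite -[RHS]h.
- by apply: eq_bigr => i _; rewrite bj.
- by move=> t k; case: ifP => // _; rewrite mxE normr0.
- by move=> t; case: ltnP => //= h1 h2; apply: vz; rewrite negb_and h2 orbT.
- by rewrite -[RHS]sumM'; apply: eq_bigr => i _; rewrite ltn_ord.
Qed.

End block_rigidity.

Import ComplexField.Normc.
Local Open Scope complex_scope.

(** * Kronecker-type theorem *)

Section complex_lemmas.
Variable R : realType.
Implicit Types z w : R[i].

Lemma ReD z w : complex.Re (z + w) = complex.Re z + complex.Re w. Proof. by case: z; case: w. Qed.
Lemma ReN z : complex.Re (- z) = - complex.Re z. Proof. by case: z. Qed.
Lemma ReC (a : R) z : complex.Re (a%:C * z) = a * complex.Re z.
Proof. by case: z => x y /=; rewrite mul0r subr0. Qed.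
Lemma Re_sum (I : Type) (s : seq I) (P : pred I) (F : I -> R[i]) :
  complex.Re (\sum_(i <- s | P i) F i) = \sum_(i <- s | P i) complex.Re (F i).
Proof. by apply: (big_morph _ ReD). Qed.

Lemma Re_normc z : `|complex.Re z| <= normc z.
Proof. by have := normc_ge_Re z; rewrite lecR. Qed.

Lemma normc_ge0 z : 0 <= normc z. Proof. by apply: le_trans (Re_normc z). Qed.

Lemma normcX z n : normc (z ^+ n) = normc z ^+ n.
Proof. by elim: n => [|n IH]; rewrite ?expr0 ?normc1 // !exprS normcM IH. Qed.

Lemma normc_prod (I : Type) (s : seq I) (P : pred I) (F : I -> R[i]) :
  normc (\prod_(i <- s | P i) F i) = \prod_(i <- s | P i) normc (F i).
Proof. by apply: (big_morph _ (@normcM R)); exact: normc1. Qed.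

Lemma normc_sum (I : Type) (s : seq I) (P : pred I) (F : I -> R[i]) :
  normc (\sum_(i <- s | P i) F i) <= \sum_(i <- s | P i) normc (F i).
Proof.
elim: s => [|i s IH]; first by rewrite !big_nil normc0.
rewrite !big_cons; case: ifP => // _; apply: le_trans (le_normcD _ _) _.
by rewrite lerD2l.
Qed.

Lemma normcR (a : R) : normc a%:C = `|a|.
Proof. by rewrite /normc /= expr0n addr0 sqrtr_sqr. Qed.

Lemma normcB z w : normc (z - w) = normc (w - z).
Proof. by rewrite -normcN opprB. Qed.

Lemma normc_dist z w : `|normc z - normc w| <= normc (z - w).
Proof.
have h a b : normc a - normc b <= normc (a - b).
  by rewrite lerBlDr; apply: le_trans (le_normcD _ _); rewrite subrK.
by rewrite ler_norml lerNl opprB h /= normcB h.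
Qed.

Lemma normc_eq0 z : (normc z == 0) = (z == 0).
Proof. by apply/eqP/eqP => [/eq0_normc //|->]; rewrite normc0. Qed.

Lemma unimod_neq0 z : normc z = 1 -> z != 0.
Proof. by move=> h; rewrite -normc_eq0 h oner_eq0. Qed.

Lemma unimodJ z : normc z = 1 -> z^-1 = z^*.
Proof.
move=> h; have n1 : `|z| = 1 by rewrite -[`|z|]/((normc z)%:C) h.
by rewrite invc_norm n1 expr1n invr1 mul1r.
Qed.

Lemma unimod_Re z : normc z = 1 -> normc (z - 1) ^+ 2 = 2 - 2 * complex.Re z.
Proof.
case: z => a b; rewrite /normc /= => h.
have e : a ^+ 2 + b ^+ 2 = 1.
  by rewrite -[LHS]sqr_sqrtr ?h ?expr1n // addr_ge0 ?sqr_ge0.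
by rewrite subr0 sqr_sqrtr ?addr_ge0 ?sqr_ge0 // sqrrB1; move: e; lra.
Qed.

Lemma geo_bound z J : normc z = 1 -> z != 1 -> normc (\sum_(j < J) z ^+ j) <= 2 / normc (z - 1).
Proof.
move=> z1 zn; have d0 : 0 < normc (z - 1).
  by rewrite lt_def normc_ge0 andbT normc_eq0 subr_eq0.
rewrite ler_pdivlMr // mulrC -normcM -subrX1; apply: le_trans (le_normcD _ _) _.
by rewrite normcN normc1 normcX z1 expr1n.
Qed.

End complex_lemmas.

Section sup_lemma.
Variables (R : realType) (V : zmodType).
Implicit Types (H : V -> Prop) (chi : V -> R[i]).

Definition uchar H chi := (forall x, H x -> normc (chi x) = 1) /\
  forall x y, H x -> H y -> chi (x + y) = chi x * chi y.

Definition trivial_on H chi := forall x, H x -> chi x = 1.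

Lemma uchar0 H chi : subgrp H -> uchar H chi -> chi 0 = 1.
Proof.
move=> [H0 _] [c1 cM]; have := cM 0 0 H0 H0; rewrite addr0 => e.
by apply: (mulfI (unimod_neq0 (c1 0 H0))); rewrite mulr1.
Qed.

Lemma ucharMn H chi x n : subgrp H -> uchar H chi -> H x -> chi (x *+ n) = chi x ^+ n.
Proof.
move=> sH cH Hx; elim: n => [|n IH]; first by rewrite mulr0n expr0 (uchar0 sH).
by rewrite mulrS exprS (proj2 cH) ?IH //; exact: subgrpMn.
Qed.

Lemma ucharN H chi x : subgrp H -> uchar H chi -> H x -> chi (- x) = (chi x)^-1.
Proof.
move=> sH cH Hx; have n0 := unimod_neq0 (proj1 cH x Hx).
apply: (mulfI n0); rewrite mulfV // -(proj2 cH) ?subrr ?(uchar0 sH cH) //; exact: subgrpN.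
Qed.

Lemma ucharB H chi x y : subgrp H -> uchar H chi -> H x -> H y -> chi (x - y) = chi x / chi y.
Proof. by move=> sH cH Hx Hy; rewrite (proj2 cH) ?(ucharN sH cH) //; exact: subgrpN. Qed.

(** Replaces integration over [H]. Averaging along [h + h0 *+ j] suppresses the terms with value
    other than 1 at [h0], whose geometric sums stay bounded, so the remaining, fewer terms satisfy
    the same bound; induction on their number. *)
Lemma sup_trivial_part H (s : seq (R[i] * (V -> R[i]))) B : subgrp H ->
  (forall p, List.In p s -> uchar H p.2) ->
  (forall h, H h -> complex.Re (\sum_(p <- s) p.1 * p.2 h) <= B) ->
  complex.Re (\sum_(p <- s | `[< trivial_on H p.2 >]) p.1) <= B.
Proof.
move=> sH; have [n] := ubnP (size s); elim: n s => // n IH s sn us sB.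
have [all1|nall] := pselect (forall p, List.In p s -> trivial_on H p.2).
  have H0 := proj1 sH; apply: le_trans (sB 0 H0); rewrite le_eqVlt; apply/orP; left; apply/eqP.
  congr (complex.Re _); elim: (s) all1 => [|p s' IHs] h; first by rewrite !big_nil.
  rewrite !big_cons IHs; last by move=> q qs; apply: h; right.
  have pt : trivial_on H p.2 by apply: h; left.
  by rewrite asboolT // pt // mulr1.
have [p0 [p0s [h0 [Hh0 nt]]]] : exists p0, List.In p0 s /\ exists h0, H h0 /\ p0.2 h0 <> 1.
  apply: contrapT => no; apply: nall => p ps h Hh; apply: contrapT => ne.
  by apply: no; exists p; split=> //; exists h.
pose P (p : R[i] * (V -> R[i])) := p.2 h0 == 1.
pose s' := [seq p <- s | P p].
have ins' p : List.In p s' -> List.In p s.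
  rewrite /s'; elim: (s) => //= q s1 IHs; case: ifP => _ /=; tauto.
have ss' : (size s' < n)%N.
  rewrite -ltnS; apply: leq_trans sn; rewrite ltnS size_filter.
  elim: (s) p0s => //= q s1 IHs [->|h]; last first.
    by rewrite -addnS -[(size s1).+1]add1n; apply: leq_add; [case: (P q) | exact: IHs].
  have -> : P p0 = false by apply/eqP.
  by rewrite add0n ltnS count_size.
have -> : \sum_(p <- s | `[< trivial_on H p.2 >]) p.1 = \sum_(p <- s' | `[< trivial_on H p.2 >]) p.1.
  rewrite big_filter_cond; apply: eq_bigl => p; case: asboolP => //=; last by rewrite andbF.
  by move=> /(_ _ Hh0) e; rewrite /P e eqxx.
apply: IH => //; first by move=> p /ins'; exact: us.
move=> h Hh; rewrite leNgt; apply/negP => lt.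
set e := complex.Re _ in lt.
(* A bound for all the discarded geometric sums, whatever their length [J]. *)
pose M := \sum_(p <- s | ~~ P p) normc p.1 * (2 / normc (p.2 h0 - 1)).
have key J : J%:R * (e - B) <= M.
  have HJ j : H (h + h0 *+ j) by apply: subgrpD => //; apply: subgrpMn.
  have l1 : \sum_(j < J) complex.Re (\sum_(p <- s) p.1 * p.2 (h + h0 *+ j)) <= J%:R * B.
    apply: le_trans (ler_sum _ (fun (j : 'I_J) _ => sB _ (HJ j))) _.
    by rewrite sumr_const card_ord mulr_natl.
  have l2 : \sum_(j < J) \sum_(p <- s) p.1 * p.2 (h + h0 *+ j) =
      \sum_(p <- s) p.1 * p.2 h * \sum_(j < J) p.2 h0 ^+ j.
    rewrite exchange_big /=; elim: (s) us => [|p s1 IHs] u1; first by rewrite !big_nil.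
    rewrite !big_cons IHs; last by move=> q qs; apply: u1; right.
    have up : uchar H p.2 by apply: u1; left.
    congr (_ + _); rewrite mulr_sumr; apply: eq_bigr => j _.
    by rewrite (proj2 up) // ?(ucharMn _ sH up) ?mulrA //; exact: subgrpMn.
  rewrite -Re_sum l2 (bigID P) /= ReD in l1.
  have l3 : \sum_(p <- s | P p) p.1 * p.2 h * \sum_(j < J) p.2 h0 ^+ j =
      (J%:R)%:C * \sum_(p <- s') p.1 * p.2 h.
    rewrite big_filter mulr_sumr; apply: eq_bigr => p /eqP ->; rewrite mulrC; congr (_ * _).
    by under eq_bigr do rewrite expr1n; rewrite sumr_const card_ord rmorph_nat.
  rewrite l3 ReC in l1.
  have l4 : - M <= complex.Re (\sum_(p <- s | ~~ P p) p.1 * p.2 h * \sum_(j < J) p.2 h0 ^+ j).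
    rewrite lerNl; apply: le_trans (ler_norm _) _; rewrite normrN; apply: le_trans (Re_normc _) _.
    apply: le_trans (normc_sum _ _ _) _; rewrite /M.
    elim: (s) us => [|p s1 IHs] u1; first by rewrite !big_nil.
    rewrite !big_cons; have le1 := IHs (fun q qs => u1 q (or_intror qs)).
    have up : uchar H p.2 by apply: u1; left.
    case: ifP => // np; apply: lerD le1; rewrite !normcM (proj1 up) // mulr1.
    by apply: ler_wpM2l (normc_ge0 _) _ _ _; apply: geo_bound => //; exact: (proj1 up).
  by move: l1 l4; rewrite mulrBr /e; lra.
have d0 : 0 < e - B by rewrite subr_gt0.
have := key (Num.bound (M / (e - B))).
rewrite leNgt -ltr_pdivrMr // => /negP; apply; apply: le_lt_trans (archi_boundP _).
  by [].
apply: divr_ge0; last exact: ltW.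
apply: sumr_ge0 => p _.
by rewrite mulr_ge0 ?divr_ge0 ?normc_ge0.
Qed.

End sup_lemma.

Lemma bin_mid_max m j : ('C(2 * m, j) <= 'C(2 * m, m))%N.
Proof.
have low i : (i <= m)%N -> ('C(2 * m, m - i) <= 'C(2 * m, m))%N.
  elim: i => [|i IH] im; first by rewrite subn0.
  apply: leq_trans (IH (ltnW im)); have -> : (m - i = (m - i.+1).+1)%N by lia.
  set k := (m - i.+1)%N; have h := mul_bin_left (2 * m) k.
  have : (k.+1 * 'C(2 * m, k) <= k.+1 * 'C(2 * m, k.+1))%N.
    by rewrite h leq_mul2r; apply/orP; right; rewrite /k; lia.
  by rewrite leq_mul2l.
have [jm|mj] := leqP j m; first by rewrite -(subKn jm) low // leq_subr.
have [j2|j2] := leqP j (2 * m); last by rewrite bin_small.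
by rewrite -bin_sub // (_ : 2 * m - j = m - (j - m))%N ?low //; lia.
Qed.

(** * Fejer kernels and the quantitative Kronecker theorem *)

Section fejer.
Variable R : realType.
Implicit Types z : R[i].

(** The squared cosine of half the argument of [z]: its powers concentrate at 1 and have nonnegative
    Fourier coefficients. *)
Definition fejer (z : R[i]) : R := (1 + complex.Re z) / 2.

Lemma fejer_unit z : normc z = 1 -> 0 <= fejer z <= 1.
Proof.
move=> h; have := Re_normc z; rewrite h ler_norml => /andP[a b].
by rewrite /fejer; apply/andP; split; lra.
Qed.

Lemma fejer_far z : normc z = 1 -> fejer z = 1 - normc (z - 1) ^+ 2 / 4.
Proof. by move=> /unimod_Re ->; rewrite /fejer; field. Qed.

(* F(z)^m = ((1 + z) (1 + 1/z) / 4)^m = (1 + z)^(2m) / (4 z)^m *)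
Lemma fejerX z m : normc z = 1 ->
  (fejer z ^+ m)%:C = \sum_(j < (2 * m).+1) ('C(2 * m, j)%:R / 4 ^+ m)%:C * z ^+ j / z ^+ m.
Proof.
move=> z1; have z0 := unimod_neq0 z1.
have e : (fejer z)%:C = (1 + z) ^+ 2 / (4 * z).
  have : (complex.Re z)%:C = (z + z^-1) / 2 by rewrite unimodJ // ReJ_add.
  rewrite /fejer rmorphM rmorphD /= => ->.
  have -> : ((2^-1 : R)%:C = 2^-1 :> R[i]) by rewrite fmorphV rmorph_nat.
  by field.
rewrite rmorphXn /= e expr_div_n -exprM exprDn mulr_suml.
rewrite -[in RHS](big_mkord xpredT (fun j => ('C(2 * m, j)%:R / 4 ^+ m)%:C * z ^+ j / z ^+ m)).
rewrite big_mkord; apply: eq_bigr => j _.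
rewrite expr1n mul1r exprMn_comm; last exact: mulrC.
rewrite rmorphM fmorphV rmorphXn /= !rmorph_nat -mulr_natl invfM.
by rewrite !mulrA; congr (_ / _); rewrite mulrAC.
Qed.

Lemma mid_coef m : ((2 * m).+1%:R)^-1 <= 'C(2 * m, m)%:R / 4 ^+ m :> R.
Proof.
rewrite ler_pdivlMr ?exprn_gt0 // mulrC ler_pdivrMr ?ltr0n //.
rewrite -natrX -natrM ler_nat (_ : 4 = 2 ^ 2)%N // -expnM.
have -> : (2 ^ (2 * m) = \sum_(j < (2 * m).+1) 'C(2 * m, j))%N.
  have := expnDn 1 1 (2 * m); rewrite addn1 => ->.
  by apply: eq_bigr => j _; rewrite !exp1n !muln1.
apply: leq_trans (_ : \sum_(j < (2 * m).+1) 'C(2 * m, m) <= _)%N.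
  by apply: leq_sum => j _; exact: bin_mid_max.
by rewrite sum_nat_const card_ord mulnC.
Qed.

Variables (I : finType) (m : nat).

Lemma fejer_prod (w : I -> R[i]) : (forall i, normc (w i) = 1) ->
  (\prod_i fejer (w i) ^+ m)%:C = \sum_(f : {ffun I -> 'I_(2 * m).+1})
    (\prod_i ('C(2 * m, f i)%:R / 4 ^+ m))%:C * (\prod_i w i ^+ f i / \prod_i w i ^+ m).
Proof.
move=> w1; rewrite rmorph_prod /=.
under eq_bigr do rewrite fejerX //.
rewrite bigA_distr_bigA /=; apply: eq_bigr => f _.
rewrite rmorph_prod -prodf_div -big_split /=; apply: eq_bigr => i _.
by rewrite mulrA.
Qed.

(** The relations say that every term of the expanded product that is trivial on [H] has phase 1. So
    [B] is at least the sum of the binomial weights of these terms, which include the central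
    one. *)
Lemma kronecker_sup (V : zmodType) (H : V -> Prop) (u : I -> V -> R[i]) (a : I -> R[i]) (B : R) : subgrp H ->
  (forall i, uchar H (u i)) -> (forall i, normc (a i) = 1) ->
  (forall f : {ffun I -> 'I_(2 * m).+1},
    (forall h, H h -> \prod_i u i h ^+ f i = \prod_i u i h ^+ m) ->
    \prod_i a i ^+ f i = \prod_i a i ^+ m) ->
  (forall h, H h -> \prod_i fejer (u i h / a i) ^+ m <= B) ->
  ((2 * m).+1%:R)^-1 ^+ #|I| <= B.
Proof.
move=> sH uu a1 rel bd.
pose co (f : {ffun I -> 'I_(2 * m).+1}) : R := \prod_i ('C(2 * m, f i)%:R / 4 ^+ m).
pose ev (w : I -> R[i]) (f : {ffun I -> 'I_(2 * m).+1}) := \prod_i w i ^+ f i / \prod_i w i ^+ m.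
pose t f : R[i] * (V -> R[i]) := ((co f)%:C / ev a f, fun h => ev (u^~ h) f).
have an (w : I -> R[i]) (e : I -> nat) : (forall i, normc (w i) = 1) -> \prod_i w i ^+ e i != 0.
  by move=> w1; apply/prodf_neq0 => i _; rewrite expf_neq0 // unimod_neq0.
have ev1 (w : I -> R[i]) f : (forall i, normc (w i) = 1) -> normc (ev w f) = 1.
  move=> w1; rewrite normcM normcV !normc_prod !big1 ?invr1 ?mulr1 // => i _;
  by rewrite normcX w1 expr1n.
have tu f : uchar H (t f).2.
  split=> [x Hx|x y Hx Hy] /=; first by apply: ev1 => i; exact: (proj1 (uu i)).
  rewrite /ev mulf_div -!big_split /=; congr (_ / _); apply: eq_bigr => i _;
  by rewrite (proj2 (uu i)) // exprMn.
have us p : List.In p [seq t f | f : {ffun I -> 'I_(2 * m).+1}] -> uchar H p.2.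
  by move=> /List.in_map_iff [f [<- _]]; exact: tu.
have ub h : H h -> complex.Re (\sum_(p <- [seq t f | f : {ffun I -> 'I_(2 * m).+1}]) p.1 * p.2 h) <= B.
  move=> Hh; apply: le_trans (bd h Hh).
  have -> : \prod_i fejer (u i h / a i) ^+ m = complex.Re (\prod_i fejer (u i h / a i) ^+ m)%:C by [].
  rewrite fejer_prod; last first.
    by move=> i; rewrite normcM normcV a1 (proj1 (uu i)) // invr1 mulr1.
  rewrite big_image /= le_eqVlt; apply/orP; left; apply/eqP; congr complex.Re; apply: eq_bigr => f _.
  rewrite -mulrA; congr (_ * _); rewrite /ev.
  under [in RHS]eq_bigr do rewrite expr_div_n.
  under [X in _ = _ / X]eq_bigr do rewrite expr_div_n.
  by rewrite !prodf_div !invf_div [LHS]mulf_div [RHS]mulf_div [X in X / _ = _]mulrC.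
apply: le_trans (sup_trivial_part sH us ub).
rewrite big_image_cond /= Re_sum.
have co0 f : 0 <= co f.
  by apply: prodr_ge0 => i _; rewrite divr_ge0 ?ler0n // exprn_ge0.
have ter f : trivial_on H (t f).2 -> complex.Re (t f).1 = co f.
  move=> tr; have -> : (t f).1 = (co f)%:C; last by [].
  rewrite /t /= /ev rel ?divff ?divr1 //; first exact: an.
  move=> h Hh; have := tr h Hh; rewrite /= /ev => /divr1_eq; exact.
pose f0 : {ffun I -> 'I_(2 * m).+1} := [ffun=> inord m].
have f0E i : f0 i = m :> nat by rewrite ffunE inordK // ltnS leq_pmull.
have tf0 : trivial_on H (t f0).2.
  move=> h Hh; rewrite /= /ev; under eq_bigr do rewrite f0E.
  by rewrite divff //; apply: an => i; exact: (proj1 (uu i)).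
rewrite (bigD1 f0) ?asboolT //= ter //.
apply: le_trans (_ : co f0 <= _); last first.
  by rewrite lerDl; apply: sumr_ge0 => f /andP[/asboolP tr _]; rewrite ter.
rewrite /co -prodr_const; apply: ler_prod => i _; rewrite f0E mid_coef andbT.
by rewrite invr_ge0 ler0n.
Qed.

End fejer.

Lemma bernoulli_inv (R : realType) (k : R) m : 0 <= k -> k <= 1 -> k ^+ m * (1 + m%:R * (1 - k)) <= 1.
Proof.
move=> k0 k1; elim: m => [|m IH]; first by rewrite mul0r addr0 expr0 mulr1.
apply: le_trans IH; rewrite exprSr -mulrA; apply: ler_wpM2l; first exact: exprn_ge0.
have -> : k * (1 + m.+1%:R * (1 - k)) = 1 + m%:R * (1 - k) - m.+1%:R * (1 - k) ^+ 2.
  by rewrite -natr1; ring.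
by rewrite gerDl oppr_le0 mulr_ge0 ?sqr_ge0.
Qed.

(** Exponential decay in [m] against a power of [2 * m + 1]; the exponent [m] is taken along
    multiples of an [m0] that brings [k ^+ m0] below 1/2. *)
Lemma exp_beats_poly (R : realType) (k : R) q : 0 <= k -> k < 1 ->
  exists m, k ^+ m < ((2 * m).+1%:R)^-1 ^+ q.
Proof.
move=> k0 k1; have d0 : 0 < 1 - k by rewrite subr_gt0.
pose m0 := Num.bound (1 - k)^-1.
have km : k ^+ m0 <= 2^-1.
  have := bernoulli_inv m0 k0 (ltW k1).
  have : 1 <= m0%:R * (1 - k).
    by rewrite -ler_pdivrMr // div1r ltW // archi_boundP // invr_ge0 ltW.
  have := exprn_ge0 m0 k0; set x := k ^+ m0; set y := _ * (1 - k); nra.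
have [w0 w0P] := asym 1 m0 0 q.
exists (m0 * w0)%N; have := w0P w0 w0 (leqnn _); rewrite mul1n => /(_ (leqnn _)).
rewrite expn0 muln1 => lt; rewrite exprVn; apply: le_lt_trans (_ : (2 ^+ w0)^-1 < _).
  rewrite exprM -exprVn; apply: lerXn2r; rewrite ?nnegrE ?exprn_ge0 ?invr_ge0 ?ler0n //.
rewrite ltf_pV2 ?posrE ?exprn_gt0 ?ltr0n // -!natrX ltr_nat.
by rewrite (_ : 2 * (m0 * w0) = 2 * w0 * m0)%N //; lia.
Qed.

(** Approximating all coordinates would need [m] to grow with [#|I|]. Every bad coordinate costs a
    factor [k ^+ m], while the supremum is at least a factor [(2 * m + 1)^-1] per coordinate; so a
    small proportion of bad ones is reached with [m] depending on [eta] and [q] only. *)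
Lemma shadow_fraction (R : realType) (eta : R) q : 0 < eta -> (0 < q)%N -> exists m,
  forall (V : zmodType) (H : V -> Prop) (I : finType) (u : I -> V -> R[i]) (a : I -> R[i]),
  subgrp H -> (forall i, uchar H (u i)) -> (forall i, normc (a i) = 1) ->
  (forall f : {ffun I -> 'I_(2 * m).+1},
    (forall h, H h -> \prod_i u i h ^+ f i = \prod_i u i h ^+ m) ->
    \prod_i a i ^+ f i = \prod_i a i ^+ m) ->
  exists2 h, H h & (q * #|[pred i | (eta <= normc (u i h - a i))%R]| <= #|I|)%N.
Proof.
move=> eta0 q0; pose k : R := Num.max 0 (1 - eta ^+ 2 / 4).
have k0 : 0 <= k by rewrite le_max lexx.
have k1 : k < 1.
  by rewrite gt_max ltr01 /= gtrDl oppr_lt0 divr_gt0 // exprn_gt0.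
have [m mP] := exp_beats_poly q k0 k1; exists m => V H I u a sH uu a1 rel.
apply: contrapT => no.
have bad h : H h -> (#|I| < q * #|[pred i | (eta <= normc (u i h - a i))%R]|)%N.
  by move=> Hh; rewrite ltnNge; apply/negP => le; apply: no; exists h.
pose c := (#|I| %/ q).+1.
have ub h : H h -> \prod_i fejer (u i h / a i) ^+ m <= k ^+ (m * c).
  move=> Hh; set bs := [pred i | eta <= normc (u i h - a i)].
  have cb : (c <= #|bs|)%N by rewrite /c ltn_divLR // mulnC bad.
  have w1 i : normc (u i h / a i) = 1 by rewrite normcM normcV a1 (proj1 (uu i)) // invr1 mulr1.
  rewrite (bigID (mem bs)) /=; apply: le_trans (_ : \prod_(i in bs) k ^+ m * 1 <= _).
    apply: ler_pM.
    - by apply: prodr_ge0 => i _; apply: exprn_ge0; case/andP: (fejer_unit (w1 i)).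
    - by apply: prodr_ge0 => i _; apply: exprn_ge0; case/andP: (fejer_unit (w1 i)).
    - apply: ler_prod => i; rewrite inE => bi.
      have /andP[f0 f1] := fejer_unit (w1 i); rewrite exprn_ge0 //=.
      apply: lerXn2r; rewrite ?nnegrE // le_max fejer_far //; apply/orP; right.
      rewrite lerD2l lerN2 ler_pM2r ?invr_gt0 ?ltr0n //.
      apply: lerXn2r; rewrite ?nnegrE ?normc_ge0 ?(ltW eta0) //.
      apply: le_trans bi _; have an := unimod_neq0 (a1 i).
      have -> : u i h / a i - 1 = (u i h - a i) / a i by rewrite mulrBl divff.
      by rewrite normcM normcV a1 invr1 mulr1.
    apply: prodr_ile1 => i _; have /andP[f0 f1] := fejer_unit (w1 i).
    by rewrite exprn_ge0 //= exprn_ile1.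
  rewrite mulr1 prodr_const -exprM; apply: ler_wiXn2l; rewrite ?k0 ?(ltW k1) //.
  by rewrite leq_mul2l cb orbT.
have := kronecker_sup sH uu a1 rel ub; apply/negP; rewrite -ltNge.
have [I0|I0] := posnP #|I|.
  by have := bad 0 (proj1 sH); rewrite I0 (eq_card0 (A := [pred i | _])) ?muln0 // => i; have := fintype0 i I0.
have r0 : 0 <= ((2 * m).+1%:R)^-1 :> R by rewrite invr_ge0 ler0n.
rewrite -(ltr_pXn2r q0) ?nnegrE ?exprn_ge0 // -!exprM.
apply: le_lt_trans (_ : k ^+ (m * #|I|) < _).
  apply: ler_wiXn2l; rewrite ?k0 ?(ltW k1) //.
  by rewrite -mulnA leq_mul2l ltnW ?orbT // /c ltn_ceil.
rewrite exprM [(#|I| * q)%N]mulnC [ltRHS]exprM ltr_pXn2r ?nnegrE ?exprn_ge0 //.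
Qed.

(** * Fourier analysis on finite groups *)

Lemma prim_root_complex (R : realType) n : (0 < n)%N -> {w : R[i] | n.-primitive_root w}.
Proof.
move=> n0; pose p : {poly R[i]} := 'X^n - 1.
have [r rE] := closed_field_poly_normal p; apply/sigW.
have p1 : p = \prod_(z <- r) ('X - z%:P).
  by rewrite rE lead_coefXnsubC // scale1r.
have sr : size r = n by apply: succn_inj; rewrite -(size_prod_XsubC r idfun) -p1 size_XnsubC.
have ur : uniq r.
  by rewrite -separable_prod_XsubC -p1 separable_Xn_sub_1 // pnatr_eq0 -lt0n.
have ar : all n.-unity_root r.
  apply/allP => z zr; have : root p z by rewrite p1 root_prod_XsubC.
  by rewrite rootE /p !hornerE ?hornerXn unity_rootE subr_eq0.
by have /hasP[w _ wP] := has_prim_root n0 ar ur (eq_leq (esym sr)); exists w.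
Qed.

Lemma unimod_root (R : realType) (w : R[i]) n : (0 < n)%N -> w ^+ n = 1 -> normc w = 1.
Proof.
move=> n0 wn; have := congr1 (@normc R) wn; rewrite normcX normc1 => /eqP.
by rewrite pexpr_eq1 ?normc_ge0 // => /eqP.
Qed.

Lemma sum_prim_root (R : realType) n (w z : R[i]) : n.-primitive_root w -> (exists j, z = w ^+ j) ->
  \sum_(k < n) z ^+ k = if z == 1 then n%:R else 0.
Proof.
move=> pw [j zE]; case: eqP => [->|/eqP z1].
  by under eq_bigr do rewrite expr1n; rewrite sumr_const card_ord.
have zn : z ^+ n = 1 by rewrite zE exprAC (prim_expr_order pw) expr1n.
have := subrX1 z n; rewrite zn subrr => /esym /eqP; rewrite mulf_eq0 subr_eq0 (negbTE z1) /=.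
by move=> /eqP.
Qed.

Section finite_fourier.
Variables (R : realType) (Q : finZmodType) (K : finType) (xi : K -> Q -> R[i]).
Hypothesis xi1 : forall k q, normc (xi k q) = 1.
Hypothesis xiD : forall k q q', xi k (q + q') = xi k q * xi k q'.
Hypothesis xi_sum : forall q, \sum_k xi k q = if q == 0 then #|Q|%:R else 0.
Let n : R := #|Q|%:R.

Let xi0 k : xi k 0 = 1.
Proof. by apply: (mulfI (unimod_neq0 (xi1 k 0))); rewrite -xiD addr0 mulr1. Qed.

Let xiN k q : xi k (- q) = conjc (xi k q).
Proof.
rewrite -unimodJ //; apply: (mulfI (unimod_neq0 (xi1 k q))).
by rewrite -xiD subrr xi0 mulfV // unimod_neq0.
Qed.

Definition fhat (F : Q -> R) k : R[i] := \sum_r (F r)%:C * xi k r.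
Definition acorr (F : Q -> R) q : R := \sum_r F r * F (r + q).

Let fhatJ F k : conjc (fhat F k) = \sum_r (F r)%:C * xi k (- r).
Proof.
rewrite /fhat rmorph_sum; apply: eq_bigr => r _.
by rewrite rmorphM /= xiN; congr (_ * _); rewrite /= oppr0.
Qed.

Let shiftQ (F : Q -> R[i]) q : \sum_r F (r + q) = \sum_r F r.
Proof.
rewrite [RHS](reindex (fun r => r + q)) //.
by exists (fun r => r - q) => r _; rewrite ?addrK ?subrK.
Qed.

Lemma fhat_acorr F k : fhat (acorr F) k = fhat F k * conjc (fhat F k).
Proof.
rewrite fhatJ /fhat /acorr mulr_sumr.
transitivity (\sum_s \sum_r (F s)%:C * (F (s + r))%:C * xi k r).
  rewrite exchange_big; apply: eq_bigr => r _.
  by rewrite rmorph_sum mulr_suml; apply: eq_bigr => s _; rewrite rmorphM.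
apply: eq_bigr => s _.
rewrite -(shiftQ (fun r => (F s)%:C * (F (s + r))%:C * xi k r) (- s)) mulr_suml.
apply: eq_bigr => r _; have -> : s + (r - s) = r by rewrite addrC subrK.
by rewrite xiD; ring.
Qed.

Lemma acorr_fourier F q : n * acorr F q = \sum_k normc (fhat F k) ^+ 2 * complex.Re (xi k q).
Proof.
have e k : (normc (fhat F k) ^+ 2)%:C = fhat F k * conjc (fhat F k).
  by rewrite -sqr_normc rmorphXn.
have -> : \sum_k normc (fhat F k) ^+ 2 * complex.Re (xi k q) =
    complex.Re (\sum_k fhat F k * conjc (fhat F k) * xi k q).
  by rewrite Re_sum; apply: eq_bigr => k _; rewrite -e ReC.
have -> : n * acorr F q = complex.Re (n * acorr F q)%:C by [].
congr complex.Re; transitivity (\sum_r \sum_s (F r)%:C * (F s)%:C * \sum_k xi k (r - s + q)); last first.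
  under [LHS]eq_bigr do under eq_bigr do rewrite mulr_sumr.
  under [LHS]eq_bigr do rewrite exchange_big.
  rewrite exchange_big; apply: eq_bigr => k _; rewrite fhatJ /fhat mulr_suml mulr_suml.
  apply: eq_bigr => r _; rewrite mulr_sumr mulr_suml; apply: eq_bigr => s _.
  by rewrite !xiD; ring.
rewrite rmorphM rmorph_sum mulr_sumr rmorph_nat; apply: eq_bigr => r _.
under [RHS]eq_bigr do rewrite xi_sum.
rewrite (bigD1 (r + q)) //= [X in _ = _ + X]big1 ?addr0 => [|s ne].
  by rewrite opprD addrA subrr sub0r addNr eqxx [LHS]mulrC rmorphM.
case: eqP => [e0|]; last by rewrite mulr0.
by case/eqP: ne; apply/esym/eqP; rewrite -subr_eq0 addrAC e0.
Qed.

Lemma fourier_equicont F k h (dl : R) : (forall r, `|F (r + h) - F r| <= dl) ->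
  normc (fhat F k) * normc (xi k h - 1) <= n * dl.
Proof.
move=> osc; have -> : normc (fhat F k) * normc (xi k h - 1) =
    normc (\sum_r (F r - F (r + h))%:C * xi k (r + h)).
  rewrite -normcM; congr normc; rewrite mulrBr mulr1.
  under [RHS]eq_bigr do rewrite rmorphB mulrBl.
  rewrite sumrB (shiftQ (fun r => (F r)%:C * xi k r)) mulr_suml; congr (_ - _).
  by apply: eq_bigr => r _; rewrite xiD mulrA.
apply: le_trans (normc_sum _ _ _) _; apply: le_trans (_ : \sum_(r : Q) dl <= _).
  by apply: ler_sum => r _; rewrite normcM xi1 mulr1 normcR distrC.
by rewrite sumr_const mulr_natl.
Qed.

Lemma acorr_diff F q : acorr F 0 - acorr F q = 2^-1 * \sum_r (F r - F (r + q)) ^+ 2.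
Proof.
have e : \sum_r F (r + q) * F (r + q) = acorr F 0.
  have := shiftQ (fun r => (F r * F r)%:C) q; rewrite -!rmorph_sum => /(congr1 (@complex.Re R)) /= ->.
  by apply: eq_bigr => r _; rewrite addr0.
have -> : \sum_r (F r - F (r + q)) ^+ 2 = acorr F 0 - 2 * acorr F q + \sum_r F (r + q) * F (r + q).
  rewrite /acorr mulr_sumr -sumrB -big_split /=; apply: eq_bigr => r _.
  by rewrite addr0; ring.
by rewrite e; field.
Qed.

(** Finds one character that separates [q0] from 0 and is as equicontinuous as [F], with constants
    independent of the finite group. [D] consists of the points where translation by [q0] changes
    [F], [D'] of the translations that hardly change [F]; only their densities enter. *)
Lemma fourier_char (F : Q -> R) (q0 : Q) (ka ka' c1 dl : R) (D D' : {set Q}) :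
  0 < ka -> 0 < ka' -> 0 < c1 -> 0 <= dl -> dl <= ka * c1 / 8 ->
  (forall r, `|F r| <= 1) -> ka * n <= #|D|%:R -> ka' * n <= #|D'|%:R ->
  (forall r, r \in D -> c1 <= (F r - F (r + q0)) ^+ 2) ->
  (forall r, r \in D' -> forall s, `|F (s + r) - F s| <= dl) ->
  exists k, let c := ka' * (ka * c1) ^+ 2 / 64 in c <= 1 - complex.Re (xi k q0) /\
    forall h e, 0 <= e -> (forall r, `|F (r + h) - F r| <= e) -> c / 2 * normc (xi k h - 1) ^+ 2 <= e ^+ 2.
Proof.
move=> ka0 ka0' c10 dl0 dlc F1 cD cD' Dq Dosc.
set c := ka' * (ka * c1) ^+ 2 / 64.
have n0 : 0 < n by rewrite ltr0n; apply/card_gt0P; exists 0.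
have c0 : 0 < c by rewrite divr_gt0 // mulr_gt0 // exprn_gt0 // mulr_gt0.
(* The autocorrelation is taken twice: the second one weighs the characters by [a k ^+ 2], and as
   the [a k] sum to at most [n * n], some single [a k * (1 - Re (xi k q0))] must be large. *)
pose g := acorr F.
have gd q r : (forall s, `|F (s + r) - F s| <= dl) -> `|g (q + r) - g q| <= n * dl.
  move=> o; rewrite /g /acorr -sumrB; apply: le_trans (ler_norm_sum _ _ _) _.
  apply: le_trans (_ : \sum_(s : Q) dl <= _); last by rewrite sumr_const mulr_natl.
  apply: ler_sum => s _; rewrite -mulrBr normrM -[leRHS]mul1r addrA.
  by apply: ler_pM.
have g0 : ka * n * c1 / 2 <= g 0 - g q0.
  rewrite acorr_diff mulrC ler_pM2l ?invr_gt0 ?ltr0n //.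
  apply: le_trans (_ : #|D|%:R * c1 <= _); first by rewrite ler_pM2r.
  rewrite (bigID (mem D)) /= mulr_natl -sumr_const; apply: le_trans (_ : \sum_(r in D) (F r - F (r + q0)) ^+ 2 <= _).
    exact: ler_sum.
  by rewrite lerDl; apply: sumr_ge0 => r _; exact: sqr_ge0.
have G0 : ka' * n * (ka * n * c1 / 4) ^+ 2 / 2 <= acorr g 0 - acorr g q0.
  rewrite acorr_diff mulrC ler_pM2l ?invr_gt0 ?ltr0n //.
  apply: le_trans (_ : #|D'|%:R * (ka * n * c1 / 4) ^+ 2 <= _); first by apply: ler_wpM2r; rewrite ?sqr_ge0.
  rewrite (bigID (mem D')) /= mulr_natl -sumr_const.
  apply: le_trans (_ : \sum_(r in D') (g r - g (r + q0)) ^+ 2 <= _); last first.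
    by rewrite lerDl; apply: sumr_ge0 => r _; exact: sqr_ge0.
  apply: ler_sum => r rD; apply: lerXn2r; rewrite ?nnegrE.
  - by rewrite divr_ge0 // !mulr_ge0 // ltW.
  - have := gd 0 r (Dosc r rD); have := gd q0 r (Dosc r rD); rewrite add0r [q0 + r]addrC.
    rewrite !ler_norml; have : n * dl <= n * (ka * c1 / 8) by rewrite ler_pM2l.
    move: g0; set a := ka * n * c1; have -> : n * (ka * c1 / 8) = a / 8 by rewrite /a; field.
    have a0' : 0 <= a by rewrite !mulr_ge0 // ltW.
    by lra.
  - have := gd 0 r (Dosc r rD); have := gd q0 r (Dosc r rD); rewrite add0r [q0 + r]addrC.
    rewrite !ler_norml; have : n * dl <= n * (ka * c1 / 8) by rewrite ler_pM2l.
    move: g0; set a := ka * n * c1; have -> : n * (ka * c1 / 8) = a / 8 by rewrite /a; field.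
    by lra.
pose a k := normc (fhat F k) ^+ 2.
have a0 k : 0 <= a k by exact: sqr_ge0.
have ga k : normc (fhat g k) = a k.
  by rewrite fhat_acorr normcM /a expr2; congr (_ * _); have := normcJ (fhat F k) => -[].
have Ga q : n * acorr g q = \sum_k a k ^+ 2 * complex.Re (xi k q).
  by rewrite acorr_fourier; apply: eq_bigr => k _; rewrite ga.
have sa : \sum_k a k <= n * n.
  have := acorr_fourier F 0; have -> : \sum_k normc (fhat F k) ^+ 2 * complex.Re (xi k 0) = \sum_k a k.
    by apply: eq_bigr => k _; rewrite xi0 mulr1.
  move=> <-; rewrite ler_pM2l //; apply: le_trans (_ : \sum_(r : Q) 1 <= _); last by rewrite sumr_const.
  apply: ler_sum => r _; rewrite addr0; have := F1 r; rewrite ler_norml; nra.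
have an k : a k <= n ^+ 2.
  apply: lerXn2r; rewrite ?nnegrE ?normc_ge0 ?(ltW n0) //; apply: le_trans (normc_sum _ _ _) _.
  apply: le_trans (_ : \sum_(r : Q) 1 <= _); last by rewrite sumr_const.
  by apply: ler_sum => r _; rewrite normcM xi1 mulr1 normcR.
have [k kP] : exists k, c * n ^+ 2 <= a k * (1 - complex.Re (xi k q0)).
  apply: contrapT => no.
  have small k : a k * (1 - complex.Re (xi k q0)) <= c * n ^+ 2.
    by rewrite leNgt; apply/negP => l; apply: no; exists k; exact: ltW.
  have : n * (acorr g 0 - acorr g q0) <= c * n ^+ 2 * (n * n).
    rewrite mulrBr !Ga -sumrB; apply: le_trans (_ : \sum_k a k * (c * n ^+ 2) <= _).
      apply: ler_sum => k _; rewrite xi0 mulr1 -{1}[a k ^+ 2]mulr1 -mulrBr expr2 -mulrA.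
      exact: ler_wpM2l.
    by rewrite -mulr_suml mulrC ler_wpM2l // mulr_ge0 ?ltW // exprn_gt0.
  apply/negP; rewrite -ltNge.
  apply: lt_le_trans (_ : n * (ka' * n * (ka * n * c1 / 4) ^+ 2 / 2) <= _); last by rewrite ler_pM2l.
  have -> : n * (ka' * n * (ka * n * c1 / 4) ^+ 2 / 2) = 2 * (c * n ^+ 2 * (n * n)).
    by rewrite /c; field.
  have : 0 < c * n ^+ 2 * (n * n) by apply: mulr_gt0; [apply: mulr_gt0 => //; exact: exprn_gt0 | exact: mulr_gt0].
  by move: (_ * (n * n)) => x; lra.
have R1 : 0 <= 1 - complex.Re (xi k q0) <= 2.
  by have := Re_normc (xi k q0); rewrite xi1 ler_norml; lra.
exists k; split.
  have : c * n ^+ 2 <= n ^+ 2 * (1 - complex.Re (xi k q0)).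
    by apply: le_trans kP _; apply: ler_wpM2r; [case/andP: R1 | exact: an].
  by rewrite mulrC ler_pM2l // exprn_gt0.
(* A large Fourier coefficient at [k] transfers the equicontinuity of [F] to the character
   [xi k]. *)
move=> h e e0 osc; have := fourier_equicont k osc.
have ak : c / 2 * n ^+ 2 <= a k.
  have : a k * (1 - complex.Re (xi k q0)) <= a k * 2 by apply: ler_wpM2l => //; case/andP: R1.
  by move: kP; lra.
move=> le1.
have le2 : a k * normc (xi k h - 1) ^+ 2 <= (n * e) ^+ 2.
  rewrite /a -exprMn; apply: lerXn2r; rewrite ?nnegrE ?mulr_ge0 ?normc_ge0 ?(ltW n0) //.
have : c / 2 * n ^+ 2 * normc (xi k h - 1) ^+ 2 <= (n * e) ^+ 2.
  by apply: le_trans le2; apply: ler_wpM2r; rewrite ?sqr_ge0.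
by rewrite exprMn mulrAC mulrC ler_pM2l // exprn_gt0.
Qed.

End finite_fourier.

HB.instance Definition _ (aT : finType) (rT : finZmodType) := Finite.on {ffun aT -> rT}.

Section torus_characters.
Variables (R : realType) (d l : nat) (w : R[i]).
Hypothesis pw : l.+2.-primitive_root w.
Local Notation Q := {ffun 'I_d -> 'Z_l.+2}.

Definition tchar (k q : Q) : R[i] := \prod_i w ^+ (k i * q i)%N.

Lemma tchar_unit k q : normc (tchar k q) = 1.
Proof.
rewrite normc_prod big1 // => i _; rewrite normcX.
by rewrite (unimod_root _ (prim_expr_order pw)) ?expr1n.
Qed.

Lemma tcharD k q q' : tchar k (q + q') = tchar k q * tchar k q'.
Proof.
rewrite -big_split; apply: eq_bigr => i _ /=; rewrite ffunE -exprD -mulnDr.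
by apply/eqP; rewrite (eq_prim_root_expr pw) /= modnMmr.
Qed.

Lemma tchar_sum q : \sum_k tchar k q = if q == 0 then #|{: Q}|%:R else 0.
Proof.
rewrite /tchar.
rewrite -(bigA_distr_bigA (fun (i : 'I_d) (j : 'Z_l.+2) => w ^+ (j * q i)%N)) /=.
have e i : \sum_(j : 'Z_l.+2) w ^+ (j * q i)%N = if q i == 0 then l.+2%:R else 0.
  have := @sum_prim_root R l.+2 w (w ^+ q i) pw (ex_intro _ (q i : nat) erefl).
  under eq_bigr do rewrite -exprM mulnC.
  move=> ->; congr (if _ then _ else _); rewrite -(prim_order_dvd pw).
  apply/idP/eqP => [dv|->]; last by rewrite dvdn0.
  apply/val_inj => /=; apply/eqP; rewrite -leqn0 leqNgt; apply/negP => q0.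
  by have := dvdn_leq q0 dv; rewrite leqNgt ltn_ord.
under eq_bigr do rewrite e.
case: eqP => [->|ne].
  under eq_bigr do rewrite ffunE eqxx.
  by rewrite prodr_const card_ffun !card_ord natrX.
have [i qi] : exists i, q i != 0.
  apply: contrapT => no; apply: ne; apply/ffunP => i; rewrite ffunE; apply/eqP.
  by apply: contrapT => /negP h; apply: no; exists i.
by rewrite (bigD1 i) //= (negbTE qi) mul0r.
Qed.

End torus_characters.

Local Close Scope complex_scope.
From mathcomp Require Import all_boot all_order all_algebra complex.
From mathcomp Require Import all_classical all_reals all_analysis measurable_realfun.
From mathcomp Require Import ring lra zify.
Import Order.TTheory GRing.Theory Num.Theory ComplexField.Normc.
Import numFieldNormedType.Exports.
Import Defs.
Local Open Scope classical_set_scope.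
Local Open Scope ring_scope.
Local Notation Re := complex.Re.
Local Notation Im := complex.Im.
Local Notation "R [i]" := (complex R).

(** * Characters of compact groups *)

Lemma compact_subcover (T : topologicalType) (A : set T) (I : Type) (U : I -> set T) :
  compact A -> (forall x, A x -> exists i, nbhs x (U i)) ->
  exists s : seq I, forall x, A x -> exists2 i, List.In i s & U i x.
Proof.
move=> cA cov; apply: contrapT => no.
pose B (s : seq I) := [set x | A x /\ forall i, List.In i s -> ~ U i x].
have FB : Filter (filter_from setT B).
  apply: filter_from_filter; first by exists [::].
  move=> s t _ _; exists (s ++ t) => // x [Ax h]; split; split=> // i ii; apply: h.
    by apply/List.in_app_iff; left.
  by apply/List.in_app_iff; right.
have PB : ProperFilter (filter_from setT B).
  apply: filter_from_proper => s _; apply: contrapT => e; apply: no; exists s => x Ax.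
  apply: contrapT => h; apply: e; exists x; split=> // i is' Ui; apply: h; by exists i.
have [|x [Ax cx]] := cA (filter_from setT B) PB; first by exists [::] => // x [].
have [i Ui] := cov x Ax.
have [|y [[Ay h] Uy]] := cx (B [:: i]) (U i) _ Ui; first by exists [:: i].
by apply: (h i) => //; left.
Qed.

Section abelian_identities.
Variable V : zmodType.
Implicit Types a b c x y p q s h : V.

Lemma zgroup1 a p q x : x + (a - (x - q) - (a + q - p)) = p.
Proof. by rewrite [- (x - q)]opprB [a + (q - x)]addrA [_ - x - _]addrAC subKr [LHS]addrC subrK. Qed.

Lemma zgroup2 a b p : a + (b - (a + b - p)) = p.
Proof. by rewrite addrA subKr. Qed.

Lemma zgroup3 h s p a b x y : h + s - p + (a + b - s) + (x - a) + (y - b) - (x + y - p) = h.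
Proof.
rewrite -[X in X - _]addrA [x - a + _]addrACA -opprD [h + s - p]addrAC [_ + s + _]addrACA subrr addr0.
move: (a + b) (x + y) => t z; rewrite opprB !addrA.
by rewrite [_ + z - t]addrAC addrK [_ + z + p]addrAC subrK addrK.
Qed.

Lemma zgroup4 a p q x : a + (x - (x - q) - (a + q - p)) = p.
Proof. by rewrite subKr zgroup2. Qed.

End abelian_identities.

Section group_topology.
Variables (X : topologicalZmodType).
Implicit Types (W O : set X) (x y a : X).

Lemma nbhs0_sub W : nbhs (0 : X) W -> exists2 W', nbhs 0 W' & forall x y, W' x -> W' y -> W (x - y).
Proof.
move=> nW; have := @sub_continuous X (0, 0) W; rewrite /= subrr => /(_ nW) [[P Q] [/= nP nQ] PQ].
exists (P `&` Q); first exact: filterI.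
by move=> x y [Px _] [_ Qy]; exact: (PQ (x, y)).
Qed.

Lemma nbhs0_add W : nbhs (0 : X) W -> exists2 W', nbhs 0 W' & forall x y, W' x -> W' y -> W (x + y).
Proof.
move=> nW; have := @add_continuous X (0, 0) W; rewrite /= addr0 => /(_ nW) [[P Q] [/= nP nQ] PQ].
exists (P `&` Q); first exact: filterI.
by move=> x y [Px _] [_ Qy]; exact: (PQ (x, y)).
Qed.

Lemma nbhs0N W : nbhs (0 : X) W -> nbhs 0 [set x | W (- x)].
Proof. by move=> nW; have := @opp_continuous X 0 W; rewrite oppr0 => /(_ nW). Qed.

Lemma addl_continuous a : continuous (fun x : X => a + x).
Proof.
move=> x V nV; have := @add_continuous X (a, x) V nV => -[[P Q] [/= nP nQ] PQ].
by apply: filterS nQ => y Qy; apply: (PQ (a, y)); split=> //=; exact: nbhs_singleton.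
Qed.

Lemma nbhs_sub0 a W : nbhs (0 : X) W -> nbhs a [set x | W (x - a)].
Proof.
move=> nW; have := @addl_continuous (- a) a W; rewrite addNr => /(_ nW) h.
by apply: filterS (h : nbhs a [set x | W (- a + x)]) => x /=; rewrite addrC.
Qed.

Lemma nbhs_add0 a V : nbhs (a : X) V -> nbhs (0 : X) [set w | V (a + w)].
Proof. by move=> nV; have := @addl_continuous a 0 V; rewrite addr0 => /(_ nV). Qed.

Lemma nbhs0_sum d W : nbhs (0 : X) W ->
  exists2 W', nbhs 0 W' & forall f : 'I_d -> X, (forall i, W' (f i)) -> W (\sum_i f i).
Proof.
elim: d W => [|d IH] W nW.
  by exists setT => [|f _]; [exact: filterT | rewrite big_ord0; exact: nbhs_singleton].
have [W1 n1 h1] := nbhs0_add nW; have [W2 n2 h2] := IH W1 n1.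
exists (W1 `&` W2); first exact: filterI.
move=> f fW; rewrite big_ord_recr /=; apply: h1; last by case: (fW ord_max).
by apply: h2 => i; case: (fW (widen_ord (leqnSn d) i)).
Qed.

Lemma unif_cont (R : realType) (f : X -> R) e : compact [set: X] -> continuous f -> 0 < e ->
  exists2 W, nbhs (0 : X) W & forall x w, W w -> `|f (x + w) - f x| <= e.
Proof.
move=> cX cf e0.
pose good x W := nbhs (0 : X) W /\ forall w w', W w -> W w' -> `|f (x + w + w') - f (x + w)| <= e.
pose I := {p : X * set X | good p.1 p.2}.
have [|s sP] := @compact_subcover X setT I (fun p y => (sval p).2 (y - (sval p).1)) cX.
  move=> x _; have e2 : 0 < e / 2 by rewrite divr_gt0.
  have nV : nbhs x [set y | `|f x - f y| < e / 2] by move: (cf x) => /cvgrPdist_lt /(_ _ e2).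
  have [W nW WP] := nbhs0_add (nbhs_add0 nV).
  have gx : good (x, W).1 (x, W).2.
    split=> //= w w' Ww Ww'; have := WP _ _ Ww Ww'; have := WP _ _ Ww (nbhs_singleton nW).
    rewrite /= addr0 addrA => h1 h2.
    have -> : f (x + w + w') - f (x + w) = (f x - f (x + w)) - (f x - f (x + w + w')) by ring.
    apply: le_trans (ler_normB _ _) _; move: h1 h2; lra.
  by exists (exist (fun p : X * set X => good p.1 p.2) (x, W) gx) => /=; exact: nbhs_sub0.
exists [set w | forall p, List.In p s -> (sval p).2 w].
  elim: s {sP} => [|p s IH]; first by apply: filterS filterT => w _ p [].
  have [np _] := svalP p; apply: filterS (filterI np IH) => w [h1 h2] p' /= [<- //|]; exact: h2.
move=> x w wP; have [p ps xp] := sP x Logic.I.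
have [np h] := svalP p; have := h _ _ xp (wP p ps); by rewrite [(sval p).1 + _]addrC subrK.
Qed.

Lemma finite_net W : compact [set: X] -> nbhs (0 : X) W ->
  exists n (t : 'I_n -> X), forall x, exists i, W (x - t i).
Proof.
move=> cX nW; have [|s sP] := @compact_subcover X setT X (fun a x => W (x - a)) cX.
  by move=> x _; exists x; exact: nbhs_sub0.
exists (size s), (fun i => nth 0 s i) => x; have [a a_s Wa] := sP x Logic.I.
have [i [il e]] : exists i, (i < size s)%N /\ nth 0 s i = a.
  elim: s a_s {sP} => //= b s IH [->|/IH [i [il e]]]; first by exists 0%N.
  by exists i.+1.
by exists (Ordinal il); rewrite /= e.
Qed.

(** Simultaneous return of multiples to 0, by pigeonhole on the cells of a finite net. *)
Lemma recurrence d (s : 'I_d -> X) W : compact [set: X] -> nbhs (0 : X) W ->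
  exists l, forall i, W (s i *+ l.+2).
Proof.
move=> cX nW; have [W' n' h'] := nbhs0_sub nW.
have [M [t tP]] := finite_net cX n'.
(* Even multiples, so that the difference of two of them is at least 2, as ['Z_l.+2] requires. *)
have [c cP] := choice (fun p : nat * 'I_d => tP (s p.2 *+ (2 * p.1))).
pose k (n : 'I_(M ^ d).+1) : {ffun 'I_d -> 'I_M} := [ffun i => c (n : nat, i)].
have /injectivePn [n1 [n2 ne e]] : ~~ injectiveb k.
  apply/negP => /injectiveP inj; have := leq_card _ inj.
  by rewrite card_ffun !card_ord ltnn.
wlog lt : n1 n2 ne e / (n1 < n2)%N.
  move=> H; case: (ltngtP n1 n2) => [|l|/val_inj eq]; first exact: H ne e.
    by apply: (H n2 n1) => //; rewrite eq_sym.
  by rewrite eq eqxx in ne.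
exists (2 * (n2 - n1)).-2 => i.
have -> : (2 * (n2 - n1)).-2.+2 = (2 * n2 - 2 * n1)%N by lia.
rewrite mulrnBr; last by rewrite leq_mul2l ltnW.
have := congr1 (fun g : {ffun _} => g i) e; rewrite !ffunE => ei.
have h1 := cP (n1 : nat, i); have h2 := cP (n2 : nat, i); rewrite -ei /= in h2.
have := h' _ _ h2 h1; by rewrite opprB addrA subrK.
Qed.

Definition sig d l (s : 'I_d -> X) (q : {ffun 'I_d -> 'Z_l.+2}) := \sum_i s i *+ q i.

(** The [s i] form a finite net and [l.+2] nearly kills all of them. Thus a carry in the addition
    modulo [l.+2] costs little, and [sig] is up to [W] a homomorphism with dense image. *)
Lemma approx_group W : compact [set: X] -> nbhs (0 : X) W ->
  exists d l (s : 'I_d -> X), (forall x, exists q : {ffun 'I_d -> 'Z_l.+2}, W (x - sig s q)) /\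
    forall q q' : {ffun 'I_d -> 'Z_l.+2}, W (sig s q + sig s q' - sig s (q + q')).
Proof.
move=> cX nW; have [d [s sP]] := finite_net cX nW.
have [W' n' h'] := nbhs0_sum d nW.
have [l lP] := recurrence s cX n'.
exists d, l, s; split=> [x|q q'].
  have [i Wi] := sP x; exists [ffun j => inord (j == i)]; rewrite /sig (bigD1 i) //= big1 ?addr0.
    by rewrite ffunE eqxx inordK.
  by move=> j ji; rewrite ffunE (negbTE ji) inordK.
rewrite /sig -big_split -sumrB /=; apply: h' => i.
rewrite ffunE -mulrnDr /=; set m := (q i + q' i)%N.
have [ml|lm] := ltnP m l.+2.
  by rewrite modn_small // subrr; exact: nbhs_singleton.
have -> : (m %% l.+2 = m - l.+2)%N.
  rewrite -{1}(subnK lm) modnDr modn_small // ltn_subLR //.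
  have h1 : (q i < l.+2)%N := ltn_ord (q i); have h2 : (q' i < l.+2)%N := ltn_ord (q' i).
  by rewrite /m; lia.
by rewrite -mulrnBr ?leq_subr // subKn.
Qed.

End group_topology.

Lemma ultra_lim (R : realType) (T : Type) (U : set_system T) (u : T -> R) M : UltraFilter U ->
  (forall t, `|u t| <= M) -> exists l : R, u @ U --> l.
Proof.
move=> UU uM; have PU : ProperFilter U by exact: ultra_proper.
have cI := @segment_compact R (- M) M.
have [|l [_ cl]] := cI (u @ U) _.
  have hT : U setT by exact: filterT.
  have h : U (u @^-1` `[- M, M]) by apply: filterS hT => t _ /=; rewrite in_itv /= -ler_norml.
  exact: h.
exists l => V nV; rewrite /= nbhs_filterE.
have [//|nv] := in_ultra_setVsetC (u @^-1` V) UU.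
by have [y [h1 h2]] := cl (~` V) V nv nV.
Qed.

Lemma complex_ultra_lim (R : realType) (T : Type) (U : set_system T) (z : T -> R[i]) : UltraFilter U ->
  (forall t, normc (z t) = 1) -> exists l : R[i], forall e, 0 < e -> U [set t | normc (z t - l) <= e].
Proof.
move=> UU z1; have PU : ProperFilter U by exact: ultra_proper.
have [t|a ha] := @ultra_lim R T U (fun t => Re (z t)) 1 UU.
  by rewrite -(z1 t) Re_normc.
have [t|b hb] := @ultra_lim R T U (fun t => Im (z t)) 1 UU.
  by have := Re_normc (z t * 'i%C); rewrite ReiNIm normrN normcM z1 mul1r /normc /= expr0n add0r expr1n sqrtr1.
exists (Complex a b) => e e0.
have e2 : 0 < e / 2 by rewrite divr_gt0.
move: ha hb => /cvgrPdist_le /(_ _ e2) ha /cvgrPdist_le /(_ _ e2) hb.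
apply: filterS (filterI ha hb) => t [h1 h2] /=.
have -> : z t - Complex a b = (Re (z t) - a)%:C%C + (Im (z t) - b)%:C%C * 'i%C.
  by case: (z t) => x y; apply/eqP; rewrite eq_complex /=; apply/andP; split; apply/eqP; ring.
apply: le_trans (le_normcD _ _) _; rewrite normcM !normcR.
have -> : normc 'i%C = 1 :> R by rewrite /normc /= expr0n add0r expr1n sqrtr1.
by rewrite mulr1 distrC [`|Im _ - _|]distrC; move: h1 h2 => /=; lra.
Qed.

Section metric.
Variables (R : realType) (X : topologicalZmodType).

Lemma metrizable_hausdorff : metrizable R X -> hausdorff_space X.
Proof.
move=> [d [d0 deq dC dT dop]] p q pq; apply/deq; apply: contrapT => ne.
have dp : 0 < d p q by rewrite lt_neqAle d0 andbT eq_sym; apply/eqP.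
have ball x e : 0 < e -> nbhs x [set y | d x y < e].
  move=> e0; apply: open_nbhs_nbhs; split; last by rewrite /= (proj2 (deq x x)).
  apply/dop => y /= xy; exists (e - d x y); first by rewrite subr_gt0.
  by move=> z /= yz; apply: le_lt_trans (dT x y z) _; move: yz; lra.
have h : 0 < d p q / 2 by rewrite divr_gt0.
have [z [/= h1 h2]] := pq _ _ (ball p _ h) (ball q _ h).
by have := dT p z q; rewrite [d z q]dC; move: h1 h2; lra.
Qed.

Lemma metrizable_separate (x0 : X) : metrizable R X -> x0 != 0 ->
  exists f : X -> R, [/\ continuous f, (forall x, `|f x| <= 1) & f 0 != f x0].
Proof.
move=> [d [d0 deq dC dT dop]] x00.
have ball x e : 0 < e -> nbhs x [set y | d x y < e].
  move=> e0; apply: open_nbhs_nbhs; split; last by rewrite /= (proj2 (deq x x)).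
  apply/dop => y /= xy; exists (e - d x y); first by rewrite subr_gt0.
  by move=> z /= yz; apply: le_lt_trans (dT x y z) _; move: yz; lra.
exists (fun x => Num.min 1 (d 0 x)); split.
- move=> x; apply/cvgrPdist_lt => e e0; apply: filterS (ball x e e0) => y /= xy.
  have h1 := dT 0 x y; have h2 := dT 0 y x; rewrite [d y x]dC in h2.
  rewrite ltr_norml /Num.min; case: ifP; case: ifP => a b; move: h1 h2 xy a b e0; lra.
- by move=> x; rewrite ger0_norm ?ge_min ?lexx // le_min ler01 d0.
- rewrite (proj2 (deq 0 0)) //; have dp : 0 < d 0 x0.
    by rewrite lt_neqAle d0 andbT eq_sym; apply: contraNneq x00 => /deq <-.
  by rewrite lt_eqF // lt_min !gt_min ltr01 dp !orbT.
Qed.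

End metric.

Definition cchar (R : realType) (X : topologicalZmodType) (chi : X -> R[i]) :=
  [/\ forall x, normc (chi x) = 1, forall x y, chi (x + y) = chi x * chi y &
      forall e : R, 0 < e -> nbhs (0 : X) [set x | normc (chi x - 1) <= e]].

Section peter_weyl.
Variables (R : realType) (X : topologicalZmodType) (f : X -> R) (x0 : X).
Hypotheses (cX : compact [set: X]) (cf : continuous f) (f1 : forall x, `|f x| <= 1).
Hypothesis fx0 : f 0 != f x0.

Definition modulus (O : set X) e := forall x w, O w -> `|f (x + w) - f x| <= e.

(** [f] is transported by [sig] to a finite group, and [fourier_char] gives a character there. Read
    on [X] through approximations [qq x], it is a character up to errors governed by the modulus of
    continuity of [f]. The constant [c] is fixed before [W], so that a limit is possible. *)
Lemma approx_char : exists2 c : R, 0 < c & exists2 W0, nbhs (0 : X) W0 & forall W, nbhs (0 : X) W -> W `<=` W0 ->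
  exists chi : X -> R[i], [/\ forall x, normc (chi x) = 1, c <= 1 - Re (chi x0),
    forall e O, 0 <= e -> modulus O e -> (forall a b u v w z, W a -> W b -> W u -> W v -> W w -> W z ->
       O (a + b + u + v - w - z)) -> forall x y, c * normc (chi (x + y) - chi x * chi y) ^+ 2 <= e ^+ 2 &
    forall e O, 0 <= e -> modulus O e -> forall x, (forall w z, W w -> W z -> O (x - w - z)) ->
       c * normc (chi x - 1) ^+ 2 <= e ^+ 2].
Proof.
pose g := `|f 0 - f x0| / 4.
have g0 : 0 < g by rewrite divr_gt0 // normr_gt0 subr_eq0.
have [N1 n1 h1] := unif_cont cX cf g0.
(* The points of the finite group that [sig] sends into [O] have density at least [1 / M], with [M]
   the size of a net of [X]: one translate receives that share, and differences of its points land
   in [O]. *)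
have big (O : set X) : nbhs (0 : X) O -> exists2 k : R, 0 < k & exists2 W0, nbhs (0 : X) W0 &
    forall W, W `<=` W0 -> forall d l (s : 'I_d -> X),
    (forall q q' : {ffun 'I_d -> 'Z_l.+2}, W (sig s q + sig s q' - sig s (q + q'))) ->
    k * #|{: {ffun 'I_d -> 'Z_l.+2}}|%:R <= #|[set q : {ffun 'I_d -> 'Z_l.+2} | `[< O (sig s q) >]]%SET|%:R.
  move=> nO; have [N2 n2 h2] := nbhs0_add nO; have [N3 n3 h3] := nbhs0_sub n2.
  have [M [t tP]] := finite_net cX n3; have M0 : (0 < M)%N by have [[i im] _] := tP 0; exact: leq_ltn_trans im.
  exists (M%:R^-1); first by rewrite invr_gt0 ltr0n.
  exists N2 => // W WO d l s sW.
  have [c cP] := choice (fun q : {ffun 'I_d -> 'Z_l.+2} => tP (sig s q)).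
  have [i iM] : exists i, (#|{: {ffun 'I_d -> 'Z_l.+2}}| <= M * #|[set q | c q == i]%SET|)%N.
    apply: contrapT => no.
    have lt i : (M * #|[set q | c q == i]%SET| < #|{: {ffun 'I_d -> 'Z_l.+2}}|)%N.
      by rewrite ltnNge; apply/negP => le; apply: no; exists i.
    have : (\sum_(i < M) M * #|[set q | c q == i]%SET| < \sum_(i < M) #|{: {ffun 'I_d -> 'Z_l.+2}}|)%N.
      have [i0 _] := tP 0; rewrite (bigD1 i0) //= [ltnRHS](bigD1 i0) //=.
      by rewrite -addSn; apply: leq_add => //; apply: leq_sum => i _; exact: ltnW.
    rewrite sum_nat_const card_ord -big_distrr /= ltn_pmul2l //.
    have -> : #|{: {ffun 'I_d -> 'Z_l.+2}}| = (\sum_(i < M) #|[set q | c q == i]%SET|)%N.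
      rewrite -sum1_card (partition_big c xpredT) //=; apply: eq_bigr => i _.
      by rewrite sum1dep_card.
    by rewrite ltnn.
  rewrite mulrC ler_pdivrMr ?ltr0n // -natrM ler_nat; apply: leq_trans iM _.
  rewrite mulnC leq_mul2r; apply/orP; right.
  have [->|[q0]] := finset.set_0Vmem [set q | c q == i]%SET; first by rewrite cards0.
  rewrite inE => /eqP cq0.
  rewrite -(card_imset [set q | c q == i]%SET (addIr (- q0))).
  apply: subset_leq_card; apply/fintype.subsetP => q' /imsetP [q]; rewrite inE => /eqP cq ->.
  rewrite inE; apply/asboolP.
  have a1 := cP q; have a2 := cP q0; rewrite cq in a1; rewrite cq0 in a2.
  have e1 : sig s q - sig s q0 = (sig s q - t i) - (sig s q0 - t i) by rewrite opprB addrA subrK.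
  have a3 := h3 _ _ a1 a2; rewrite -e1 in a3.
  have a4 := sW (q - q0) q0; rewrite subrK in a4.
  have := h2 _ _ a3 (WO _ a4).
  by rewrite [_ - sig s q]addrC [- _ + _]addrC [_ + (_ - sig s q)]addrC addrA subrK addrK.
have [N2 n2 h2] := nbhs0_sub n1.
have [N3 n3 h3] := nbhs0_sub n2.
have N32 x : N3 x -> N2 x by move=> h; rewrite -[x]subr0; apply: h3 => //; exact: nbhs_singleton.
have N31 x : N3 x -> N1 x by move=> h; rewrite -[x]subr0; apply: h2; [exact: N32 | exact: nbhs_singleton].
have [ka ka0 [V1 nV1 bg1]] := big _ n3.
pose c1 := (2 * g) ^+ 2; have c10 : 0 < c1 by rewrite exprn_gt0 // mulr_gt0.
pose dl := ka * c1 / 8; have dl0 : 0 < dl by rewrite divr_gt0 // mulr_gt0.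
have [N4 n4 h4] := unif_cont cX cf dl0.
have [N5 n5 h5] := nbhs0_sub n4.
have [ka' ka'0 [V2 nV2 bg2]] := big _ n5.
pose c := ka' * (ka * c1) ^+ 2 / 64.
have c0 : 0 < c by apply: divr_gt0 => //; apply: mulr_gt0 => //; apply: exprn_gt0; exact: mulr_gt0.
exists (c / 2); first exact: divr_gt0.
exists (N3 `&` (N5 `&` (V1 `&` V2))); first by do !apply: filterI.
move=> W nW WO; have [d [l [s [sX sW]]]] := approx_group cX nW.
have [W3 W5 W1 W2] : [/\ W `<=` N3, W `<=` N5, W `<=` V1 & W `<=` V2].
  by split=> x /WO [? [? []]].
have [qq qqP] := choice sX.
have [w pw] := @prim_root_complex R l.+2 isT.
pose F (q : {ffun 'I_d -> 'Z_l.+2}) := f (sig s q).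
have [|||||||k [kx kosc]] := @fourier_char R {ffun 'I_d -> 'Z_l.+2} {ffun 'I_d -> 'Z_l.+2} (tchar w) (tchar_unit pw) (tcharD pw) (tchar_sum pw)
   F (qq x0) ka ka' c1 dl [set q | `[< N3 (sig s q) >]]%SET [set q | `[< N5 (sig s q) >]]%SET ka0 ka'0 c10.
- exact: ltW.
- by [].
- by move=> r; exact: f1.
- exact: (bg1 W W1 d l s sW).
- exact: (bg2 W W2 d l s sW).
- move=> r; rewrite inE => /asboolP Or.
  have a1 : `|F r - f 0| <= g by have := h1 0 _ (N31 _ Or); rewrite add0r.
  have e2 : sig s (r + qq x0) = x0 + (sig s r - (x0 - sig s (qq x0)) - (sig s r + sig s (qq x0) - sig s (r + qq x0))).
    by rewrite zgroup1.
  have a2 : `|F (r + qq x0) - f x0| <= g.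
    rewrite /F e2; apply: h1; apply: h2; last exact/N32/W3/sW.
    apply: h3 => //; exact/W3/qqP.
  have a3 : `|f 0 - f x0| = 4 * g by rewrite /g; field.
  have a4 : 2 * g <= `|F r - F (r + qq x0)|.
    have := ler_normD (F r - F (r + qq x0)) (F (r + qq x0) - f x0 - (F r - f 0)).
    have -> : F r - F (r + qq x0) + (F (r + qq x0) - f x0 - (F r - f 0)) = f 0 - f x0 by ring.
    have := ler_normB (F (r + qq x0) - f x0) (F r - f 0).
    by move: a1 a2 a3; lra.
  rewrite /c1 -[leRHS]real_normK ?num_real //; apply: lerXn2r; rewrite ?nnegrE ?normr_ge0 //.
  by rewrite mulr_ge0 // ltW.
- move=> r; rewrite inE => /asboolP Or q; rewrite /F.
  have -> : sig s (q + r) = sig s q + (sig s r - (sig s q + sig s r - sig s (q + r))).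
    by rewrite zgroup2.
  by apply: h4; apply: h5 => //; exact/W5/sW.
have uni q : normc (tchar w k q) = 1 by exact: tchar_unit.
have chD q q' : tchar w k (q + q') = tchar w k q * tchar w k q' by exact: tcharD.
exists (fun x => tchar w k (qq x)); split=> //.
- by apply: le_trans kx; rewrite -/c; move: c0; lra.
- move=> e O e0 mO WW x y; set h := qq (x + y) - (qq x + qq y).
  have -> : normc (tchar w k (qq (x + y)) - tchar w k (qq x) * tchar w k (qq y)) = normc (tchar w k h - 1).
    have e3 : tchar w k (qq (x + y)) = tchar w k h * (tchar w k (qq x) * tchar w k (qq y)).
      by rewrite -!chD subrK.
    by rewrite e3 -[X in _ - X]mul1r -mulrBl normcM normcM !uni !mulr1.
  apply: kosc => // r; rewrite /F.
  have e4 : sig s (r + h) = sig s r + (sig s h - (sig s r + sig s h - sig s (r + h))).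
    by rewrite zgroup2.
  rewrite e4; apply: mO; have := WW _ _ _ _ _ _ (sW h (qq x + qq y)) (sW (qq x) (qq y)) (qqP x) (qqP y)
     (qqP (x + y)) (sW r h).
  rewrite {1}/h subrK; set z := sig s r + _ - _; set S := sig s (qq x + qq y); set P := sig s (qq (x + y)).
  by rewrite zgroup3.
- move=> e O e0 mO x WW; apply: kosc => // r; rewrite /F.
  have -> : sig s (r + qq x) = sig s r + (x - (x - sig s (qq x)) - (sig s r + sig s (qq x) - sig s (r + qq x))).
    by rewrite zgroup4.
  by apply: mO; apply: WW; [exact: qqP | exact: sW].
Qed.

(** The pointwise limit of the approximate characters along an ultrafilter of shrinking [W] is an
    exact one. *)
Lemma separating_char : exists2 chi : X -> R[i], cchar chi & chi x0 != 1.
Proof.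
have [c c0 [W0 nW0 ac]] := approx_char.
(* The index set is the family of neighbourhoods [W], filtered by inclusion in smaller and smaller
   [V]. *)
pose D (V : set X) := [set W | nbhs (0 : X) W /\ W `<=` V].
have FD : Filter (filter_from (nbhs (0 : X)) D).
  apply: filter_from_filter; first by exists setT; exact: filterT.
  move=> V V' nV nV'; exists (V `&` V'); first exact: filterI.
  by move=> W [nW WV]; split; split=> // x /WV [].
have PD : ProperFilter (filter_from (nbhs (0 : X)) D).
  by apply: filter_from_proper => V nV; exists V; split.
have [U [UU DU]] := ultraFilterLemma PD.
have PU : ProperFilter U by exact: ultra_proper.
have UD V : nbhs (0 : X) V -> U (D V) by move=> nV; apply: DU; exists V.
have /choice [chi chiP] : forall W, exists chi : X -> R[i], (forall x, normc (chi x) = 1) /\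
    (nbhs (0 : X) W -> W `<=` W0 -> [/\ c <= 1 - Re (chi x0),
    forall e O, 0 <= e -> modulus O e -> (forall a b u v w z, W a -> W b -> W u -> W v -> W w -> W z ->
       O (a + b + u + v - w - z)) -> forall x y, c * normc (chi (x + y) - chi x * chi y) ^+ 2 <= e ^+ 2 &
    forall e O, 0 <= e -> modulus O e -> forall x, (forall w z, W w -> W z -> O (x - w - z)) ->
       c * normc (chi x - 1) ^+ 2 <= e ^+ 2]).
  move=> W; have [[nW WW]|no] := pselect (nbhs (0 : X) W /\ W `<=` W0).
    by have [chi [h1 h2 h3 h4]] := ac W nW WW; exists chi.
  by exists (fun=> 1); split=> [x|nW WW]; [exact: normc1 | case: no].
have /choice [L LP] x := complex_ultra_lim UU (fun W => proj1 (chiP W) x).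
have ex (V : set (set X)) : U V -> exists W, [/\ nbhs (0 : X) W, W `<=` W0 & V W].
  by move=> UV; have [W [[nW WW] VW]] := @filter_ex _ U PU _ (filterI (UD _ nW0) UV); exists W.
have small (a b : R) : 0 <= a -> (forall e, 0 < e -> a <= b + e) -> a <= b.
  by move=> _ h; apply/ler_addgt0Pr.
have L1 x : normc (L x) = 1.
  apply/eqP; rewrite -subr_eq0 -normr_le0; apply: small => // e e0; rewrite add0r.
  have [W [nW WW h]] := ex _ (LP x e e0).
  have := normc_dist (L x) (chi W x); rewrite (proj1 (chiP W)) normcB => /le_trans; exact.
have eps e : 0 < e -> exists e1, 0 <= e1 /\ 0 < e1 /\ e1 ^+ 2 = c * e ^+ 2.
  have s0 : 0 < Num.sqrt c by rewrite sqrtr_gt0.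
  move=> e0; exists (Num.sqrt c * e); rewrite exprMn (sqr_sqrtr (ltW c0)).
  by split; [rewrite mulr_ge0 ?ltW | rewrite mulr_gt0].
have back e n : 0 < e -> 0 <= n -> c * n ^+ 2 <= c * e ^+ 2 -> n <= e.
  move=> e0 n0; rewrite ler_pM2l // ler_pXn2r ?nnegrE ?(ltW e0) //.
exists L; last first.
  have e4 : 0 < c / 2 by rewrite divr_gt0.
  have [W [nW WW h]] := ex _ (LP x0 _ e4).
  have [h1 _ _] := proj2 (chiP W) nW WW.
  apply/eqP => e; rewrite e in h; have := Re_normc (chi W x0 - 1); rewrite ReD ReN /=.
  by move: h h1; rewrite /= ler_norml; move: (normc _) => n; lra.
split=> // [x y|e e0].
  apply/eqP; rewrite -subr_eq0 -normc_eq0 eq_le normc_ge0 andbT.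
  apply: small => [|e e0]; first exact: normc_ge0.
  rewrite add0r; have e5 : 0 < e / 5 by rewrite divr_gt0.
  have [e1 [e10 [e1p e1E]]] := eps _ e5.
  have [V nV mV] := unif_cont cX cf e1p.
  have [N1 n1 a1] := nbhs0_add nV; have [N2 n2 a2] := nbhs0_sub n1.
  have [N3 n3 a3] := nbhs0_add n1; have [N4 n4 a4] := nbhs0_sub n3; have [N5 n5 a5] := nbhs0_add n4.
  have [W [nW WW [[[hx hy] hxy] [_ WN]]]] := ex _ (filterI (filterI (filterI (LP x _ e5) (LP y _ e5)) (LP (x + y) _ e5))
    (UD _ (filterI n5 n2))).
  have [_ h1 _] := proj2 (chiP W) nW WW.
  have hm : normc (chi W (x + y) - chi W x * chi W y) <= e / 5.
    apply: back => //; first exact: normc_ge0.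
    rewrite -e1E; apply: (h1 e1 V) => // a b u v w z Wa Wb Wu Wv Ww Wz.
    have W5 t : W t -> N5 t by move=> /WN [].
    have W4 t : W t -> N4 t by move=> Wt; rewrite -[t]addr0; apply: a5; [exact: W5 | exact: nbhs_singleton].
    have W3 t : W t -> N3 t by move=> Wt; rewrite -[t]subr0; apply: a4; [exact: W4 | exact: nbhs_singleton].
    have W0' t : N4 t -> N3 t by move=> Wt; rewrite -[t]subr0; apply: a4 => //; exact: nbhs_singleton.
    have -> : a + b + u + v - w - z = (a + b - w) + (u + v - z).
      by rewrite [RHS]addrACA -!addrA.
    by apply: a1; [have := a4 _ _ (a5 _ _ (W5 _ Wa) (W5 _ Wb)) (W4 _ Ww) | have := a4 _ _ (a5 _ _ (W5 _ Wu) (W5 _ Wv)) (W4 _ Wz)];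
      move=> h; rewrite -[_ - _]addr0; apply: a3 => //; exact: nbhs_singleton.
  have -> : L (x + y) - L x * L y = (L (x + y) - chi W (x + y)) + (chi W (x + y) - chi W x * chi W y)
     + (chi W x - L x) * chi W y + L x * (chi W y - L y) by ring.
  have t4 (a b u v : R[i]) : normc (a + b + u + v) <= normc a + normc b + normc u + normc v.
    apply: le_trans (le_normcD _ _) _; rewrite lerD2r.
    by apply: le_trans (le_normcD _ _) _; rewrite lerD2r le_normcD.
  apply: le_trans (t4 _ _ _ _) _; rewrite !normcM L1 (proj1 (chiP W)) mulr1 mul1r.
  by rewrite [normc (L (x + y) - _)]normcB; move: hx hy hxy hm => /=; lra.
have e2 : 0 < e / 2 by rewrite divr_gt0.
have [e1 [e10 [e1p e1E]]] := eps _ e2.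
have [V nV mV] := unif_cont cX cf e1p.
have [N1 n1 a1] := nbhs0_sub nV; have [N2 n2 a2] := nbhs0_sub n1.
have n21 t : N2 t -> N1 t by move=> h; rewrite -[t]subr0; apply: a2 => //; exact: nbhs_singleton.
apply: (filterS _ (n2)) => x Nx.
have [W [nW WW [hx [_ WN]]]] := ex _ (filterI (LP x _ e2) (UD _ n2)).
have [_ _ h1] := proj2 (chiP W) nW WW.
have hm : normc (chi W x - 1) <= e / 2.
  apply: back => //; first exact: normc_ge0.
  rewrite -e1E; apply: (h1 e1 V) => // w z Ww Wz.
  by apply: a1; [apply: a2 => //; exact: WN | exact/n21/WN].
rewrite /=; have -> : L x - 1 = (L x - chi W x) + (chi W x - 1) by rewrite addrA subrK.
apply: le_trans (le_normcD _ _) _; rewrite [normc (L x - _)]normcB /=.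
by move: hx hm => /=; lra.
Qed.

End peter_weyl.

Lemma characters_separate (R : realType) (X : topologicalZmodType) (x : X) : compact [set: X] ->
  metrizable R X -> x != 0 -> exists2 chi : X -> R[i], cchar chi & chi x != 1.
Proof.
by move=> cX mX x0; have [f [cf f1 fx]] := metrizable_separate mX x0; exact: (separating_char cX cf f1 fx).
Qed.

(** * Duality for compact subgroups *)

Section dual_group.
Variables (R : realType) (X : topologicalZmodType) (Y : set X).

(** Characters of [Y] are functions on all of [X] with value 1 off [Y]: equality of characters is
    then equality of functions. Continuity is required at 0 and relative to [Y]. *)
Definition dual_axiom (chi : X -> R[i]) := [/\ forall x, normc (chi x) = 1, forall x, ~ Y x -> chi x = 1,
  forall x y, Y x -> Y y -> chi (x + y) = chi x * chi y &
  forall e : R, 0 < e -> nbhs (0 : X) [set x | Y x -> normc (chi x - 1) <= e]].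

Record dual := Dual { dual_fun :> X -> R[i]; dualP : dual_axiom dual_fun }.

Lemma dual_ext (f g : dual) : f =1 g -> f = g.
Proof.
case: f g => [f fP] [g gP] /= /funext e; case: _ / e in gP *.
by rewrite (Prop_irrelevance fP gP).
Qed.

Lemma dual_zero_axiom : dual_axiom (fun=> 1).
Proof.
split=> [x|//|x y _ _|e e0]; rewrite ?normc1 ?mulr1 //.
apply: filterS filterT => x _ _; change (normc (1 - 1 : R[i]) <= e).
by have /eqP -> : normc (1 - 1 : R[i]) == 0; [rewrite normc_eq0 subrr | exact: ltW].
Qed.

Lemma dual_add_axiom (f g : dual) : dual_axiom (fun x => f x * g x).
Proof.
have [f1 f2 f3 f4] := dualP f; have [g1 g2 g3 g4] := dualP g.
split=> [x|x nx|x y xY yY|e e0]; rewrite ?normcM ?f1 ?g1 ?mulr1 //.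
- by rewrite f2 // g2 // mulr1.
- by rewrite f3 // g3 // mulrACA.
have e2 : 0 < e / 2 by rewrite divr_gt0.
apply: filterS (filterI (f4 _ e2) (g4 _ e2)) => x [/= h1 h2] xY.
have -> : f x * g x - 1 = (f x - 1) * g x + (g x - 1) by ring.
apply: le_trans (le_normcD _ _) _; rewrite normcM g1 mulr1.
by move: (h1 xY) (h2 xY); lra.
Qed.

Lemma dual_opp_axiom (f : dual) : dual_axiom (fun x => (f x)^-1).
Proof.
have [f1 f2 f3 f4] := dualP f.
split=> [x|x nx|x y xY yY|e e0].
- by rewrite normcV f1 invr1.
- by rewrite f2 // invr1.
- by rewrite f3 // invfM.
apply: filterS (f4 _ e0) => x /= h xY.
have fx := unimod_neq0 (f1 x).
have -> : (f x)^-1 - 1 = (1 - f x) / f x by rewrite mulrBl mul1r divff.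
by rewrite normcM normcV f1 invr1 mulr1 normcB; exact: h.
Qed.

HB.instance Definition _ := gen_eqMixin dual.
HB.instance Definition _ := gen_choiceMixin dual.

Let zero := Dual dual_zero_axiom.
Let add f g := Dual (dual_add_axiom f g).
Let opp f := Dual (dual_opp_axiom f).

Let addA : associative add. Proof. by move=> f g h; apply: dual_ext => x /=; rewrite mulrA. Qed.
Let addC : commutative add. Proof. by move=> f g; apply: dual_ext => x /=; rewrite mulrC. Qed.
Let add0 : left_id zero add. Proof. by move=> f; apply: dual_ext => x /=; rewrite mul1r. Qed.
Let addN : left_inverse zero opp add.
Proof.
by move=> f; apply: dual_ext => x /=; rewrite mulVf // unimod_neq0 //; case: (dualP f).
Qed.

HB.instance Definition _ := GRing.isZmodule.Build dual addA addC add0 addN.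

Implicit Types f g : dual.

Lemma dual_unit f x : normc (f x) = 1. Proof. by case: (dualP f). Qed.
Lemma dual_off f x : ~ Y x -> f x = 1. Proof. by case: (dualP f) => _ + _ _; apply. Qed.
Lemma dual0E x : (0 : dual) x = 1. Proof. by []. Qed.
Lemma dualDE f g x : (f + g) x = f x * g x. Proof. by []. Qed.
Lemma dualNE f x : (- f) x = (f x)^-1. Proof. by []. Qed.
Lemma dual_sumE (I : Type) (s : seq I) (P : pred I) (F : I -> dual) x :
  (\sum_(i <- s | P i) F i) x = \prod_(i <- s | P i) F i x.
Proof. by apply: (big_morph (fun f : dual => f x)). Qed.
Lemma dualMnE f n x : (f *+ n) x = f x ^+ n.
Proof. by elim: n => [|n IH]; rewrite ?mulr0n // mulrS dualDE IH exprS. Qed.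
Lemma dualMzE f (a m : nat) x : (f *~ (a%:Z - m%:Z)) x = f x ^+ a / f x ^+ m.
Proof. by rewrite mulrzBr -!pmulrn dualDE dualNE !dualMnE. Qed.

Lemma dual_eq0 f : (forall x, Y x -> f x = 1) -> f = 0.
Proof.
by move=> h; apply: dual_ext => x; have [/h //|/dual_off ->] := pselect (Y x).
Qed.

Lemma dual_uchar f (H : X -> Prop) : (forall x, H x -> Y x) -> uchar H f.
Proof.
move=> HY; have [f1 _ f3 _] := dualP f; split=> [x _ //|x y /HY hx /HY hy]; exact: f3.
Qed.

Hypothesis sY : subgrp Y.

Lemma dual_cont f y e : Y y -> 0 < e -> nbhs y [set z | Y z -> normc (f z - f y) <= e].
Proof.
move=> Yy e0; have [f1 _ f3 f4] := dualP f.
apply: filterS (nbhs_sub0 y (f4 e e0)) => z /= h Yz.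
have Yzy : Y (z - y) by exact: (proj2 sY).
have -> : f z - f y = (f (z - y) - 1) * f y by rewrite mulrBl mul1r -f3 // subrK.
by rewrite normcM f1 mulr1; exact: h.
Qed.

Lemma dual_at0 f : f 0 = 1.
Proof. by apply: uchar0 (dual_uchar f (fun x h => h)). Qed.

Hypothesis cY : compact Y.

(* If f is not in N, integrating prod F(chi_i)^m (1/2 - f) against Y gives a positive
   number, while f is close to 1 wherever the product is not small. *)
Lemma dual_perp (N : dual -> Prop) f : subgrp N ->
  (forall y, Y y -> (forall g, N g -> g y = 1) -> f y = 1) -> N f.
Proof.
move=> sN perp; apply: contrapT => nN.
(* [Y] is covered by the set where [f] has real part at least 1/2 and by sets where some element of
   [N] stays away from 1; a finite subcover selects the factors [ch i]. *)
pose J := option {p : dual * R | N p.1 /\ 0 < p.2}.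
pose U (j : J) : set X := match j with
  | None => [set z | Y z -> 2^-1 <= Re (f z)]
  | Some p => [set z | Y z -> (sval p).2 <= normc ((sval p).1 z - 1)] end.
have [|s sP] := @compact_subcover X Y J U cY.
  move=> y Yy; have [e|ne] := eqVneq (f y) 1.
    exists None; have e2 : (0 : R) < 2^-1 by rewrite invr_gt0.
    apply: filterS (dual_cont f Yy e2) => z /= h Yz; have := h Yz; rewrite e => h1.
    by have := le_trans (Re_normc _) h1; rewrite ReD ReN ler_norml /=; lra.
  have [g [Ng gy]] : exists g, N g /\ g y <> 1.
    apply: contrapT => no; move/eqP: ne; apply; apply: perp => // g Ng.
    by apply: contrapT => h; apply: no; exists g.
  pose d := normc (g y - 1) / 2.
  have d0 : 0 < d.
    by rewrite divr_gt0 // lt_neqAle normc_ge0 andbT eq_sym normc_eq0 subr_eq0; apply/eqP.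
  exists (Some (exist (fun p : dual * R => N p.1 /\ 0 < p.2) (g, d) (conj Ng d0))).
  apply: filterS (dual_cont g Yy d0) => z /= h Yz; have := h Yz => h1.
  have := normc_dist (g y - 1) (g z - 1); rewrite opprB addrA subrK.
  have -> : normc (g y - 1) = 2 * d by rewrite /d; field.
  by rewrite ler_norml; move: h1; rewrite [normc (g y - g z)]normcB; lra.
pose s' := pmap id s.
pose n := size s'.
have insome p : List.In (Some p) s -> exists i : 'I_n, tnth (in_tuple s') i = p.
  rewrite /n /s' => h; suff [i [il e]] : exists i, (i < size (pmap id s))%N /\ onth (pmap id s) i = Some p.
    by exists (Ordinal il); apply: Some_inj; rewrite -e /= (tnth_nth p) /= onthE (nth_map p).
  elim: (s) h => //= q t IH [->|h] /=; first by exists 0%N.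
  have [i [il e]] := IH h; case: q => [q|] /=; last by exists i.
  by exists i.+1.
pose ch (i : 'I_n) := (sval (tnth (in_tuple s') i)).1.
pose de (i : 'I_n) := (sval (tnth (in_tuple s') i)).2.
have chN i : N (ch i) by rewrite /ch; case: (svalP (tnth (in_tuple s') i)).
have de0 i : 0 < de i by rewrite /de; case: (svalP (tnth (in_tuple s') i)).
pose k : R := \big[Num.max/0]_i (1 - de i ^+ 2 / 4).
have k0 : 0 <= k by exact: bigmax_ge_id.
have k1 : k < 1.
  rewrite /k; apply: bigmax_lt => // i _.
  by rewrite gtrDl oppr_lt0 divr_gt0 // exprn_gt0.
have ki i : 1 - de i ^+ 2 / 4 <= k by rewrite /k; apply: le_bigmax.
(* The exponent [n.+2] leaves a factor [(2 * m + 1) ^+ 2], which pays for the 3/2 against 1/2 in the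
   final comparison. *)
have [m mP] := exp_beats_poly n.+2 k0 k1.
pose co (h : {ffun 'I_n -> 'I_(2 * m).+1}) : R := \prod_i ('C(2 * m, h i)%:R / 4 ^+ m).
pose ev (w : 'I_n -> R[i]) (h : {ffun 'I_n -> 'I_(2 * m).+1}) := \prod_i w i ^+ h i / \prod_i w i ^+ m.
pose dv (h : {ffun 'I_n -> 'I_(2 * m).+1}) : dual := \sum_i (ch i *+ nat_of_ord (h i) - ch i *+ m).
have dvE h y : ev (fun i => ch i y) h = dv h y.
  rewrite /ev /dv dual_sumE -prodf_div; apply: eq_bigr => i _.
  by rewrite dualDE dualNE !dualMnE.
have dvN h : N (dv h) by apply: subgrp_sum => // i _; apply: (proj2 sN); apply: subgrpMn.
pose t0 h : R[i] * (X -> R[i]) := ((co h / 2)%:C%C, dv h : X -> R[i]).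
pose t1 h : R[i] * (X -> R[i]) := ((- co h)%:C%C, dv h + f : X -> R[i]).
pose sq := [seq t0 h | h : {ffun 'I_n -> 'I_(2 * m).+1}] ++ [seq t1 h | h : {ffun 'I_n -> 'I_(2 * m).+1}].
have us p : List.In p sq -> uchar Y p.2.
  by move=> /List.in_app_iff [] /List.in_map_iff [h [<- _]]; exact: dual_uchar.
have w1 y i : normc (ch i y) = 1 by exact: dual_unit.
have ub y : Y y -> Re (\sum_(p <- sq) p.1 * p.2 y) <= k ^+ m * (3 / 2).
  move=> Yy; have -> : \sum_(p <- sq) p.1 * p.2 y = (\prod_i fejer (ch i y) ^+ m)%:C%C * (2^-1%:C%C - f y).
    rewrite (fejer_prod m (w1 y)) big_cat !big_image /= mulrBr mulr_suml mulr_suml -sumrN; congr (_ + _); apply: eq_bigr => h _.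
      by rewrite /t0 rmorphM /= -dvE mulrAC.
    have e1 : (- co h)%:C%C = - (co h)%:C%C :> R[i] by exact: rmorphN.
    by rewrite /t1 [LHS]/= e1 -dvE mulNr; congr (- _); exact: mulrA.
  rewrite ReC ReD ReN /=.
  have pr0 : 0 <= \prod_i fejer (ch i y) ^+ m.
    by apply: prodr_ge0 => i _; apply: exprn_ge0; case/andP: (fejer_unit (w1 y i)).
  have Rf : `|Re (f y)| <= 1 by rewrite -(dual_unit f y) Re_normc.
  have [j js jy] := sP y Yy; case: j js jy => [p|] js /= /(_ Yy) jy; last first.
    apply: le_trans (_ : 0 <= _); last by rewrite mulr_ge0 ?exprn_ge0 // divr_ge0.
    by apply: mulr_ge0_le0 => //; move: jy; lra.
  apply: le_trans (_ : \prod_i fejer (ch i y) ^+ m * (3 / 2) <= _).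
    by apply: ler_wpM2l => //; move: Rf; rewrite ler_norml; lra.
  apply: ler_wpM2r; first by rewrite divr_ge0.
  have [i iE] := insome p js.
  rewrite (bigD1 i) //= -[leRHS]mulr1; apply: ler_pM.
  - by apply: exprn_ge0; case/andP: (fejer_unit (w1 y i)).
  - by apply: prodr_ge0 => i' _; apply: exprn_ge0; case/andP: (fejer_unit (w1 y i')).
  - apply: lerXn2r; rewrite ?nnegrE //; first by case/andP: (fejer_unit (w1 y i)).
    apply: le_trans (ki i); rewrite fejer_far // lerD2l lerN2 ler_pM2r ?invr_gt0 //.
    apply: lerXn2r; rewrite ?nnegrE ?normc_ge0 ?(ltW (de0 i)) //.
    by rewrite /de /ch iE.
  - apply: prodr_ile1 => i' _; have /andP[f0 f1] := fejer_unit (w1 y i').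
    by rewrite exprn_ge0 //= exprn_ile1.
have := sup_trivial_part sY us ub.
rewrite big_cat /= !big_image_cond /= ReD !Re_sum.
have nt1 h : ~ trivial_on Y (t1 h).2.
  move=> tr; apply: nN; have -> : f = (dv h + f) - dv h by rewrite addrAC subrr add0r.
  rewrite (_ : dv h + f = 0) ?sub0r; first exact: subgrpN.
  by apply: dual_eq0 => x Yx; exact: tr.
rewrite [X in _ + X]big1 ?addr0; last by move=> h /asboolP /nt1.
have co0 h : 0 <= co h.
  by apply: prodr_ge0 => i _; rewrite divr_ge0 ?ler0n // exprn_ge0.
pose h0 : {ffun 'I_n -> 'I_(2 * m).+1} := [ffun=> inord m].
have h0E i : h0 i = m :> nat by rewrite ffunE inordK // ltnS leq_pmull.
have th0 : trivial_on Y (t0 h0).2.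
  move=> y Yy; rewrite /= dual_sumE big1 // => i _; rewrite h0E subrr; exact: dual0E.
rewrite (bigD1 h0) ?asboolT //= => le.
have cole : ((2 * m).+1%:R)^-1 ^+ n <= co h0.
  have -> : (2 * m).+1%:R^-1 ^+ n = \prod_(i < n) (2 * m).+1%:R^-1 :> R by rewrite prodr_const card_ord.
  apply: ler_prod => i _; rewrite h0E mid_coef andbT.
  by rewrite invr_ge0 ler0n.
have s0 : 0 <= \sum_(i | `[< trivial_on Y (dv i) >] && (i != h0)) co i / 2.
  by apply: sumr_ge0 => h _; rewrite divr_ge0.
have m0 : (0 < m)%N.
  by case: (m) mP => // ; rewrite expr0 muln0 invr1 expr1n ltxx.
have mm : 3 * ((2 * m).+1%:R)^-1 ^+ n.+2 <= ((2 * m).+1%:R)^-1 ^+ n :> R.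
  have x3 : (2 * m).+1%:R^-1 <= 3^-1 :> R.
    by rewrite lef_pV2 ?posrE ?ltr0n // ler_nat; lia.
  have x0 : 0 <= (2 * m).+1%:R^-1 :> R by rewrite invr_ge0 ler0n.
  move: (_ %:R^-1) x3 x0 => x x3 x0.
  have -> : 3 * x ^+ n.+2 = x ^+ n * (3 * x * x) by rewrite !exprSr; ring.
  apply: ler_piMr; first exact: exprn_ge0.
  by nra.
by move: mP mm cole le s0; move: (k ^+ m) (_ ^+ n.+2) (_ ^+ n) (co h0); move=> a b c d; lra.
Qed.

(** [f] descends to the quotient of [Y] by the kernel of [D], which is [Y] again; continuity of the
    descended function is where compactness enters. *)
Lemma dual_lift (D : X -> X) f : hausdorff_space X -> {morph D : x y / x - y} -> continuous D ->
  (forall y, Y y -> Y (D y)) -> (forall y, Y y -> exists2 x, Y x & D x = y) ->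
  (forall x, Y x -> D x = 0 -> f x = 1) ->
  exists c : dual, forall y, Y y -> c (D y) = f y.
Proof.
move=> hX DB cD DY Dsurj ker.
have /choice [g gP] : forall y, exists x, Y y -> Y x /\ D x = y.
  move=> y; have [Yy|nY] := pselect (Y y); last by exists 0.
  by have [x Yx e] := Dsurj y Yy; exists x.
have wd a b : Y a -> Y b -> D a = D b -> f a = f b.
  move=> Ya Yb e; have Yab : Y (a - b) by exact: (proj2 sY).
  have := ker _ Yab; rewrite DB e subrr => /(_ erefl).
  rewrite (ucharB sY (dual_uchar f (fun x h => h))) // => h.
  by rewrite -[LHS](divfK (unimod_neq0 (dual_unit f b))) h mul1r.
have D0 : D 0 = 0 by have := DB 0 0; rewrite !subrr.
have DN a : D (- a) = - D a by rewrite -sub0r DB D0 sub0r.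
have DD a b : D (a + b) = D a + D b by rewrite -{1}[b]opprK DB DN opprK.
pose c0 y : R[i] := if `[< Y y >] then f (g y) else 1.
have c0D x : Y x -> c0 (D x) = f x.
  move=> Yx; have YD := DY x Yx; rewrite /c0 asboolT //.
  by have [Yg e] := gP _ YD; exact: wd.
have cA : dual_axiom c0.
  split=> [x|x nx|x y Yx Yy|e e0].
  - by rewrite /c0; case: ifP => _; [exact: dual_unit | exact: normc1].
  - by rewrite /c0 asboolF.
  - have Yxy := subgrpD sY Yx Yy; rewrite /c0 !asboolT //.
    have [Ygx ex] := gP _ Yx; have [Ygy ey] := gP _ Yy; have [Ygxy exy] := gP _ Yxy.
    have [_ _ f3 _] := dualP f; rewrite -f3 //; apply: wd => //; first exact: subgrpD.
    by rewrite DD ex ey.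
  (* Near the kernel of [D] the values of [f] are close to 1; elsewhere [D z] avoids some
     neighbourhood of 0. Finitely many such pieces cover [Y]. *)
  pose I := {p : set X * set X | nbhs (0 : X) p.2 /\ forall z, p.1 z -> Y z -> p.2 (D z) -> normc (f z - 1) <= e}.
  have [|s sP] := @compact_subcover X Y I (fun p => (sval p).1) cY.
    move=> y Yy; have [Dy|Dy] := pselect (D y = 0).
      have h : nbhs (0 : X) setT /\ forall z, [set z | Y z -> normc (f z - f y) <= e] z -> Y z -> setT (D z) -> normc (f z - 1) <= e.
        by split=> [|z h Yz _]; [exact: filterT | rewrite -(ker y) //; exact: h].
      by exists (exist (fun p : set X * set X => nbhs (0 : X) p.2 /\ forall z, p.1 z -> Y z -> p.2 (D z) -> normc (f z - 1) <= e)
        ([set z | Y z -> normc (f z - f y) <= e], setT) h) => /=; exact: dual_cont.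
    have [P [Q [nP nQ PQ]]] : exists P Q, [/\ nbhs (D y) P, nbhs (0 : X) Q & forall z, P z -> Q z -> False].
      apply: contrapT => no; apply: Dy; apply: hX => P Q nP nQ; apply: contrapT => e1; apply: no.
      by exists P, Q; split=> // z Pz Qz; apply: e1; exists z.
    have h : nbhs (0 : X) Q /\ forall z, (D @^-1` P) z -> Y z -> Q (D z) -> normc (f z - 1) <= e.
      by split=> // z Pz Yz Qz; case: (PQ (D z)).
    by exists (exist (fun p : set X * set X => nbhs (0 : X) p.2 /\ forall z, p.1 z -> Y z -> p.2 (D z) -> normc (f z - 1) <= e)
        (D @^-1` P, Q) h) => /=; exact: cD.
  have nQ : nbhs (0 : X) [set w | forall p, List.In p s -> (sval p).2 w].
    elim: s {sP} => [|p s IH]; first by apply: filterS filterT => w _ p [].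
    have [np _] := svalP p; apply: filterS (filterI np IH) => w [h1 h2] p' /= [<- //|]; exact: h2.
  apply: filterS nQ => x xQ Yx; rewrite /c0 asboolT //.
  have [Yg eg] := gP _ Yx; have [p ps pg] := sP _ Yg.
  by have [_ h] := svalP p; apply: h => //; rewrite eg; exact: xQ.
by exists (Dual cA) => y Yy; exact: c0D.
Qed.

Lemma restrict_axiom (chi : X -> R[i]) : cchar chi -> dual_axiom (fun x => if `[< Y x >] then chi x else 1).
Proof.
move=> [c1 c2 c3]; split=> [x|x nx|x y Yx Yy|e e0].
- by case: ifP => _ //; exact: normc1.
- by rewrite asboolF.
- by rewrite !asboolT //; exact: subgrpD.
by apply: filterS (c3 e e0) => x /= h Yx; rewrite asboolT.
Qed.

Definition restrict chi (h : cchar chi) := Dual (restrict_axiom h).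

Lemma restrictE chi (h : cchar chi) y : Y y -> restrict h y = chi y.
Proof. by move=> Yy; rewrite /= asboolT. Qed.

Lemma dual_compose (S : X -> X) : {morph S : x y / x - y} -> continuous S -> (forall x, Y (S x) <-> Y x) ->
  exists tau : {additive dual -> dual}, forall f x, tau f x = f (S x).
Proof.
move=> SB cS SY.
have S0 : S 0 = 0 by have := SB 0 0; rewrite !subrr.
have SD a b : S (a + b) = S a + S b by rewrite -{1}[b]opprK SB -[- b]sub0r SB S0 sub0r opprK.
have ax (f : dual) : dual_axiom (fun x => f (S x)).
  have [f1 f2 f3 f4] := dualP f; split=> // [x nx|x y Yx Yy|e e0].
  - by apply: f2 => /SY.
  - by rewrite SD f3 //; apply/SY.
  have h0 : nbhs (S 0) [set x | Y x -> normc (f x - 1) <= e] by rewrite S0; exact: f4.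
  have h := cS 0 _ h0.
  by apply: filterS (h : nbhs (0 : X) (S @^-1` _)) => x /= h1 /SY; exact: h1.
pose t f := Dual (ax f).
have tB : zmod_morphism t by move=> f g; exact: dual_ext.
pose ta : {additive dual -> dual} := HB.pack t (GRing.isZmodMorphism.Build _ _ t tB).
by exists ta.
Qed.

End dual_group.

Section additive_continuous.
Variables (X : topologicalZmodType).

Lemma iter_continuous (S : X -> X) n : continuous S -> continuous (iter n S).
Proof.
move=> cS; elim: n => [|n IH] x; first exact: cvg_id.
by apply: (@continuous_comp _ _ _ (iter n S) S); [exact: IH | exact: cS].
Qed.

Lemma continuous_subf (f g : X -> X) : continuous f -> continuous g -> continuous (fun x => f x - g x).
Proof.
move=> cf cg x V nV; have := @sub_continuous X (f x, g x) V nV => -[[P Q] [/= nP nQ] PQ].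
have h1 : nbhs x (f @^-1` P) := cf x P nP.
have h2 : nbhs x (g @^-1` Q) := cg x Q nQ.
have h' : nbhs x [set y | V (f y - g y)] by apply: filterS (filterI h1 h2) => y [Py Qy]; exact: (PQ (f y, g y)).
exact: h'.
Qed.

End additive_continuous.

(** * Gluing orbits *)

Section char_facts.
Variables (R : realType) (X : topologicalZmodType).
Implicit Types e : X -> R[i].

Lemma cchar_uchar e (H : X -> Prop) : cchar e -> uchar H e.
Proof. by move=> [h1 h2 _]; split=> [x _|x y _ _]; [exact: h1 | exact: h2]. Qed.

Lemma cchar_sub e x y : cchar e -> e (x - y) = e x / e y.
Proof.
move=> ce; apply: (@ucharB _ _ (fun=> True)) => //; exact: cchar_uchar.
Qed.

Lemma cchar0 e : cchar e -> e 0 = 1.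
Proof. by move=> ce; apply: (@uchar0 _ _ (fun=> True)) => //; exact: cchar_uchar. Qed.

Lemma cchar_dist e x y : cchar e -> normc (e x - e y) = normc (e (x - y) - 1).
Proof.
move=> ce; have [e1 _ _] := ce; have n0 := unimod_neq0 (e1 y).
rewrite cchar_sub //; have -> : e x / e y - 1 = (e x - e y) / e y by rewrite mulrBl divff.
by rewrite normcM normcV e1 invr1 mulr1.
Qed.

Lemma cchar_cont e x d : cchar e -> 0 < d -> nbhs x [set z | normc (e z - e x) <= d].
Proof.
move=> ce d0; have [_ _ h] := ce; apply: filterS (nbhs_sub0 x (h d d0)) => z /=.
by rewrite cchar_dist.
Qed.

Lemma cchar_comp e (f : X -> X) : {morph f : x y / x + y} -> continuous f -> cchar e -> cchar (e \o f).
Proof.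
move=> fD cf [h1 h2 h3]; split=> [x|x y|d d0] /=; first exact: h1.
  by rewrite fD h2.
have f0 : f 0 = 0 by apply: (addIr (f 0)); rewrite -fD !add0r.
have h0 : nbhs (f 0) [set x | normc (e x - 1) <= d] by rewrite f0; exact: h3.
exact: (cf 0 _ h0).
Qed.

Lemma cchar_closed e : cchar e -> closed [set x | e x = 1].
Proof.
move=> ce x cx /=; apply: contrapT => ne.
have d0 : 0 < normc (e x - 1) / 2.
  by rewrite divr_gt0 // lt_neqAle normc_ge0 andbT eq_sym normc_eq0 subr_eq0; apply/eqP.
have [y [/= ey h]] := cx _ (cchar_cont x ce d0).
by move: h; rewrite ey normcB; move: d0; lra.
Qed.

End char_facts.

Section separating_family.
Variables (R : realType) (X : topologicalZmodType) (T T' : {additive X -> X}).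
Hypotheses (TK : cancel T T') (T'K : cancel T' T) (cT : continuous T) (cT' : continuous T').

(** Characters are added one at a time, each nontrivial on what the previous ones do not see. The
    common kernels of their two-sided orbits form a strictly decreasing chain of closed invariant
    subgroups, which the chain condition stops. *)
Lemma finite_separating : compact [set: X] -> metrizable R X -> dcc T ->
  exists s (e : 'I_s -> X -> R[i]), (forall i, cchar (e i)) /\
    forall x, (forall i k, e i (iter k T x) = 1 /\ e i (iter k T' x) = 1) -> x = 0.
Proof.
move=> cX mX D; apply: contrapT => no.
pose P (l : seq (X -> R[i])) := [set x | forall e, List.In e l -> cchar e -> forall k, e (iter k T x) = 1 /\ e (iter k T' x) = 1].
have step l : exists e : X -> R[i], cchar e /\ exists2 x, P l x & e x <> 1.
  apply: contrapT => nx; apply: no.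
  pose l' := [seq e <- l | `[< cchar e >]].
  exists (size l'), (fun i => tnth (in_tuple l') i); split.
    move=> i; have := mem_tnth i (in_tuple l'); rewrite /l' mem_filter => /andP[/asboolP //].
  move=> x hx; apply: contrapT => /eqP x0; have [e ce ex] := characters_separate cX mX x0.
  apply: nx; exists e; split=> //; exists x; last exact/eqP.
  move=> g gl cg k; have : g \in l'.
    by rewrite mem_filter asboolT //=; elim: (l) gl => //= h t IH [->|/IH]; rewrite inE ?eqxx // => ->; rewrite orbT.
  by move=> /(tnthP (in_tuple l')) [i ->]; exact: hx.
have [nx nxP] := choice step.
pose ls := fix ls n := if n is n.+1 then nx (ls n) :: ls n else [::].
have dT (x : X) k : iter k T' (T x) = if k is k.+1 then iter k T' x else T x.
  by case: k => // k; rewrite iterSr TK.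
have dT' (x : X) k : iter k T (T' x) = if k is k.+1 then iter k T x else T' x.
  by case: k => // k; rewrite iterSr T'K.
have [||||K KP] := D (fun n => P (ls n)).
- move=> n; split=> [e _ ce k|x y Px Py e el ce k]; first by rewrite !raddf0 (cchar0 ce).
  have [x1 x2] := Px e el ce k; have [y1 y2] := Py e el ce k.
  by rewrite !raddfB !(cchar_sub _ _ ce) x1 x2 y1 y2 divr1.
- move=> n; have -> : P (ls n) = \bigcap_(p in [set p : (X -> R[i]) * nat | List.In p.1 (ls n) /\ cchar p.1])
      ([set x | (p.1 \o iter p.2 T) x = 1] `&` [set x | (p.1 \o iter p.2 T') x = 1]).
    apply/seteqP; split=> x h; first by move=> [e k] [/= el ce]; exact: h.
    by move=> e el ce k; have [h1 h2] := h (e, k) (conj el ce).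
  apply: closed_bigI => -[e k] [/= el ce]; apply: closedI; apply: cchar_closed; apply: cchar_comp => //.
  + by move=> x y; rewrite raddfD.
  + exact: iter_continuous.
  + by move=> x y; rewrite raddfD.
  + exact: iter_continuous.
- move=> n; apply/seteqP; split=> [_ [x Px <-]|x Px].
    move=> e el ce k; split; first by rewrite -iterSr; exact: (proj1 (Px e el ce k.+1)).
    by rewrite dT; case: k => [|k]; [exact: (proj1 (Px e el ce 1%N)) | exact: (proj2 (Px e el ce k))].
  exists (T' x) => //; move=> e el ce k; split; last by rewrite -iterSr; exact: (proj2 (Px e el ce k.+1)).
  by rewrite dT'; case: k => [|k]; [exact: (proj2 (Px e el ce 1%N)) | exact: (proj1 (Px e el ce k))].
- by move=> n x Px e el; apply: Px; right.
have [ce [x Px ex]] := nxP (ls K).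
have : P (ls K.+1) x by rewrite KP.
by move=> /(_ (nx (ls K)) (or_introl erefl) ce 0%N) [/ex].
Qed.

End separating_family.

Section glue.
Variables (R : realType) (X : topologicalZmodType) (S S' : {additive X -> X}).
Hypotheses (SK : cancel S S') (S'K : cancel S' S) (cS : continuous S) (cS' : continuous S').
Hypothesis hX : hausdorff_space X.
Variable Y : set X.
Hypotheses (sY : subgrp Y) (cY : compact Y) (SY : forall x, Y (S x) <-> Y x).
Hypothesis SYm : forall m y, (0 < m)%N -> Y y -> exists2 x, Y x & iter m S x - x = y.
Variables (s : nat) (E : 'I_s -> dual R Y).
Hypothesis sepE : forall y, Y y -> (forall i k, E i (iter k S y) = 1 /\ E i (iter k S' y) = 1) -> y = 0.

(** [shadow_fraction] for the group of points of [Y] with period [N]. A relation valid on it is a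
    character [(tau ^ N - 1) c], and [block_rigidity] splits it into relations within single blocks;
    those are satisfied by any prescribed orbit pieces. *)
Lemma glue (eta : R) q K0 : 0 < eta -> (0 < q)%N -> exists b0, forall b b', (b0 <= b')%N -> (b < b')%N ->
  (b' <= K0 * (b' - b))%N -> forall P, (0 < P)%N -> exists N0 h, forall N1, (N0 <= N1)%N -> exists N,
  [/\ (P %| N)%N, (N1 < N <= N1 + h)%N & forall M (ys : nat -> X), (N <= K0 * (N - M * b'))%N ->
    (forall j, Y (ys j)) -> exists p, [/\ Y p, iter N S p = p &
    (q * #|[pred z : 'I_M * 'I_b * 'I_s | (eta <= normc (E z.2 (iter (z.1.1 * b' + z.1.2) S p)
        - E z.2 (iter z.1.2 S (ys z.1.1))))%R]| <= #|{: 'I_M * 'I_b * 'I_s}|)%N]].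
Proof.
move=> eta0 q0; have [m shadow] := shadow_fraction eta0 q0.
have SB : {morph S : x y / x - y} by move=> x y; rewrite raddfB.
have S'B : {morph S' : x y / x - y} by move=> x y; rewrite raddfB.
have SY' x : Y (S' x) <-> Y x by rewrite -SY S'K.
have [tau tauE] := @dual_compose R X Y S SB cS SY.
have [tau' tau'E] := @dual_compose R X Y S' S'B cS' SY'.
have tauK : cancel tau tau' by move=> f; apply: dual_ext => x; rewrite tau'E tauE S'K.
have tau'K : cancel tau' tau by move=> f; apply: dual_ext => x; rewrite tauE tau'E SK.
have itauE n (f : dual R Y) x : iter n tau f x = f (iter n S x).
  by elim: n f x => // n IH f x; rewrite /= tauE IH -iterSr.
have itau'E n (f : dual R Y) x : iter n tau' f x = f (iter n S' x).
  by elim: n f x => // n IH f x; rewrite /= tau'E IH -iterSr.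
have iY n x : Y x -> Y (iter n S x) by elim: n => //= n IH /IH ?; apply/SY.
have erg n f : (0 < n)%N -> iter n tau f = f -> f = 0.
  move=> n0 fn; apply: dual_eq0 => y Yy; have [x Yx <-] := SYm n0 Yy.
  rewrite (ucharB sY (dual_uchar f (fun x h => h))) //; last exact: iY.
  by rewrite -itauE fn divff // unimod_neq0 // dual_unit.
(* The subgroup generated by the two-sided [tau]-orbits of the [E i]; by [dual_perp] it is the whole
   dual. *)
pose G f := exists h n, win tau E n (iter h tau f).
have sG : subgrp G.
  split; first by exists 0%N, 0%N; exact: (proj1 (win_subgrp _ _ _)).
  move=> f g [h [n fn]] [h' [n' gn]]; exists (h + h')%N, (n + n' + h + h')%N.
  rewrite raddfB; apply: (proj2 (win_subgrp _ _ _)).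
    rewrite [(h + h')%N]addnC; have w1 := win_shift h' fn; rewrite -iterD in w1.
    by apply: win_le w1; lia.
  by have w2 := win_shift h gn; rewrite -iterD in w2; apply: win_le w2; lia.
have Egen k : E k = zcomb E (delta_mx 0 k).
  rewrite /zcomb (bigD1 k) //= mxE !eqxx mulr1z big1 ?addr0 // => i ik.
  by rewrite mxE eqxx (negbTE ik) mulr0z.
have G1 k i : G (iter k tau (E i)).
  by exists 0%N, k.+1; rewrite Egen; exact: win1.
have G2 k i : G (iter k tau' (E i)).
  by exists k, 1%N; rewrite iter_tau'K // Egen; apply: (@win1 _ _ _ _ 1 0).
have gen f : G f.
  apply: (dual_perp sY cY sG) => y Yy yG.
  rewrite (sepE Yy) ?dual_at0 // => i k; split.
    by rewrite -itauE; apply: yG.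
  by rewrite -itau'E; apply: yG.
have [b0 rig] := block_rigidity tauK tau'K erg gen m K0.
exists b0 => b b' bb' bltb bK P P0; have [N0 [h Nh]] := rig b b' bb' bltb bK P P0.
exists N0, h => N1 N01; have [N [PN Nb Nrig]] := Nh N1 N01.
exists N; split=> // M ys MN ysY.
have N_gt0 : (0 < N)%N by case/andP: Nb => + _; exact: leq_ltn_trans.
have b'0 : (0 < b')%N by apply: leq_ltn_trans bltb.
have MbN : (M * b' <= N)%N.
  rewrite leqNgt; apply/negP => lt; move: MN; have -> : (N - M * b' = 0)%N by apply/eqP; rewrite subn_eq0 ltnW.
  by rewrite muln0 leqNgt N_gt0.
pose H x := Y x /\ iter N S x = x.
have sH : subgrp H.
  split; first by split; [exact: (proj1 sY) | rewrite raddf0].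
  by move=> x y [Yx ex] [Yy ey]; split; [exact: (proj2 sY) | rewrite raddfB /= ex ey].
pose J : finType := ('I_M * 'I_b * 'I_s)%type.
pose pos (z : 'I_M * 'I_b) := (z.1 * b' + z.2)%N.
pose u (z : J) x := E z.2 (iter (pos z.1) S x).
pose a (z : J) := E z.2 (iter z.1.2 S (ys z.1.1)).
have posN z : (pos z < N)%N.
  apply: leq_trans MbN; rewrite /pos; apply: leq_trans (_ : z.1.+1 * b' <= _)%N; last by rewrite leq_mul2r ltn_ord orbT.
  by rewrite mulSn addnC ltn_add2r (ltn_trans (ltn_ord z.2)).
have pos_inj z z' : pos z = pos z' -> z = z'.
  move=> e; have lt w : (w < b -> w < b')%N by move=> h'; exact: ltn_trans bltb.
  have := congr1 (fun n => n %/ b')%N e; have := congr1 (fun n => n %% b')%N e.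
  rewrite /pos !modnMDl !divnMDl // !modn_small ?lt ?ltn_ord // !divn_small ?lt ?ltn_ord // !addn0.
  by case: z z' {e} => [z1 z2] [z1' z2'] /= /val_inj -> /val_inj ->.
have uu z : uchar H (u z).
  split=> [x _|x y [Yx _] [Yy _]]; first exact: dual_unit.
  have [_ _ h3 _] := dualP (E z.2); rewrite /u raddfD h3 //; exact: iY.
have a1 z : normc (a z) = 1 by exact: dual_unit.
have rel (f : {ffun J -> 'I_(2 * m).+1}) : (forall x, H x -> \prod_z u z x ^+ f z = \prod_z u z x ^+ m) ->
    \prod_z a z ^+ f z = \prod_z a z ^+ m.
  move=> rel.
  pose w (z : 'I_M * 'I_b) : 'rV[int]_s := \row_k ((f (z, k))%:Z - m%:Z).
  pose v t : 'rV[int]_s := \sum_(z : 'I_M * 'I_b | pos z == t) w z.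
  have vpos z : v (pos z) = w z.
    rewrite /v (bigD1 z) //= big1 ?addr0 // => z' /andP[/eqP /pos_inj ->].
    by rewrite eqxx.
  have v0 t : (forall z, pos z != t) -> v t = 0.
    by move=> nz; rewrite /v big_pred0 // => z; apply/negbTE.
  have wb z k : `|w z 0 k| <= m%:Z.
    rewrite mxE; have : (f (z, k) < (2 * m).+1)%N := ltn_ord _; lia.
  have vb t k : `|v t 0 k| <= m%:Z.
    have [[z /eqP <-]|nz] := pselect (exists z, pos z == t); first by rewrite vpos.
    by rewrite v0 ?mxE ?normr0 // => z; apply/negP => h'; apply: nz; exists z.
  have vz t : ~~ ((t < M * b') && (t %% b' < b))%N -> v t = 0.
    move=> nt; apply: v0 => z; apply/negP => /eqP e; move/negP: nt; apply; rewrite -e /pos modnMDl.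
    have lt : (z.2 < b')%N := ltn_trans (ltn_ord z.2) bltb.
    rewrite modn_small // ltn_ord andbT.
    apply: leq_trans (_ : z.1.+1 * b' <= _)%N; last by rewrite leq_mul2r ltn_ord orbT.
    by rewrite mulSn addnC ltn_add2r.
  have Ev z x : Y x -> zcomb E (w z) x = \prod_k (E k x ^+ f (z, k) / E k x ^+ m).
    move=> Yx; rewrite /zcomb dual_sumE; apply: eq_bigr => k _.
    by rewrite mxE dualMzE.
  pose chi : dual R Y := \sum_(t < N) iter t tau (zcomb E (v t)).
  have chiE : chi = \sum_(z : 'I_M * 'I_b) iter (pos z) tau (zcomb E (w z)).
    have vs t : iter t tau (zcomb E (v t)) = \sum_(z : 'I_M * 'I_b | pos z == t) iter t tau (zcomb E (w z)).
      by rewrite /v (raddf_sum (zcomb E)) (raddf_sum (iter t tau)).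
    rewrite /chi; under eq_bigr do rewrite vs.
    rewrite (exchange_big_dep xpredT) //=; apply: eq_bigr => z _.
    rewrite (bigD1 (Ordinal (posN z))) //= big1 ?addr0 // => t /andP[/eqP e /eqP ne].
    by case: ne; apply: val_inj.
  have chi1 x : Y x -> chi x = \prod_z (u z x ^+ f z / u z x ^+ m).
    move=> Yx; rewrite chiE dual_sumE.
    transitivity (\prod_(z : 'I_M * 'I_b) \prod_(k < s) (u (z, k) x ^+ f (z, k) / u (z, k) x ^+ m)).
      by apply: eq_bigr => z _; rewrite itauE Ev //; exact: iY.
    by rewrite pair_bigA; apply: eq_bigr => -[z k].
  have chiH x : Y x -> iter N S x - x = 0 -> chi x = 1.
    move=> Yx /eqP; rewrite subr_eq0 => /eqP ex; rewrite chi1 // prodf_div rel //.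
    by rewrite divff //; apply/prodf_neq0 => z _; rewrite expf_neq0 // unimod_neq0 // dual_unit.
  (* The periodic points are the kernel of [S ^ N - 1], which is onto, so a character trivial on
     them is [c] composed with it. *)
  have [||||c cP] := @dual_lift R X Y sY cY (fun x => iter N S x - x) chi hX _ _ _ _ chiH.
  + move=> x y /=; rewrite raddfB /= !opprB [LHS]addrACA [RHS]addrACA; congr (_ + _); exact: addrC.
  + by apply: continuous_subf => [|x]; [exact: iter_continuous | exact: cvg_id].
  + by move=> y Yy; apply: (proj2 sY) => //; exact: iY.
  + by move=> y Yy; exact: SYm.
  have cE : chi = iter N tau c - c.
    apply: dual_ext => x; have [Yx|nY] := pselect (Y x); last by rewrite !dual_off.
    rewrite dualDE dualNE itauE -cP // (ucharB sY (dual_uchar c (fun x h => h))) //; exact: iY.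
  have blk (j : 'I_M) : \prod_(i < b) \prod_k (a (j, i, k) ^+ f (j, i, k) / a (j, i, k) ^+ m) = 1.
    have := Nrig M v c MN vb vz cE j (ltn_ord j) => /(congr1 (fun g : dual R Y => g (ys j))).
    rewrite dual_sumE dual0E => e; rewrite -[RHS]e; apply: eq_bigr => i _.
    rewrite itauE (vpos (j, i)) Ev //; exact: iY.
  have : \prod_z (a z ^+ f z / a z ^+ m) = 1.
    transitivity (\prod_(j < M) \prod_(i < b) \prod_(k < s) (a (j, i, k) ^+ f (j, i, k) / a (j, i, k) ^+ m)).
      rewrite pair_bigA pair_bigA; apply: eq_bigr => -[[j i] k] _ //.
    by rewrite big1 // => j _; exact: blk.
  by rewrite prodf_div => /divr1_eq.
have [x0 [Yx0 px0] cnt] := @shadow X H J u a sH uu a1 rel.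
by exists x0; split.
Qed.

End glue.

(** * Unipotent orbits *)

(** In [i * 'C(n, i) = n * 'C(n - 1, i - 1)] with [n = M * k!], the factor [i] divides [k!], which
    leaves [M]. *)
Lemma fact_dvd_bin k M i : (0 < i < k)%N -> (M %| 'C(M * k`!, i))%N.
Proof.
move=> /andP[i0 ik]; have : (i * 'C(M * k`!, i) = M * k`! * 'C((M * k`!).-1, i.-1))%N.
  by case: i i0 {ik} => // i _; rewrite mul_bin_diag.
have [q kq] : exists q, k`! = (i * q)%N.
  have /dvdnP[q ->] : (i %| k`!)%N by rewrite dvdn_fact // i0 ltnW.
  by exists q; rewrite mulnC.
rewrite kq mulnCA -mulnA => /eqP; rewrite eqn_pmul2l // => /eqP ->.
by rewrite -!mulnA dvdn_mulr.
Qed.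

Module Difference.

Section unipotent.
Variable A : zmodType.
Implicit Types S : {additive A -> A}.

Definition dif (S : A -> A) x := S x - x.

Lemma dif_sub S : {morph dif S : x y / x - y}.
Proof. by move=> x y; rewrite /dif raddfB !opprD !opprK [RHS]addrACA; congr (_ + _); rewrite addrC. Qed.

HB.instance Definition _ S := GRing.isZmodMorphism.Build A A (dif S) (dif_sub S).

Lemma dif_comm S x : dif S (S x) = S (dif S x).
Proof. by rewrite /dif raddfB. Qed.

Lemma iter_dif_comm S i n x : iter i (dif S) (iter n S x) = iter n S (iter i (dif S) x).
Proof.
elim: i n x => // i IH n x; rewrite !iterSr -IH; congr (iter i _ _).
by elim: n => //= n IHn; rewrite dif_comm IHn.
Qed.

Lemma iter_unip S k x m : iter k (dif S) x = 0 ->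
  iter m S x = \sum_(i < k) iter i (dif S) x *+ 'C(m, i).
Proof.
move=> nil; elim: m => [|m IH].
  case: k nil => [/= ->|k nil]; first by rewrite big_ord0.
  by rewrite big_ord_recl bin0 mulr1n big1 ?addr0 // => i _; rewrite bin0n.
have Sd y : S y = y + dif S y by rewrite /dif addrC subrK.
rewrite iterS Sd IH raddf_sum -big_split /=.
case: k nil {IH} => [|k nil]; first by rewrite !big_ord0.
rewrite big_split /= big_ord_recl [X in _ + X]big_ord_recr /= raddfMn /= -iterS nil mul0rn addr0.
rewrite [RHS]big_ord_recl !bin0 -addrA; congr (_ + _).
rewrite -big_split; apply: eq_bigr => i _ /=.
by rewrite raddfMn /= binS mulrnDr addrC.
Qed.

(** In the binomial expansion [iter_unip] at time [M * k!] all coefficients but the first are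
    multiples of [M]. *)
Lemma torsion_unip_period S k x M : (0 < M)%N -> iter k (dif S) x = 0 -> x *+ M = 0 ->
  iter (M * k`!) S x = x.
Proof.
move=> M0 nil tor; rewrite (iter_unip _ nil).
case: k nil => [<-|k nil]; first by rewrite big_ord0.
rewrite big_ord_recl bin0 mulr1n big1 ?addr0 // => i _.
have /dvdnP[q ->] : (M %| 'C(M * k.+1`!, lift ord0 i))%N by apply: fact_dvd_bin; rewrite /= ltnS ltn_ord.
by rewrite mulnC mulrnA -[_ *+ M](raddfMn (iter (lift ord0 i) (dif S))) tor raddf0 mul0rn.
Qed.

Lemma dif_iter S n y : dif (iter n S) y = \sum_(i < n) iter i S (dif S y).
Proof.
rewrite /dif; elim: n => [|n IH]; first by rewrite big_ord0 subrr.
by rewrite big_ord_recr /= -IH raddfB /= addrC -iterS -iterSr addrA subrK.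
Qed.

Lemma dif_pow S k x n : iter k (dif S) x = 0 -> iter k (dif (iter n S)) x = 0.
Proof.
pose G y := \sum_(i < n) iter i S y.
have dE y : dif (iter n S) y = G (dif S y) by exact: dif_iter.
have comm y : dif S (G y) = G (dif S y).
  by rewrite /G raddf_sum; apply: eq_bigr => i _; rewrite -(iter_dif_comm S 1).
have key j y : iter j (dif (iter n S)) y = iter j G (iter j (dif S) y).
  have c2 i z : iter i (dif S) (G z) = G (iter i (dif S) z).
    by elim: i => //= i ->; rewrite comm.
  by elim: j y => // j IH y; rewrite !iterSr IH dE c2.
move=> nil; rewrite key nil; elim: (k) => //= j ->.
by rewrite /G big1 // => i _; rewrite raddf0.
Qed.

End unipotent.

End Difference.
Import Difference.

(** * Van der Corput's inequality *)

Lemma sum_sqr_le (R : realType) N (x : 'I_N -> R) : (\sum_m x m) ^+ 2 <= N%:R * \sum_m x m ^+ 2.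
Proof.
case: N x => [|N] x; first by rewrite !big_ord0 expr0n mulr0.
set s := \sum_m x m; have N0 : (0 : R) < N.+1%:R by rewrite ltr0n.
have : 0 <= \sum_m (x m - s / N.+1%:R) ^+ 2 by apply: sumr_ge0 => m _; exact: sqr_ge0.
have -> : \sum_m (x m - s / N.+1%:R) ^+ 2 = \sum_m x m ^+ 2 - s ^+ 2 / N.+1%:R.
  under eq_bigr do rewrite sqrrB.
  rewrite big_split sumrB /= sumr_const card_ord -mulr_natl.
  under [X in _ - X + _]eq_bigr do rewrite -mulrnAr.
  rewrite -mulr_suml -/s; field; exact: lt0r_neq0.
by rewrite subr_ge0 ler_pdivrMr // mulrC.
Qed.

Lemma normc_nat (R : realType) n : normc (n%:R : R[i]) = n%:R.
Proof. by rewrite -(rmorph_nat (real_complex R)) normcR ger0_norm ?ler0n. Qed.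

Section van_der_corput.
Variable R : realType.
Implicit Types (a : nat -> R[i]) (e : R).

Lemma sum_shift a h N : (forall m, normc (a m) = 1) ->
  normc (\sum_(m < N) a (m + h)%N - \sum_(m < N) a m) <= 2 * h%:R.
Proof.
move=> a1; elim: h => [|h IH].
  rewrite mulr0; under eq_bigr do rewrite addn0.
  by rewrite le_eqVlt normc_eq0 subrr eqxx.
have e : \sum_(m < N) a (m + h.+1)%N - \sum_(m < N) a (m + h)%N = a (N + h)%N - a h.
  elim: N {IH} => [|N IHN]; first by rewrite !big_ord0 !subrr.
  by rewrite !big_ord_recr /= opprD addrACA IHN addnS addSn; ring.
have -> : \sum_(m < N) a (m + h.+1)%N - \sum_(m < N) a m = (a (N + h)%N - a h)
    + (\sum_(m < N) a (m + h)%N - \sum_(m < N) a m) by rewrite -e; ring.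
apply: le_trans (le_normcD _ _) _; have := le_normcD (a (N + h)%N) (- a h).
by rewrite normcN !a1 -natr1; move: IH; lra.
Qed.

(** Replace [a] by its average over [H] shifts, apply Cauchy-Schwarz, and expand the square into
    correlations. *)
Lemma van_der_corput e : 0 < e -> exists H e' N0, 0 < e' /\ forall a N, (forall m, normc (a m) = 1) ->
  (N0 <= N)%N -> (forall d, (0 < d < H)%N -> normc (\sum_(m < N) a (m + d)%N * (a m)^-1) <= e' * N%:R) ->
  normc (\sum_(m < N) a m) <= e * N%:R.
Proof.
(* With [t = e ^+ 2 / 16], the diagonal, the correlations and the boundary contribute at most three
   times [H ^+ 2 * (t * N)] once [H * t >= 1] and [N] is large, and [4 * N] times this is
   [(H * e * N / 2) ^+ 2], up to a factor left to spare. *)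
move=> e0; pose t := e ^+ 2 / 16; have t0 : 0 < t by rewrite divr_gt0 // exprn_gt0.
pose H := (Num.bound t^-1).+1; pose N0 := (Num.bound (2 * H%:R / t) + Num.bound (4 * H%:R / e)).+1.
have H0 : (0 : R) < H%:R by rewrite ltr0n.
have Ht : 1 <= H%:R * t.
  rewrite mulrC -ler_pdivrMl // mulr1; apply: ltW; apply: lt_le_trans (archi_boundP _) _; first by rewrite invr_ge0 ltW.
  by rewrite ler_nat.
exists H, t, N0; split=> // a N a1 NN corr.
have Nn : (0 : R) < N%:R by rewrite ltr0n; apply: leq_trans NN.
have N1 : 2 * H%:R <= t * N%:R.
  rewrite [leRHS]mulrC -ler_pdivrMr //; apply: ltW; apply: lt_le_trans (archi_boundP _) _; first by apply: divr_ge0; [rewrite mulr_ge0 ?ler0n | exact: ltW].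
  by rewrite ler_nat (leq_trans _ NN) // /N0 leqW // leq_addr.
have N2 : 4 * H%:R <= e * N%:R.
  rewrite [leRHS]mulrC -ler_pdivrMr //; apply: ltW; apply: lt_le_trans (archi_boundP _) _; first by apply: divr_ge0; [rewrite mulr_ge0 ?ler0n | exact: ltW].
  by rewrite ler_nat (leq_trans _ NN) // /N0 leqW // leq_addl.
set s := \sum_(m < N) a m.
pose Z (m : nat) := \sum_(h < H) a (m + h)%N.
have sZ : normc (H%:R * s - \sum_(m < N) Z m) <= 2 * H%:R ^+ 2.
  have -> : H%:R * s - \sum_(m < N) Z m = - \sum_(h < H) (\sum_(m < N) a (m + h)%N - s).
    by rewrite /Z exchange_big sumrB sumr_const card_ord opprB mulr_natl.
  rewrite normcN; apply: le_trans (normc_sum _ _ _) _.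
  apply: le_trans (_ : \sum_(h < H) 2 * H%:R <= _); last by rewrite sumr_const card_ord -[leLHS]mulr_natr expr2 mulrA.
  apply: ler_sum => h _; apply: le_trans (sum_shift _ _ a1) _.
  by rewrite ler_pM2l // ler_nat ltnW.
have c1 d m : normc (a (m + d)%N * (a m)^-1) = 1 by rewrite normcM normcV !a1 invr1 mulr1.
have off h h' : (h < h' < H)%N -> normc (\sum_(m < N) a (m + h')%N * (a (m + h)%N)^-1) <= t * N%:R + 2 * H%:R.
  move=> /andP[hh' h'H]; have -> : h' = (h + (h' - h))%N by rewrite subnKC // ltnW.
  pose b m := a (m + (h' - h))%N * (a m)^-1.
  under eq_bigr do rewrite addnA -/(b (_ + h)%N).
  have -> : \sum_(m < N) b (m + h)%N = \sum_(m < N) b m + (\sum_(m < N) b (m + h)%N - \sum_(m < N) b m) by ring.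
  apply: le_trans (le_normcD _ _) _; apply: lerD.
    by apply: corr; rewrite subn_gt0 hh' /=; apply: leq_ltn_trans (leq_subr _ _) h'H.
  apply: le_trans (sum_shift h N (c1 (h' - h)%N)) _.
  by rewrite ler_pM2l // ler_nat ltnW // (ltn_trans hh').
have Zsq : \sum_(m < N) normc (Z m) ^+ 2 <= H%:R * N%:R + H%:R ^+ 2 * (t * N%:R + 2 * H%:R).
  have Zm m : normc (Z m) ^+ 2 = Re (\sum_(h < H) \sum_(h' < H) a (m + h')%N * (a (m + h)%N)^-1).
    have -> : \sum_(h < H) \sum_(h' < H) a (m + h')%N * (a (m + h)%N)^-1 = Z m * conjc (Z m).
      rewrite /Z rmorph_sum mulr_suml exchange_big; apply: eq_bigr => h _.
      by rewrite mulr_sumr; apply: eq_bigr => h' _; rewrite unimodJ.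
    have -> : Z m * conjc (Z m) = (normc (Z m) ^+ 2)%:C%C by rewrite -sqr_normc rmorphXn.
    by [].
  under eq_bigr do rewrite Zm.
  rewrite -Re_sum exchange_big /=.
  under eq_bigr do rewrite exchange_big /=.
  apply: le_trans (ler_norm _) _; apply: le_trans (Re_normc _) _.
  apply: le_trans (normc_sum _ _ _) _.
  apply: le_trans (_ : \sum_(h < H) (N%:R + H%:R * (t * N%:R + 2 * H%:R)) <= _); last first.
    by rewrite sumr_const card_ord -[leLHS]mulr_natl mulrDr expr2 mulrA.
  apply: ler_sum => h _; apply: le_trans (normc_sum _ _ _) _.
  rewrite (bigD1 h) //=; apply: lerD.
    under eq_bigr do rewrite mulfV ?unimod_neq0 //.
    by rewrite sumr_const card_ord normc_nat.
  apply: le_trans (_ : \sum_(h' < H | h' != h) (t * N%:R + 2 * H%:R) <= _).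
    apply: ler_sum => h' ne; have [lt|gt|eq] := ltngtP h h'.
    - by apply: off; rewrite lt ltn_ord.
    - have -> : \sum_(m < N) a (m + h')%N * (a (m + h)%N)^-1 = conjc (\sum_(m < N) a (m + h)%N * (a (m + h')%N)^-1).
        rewrite rmorph_sum; apply: eq_bigr => m _; rewrite rmorphM /= unimodJ // unimodJ //.
        by rewrite conjcK mulrC.
      have := normcJ (\sum_(m < N) a (m + h)%N * (a (m + h')%N)^-1) => -[->].
      by apply: off; rewrite gt ltn_ord.
    - by case/eqP: ne; apply: val_inj.
  rewrite sumr_const -[leLHS]mulr_natl ler_pM2r ?ler_nat.
    by rewrite -[leqRHS]card_ord max_card.
  by rewrite addr_gt0 ?mulr_gt0.
have CS : normc (\sum_(m < N) Z m) ^+ 2 <= N%:R * (H%:R * N%:R + H%:R ^+ 2 * (t * N%:R + 2 * H%:R)).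
  apply: le_trans (_ : (\sum_(m < N) normc (Z m)) ^+ 2 <= _).
    by apply: lerXn2r; rewrite ?nnegrE ?normc_ge0 ?normc_sum //; apply: sumr_ge0 => m _; exact: normc_ge0.
  by apply: le_trans (sum_sqr_le _) _; rewrite ler_pM2l.
rewrite leNgt; apply/negP => big.
have Hs : H%:R * normc s <= normc (\sum_(m < N) Z m) + 2 * H%:R ^+ 2.
  have := le_normcD (H%:R * s - \sum_(m < N) Z m) (\sum_(m < N) Z m).
  by rewrite subrK normcM normc_nat; move: sZ; lra.
have low : H%:R * (e * N%:R / 2) < normc (\sum_(m < N) Z m).
  have : H%:R * (e * N%:R) < H%:R * normc s by rewrite ltr_pM2l.
  have : H%:R * (4 * H%:R) <= H%:R * (e * N%:R) by rewrite ler_pM2l.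
  by move: Hs; rewrite expr2; lra.
have : (H%:R * (e * N%:R / 2)) ^+ 2 < N%:R * (H%:R * N%:R + H%:R ^+ 2 * (t * N%:R + 2 * H%:R)).
  apply: lt_le_trans CS; rewrite ltr_pXn2r ?nnegrE ?normc_ge0 ?mulr_ge0 ?ler0n ?divr_ge0 ?mulr_ge0 ?(ltW e0) ?ler0n //.
apply/negP; rewrite -leNgt.
have -> : (H%:R * (e * N%:R / 2)) ^+ 2 = N%:R * (4 * (H%:R ^+ 2 * (t * N%:R))) by rewrite /t; field.
rewrite ler_pM2l //.
have h1 : H%:R * N%:R <= H%:R ^+ 2 * (t * N%:R).
  by rewrite expr2 -mulrA ler_pM2l // mulrA -{1}[N%:R]mul1r ler_pM2r.
have h2 : H%:R ^+ 2 * (2 * H%:R) <= H%:R ^+ 2 * (t * N%:R) by rewrite ler_pM2l // exprn_gt0.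
have h3 : 0 <= H%:R ^+ 2 * (t * N%:R) by apply: le_trans h1; rewrite mulr_ge0 ?ler0n.
by move: h1 h2 h3; rewrite mulrDr; lra.
Qed.

End van_der_corput.

(** * Weyl sums of polynomial sequences, uniformly near a point *)

Section weyl.
Variables (R : realType) (T : Type) (F : set_system T) (t0 : T).
Hypothesis FF : Filter F.
Implicit Types (l : seq (T -> R[i])).

Definition cvf (f : T -> R[i]) := (forall t, normc (f t) = 1) /\
  forall e : R, 0 < e -> F [set t | normc (f t - f t0) <= e].

(** The polynomial phase [\prod_j f_j ^ 'C(m, j)] in Newton's form: the head is the value at
    [m = 0], the tail codes the successive quotients. *)
Fixpoint pq l (m : nat) (t : T) : R[i] :=
  if l is f :: l' then f t * \prod_(i < m) pq l' i t else 1.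

(** Newton coefficients of the sequence advanced by one step, by Pascal's rule. *)
Fixpoint shq l := if l is f :: l' then (if l' is g :: _ then fun t => f t * g t else f) :: shq l' else [::].

Fixpoint mulq l l' := match l, l' with f :: s, g :: s' => (fun t => f t * g t) :: mulq s s' | _, _ => [::] end.

(** Codes the product of [d] consecutive terms, which is the quotient of two terms at distance [d]
    of a sequence with tail [l]; its degree is one less than that of the sequence. *)
Fixpoint difq d l := if d is d.+1 then mulq l (difq d (shq l)) else map (fun _ _ => 1) l.

Lemma pq_shq l m t : pq (shq l) m t = pq l m.+1 t.
Proof.
elim: l m => // f l IH m /=; rewrite big_ord_recl.
have e : \prod_(i < m) pq (shq l) i t = \prod_(i < m) pq l (bump 0 i) t.
  by apply: eq_bigr => i _; rewrite IH.
rewrite e; case: l {IH e} => [|g l]; first by rewrite /= mul1r.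
by rewrite /= big_ord0 mulr1 mulrA.
Qed.

Lemma pq_mulq l l' m t : size l = size l' -> pq (mulq l l') m t = pq l m t * pq l' m t.
Proof.
elim: l l' m => [|f l IH] [|g l'] m //=; first by rewrite mulr1.
move=> [e]; under eq_bigr do rewrite IH //.
by rewrite big_split mulrACA.
Qed.

Lemma size_shq l : size (shq l) = size l.
Proof. by elim: l => //= f l ->. Qed.

Lemma size_mulq l l' : size l = size l' -> size (mulq l l') = size l.
Proof. by elim: l l' => [|f l IH] [|g l'] //= [/IH ->]. Qed.

Lemma size_difq d l : size (difq d l) = size l.
Proof.
elim: d l => [|d IH] l /=; first by rewrite size_map.
by rewrite size_mulq // IH size_shq.
Qed.

Lemma pq_difq d l m t : pq (difq d l) m t = \prod_(i < d) pq l (m + i) t.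
Proof.
elim: d l m => [|d IH] l m /=.
  by rewrite big_ord0; elim: l m => //= f l IH m; rewrite big1 ?mulr1.
rewrite pq_mulq ?size_difq ?size_shq // IH big_ord_recl addn0; congr (_ * _).
by apply: eq_bigr => i _; rewrite pq_shq addnS.
Qed.

Lemma last_shq c l t : l != [::] -> last c (shq l) t = last c l t.
Proof. by elim: l c => // f [|g l] IH c _ //=; apply: (IH f). Qed.

Lemma last_mulq c l l' t : l != [::] -> size l = size l' -> last c (mulq l l') t = last c l t * last c l' t.
Proof.
elim: l l' c => // f l IH [|g l'] // c _ [e] /=.
case: l l' e IH => [|f' l] [|g' l'] // e IH /=.
by have := IH (g' :: l') f isT e.
Qed.

Lemma last_difq c d l t : l != [::] -> last c (difq d l) t = last c l t ^+ d.
Proof.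
elim: d l => [|d IH] l l0; first by case: l l0 => //= f l _; elim: l f => //= g l IHl _; exact: IHl.
rewrite [difq _ _]/= last_mulq ?size_difq ?size_shq // IH ?last_shq // ?exprS //.
by case: l l0.
Qed.

Definition allcv l := foldr (fun f P => cvf f /\ P) True l.

Lemma cvf1 : cvf (fun=> 1).
Proof.
split=> [t|e e0]; first exact: normc1.
apply: filterS filterT => t _; change (normc (1 - 1 : R[i]) <= e).
by have /eqP -> : normc (1 - 1 : R[i]) == 0; [rewrite normc_eq0 subrr | exact: ltW].
Qed.

Lemma cvfM f g : cvf f -> cvf g -> cvf (fun t => f t * g t).
Proof.
move=> [f1 fc] [g1 gc]; split=> [t|e e0]; first by rewrite normcM f1 g1 mulr1.
have e2 : 0 < e / 2 by rewrite divr_gt0.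
apply: filterS (filterI (fc _ e2) (gc _ e2)) => t [/= h1 h2].
have -> : f t * g t - f t0 * g t0 = (f t - f t0) * g t + f t0 * (g t - g t0) by ring.
by apply: le_trans (le_normcD _ _) _; rewrite !normcM f1 g1; move: h1 h2; lra.
Qed.

Lemma allcv_shq l : allcv l -> allcv (shq l).
Proof.
elim: l => //= f l IH [cf cl]; split; last exact: IH.
by case: l cl {IH} => //= g l [cg _]; exact: cvfM.
Qed.

Lemma allcv_mulq l l' : allcv l -> allcv l' -> allcv (mulq l l').
Proof. by elim: l l' => [|f l IH] [|g l'] //= [cf cl] [cg cl']; split; [exact: cvfM | exact: IH]. Qed.

Lemma allcv_difq d l : allcv l -> allcv (difq d l).
Proof.
elim: d l => [|d IH] l cl /=; first by elim: l cl => //= f l IHl [_ /IHl]; split=> //; exact: cvf1.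
by apply: allcv_mulq => //; apply: IH; exact: allcv_shq.
Qed.

Lemma pq_unit l m t : allcv l -> normc (pq l m t) = 1.
Proof.
elim: l m => [|f l IH] m /=; first by move=> _; exact: normc1.
by move=> [[f1 _] cl]; rewrite normcM f1 mul1r normc_prod big1 // => i _; exact: IH.
Qed.

(** Induction on the degree: geometric sums in degree one, and van der Corput reduces the rest to
    correlations, whose top coefficient is a [d]-th power and so again not a root of unity. Only
    finitely many [d] occur, which keeps [N0] uniform near [t0]. *)
Lemma weyl c l : l != [::] -> allcv (c :: l) -> (forall n, (0 < n)%N -> last c l t0 ^+ n != 1) ->
  forall e : R, 0 < e -> exists N0, F [set t | forall N, (N0 <= N)%N -> normc (\sum_(m < N) pq (c :: l) m t) <= e * N%:R].
Proof.
have [n] := ubnP (size l); elim: n c l => // n IH c l sn l0 [cc cl] top e e0.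
case: l sn l0 cl top => // f [|g l] sn _ cl top.
  have [[f1 fc] _] := cl; have ft := top 1%N isT; rewrite expr1 /= in ft.
  have d0 : 0 < normc (f t0 - 1) by rewrite lt_neqAle normc_ge0 andbT eq_sym normc_eq0 subr_eq0.
  have d2 : 0 < normc (f t0 - 1) / 2 by rewrite divr_gt0.
  exists (Num.bound (4 / normc (f t0 - 1) / e)); apply: filterS (fc _ d2) => t /= ht N NN.
  have dt : normc (f t0 - 1) / 2 <= normc (f t - 1).
    have := normc_dist (f t - 1) (f t0 - 1); rewrite opprB addrA subrK ler_norml.
    by move: ht; lra.
  have -> : \sum_(m < N) c t * \prod_(i < m) (f t * \prod_(i0 < i) 1) = c t * \sum_(m < N) f t ^+ m.
    rewrite mulr_sumr; apply: eq_bigr => m _; congr (_ * _).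
    under eq_bigr do rewrite big1 // mulr1.
    by rewrite prodr_const card_ord.
  rewrite normcM (proj1 cc) mul1r; apply: le_trans (geo_bound _ _ _) _ => //.
    by apply: contraTneq dt => ->; rewrite -ltNge subrr (eqP (_ : normc (0 : R[i]) == 0)) // normc_eq0.
  apply: le_trans (_ : 4 / normc (f t0 - 1) <= _).
    rewrite ler_pdivrMr; last exact: lt_le_trans dt.
    rewrite mulrAC ler_pdivlMr //; move: dt; lra.
  rewrite [leRHS]mulrC -ler_pdivrMr //; apply: ltW; apply: lt_le_trans (archi_boundP _) _; last by rewrite ler_nat.
  by rewrite !divr_ge0 ?normc_ge0 ?ltW.
have [H [e' [N1 [e'0 vdc]]]] := van_der_corput e0.
have cor d : (0 < d)%N -> exists N0, F [set t | forall N, (N0 <= N)%N ->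
    normc (\sum_(m < N) pq (difq d [:: f, g & l]) m t) <= e' * N%:R].
  move=> d0; have ad : allcv (difq d [:: f, g & l]) := @allcv_difq d [:: f, g & l] cl; have sd := size_difq d [:: f, g & l].
  have ld := @last_difq c d [:: f, g & l] t0 isT.
  case: (difq d _) ad sd ld => [|c' [|g' l']] // ad [sd] ld.
  apply: (IH c' (g' :: l')) => //; first by rewrite /= sd.
  move=> k k0; rewrite -[last c' _]/(last c [:: c', g' & l']) ld -exprM.
  by apply: top; rewrite muln_gt0 d0.
have all_cor h : exists N0, F [set t | forall d N, (0 < d < h)%N -> (N0 <= N)%N ->
    normc (\sum_(m < N) pq (difq d [:: f, g & l]) m t) <= e' * N%:R].
  elim: h => [|h [N0 FN0]]; first by exists 0%N; apply: filterS filterT => t _ d N; rewrite ltn0 andbF.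
  have [->|/cor [N0' FN']] := posnP h.
    by exists 0%N; apply: filterS filterT => t _ d N /andP[]; case: d.
  exists (maxn N0 N0'); apply: filterS (filterI FN0 FN') => t [/= h1 h2] d N /andP[d0].
  rewrite ltnS geq_max leq_eqVlt => /orP[/eqP -> /andP[_]|dh /andP[+ _]]; first exact: h2.
  by apply: h1; rewrite d0.
have [N2 FN2] := all_cor H; exists (maxn N1 N2); apply: filterS FN2 => t ht N.
rewrite geq_max => /andP[NN1 NN2]; apply: (vdc (fun m => pq (c :: [:: f, g & l]) m t)) => // [m|d dH]; first by apply: pq_unit; split.
apply: le_trans (ht d N dH NN2); rewrite le_eqVlt; apply/orP; left; apply/eqP; congr normc.
apply: eq_bigr => m _; rewrite pq_difq.
have ne m' : pq (c :: [:: f, g & l]) m' t != 0 by apply: unimod_neq0; apply: pq_unit; split.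
have -> : pq (c :: [:: f, g & l]) (m + d)%N t = pq (c :: [:: f, g & l]) m t * \prod_(i < d) pq [:: f, g & l] (m + i)%N t.
  elim: (d) => [|n' IHn]; first by rewrite addn0 big_ord0 mulr1.
  rewrite [X in _ = _ * X]big_ord_recr mulrA -IHn addnS.
  rewrite -[LHS]/(c t * \prod_(i < (m + n').+1) pq [:: f, g & l] i t) big_ord_recr.
  exact: mulrA.
by rewrite mulrAC divff ?mul1r.
Qed.

Lemma pq_rcons l f m t : f t = 1 -> pq (rcons l f) m t = pq l m t.
Proof.
move=> ft; elim: l m => [|g l IH] m /=; first by rewrite ft mul1r big1.
by congr (_ * _); apply: eq_bigr => i _; exact: IH.
Qed.

Lemma allcv_rcons l f : allcv (rcons l f) <-> allcv l /\ cvf f.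
Proof. by elim: l => [|g l IH] /=; [tauto | rewrite IH; tauto]. Qed.

(** Top coefficients that are identically 1 near [t0] are dropped one by one; the first that is not
    a root of unity makes the mean 0 by [weyl]. *)
Lemma weyl_mean c l : allcv (c :: l) ->
  (forall f, List.In f l -> F [set t | f t = 1] \/ forall n, (0 < n)%N -> f t0 ^+ n != 1) ->
  forall e : R, 0 < e -> exists z N0, F [set t | forall N, (N0 <= N)%N ->
    normc (\sum_(m < N) pq (c :: l) m t - N%:R * z) <= e * N%:R].
Proof.
elim/last_ind: l => [[[c1 cc] _] _ e e0|l f IH [cc /allcv_rcons[cl cf]] alt e e0].
  exists (c t0), 0%N; apply: filterS (cc _ e0) => t /= ht N _.
  under eq_bigr do rewrite big1 // mulr1.
  by rewrite sumr_const card_ord -[X in X - _]mulr_natl -mulrBr normcM normc_nat mulrC ler_wpM2r.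
have inr (g : T -> R[i]) s h : List.In g (rcons s h) <-> List.In g s \/ g = h.
  by elim: s => [|g' s IHs] /=; [split=> [[->|]|[|->]] //; [right|left] | rewrite IHs; tauto].
have [f1|fn] := alt f (proj2 (inr f l f) (or_intror erefl)).
  have [|z [N0 FN]] := IH (conj cc cl) _ e e0; first by move=> g gl; apply: alt; apply/inr; left.
  exists z, N0; apply: filterS (filterI f1 FN) => t [/= ft h] N NN.
  under eq_bigr do rewrite -/(pq (c :: rcons l f) _ t) -rcons_cons pq_rcons //.
  exact: h.
have [|||N0 FN] := @weyl c (rcons l f) _ _ _ e e0.
- by case: (l).
- by split=> //; apply/allcv_rcons.
- by move=> n n0; rewrite last_rcons; exact: fn.
by exists 0, N0; apply: filterS FN => t h N NN; rewrite mulr0 subr0; exact: h.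
Qed.

End weyl.

Lemma torsion_exponent (A : zmodType) r (ga : 'I_r -> A) : (forall x, exists v, x = zcomb ga v) ->
  exists2 Q, (0 < Q)%N & forall x : A, torsion x -> x *+ Q = 0.
Proof.
move=> gen; have [|ka [_ _ _ [B fin]]] := @coords A r ga (fun=> True); first by move=> x; split.
exists B`!; first exact: fact_gt0.
move=> x [n n0 xn]; have [|i [j [/andP[ij jB] e]]] := fin (fun i => x *+ i).
  by move=> i _; split=> //; exists n => //; rewrite mulrnAC xn mul0rn.
have d0 : x *+ (j - i) = 0 by rewrite mulrnBr ?(ltnW ij) // e subrr.
have /dvdnP[k ->] : (j - i %| B`!)%N by rewrite dvdn_fact // subn_gt0 ij (leq_trans (leq_subr _ _)).
by rewrite mulnC mulrnA d0 mul0rn.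
Qed.

(** An element divisible by every integer has zero coordinates, hence is torsion; being also a
    multiple of the torsion exponent of a torsion element, it is 0. *)
Lemma residually_finite (A : zmodType) r (ga : 'I_r -> A) : (forall x, exists v, x = zcomb ga v) ->
  forall x : A, (forall M, (0 < M)%N -> exists y, x = y *+ M) -> x = 0.
Proof.
move=> gen x div; have [|ka [kaB ka0 kaZ [B fin]]] := @coords A r ga (fun=> True); first by move=> y; split.
have [Q Q0 tQ] := torsion_exponent gen.
have k0 : ka 0 = 0 by apply/ka0 => //; exists 1%N.
have kN y : ka (- y) = - ka y by rewrite -sub0r kaB // k0 sub0r.
have kM y n : ka (y *+ n) = ka y *+ n.
  by elim: n => [|n IH]; rewrite ?mulr0n // !mulrSr -[X in ka (_ + X)]opprK kaB // kN opprK IH.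
have tx : torsion x.
  apply/ka0 => //; have [w wE] := kaZ x I; rewrite wE.
  suff -> : w = 0 by rewrite map_mx0.
  apply/matrixP => i j; rewrite mxE; apply/eqP/negPn/negP => wij.
  have [y xy] := div (`|w i j|%N.+1) isT; have [u uE] := kaZ y I.
  have := congr1 (fun M : 'rV[rat]_r => M i j) wE; rewrite {1}xy kM uE mulmxnE !mxE => e.
  have {}e : u i j * (`|w i j|%N.+1)%:Z = w i j.
    by apply: (@intr_inj rat); rewrite -e intrM -mulr_natr.
  have ea : (`|u i j| * `|w i j|.+1 = `|w i j|)%N by rewrite -[in RHS]e abszM.
  move: wij; rewrite -absz_gt0; move: ea; case: `|u i j|%N => [|n]; nia.
have [y xy] := div Q Q0; rewrite xy; apply: tQ.
have [n n0 xn] := tx; exists (Q * n)%N; first by rewrite muln_gt0 Q0.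
by rewrite mulrnA -xy.
Qed.

Lemma sum_blocks (V : nmodType) n q r (F : nat -> V) : \sum_(m < n * q + r) F m =
  \sum_(j < n) \sum_(c < q) F (j * q + c)%N + \sum_(i < r) F (n * q + i)%N.
Proof.
rewrite big_split_ord /=; congr (_ + _); elim: n => [|n IH]; first by rewrite !big_ord0.
rewrite big_ord_recr /= -IH; transitivity (\sum_(i < n * q + q) F i); first by rewrite addnC -mulSn.
by rewrite big_split_ord.
Qed.

(** * The closed subgroup generated by a unipotent point *)

Section unipotent_shadow.
Variables (R : realType) (X : topologicalZmodType) (U : {additive X -> X}).
Hypotheses (cX : compact [set: X]) (hX : hausdorff_space X) (cU : continuous U).
Variables (k : nat) (v : X).
Hypothesis nil : iter k (dif U) v = 0.
Variables (q : nat) (g : 'I_q -> X -> R[i]).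
Hypotheses (cg : forall i, cchar (g i))
  (sepg : forall w, iter k (dif U) w = 0 -> (forall i, g i w = 1) -> w = 0).

Definition cyc : set X := closure (range (fun n : int => v *~ n)).

Lemma cyc_subgrp : subgrp cyc.
Proof.
split; first by apply: subset_closure; exists 0 => //; rewrite mulr0z.
move=> x y Hx Hy; move=> V nV.
have := @sub_continuous X (x, y) V nV => -[[P Q] [/= nP nQ] PQ].
have [_ [[m _ <-] Pm]] := Hx _ nP; have [_ [[n _ <-] Qn]] := Hy _ nQ.
exists (v *~ (m - n)); split; first by exists (m - n).
by rewrite mulrzBr; exact: (PQ (_, _)).
Qed.

Lemma cyc_mem : cyc v.
Proof. by apply: subset_closure; exists 1 => //; rewrite mulr1z. Qed.

Lemma cyc_compact : compact cyc.
Proof. by apply: (subclosed_compact _ cX) => //; exact: closed_closure. Qed.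

Lemma cyc_mulz n : cyc (v *~ n).
Proof. by apply: subset_closure; exists n. Qed.

Lemma closed_kernel (f : {additive X -> X}) : continuous f -> closed [set x | f x = 0].
Proof.
move=> cf; have -> : [set x | f x = 0] = f @^-1` [set 0] by [].
apply: closed_comp => [x _|]; first exact: cf.
by apply: accessible_closed_set1; exact: hausdorff_accessible.
Qed.

Lemma dif_continuous (W : {additive X -> X}) : continuous W -> continuous (dif W).
Proof. by move=> cW; apply: continuous_subf => // x; exact: cvg_id. Qed.

Lemma cyc_nil w : cyc w -> iter k (dif U) w = 0.
Proof.
have cl : closed [set w | iter k (dif U) w = 0].
  by apply: closed_kernel; apply: iter_continuous; exact: dif_continuous.
move=> Hw; apply: cl; apply: closureS Hw => _ [n _ <-] /=.
by rewrite (raddfMz (iter k (dif U))) /= nil mul0rz.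
Qed.

Lemma cyc_dual_eq0 (f : dual R cyc) : f v = 1 -> f = 0.
Proof.
move=> fv; apply: dual_eq0 => x Hx; apply: contrapT => ne.
have fu := dual_uchar f (fun x (h : cyc x) => h).
have d0 : 0 < normc (f x - 1) / 2.
  by rewrite divr_gt0 // lt_neqAle normc_ge0 andbT eq_sym normc_eq0 subr_eq0; apply/eqP.
have [_ [[n _ <-] h]] := Hx _ (dual_cont cyc_subgrp f Hx d0).
have fn : f (v *~ n) = 1.
  have fvn m : f (v *+ m) = 1 by rewrite (ucharMn m cyc_subgrp fu cyc_mem) fv expr1n.
  case: n {h} => n; rewrite ?NegzE ?mulrNz -pmulrn; first exact: fvn.
  have -> : f (- (v *+ n.+1)) = (f (v *+ n.+1))^-1 by apply: (ucharN cyc_subgrp fu); rewrite pmulrn; exact: cyc_mulz.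
  by rewrite fvn invr1.
by have := h (@cyc_mulz n); rewrite fn normcB; move: d0; lra.
Qed.

Definition cyc_gen i : dual R cyc := restrict cyc_subgrp (cg i).

Lemma cyc_dual_gen (f : dual R cyc) : exists z, f = zcomb cyc_gen z.
Proof.
apply: (dual_perp cyc_subgrp cyc_compact (N := fun f => exists z, f = zcomb cyc_gen z)).
  split; first by exists 0; rewrite raddf0.
  by move=> _ _ [z ->] [z' ->]; exists (z - z'); rewrite raddfB.
move=> y Hy h; rewrite (sepg (cyc_nil Hy)) ?(dual_at0 cyc_subgrp) // => i.
rewrite -(restrictE cyc_subgrp (cg i) Hy) -/(cyc_gen i); apply: h; exists (delta_mx 0 i).
rewrite /zcomb (bigD1 i) //= mxE !eqxx mulr1z big1 ?addr0 // => j ij.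
by rewrite mxE eqxx (negbTE ij) mulr0z.
Qed.

(** Neighbourhoods of [v] in [cyc], measured by the finitely many [g i]; since these generate the
    dual of [cyc], all characters are continuous along this filter. *)
Definition cyc_near : set_system X := [set A | exists2 d : R, 0 < d & forall w, cyc w ->
  (forall i, normc (g i w - g i v) <= d) -> A w].

Lemma cyc_near_filter : Filter cyc_near.
Proof.
split; first by exists 1.
  move=> A B [d d0 hA] [d' d'0 hB]; exists (Num.min d d'); first by rewrite lt_min d0.
  by move=> w Hw h; split; [apply: hA => // i|apply: hB => // i]; apply: le_trans (h i) _; rewrite ge_min lexx ?orbT.
by move=> A B AB [d d0 h]; exists d => // w Hw hw; exact/AB/h.
Qed.

Lemma cvf_dual (f : dual R cyc) : cvf cyc_near v f.
Proof.
have FF := cyc_near_filter.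
have cN (f' : dual R cyc) : cvf cyc_near v f' -> cvf cyc_near v (- f').
  move=> [f1 fc]; split=> [t|e e0]; first by rewrite dualNE normcV f1 invr1.
  apply: filterS (fc e e0) => t; change (normc (f' t - f' v) <= e -> normc ((f' t)^-1 - (f' v)^-1) <= e); rewrite !unimodJ // -rmorphB.
  by have := normcJ (f' t - f' v) => -[->].
have c0 : cvf cyc_near v (0 : dual R cyc) by exact: cvf1.
have cM (f' : dual R cyc) n : cvf cyc_near v f' -> cvf cyc_near v (f' *+ n).
  by move=> cf; elim: n => [|n IH]; rewrite ?mulr0n // mulrS; exact: cvfM.
have [z ->] := cyc_dual_gen f; rewrite /zcomb; elim/big_ind: _ => // [f1 f2|i _]; first exact: cvfM.
have ci : cvf cyc_near v (cyc_gen i).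
  split=> [t|e e0]; first exact: dual_unit.
  exists e => // w Hw h; change (normc (restrict cyc_subgrp (cg i) w - restrict cyc_subgrp (cg i) v) <= e).
  rewrite !restrictE //; exact: cyc_mem.
case: (z 0 i) => n; first by rewrite -pmulrn; exact: cM.
by rewrite NegzE mulrNz -pmulrn; apply: cN; exact: cM.
Qed.

Lemma cvf_cchar (psi : X -> R[i]) : cchar psi -> cvf cyc_near v psi.
Proof.
move=> cp; have [p1 _ _] := cp; split=> // e e0.
have [_ /(_ e e0) [d d0 h]] := cvf_dual (restrict cyc_subgrp cp).
exists d => // w Hw hw; have := h w Hw hw.
change (normc (restrict cyc_subgrp cp w - restrict cyc_subgrp cp v) <= e -> normc (psi w - psi v) <= e).
by rewrite !restrictE //; exact: cyc_mem.
Qed.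

(** The [M]-torsion of [cyc] is annihilated exactly by the multiples of [M] in its dual. As the dual
    is residually finite, a suitable [M] makes every bounded relation valid on the [M]-torsion valid
    at [v]. *)
Lemma torsion_near (d : R) : 0 < d -> exists w M, [/\ cyc w, (0 < M)%N, w *+ M = 0 &
  forall i, normc (g i w - g i v) <= d].
Proof.
(* A proportion of at most [1 / q.+1] bad indices among [q] means none. *)
move=> d0; have [m shadow] := @shadow_fraction R d q.+1 d0 isT.
pose comb (f : {ffun 'I_q -> 'I_(2 * m).+1}) : dual R cyc := \sum_i cyc_gen i *~ ((f i)%:Z - m%:Z).
have combE f x : cyc x -> comb f x = \prod_i (g i x ^+ f i / g i x ^+ m).
  move=> Hx; rewrite /comb dual_sumE; apply: eq_bigr => i _.
  by rewrite dualMzE restrictE.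
(* Each of the finitely many nonzero combinations escapes divisibility by some integer; [M] is the
   product of these. *)
have [M M0 MP] : exists2 M, (0 < M)%N & forall f, (exists y, comb f = y *+ M) -> comb f = 0.
  have bad f : exists M, (0 < M)%N /\ ((exists y, comb f = y *+ M) -> comb f = 0).
    have [->|nz] := eqVneq (comb f) 0; first by exists 1%N.
    apply: contrapT => no; move/eqP: nz; apply; apply: (residually_finite cyc_dual_gen) => M M0.
    apply: contrapT => nx; apply: no; exists M; split=> // y; by case: nx.
  have [Mf MfP] := choice bad; exists (\prod_f Mf f)%N.
    by apply: prodn_gt0 => f; exact: (proj1 (MfP f)).
  move=> f [y yE]; apply: (proj2 (MfP f)); exists (y *+ (\prod_(f' | f' != f) Mf f')%N).
  by rewrite -mulrnA mulnC yE (bigD1 f).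
pose HM x := cyc x /\ x *+ M = 0.
have sHM : subgrp HM.
  split; first by split; [exact: (proj1 cyc_subgrp) | rewrite mul0rn].
  by move=> x y [Hx xM] [Hy yM]; split; [exact: (proj2 cyc_subgrp) | rewrite mulrnBl xM yM subrr].
have [|||w [Hw wM] cnt] := shadow X HM 'I_q g (fun i => g i v) sHM.
- by move=> i; exact: cchar_uchar.
- by move=> i; have [h _ _] := cg i.
- move=> f rel; have c0 : comb f = 0.
    apply: MP; pose N (f : dual R cyc) := exists y, f = y *+ M.
    apply: (dual_perp cyc_subgrp cyc_compact (N := N)).
      split; first by exists 0; rewrite mul0rn.
      by move=> _ _ [y ->] [y' ->]; exists (y - y'); rewrite mulrnBl.
    move=> y Hy h; have yM : HM y.
      have yM : cyc (y *+ M).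
        by elim: (M) => [|n IH]; [rewrite mulr0n; exact: (proj1 cyc_subgrp) | rewrite mulrS; exact: (subgrpD cyc_subgrp Hy IH)].
      split=> //; apply: (sepg (cyc_nil yM)) => i; rewrite -(restrictE cyc_subgrp (cg i)) //.
      rewrite (ucharMn M cyc_subgrp (dual_uchar _ (fun x h => h))) // -dualMnE; apply: h.
      by exists (cyc_gen i).
    rewrite combE // prodf_div rel // divff //; apply/prodf_neq0 => i _.
    by rewrite expf_neq0 // unimod_neq0 //; have [h' _ _] := cg i.
  have : comb f v = 1 by rewrite c0.
  by rewrite combE ?prodf_div => [/divr1_eq|]; last exact: cyc_mem.
exists w, M; split=> // i; rewrite leNgt; apply/negP => lt; move: cnt; rewrite card_ord leqNgt => /negP; apply.
rewrite mulnC; apply: (@leq_trans (1 * q.+1)); first by rewrite mul1n.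
by rewrite leq_mul2r; apply/orP; right; apply/card_gt0P; exists i; rewrite inE ltW.
Qed.

(** The Newton coefficients of [m |-> psi (W^m (U^c w))], as functions of [w]. *)
Fixpoint taylor (psi : X -> R[i]) (W : X -> X) c j n : seq (X -> R[i]) :=
  if n is n.+1 then (fun w => psi (iter j (dif W) (iter c U w))) :: taylor psi W c j.+1 n else [::].

Lemma pq_taylor (psi : X -> R[i]) (W : {additive X -> X}) c j n w m : cchar psi ->
  iter (j + n) (dif W) (iter c U w) = 0 ->
  pq (taylor psi W c j n) m w = psi (iter j (dif W) (iter m W (iter c U w))).
Proof.
move=> cp; have [_ pD _] := cp; elim: n j m => [|n IH] j m h /=.
  by rewrite iter_dif_comm; rewrite addn0 in h; rewrite h raddf0 cchar0.
have IH' m' : pq (taylor psi W c j.+1 n) m' w = psi (iter j.+1 (dif W) (iter m' W (iter c U w))).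
  by apply: IH; rewrite addSnnS.
elim: m => [|m IHm]; first by rewrite big_ord0 mulr1.
rewrite big_ord_recr mulrA IHm IH' -pD iterSr; congr psi.
by rewrite -raddfD iterS; congr (iter j _ _); rewrite /dif addrC subrK.
Qed.

Lemma mem_taylor (psi : X -> R[i]) W c j n f : List.In f (taylor psi W c j n) ->
  exists2 i, (j <= i)%N & f = fun w => psi (iter i (dif W) (iter c U w)).
Proof.
elim: n j => //= n IH j [<-|/IH [i ji ->]]; first by exists j.
by exists i => //; exact: ltnW.
Qed.

Lemma cchar_taylor (psi : X -> R[i]) (W : {additive X -> X}) c i : cchar psi -> continuous W ->
  cchar (fun w => psi (iter i (dif W) (iter c U w))).
Proof.
move=> cp cW.
apply: (@cchar_comp R X (psi \o iter i (dif W)) (iter c U)); [by move=> x y; rewrite raddfD | exact: iter_continuous |].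
by apply: cchar_comp => //; [move=> x y; rewrite raddfD | apply: iter_continuous; exact: dif_continuous].
Qed.

Lemma allcv_taylor (psi : X -> R[i]) (W : {additive X -> X}) c j n : cchar psi -> continuous W ->
  allcv cyc_near v (taylor psi W c j n).
Proof.
move=> cp cW; elim: n j => //= n IH j; split; last exact: IH.
by apply: cvf_cchar; exact: cchar_taylor.
Qed.

(* For [W = U^(Q k.+1!)], with [Q] killing the torsion of the dual of [cyc], the characters
   of [cyc] of the form [psi \o dif W] are [Q]-th powers, hence trivial as soon as their value at
   [v] is a root of unity. *)
Lemma progression_mean Q psi c : (0 < Q)%N -> (forall f : dual R cyc, torsion f -> f *+ Q = 0) -> cchar psi ->
  forall e : R, 0 < e -> exists z N0, cyc_near [set w | forall N, (N0 <= N)%N ->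
    normc (\sum_(m < N) psi (iter m (iter (Q * k.+1`!) U) (iter c U w)) - N%:R * z) <= e * N%:R].
Proof.
move=> Q0 tQ cp e e0; have FF := cyc_near_filter.
pose W : {additive X -> X} := iter (Q * k.+1`!) U.
have cW : continuous W by exact: iter_continuous.
have nilW w : cyc w -> iter k.+1 (dif W) (iter c U w) = 0.
  move=> /cyc_nil h; rewrite iterS dif_pow ?raddf0 //.
  by rewrite iter_dif_comm h raddf0.
(* On [cyc] one has [dif W = Q G], since all binomials in the expansion are divisible by [Q]; hence
   the [Q]-th powers. *)
pose G x := \sum_(i < k) iter i.+1 (dif U) x *+ ('C(Q * k.+1`!, i.+1) %/ Q).
have DG w : cyc w -> dif W w = G w *+ Q.
  move=> /cyc_nil h; have h' : iter k.+1 (dif U) w = 0 by rewrite iterS h raddf0.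
  rewrite /dif /W /= (iter_unip _ h') big_ord_recl bin0 mulr1n /= addrC addKr /G -sumrMnl.
  apply: eq_bigr => i _; rewrite -mulrnA divnK //.
  by apply: (@fact_dvd_bin k.+1 Q i.+1); rewrite ltn0Sn ltnS ltn_ord.
have GU w : G (iter c U w) = iter c U (G w).
  by rewrite /G raddf_sum; apply: eq_bigr => i _; rewrite raddfMn /= -iterS iter_dif_comm.
have GD : {morph G : x y / x + y}.
  by move=> x y; rewrite /G -big_split; apply: eq_bigr => i _; rewrite (raddfD (iter i.+1 (dif U))) mulrnDl.
have cD : continuous (dif U) by exact: dif_continuous.
have cMn (f : X -> X) n : continuous f -> continuous (fun x => f x *+ n).
  move=> cf; elim: n => [|n IH]; first by move=> x; exact: cvg_cst.
  have -> : (fun x => f x *+ n.+1) = (fun x => f x - (0 - f x *+ n)).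
    by apply/funext => x; rewrite mulrS sub0r opprK.
  apply: continuous_subf => //; apply: continuous_subf => //; by move=> x; exact: cvg_cst.
have cG : continuous G.
  suff cS n (co : nat -> nat) : continuous (fun x => \sum_(i < n) iter i.+1 (dif U) x *+ co i).
    exact: (cS k (fun i => 'C(Q * k.+1`!, i.+1) %/ Q)%N).
  elim: n => [|n IH].
    have -> : (fun x => \sum_(i < 0) iter i.+1 (dif U) x *+ co i) = (fun=> 0).
      by apply/funext => x; rewrite big_ord0.
    by move=> x; exact: cvg_cst.
  have -> : (fun x => \sum_(i < n.+1) iter i.+1 (dif U) x *+ co i) =
    (fun x => \sum_(i < n) iter i.+1 (dif U) x *+ co i - (0 - iter n.+1 (dif U) x *+ co n)).
    by apply/funext => x; rewrite big_ord_recr sub0r opprK.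
  apply: continuous_subf => //; apply: continuous_subf; first by move=> x; exact: cvg_cst.
  by apply: cMn; exact: iter_continuous.
have al : allcv cyc_near v (taylor psi W c 0 k.+1) by exact: allcv_taylor.
have [|z [N0 zP]] := @weyl_mean R X cyc_near v FF _ _ al _ e e0.
  move=> f /mem_taylor [i i1 fE]; have [i' iE] : exists i', i = i'.+1 by case: i i1 {fE} => // i' _; exists i'.
  have [|nr] := pselect (exists n, (0 < n)%N /\ f v ^+ n = 1); last first.
    by right=> n n0; apply/negP => /eqP h; apply: nr; exists n.
  move=> [n [n0 fn]]; left; exists 1 => // w Hw _ /=.
  pose phi x := psi (iter i' (dif W) (iter c U (G x))).
  have cphi : cchar phi.
    apply: (@cchar_comp R X (fun w => psi (iter i' (dif W) (iter c U w))) G) => //.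
    exact: cchar_taylor.
  have fphi x : cyc x -> f x = (restrict cyc_subgrp cphi *+ Q) x.
    move=> Hx; rewrite dualMnE restrictE // fE iE iterSr.
    have -> : dif W (iter c U x) = iter c U (dif W x).
      have := iter_dif_comm W 1 0; rewrite /dif raddfB /= => _.
      by rewrite /W /= -!iterD addnC.
    rewrite DG // raddfMn (raddfMn (iter i' (dif W))) /=.
    by rewrite (@ucharMn _ _ (fun=> True)) //; exact: cchar_uchar.
  rewrite fphi // tQ ?dual0E //; exists (Q * n)%N; first by rewrite muln_gt0 Q0.
  rewrite mulrnA; apply: cyc_dual_eq0; rewrite dualMnE -fphi //; exact: cyc_mem.
exists z, N0; have : cyc_near cyc by exists 1.
apply: filterS2 zP => w h Hw N NN; apply: le_trans (h N NN).
rewrite le_eqVlt; apply/orP; left; apply/eqP; congr (normc (_ - _)); apply: eq_bigr => m _.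
by rewrite -[c in RHS]/c -/(taylor psi W c 0 k.+1) pq_taylor //; exact: nilW.
Qed.

(** Sums over an interval are split into the residue classes modulo the step of [progression_mean];
    the mean is the average of their means. *)
Lemma unipotent_mean psi : cchar psi -> forall e : R, 0 < e -> exists z N0,
  cyc_near [set w | forall N, (N0 <= N)%N -> normc (\sum_(m < N) psi (iter m U w) - N%:R * z) <= e * N%:R].
Proof.
move=> cp e e0; have FF := cyc_near_filter.
have [Q Q0 tQ] := torsion_exponent cyc_dual_gen.
set q1 := (Q * k.+1`!)%N; have q0 : (0 < q1)%N by rewrite muln_gt0 Q0 fact_gt0.
have e2 : 0 < e / 2 by rewrite divr_gt0.
have all_c h : exists (z : nat -> R[i]) N0, cyc_near [set w | forall c N, (c < h)%N -> (N0 <= N)%N ->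
    normc (\sum_(m < N) psi (iter m (iter q1 U) (iter c U w)) - N%:R * z c) <= e / 2 * N%:R].
  elim: h => [|h [z [N0 FN0]]]; first by exists (fun=> 0), 0%N; apply: filterS filterT.
  have [z' [N0' FN']] := progression_mean h Q0 tQ cp e2.
  exists (fun c => if (c < h)%N then z c else z'), (maxn N0 N0').
  apply: filterS (filterI FN0 FN') => w [/= h1 h2] c N; rewrite ltnS geq_max => ch /andP[NN NN'].
  case: ifP => [lt|/negbT]; first exact: h1.
  rewrite -leqNgt => hc; have -> : c = h by apply/eqP; rewrite eqn_leq ch.
  exact: h2.
have [z [N0 FN0]] := all_c q1.
pose Z := \sum_(c < q1) z c / q1%:R.
have qR : (q1%:R : R[i]) != 0 by rewrite pnatr_eq0 -lt0n.
pose N1 := Num.bound (q1%:R * (1 + normc Z) / (e / 2)).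
exists Z, (q1 * N0 + q1 + N1)%N; apply: filterS FN0 => w h N NN.
set n := (N %/ q1)%N; set r := (N %% q1)%N.
have nN0 : (N0 <= n)%N.
  by rewrite /n leq_divRL // mulnC; apply: leq_trans NN; rewrite -addnA leq_addr.
have rq : (r < q1)%N by exact: ltn_pmod.
have split_sum : \sum_(m < N) psi (iter m U w) =
    \sum_(c < q1) \sum_(m < n) psi (iter m (iter q1 U) (iter c U w)) + \sum_(i < r) psi (iter (n * q1 + i) U w).
  have iti m y : iter m (iter q1 U) y = iter (m * q1) U y.
    by elim: m => //= m ->; rewrite mulSn iterD.
  transitivity (\sum_(m < n * q1 + r) psi (iter m U w)); first by rewrite -divn_eq.
  rewrite (sum_blocks n q1 r (fun m => psi (iter m U w))) exchange_big; congr (_ + _).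
  by apply: eq_bigr => m _; apply: eq_bigr => c _; rewrite iti iterD.
have tail : normc (\sum_(i < r) psi (iter (n * q1 + i) U w)) <= q1%:R.
  apply: le_trans (normc_sum _ _ _) _; have [p1 _ _] := cp.
  by under eq_bigr do rewrite p1; rewrite sumr_const card_ord ler_nat ltnW.
have main : normc (\sum_(c < q1) (\sum_(m < n) psi (iter m (iter q1 U) (iter c U w)) - n%:R * z c)) <= e / 2 * N%:R.
  apply: le_trans (normc_sum _ _ _) _.
  apply: le_trans (_ : \sum_(c < q1) e / 2 * n%:R <= _); first by apply: ler_sum => c _; exact: h.
  rewrite sumr_const card_ord -[leLHS]mulr_natr -mulrA -natrM.
  by apply: ler_wpM2l; [exact: ltW | rewrite ler_nat leq_trunc_div].
have NE : (N%:R : R[i]) = n%:R * q1%:R + r%:R by rewrite {1}(divn_eq N q1) natrD natrM.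
rewrite split_sum.
have -> : \sum_(c < q1) \sum_(m < n) psi (iter m (iter q1 U) (iter c U w)) + \sum_(i < r) psi (iter (n * q1 + i) U w) - N%:R * Z =
    \sum_(c < q1) (\sum_(m < n) psi (iter m (iter q1 U) (iter c U w)) - n%:R * z c) +
     (\sum_(i < r) psi (iter (n * q1 + i) U w) - r%:R * Z).
  rewrite sumrB -mulr_sumr NE; have -> : \sum_(c < q1) z c = q1%:R * Z.
    by rewrite /Z -mulr_suml mulrC divfK.
  by ring.
have rem : normc (\sum_(i < r) psi (iter (n * q1 + i) U w) - r%:R * Z) <= q1%:R * (1 + normc Z).
  apply: le_trans (le_normcD _ _) _; rewrite normcN normcM normc_nat mulrDr mulr1.
  by apply: lerD => //; rewrite ler_wpM2r ?normc_ge0 // ler_nat ltnW.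
have fin : q1%:R * (1 + normc Z) <= e / 2 * N%:R.
  rewrite [leRHS]mulrC -ler_pdivrMr //; apply: ltW; apply: lt_le_trans (archi_boundP _) _.
    by apply: divr_ge0; [rewrite mulr_ge0 ?ler0n // addr_ge0 ?normc_ge0 | exact: ltW].
  by rewrite ler_nat (leq_trans _ NN) // leq_addl.
by apply: le_trans (le_normcD _ _) _; move: main rem fin; lra.
Qed.

(** [unipotent_mean] has one [z] and one [N0] for a whole neighbourhood of [v] in [cyc], and a
    torsion point lies in it; so the two orbits have nearly equal averages at all large lengths,
    independently chosen. *)
Lemma periodic_twin p (psi : 'I_p -> X -> R[i]) (e : R) : (forall i, cchar (psi i)) -> 0 < e ->
  exists w P N0 (z : 'I_p -> R[i]), [/\ (0 < P)%N, iter P U w = w &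
    forall i N, (N0 <= N)%N -> normc (\sum_(m < N) psi i (iter m U v) - N%:R * z i) <= e * N%:R /\
      normc (\sum_(m < N) psi i (iter m U w) - N%:R * z i) <= e * N%:R].
Proof.
move=> cpsi e0; have FF := cyc_near_filter.
have /choice [z] := fun i => unipotent_mean (cpsi i) e0; move=> /choice [N0 zN].
have [d d0 dP] : cyc_near [set w | forall i N, (N0 i <= N)%N ->
    normc (\sum_(m < N) psi i (iter m U w) - N%:R * z i) <= e * N%:R].
  have all (s : seq 'I_p) : cyc_near [set w | forall i N, i \in s -> (N0 i <= N)%N ->
      normc (\sum_(m < N) psi i (iter m U w) - N%:R * z i) <= e * N%:R].
    elim: s => [|i s IH]; first by apply: filterS filterT.
    apply: filterS (filterI (zN i) IH) => w [/= h1 h2] j N; rewrite inE => /orP[/eqP ->|]; [exact: h1 | exact: h2].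
  by apply: filterS (all (enum 'I_p)) => w h i N; apply: h; rewrite mem_enum.
have [w [M [Hw M0 wM near]]] := torsion_near d0.
exists w, (M * k`!)%N, (\max_i N0 i), z; split.
- by rewrite muln_gt0 M0 fact_gt0.
- by apply: torsion_unip_period => //; exact: cyc_nil.
move=> i N NN; have NN' : (N0 i <= N)%N by apply: leq_trans NN; exact: leq_bigmax.
split; last exact: dP.
apply: dP => //; first exact: cyc_mem.
by move=> j; have /eqP -> : normc (g j v - g j v) == 0; [rewrite normc_eq0 subrr | exact: ltW].
Qed.

End unipotent_shadow.

(** For a unipotent point the whole orbit under [U = T^n] is generated by finitely many differences,
    so the [e i] need testing only on the first [k] differences and on [n + 1] shifts by [T]. *)
Lemma unipotent_separating (R : realType) (X : topologicalZmodType) (T T' : {additive X -> X})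
    s (e : 'I_s -> X -> R[i]) n k : cancel T T' -> cancel T' T -> continuous T -> (0 < n)%N ->
  (forall i, cchar (e i)) -> (forall x, (forall i m, e i (iter m T x) = 1 /\ e i (iter m T' x) = 1) -> x = 0) ->
  exists q (g : 'I_q -> X -> R[i]), (forall i, cchar (g i)) /\
    forall w, iter k (dif (iter n T)) w = 0 -> (forall i, g i w = 1) -> w = 0.
Proof.
move=> TK T'K cT n0 ce sep; pose U : {additive X -> X} := iter n T; pose U' : {additive X -> X} := iter n T'.
have cU : continuous U by exact: iter_continuous.
have cdU : continuous (dif U) by apply: continuous_subf => // x; exact: cvg_id.
pose J : finType := ('I_s * 'I_n.+1 * 'I_k)%type.
exists #|J|, (fun i => let z : J := enum_val i in e z.1.1 \o (iter z.1.2 T \o iter z.2 (dif U))); split=> [i|].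
  apply: cchar_comp => // [x y /=|x].
    by rewrite (raddfD (iter (enum_val i).2 (dif U))) raddfD.
  by apply: (@continuous_comp _ _ _ (iter (enum_val i).2 (dif U))); exact: iter_continuous.
move=> w nil h; pose P w := iter k (dif U) w = 0 /\ forall i r j, (r <= n)%N -> e i (iter r T (iter j (dif U) w)) = 1.
have nil_ge w' j : iter k (dif U) w' = 0 -> (k <= j)%N -> iter j (dif U) w' = 0.
  by move=> z /subnK <-; rewrite iterD z raddf0.
have Pw : P w.
  split=> // i r j rn; have [kj|jk] := leqP k j; first by rewrite nil_ge // raddf0 cchar0.
  by have := h (enum_rank ((i, Ordinal (rn : (r < n.+1)%N), Ordinal jk) : J)); rewrite enum_rankK.
have Dadd w' : U w' = w' + dif U w' by rewrite /dif addrC subrK.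
have itS j y : iter j (dif U) (dif U y) = iter j.+1 (dif U) y by rewrite iterSr.
have itD j y y' i r : e i (iter r T (iter j (dif U) (y + y'))) = e i (iter r T (iter j (dif U) y)) * e i (iter r T (iter j (dif U) y')).
  by have [_ eD _] := ce i; rewrite (raddfD (iter j (dif U))) (raddfD (iter r T)) eD.
have PU w' : P w' -> P (U w').
  move=> [z hw]; split; first by rewrite (iter_dif_comm U k 1) /= z raddf0.
  by move=> i r j rn; rewrite Dadd itD itS !hw // mulr1.
have TT' m y : iter m T (iter m T' y) = y by elim: m y => // m IH y; rewrite iterSr iterS T'K IH.
have T'T m y : iter m T' (iter m T y) = y by elim: m y => // m IH y; rewrite iterSr iterS TK IH.
have UU' w' : U (U' w') = w' by exact: TT'.
have U'U w' : U' (U w') = w' by exact: T'T.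
have PU' w' : P w' -> P (U' w').
  move=> [z hw]; have z' : iter k (dif U) (U' w') = 0.
    by rewrite -[LHS]U'U -[U (iter _ _ _)]/(iter 1 U _) -iter_dif_comm /= UU' z raddf0.
  split=> // i.
  (* Backwards in time the values are recovered from the highest difference down, where nilpotency
     starts the induction. *)
  have key d r j : (k <= j + d)%N -> (r <= n)%N -> e i (iter r T (iter j (dif U) (U' w'))) = 1.
    elim: d j => [|d IH] j kj rn; first by rewrite addn0 in kj; rewrite nil_ge // raddf0 cchar0.
    have := hw i r j rn; rewrite -{1}[w']UU' Dadd itD itS (IH j.+1) ?mulr1 //.
    by rewrite addSnnS.
  by move=> r j; apply: (key k); rewrite leq_addl.
have itP m w' : P w' -> P (iter m U w') by elim: m => //= m IH /IH; exact: PU.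
have itP' m w' : P w' -> P (iter m U' w') by elim: m => //= m IH /IH; exact: PU'.
have itM (f : X -> X) m y : iter m (iter n f) y = iter (m * n) f y.
  by elim: m => //= m ->; rewrite mulSn iterD.
apply: sep => i m; split.
  have [_ /(_ i (m %% n)%N 0%N)] := itP (m %/ n)%N w Pw; rewrite /= itM -iterD addnC -divn_eq; apply.
  by rewrite ltnW // ltn_pmod.
have [_ /(_ i (n - m %% n)%N 0%N (leq_subr _ _))] := itP' (m %/ n).+1 w Pw; rewrite /= -[U' _]/(iter (m %/ n).+1 U' w) itM.
have -> : ((m %/ n).+1 * n = (n - m %% n) + m)%N.
  have := divn_eq m n; have := ltn_pmod m n0; rewrite mulSn; lia.
by rewrite iterD TT'.
Qed.

(** * Matching of blocks *)

Definition fejer_mass (R : realType) m : R := (2 * m).+1%:R * ('C(2 * m, m)%:R / 4 ^+ m).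

Lemma fejer_mass_ge1 (R : realType) m : 1 <= fejer_mass R m.
Proof.
rewrite /fejer_mass; have n0 : (0 : R) < (2 * m).+1%:R by rewrite ltr0n.
rewrite -[leLHS](@mulfV _ (2 * m).+1%:R) ?gt_eqF // ler_pM2l //; exact: mid_coef.
Qed.

Section fejer_partition.
Variables (R : realType) (m : nat) (om : R[i]).
Hypothesis om_prim : (2 * m).+1.-primitive_root om.

Lemma om_unit a : normc (om ^+ a) = 1.
Proof. by rewrite normcX (@unimod_root _ om (2 * m).+1) ?expr1n // (prim_expr_order om_prim). Qed.

(** The kernel has degree [m], less than the number [2 * m + 1] of nodes, so summation over the
    nodes leaves only its constant term. *)
Lemma fejer_partition z : normc z = 1 -> \sum_(a < (2 * m).+1) fejer (z / om ^+ a) ^+ m = fejer_mass R m.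
Proof.
move=> z1; apply: (@complexI R); rewrite rmorph_sum /=.
have z0 := unimod_neq0 z1.
have o0 a : om ^+ a != 0 by apply: unimod_neq0; exact: om_unit.
have za a : normc (z / om ^+ a) = 1 by rewrite normcM normcV om_unit z1 invr1 mulr1.
under eq_bigr do rewrite fejerX //.
rewrite exchange_big /=.
have orth (j : 'I_(2 * m).+1) : \sum_(a < (2 * m).+1) ('C(2 * m, j)%:R / 4 ^+ m)%:C%C * (z / om ^+ a) ^+ j / (z / om ^+ a) ^+ m
    = if j == m :> nat then (fejer_mass R m)%:C%C else 0.
  have jl : (j < (2 * m).+1)%N by [].
  pose w := om ^+ m / om ^+ j.
  have -> : \sum_(a < (2 * m).+1) ('C(2 * m, j)%:R / 4 ^+ m)%:C%C * (z / om ^+ a) ^+ j / (z / om ^+ a) ^+ m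
      = ('C(2 * m, j)%:R / 4 ^+ m)%:C%C * (z ^+ j / z ^+ m) * \sum_(a < (2 * m).+1) w ^+ a.
    rewrite mulr_sumr; apply: eq_bigr => a _; rewrite /w !expr_div_n -!exprM.
    rewrite [(m * a)%N]mulnC [(j * a)%N]mulnC; field.
    by rewrite !o0 expf_neq0 //= fmorph_eq0 expf_neq0 // pnatr_eq0.
  case: eqP => [jm|jm].
    have -> : w = 1 by rewrite /w jm divff.
    under eq_bigr do rewrite expr1n.
    rewrite sumr_const card_ord jm divff ?expf_neq0 // mulr1 mulrC /fejer_mass [in RHS]rmorphM; congr (_ * _).
    by rewrite rmorph_nat.
  have w1 : w != 1.
    apply/eqP => /divr1_eq /eqP; rewrite (eq_prim_root_expr om_prim) !modn_small //; last by rewrite ltnS leq_pmull.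
    by move/eqP => e; case: jm.
  have : (w - 1) * \sum_(a < (2 * m).+1) w ^+ a = 0.
    rewrite -subrX1 /w expr_div_n -!exprM ![(_ * (2 * m).+1)%N]mulnC !exprM (prim_expr_order om_prim) !expr1n.
    by rewrite divr1 subrr.
  by move/eqP; rewrite mulf_eq0 subr_eq0 (negbTE w1) /= => /eqP ->; rewrite mulr0.
under eq_bigr do rewrite orth.
have mo : (m < (2 * m).+1)%N by rewrite ltnS leq_pmull.
rewrite (bigD1 (Ordinal mo)) //= eqxx big1 ?addr0 // => j /eqP jm.
by case: eqP => // e; case: jm; apply: val_inj.
Qed.

End fejer_partition.

(** Index [l] is repeated as often as the integer part of [n * W l] allows; fewer than [L.+1] places
    are left over, and they get the default [l0]. *)
Lemma quantize (R : realType) L (W : 'I_L -> R) n : (0 < L)%N -> (forall l, 0 <= W l) -> \sum_l W l = 1 ->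
  exists s : 'I_n -> 'I_L, forall (B : R) (h : 'I_L -> R), (forall l, `|h l| <= B) ->
    `|\sum_r h (s r) - n%:R * \sum_l W l * h l| <= 2 * B * L%:R.
Proof.
move=> L0 W0 W1; pose c l := Num.truncn (n%:R * W l).
have cP l : (c l)%:R <= n%:R * W l < (c l).+1%:R.
  by apply: Num.Theory.truncn_itv; rewrite mulr_ge0 ?ler0n.
pose q := flatten [seq nseq (c l) l | l <- enum 'I_L].
have sq h : \sum_(x <- q) h x = \sum_l h l *+ c l :> R.
  rewrite big_flatten /= big_map big_enum /=; apply: eq_bigr => l _.
  by rewrite big_nseq iter_addr_0.
have szE : (size q)%:R = \sum_l (c l)%:R :> R.
  by rewrite -sum1_size natr_sum (sq (fun=> 1)).
have szn : (size q <= n)%N.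
  rewrite -(ler_nat R) szE; apply: le_trans (_ : \sum_l n%:R * W l <= _).
    by apply: ler_sum => l _; case/andP: (cP l).
  by rewrite -mulr_sumr W1 mulr1.
pose l0 := Ordinal L0; exists (fun r => nth l0 q r) => B h hB.
have B0 : 0 <= B by apply: le_trans (hB l0); exact: normr_ge0.
have -> : \sum_(r < n) h (nth l0 q r) = \sum_l h l *+ c l + h l0 *+ (n - size q).
  rewrite -sq (big_nth l0) big_mkord -[in LHS](subnKC szn) big_split_ord /=; congr (_ + _).
  rewrite -[in RHS](card_ord (n - size q)) -sumr_const; apply: eq_bigr => i _.
  by rewrite nth_default // leq_addr.
have nE : n%:R = \sum_l n%:R * W l by rewrite -mulr_sumr W1 mulr1.
have gap : \sum_l `|h l *+ c l - n%:R * (W l * h l)| <= B * (n%:R - (size q)%:R).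
  rewrite szE [X in B * (X - _)]nE -sumrB mulr_sumr; apply: ler_sum => l _.
  have -> : h l *+ c l - n%:R * (W l * h l) = h l * ((c l)%:R - n%:R * W l) by rewrite -mulr_natr; ring.
  rewrite normrM; apply: ler_pM => //.
  by case/andP: (cP l) => h1 _; rewrite distrC ger0_norm ?subr_ge0.
have left : n%:R - (size q)%:R <= L%:R :> R.
  rewrite szE nE -sumrB; apply: le_trans (_ : \sum_(l < L) 1 <= _).
    by apply: ler_sum => l _; case/andP: (cP l) => _; rewrite -natr1; lra.
  by rewrite sumr_const card_ord.
have tail : `|h l0 *+ (n - size q)| <= B * (n%:R - (size q)%:R).
  by rewrite normrMn -[leLHS]mulr_natr -natrB // ler_wpM2r // ler0n.
have le2 : B * (n%:R - (size q)%:R) <= B * L%:R by exact: ler_wpM2l.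
rewrite mulr_sumr addrAC -sumrB; apply: le_trans (ler_normD _ _) _.
apply: le_trans (lerD (ler_norm_sum _ _ _) (lexx _)) _; move: gap tail le2; lra.
Qed.

Section matching.
Variables (R : realType) (I : finType).

(** The character of the torus with exponents [f i - m]. *)
Definition mono m (f : {ffun I -> 'I_(2 * m).+1}) (w : I -> R[i]) := \prod_i w i ^+ f i / \prod_i w i ^+ m.

Lemma mono_unit m f (w : I -> R[i]) : (forall i, normc (w i) = 1) -> normc (@mono m f w) = 1.
Proof.
move=> w1; rewrite /mono normcM normcV !normc_prod.
by rewrite !big1 ?invr1 ?mulr1 // => i _; rewrite normcX w1 expr1n.
Qed.

Lemma monoM m f (w w' : I -> R[i]) : @mono m f (fun i => w i * w' i) = mono f w * mono f w'.
Proof.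
rewrite /mono; under eq_bigr do rewrite exprMn.
under [X in _ / X]eq_bigr do rewrite exprMn.
by rewrite !big_split /= invfM mulrACA.
Qed.

(** Translated Fejer kernels [psi a] form a partition of unity into soft cells. Each point [u' j] is
    spread over the cells and, within a cell, over the [u l] in proportion to their weight there.
    Closeness of low Fourier coefficients makes the cell masses [c] and [c'] agree, and points far
    apart share almost no cell. *)
Lemma matching (eta tau : R) : 0 < eta -> 0 < tau -> exists m d, 0 < d /\
  forall L M (u : 'I_L -> I -> R[i]) (u' : 'I_M -> I -> R[i]), (0 < L)%N -> (0 < M)%N ->
  (forall l i, normc (u l i) = 1) -> (forall j i, normc (u' j i) = 1) ->
  (forall f : {ffun I -> 'I_(2 * m).+1},
    normc ((\sum_l mono f (u l)) / L%:R - (\sum_j mono f (u' j)) / M%:R) <= d) ->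
  exists W : 'I_M -> 'I_L -> R, [/\ forall j l, 0 <= W j l, forall j, \sum_l W j l = 1,
    \sum_l `|(\sum_j W j l) / M%:R - 1 / L%:R| <= tau &
    \sum_j \sum_(l | [exists i, eta <= normc (u l i - u' j i)]) W j l <= tau * M%:R].
Proof.
move=> eta0 tau0; pose rho : R := Num.max 0 (1 - (eta / 2) ^+ 2 / 4).
have r0 : 0 <= rho by rewrite le_max lexx.
have r1 : rho < 1.
  by rewrite gt_max ltr01 /= ltrBlDr ltrDl divr_gt0 // exprn_gt0 // divr_gt0.
pose K := Num.bound (4 / tau).
have [m mP] := exp_beats_poly (#|I| + K) r0 r1.
have m0 : (0 < m)%N by rewrite lt0n; apply/negP => /eqP m0; move: mP; rewrite m0 expr0 muln0 invr1 expr1n ltxx.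
pose nA : R := (2 * m).+1%:R ^+ #|I|.
have nA1 : 1 <= nA by apply: exprn_ege1; rewrite ler1n.
have nA0 : 0 < nA by exact: lt_le_trans nA1.
have small : nA * rho ^+ m <= tau / 4.
  apply: le_trans (_ : ((2 * m).+1%:R)^-1 ^+ K <= _).
    rewrite -ler_pdivlMl // /nA -exprVn -exprD; exact: ltW.
  apply: le_trans (_ : (2%:R)^-1 ^+ K <= _).
    apply: lerXn2r; rewrite ?nnegrE ?invr_ge0 ?ler0n // lef_pV2 ?posrE ?ltr0n // ler_nat; lia.
  rewrite exprVn -[tau / 4]invrK lef_pV2 ?posrE ?exprn_gt0 ?invr_gt0 ?divr_gt0 // invf_div.
  apply: ltW; apply: lt_trans (archi_boundP _) _; first by rewrite divr_ge0 // ltW.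
  by rewrite -natrX ltr_nat ltn_expl.
(* [nA] is the number of cells, and the error in the cell masses is paid once per cell. *)
exists m, (tau / (2 * nA)); split; first by rewrite divr_gt0 // mulr_gt0.
move=> L M u u' L0 M0 u1 u'1 close.
have [om omP] := @prim_root_complex R (2 * m).+1 isT.
have Z1 := @fejer_mass_ge1 R m; set Z := fejer_mass R m in Z1.
have Z0 : 0 < Z by exact: lt_le_trans Z1.
pose A : finType := {ffun I -> 'I_(2 * m).+1}.
have cardA : (#|A|%:R : R) = nA by rewrite card_ffun card_ord natrX.
pose psi (a : A) (w : I -> R[i]) : R := \prod_i (fejer (w i / om ^+ a i) ^+ m / Z).
have wa w (a : A) : (forall i, normc (w i) = 1) -> forall i, normc (w i / om ^+ a i) = 1.
  by move=> w1 i; rewrite normcM normcV w1 (om_unit omP) invr1 mulr1.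
have psi0 a w : (forall i, normc (w i) = 1) -> 0 <= psi a w.
  move=> w1; apply: prodr_ge0 => i _; apply: divr_ge0; last exact: ltW.
  by apply: exprn_ge0; case/andP: (fejer_unit (wa w a w1 i)).
have psi1 w : (forall i, normc (w i) = 1) -> \sum_a psi a w = 1.
  move=> w1; rewrite /psi -(bigA_distr_bigA (fun i (a : 'I_(2 * m).+1) => fejer (w i / om ^+ a) ^+ m / Z)).
  by rewrite big1 // => i _; rewrite -mulr_suml fejer_partition // divff // gt_eqF.
have far_small (a : A) w i : (forall i, normc (w i) = 1) -> eta / 2 <= normc (w i - om ^+ a i) -> psi a w <= rho ^+ m.
  move=> w1 far; rewrite /psi (bigD1 i) //=.
  have fac j : 0 <= fejer (w j / om ^+ a j) ^+ m / Z <= 1.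
    have /andP[f0 f1] := fejer_unit (wa w a w1 j); rewrite divr_ge0 ?exprn_ge0 ?(ltW Z0) //=.
    by rewrite ler_pdivrMr // mul1r; apply: le_trans Z1; exact: exprn_ile1.
  apply: le_trans (_ : fejer (w i / om ^+ a i) ^+ m / Z * 1 <= _).
    apply: ler_wpM2l; first by case/andP: (fac i).
    suff /andP[] : 0 <= \prod_(j | j != i) (fejer (w j / om ^+ a j) ^+ m / Z) <= 1 by [].
    elim/big_ind: _ => [|x y /andP[x0 x1] /andP[y0 y1]|j _]; [by rewrite ler01 lexx | | exact: fac].
    by rewrite mulr_ge0 // mulr_ile1.
  rewrite mulr1; have /andP[f0 f1] := fejer_unit (wa w a w1 i).
  apply: le_trans (_ : fejer (w i / om ^+ a i) ^+ m <= _).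
    by rewrite ler_pdivrMr // ler_peMr // exprn_ge0.
  apply: lerXn2r; rewrite ?nnegrE //; rewrite le_max; apply/orP; right.
  rewrite fejer_far ?wa // lerD2l lerN2 ler_pM2r ?invr_gt0 //.
  have o0 := unimod_neq0 (om_unit omP (a i)).
  have -> : w i / om ^+ a i - 1 = (w i - om ^+ a i) / om ^+ a i by rewrite mulrBl divff.
  rewrite normcM normcV (om_unit omP) invr1 mulr1.
  by apply: lerXn2r; rewrite ?nnegrE ?normc_ge0 ?divr_ge0 ?(ltW eta0).
pose c a := (\sum_l psi a (u l)) / L%:R; pose c' a := (\sum_j psi a (u' j)) / M%:R.
have LR : (0 : R) < L%:R by rewrite ltr0n.
have MR : (0 : R) < M%:R by rewrite ltr0n.
have cc a : `|c a - c' a| <= tau / (2 * nA).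
  have psiE w : (forall i, normc (w i) = 1) -> (psi a w)%:C%C = (Z ^+ #|I|)^-1%:C%C *
      \sum_(f : A) (\prod_i ('C(2 * m, f i)%:R / 4 ^+ m))%:C%C * (mono f (fun i => (om ^+ a i)^-1) * mono f w).
    move=> w1; rewrite /psi prodf_div /= mulrC rmorphM /= prodr_const; congr (_ * _).
    rewrite fejer_prod; last exact: wa.
    by apply: eq_bigr => f _; rewrite -monoM; congr (_ * _); rewrite /mono; congr (_ / _); apply: eq_bigr => i _; rewrite mulrC.
  have mass : \sum_(f : A) \prod_i ('C(2 * m, f i)%:R / 4 ^+ m) = 1 :> R.
    have := @fejer_prod R I m (fun=> 1) (fun=> normc1 R); rewrite big1; last by move=> i _; rewrite /fejer /= -mulr2n divff ?expr1n // pnatr_eq0.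
    have -> : \sum_(f : A) (\prod_i ('C(2 * m, f i)%:R / 4 ^+ m))%:C%C * (\prod_(i : I) 1 ^+ f i / \prod_(i : I) 1 ^+ m) =
        (\sum_(f : A) \prod_i ('C(2 * m, f i)%:R / 4 ^+ m) : R)%:C%C.
      rewrite rmorph_sum; apply: eq_bigr => f _.
      have p1 (g : I -> nat) : \prod_i (1 : R[i]) ^+ g i = 1 by rewrite big1 // => i _; rewrite expr1n.
      by rewrite (p1 (fun i => f i)) (p1 (fun=> m)) divr1 mulr1.
    by move/complexI.
  pose D (f : A) := (\sum_l mono f (u l)) / L%:R - (\sum_j mono f (u' j)) / M%:R.
  have cE : (c a - c' a)%:C%C = (Z ^+ #|I|)^-1%:C%C *
      \sum_(f : A) (\prod_i ('C(2 * m, f i)%:R / 4 ^+ m))%:C%C * (mono f (fun i => (om ^+ a i)^-1) * D f).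
    have avgE k (x : 'I_k -> R) : ((\sum_l x l) / k%:R)%:C%C = (\sum_l (x l)%:C%C) / k%:R.
      by rewrite rmorphM rmorph_sum fmorphV rmorph_nat.
    pose RH w := (Z ^+ #|I|)^-1%:C%C *
      \sum_(f : A) (\prod_i ('C(2 * m, f i)%:R / 4 ^+ m))%:C%C * (mono f (fun i => (om ^+ a i)^-1) * mono f w).
    have -> : (c a - c' a)%:C%C = (\sum_l RH (u l)) / L%:R - (\sum_j RH (u' j)) / M%:R.
      rewrite rmorphB /c /c' /= !avgE; congr (_ / _ - _ / _); apply: eq_bigr => l _; exact: psiE.
    rewrite /RH.
    rewrite -!mulr_sumr exchange_big [X in _ - _ * X / _]exchange_big /= -!mulrA -mulrBr; congr (_ * _).
    rewrite !mulr_suml -sumrB; apply: eq_bigr => f _; rewrite /D.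
    by rewrite -!mulr_sumr; ring.
  rewrite -[leLHS](normcR) cE normcM; apply: le_trans (_ : 1 * (tau / (2 * nA)) <= _); last by rewrite mul1r.
  apply: ler_pM; rewrite ?normc_ge0 //.
    rewrite normcR ger0_norm ?invr_ge0 ?exprn_ge0 ?(ltW Z0) // invf_le1 ?exprn_gt0 //; exact: exprn_ege1.
  apply: le_trans (normc_sum _ _ _) _.
  apply: le_trans (_ : \sum_(f : A) \prod_i ('C(2 * m, f i)%:R / 4 ^+ m) * (tau / (2 * nA)) <= _); last by rewrite -mulr_suml mass mul1r.
  apply: ler_sum => f _; rewrite normcM [X in _ * X <= _]normcM mono_unit ?mul1r; last by move=> i; rewrite normcV (om_unit omP) invr1.
  apply: ler_pM; rewrite ?normc_ge0 //; last exact: close.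
  by rewrite normcR ger0_norm // prodr_ge0 // => i _; rewrite divr_ge0 ?ler0n ?exprn_ge0.
(* A cell without mass is spread uniformly, so that the weights [p a] always sum to 1. *)
pose p a l := if c a == 0 then L%:R^-1 else psi a (u l) / (c a * L%:R).
have c0 a : 0 <= c a by rewrite divr_ge0 ?ler0n // sumr_ge0 // => l _; exact: psi0.
have p0 a l : 0 <= p a l.
  rewrite /p; case: ifP => _; first by rewrite invr_ge0 ler0n.
  by apply: divr_ge0; [exact: psi0 | rewrite mulr_ge0 ?ler0n ?c0].
have p1 a : \sum_l p a l = 1.
  rewrite /p; case: (boolP (c a == 0)) => [_|ca]; first by rewrite sumr_const card_ord -[LHS]mulr_natl mulfV // gt_eqF.
  rewrite -mulr_suml; have -> : \sum_l psi a (u l) = c a * L%:R by rewrite /c divfK // gt_eqF.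
  by rewrite divff // mulf_neq0 // gt_eqF.
have cp a l : c a * p a l = psi a (u l) / L%:R.
  rewrite /p; case: (boolP (c a == 0)) => [/eqP ca|ca]; last by field; rewrite ca gt_eqF.
  rewrite ca mul0r; have : \sum_l psi a (u l) = 0.
    by move: ca; rewrite /c => /eqP; rewrite mulf_eq0 invr_eq0 [L%:R == 0]gt_eqF // orbF => /eqP.
  by move=> /psumr_eq0P -> //; [rewrite mul0r | move=> l' _; exact: psi0].
exists (fun j l => \sum_a psi a (u' j) * p a l).
have Wcol l : (\sum_j \sum_a psi a (u' j) * p a l) / M%:R = \sum_a c' a * p a l.
  rewrite exchange_big /= mulr_suml; apply: eq_bigr => a _.
  by rewrite -mulr_suml /c' mulrAC.
have Ucol l : 1 / L%:R = \sum_a c a * p a l.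
  by under eq_bigr do rewrite cp; rewrite -mulr_suml psi1.
split.
- by move=> j l; apply: sumr_ge0 => a _; rewrite mulr_ge0 ?psi0.
- by move=> j; rewrite exchange_big /=; under eq_bigr do rewrite -mulr_sumr p1 mulr1; exact: psi1.
- apply: le_trans (_ : \sum_l \sum_a (tau / (2 * nA)) * p a l <= _).
    apply: ler_sum => l _; rewrite Wcol (Ucol l) -sumrB; apply: le_trans (ler_norm_sum _ _ _) _.
    apply: ler_sum => a _; rewrite -mulrBl normrM distrC [X in _ * X]ger0_norm //.
    by apply: ler_wpM2r.
  rewrite exchange_big /=; under eq_bigr do rewrite -mulr_sumr p1 mulr1.
  rewrite sumr_const -[leLHS]mulr_natr cardA; have -> : tau / (2 * nA) * nA = tau / 2 by field; rewrite gt_eqF.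
  by move: tau0; lra.
pose t := rho ^+ m; have t0 : 0 <= t by exact: exprn_ge0.
(* Two points at distance [eta] cannot both be within [eta / 2] of the centre of a cell. *)
have split_far j l (a : A) : [exists i, eta <= normc (u l i - u' j i)] -> psi a (u' j) <= t \/ psi a (u l) <= t.
  case/existsP => i h; have [lt|ge] := ltP (normc (u l i - om ^+ a i)) (eta / 2); last by right; apply: (far_small a (u l) i).
  left; apply: (far_small a (u' j) i) => //.
  have := le_normcD (u l i - om ^+ a i) (om ^+ a i - u' j i).
  by rewrite addrA subrK [normc (om ^+ a i - _)]normcB; move: h lt; lra.
apply: le_trans (_ : \sum_j \sum_l \sum_a (t * p a l + psi a (u' j) * (if psi a (u l) <= t then p a l else 0)) <= _).
  apply: ler_sum => j _; rewrite big_mkcond; apply: ler_sum => l _; case: ifP => [far|_].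
    apply: ler_sum => a _; have [h|h] := split_far j l a far.
      rewrite -[leLHS]addr0; apply: lerD; first exact: ler_wpM2r.
      by case: ifP => _; rewrite mulr_ge0 ?psi0.
    by rewrite h -[leLHS]add0r; apply: lerD => //; rewrite mulr_ge0.
  apply: sumr_ge0 => a _; apply: addr_ge0; first exact: mulr_ge0.
  by apply: mulr_ge0; [exact: psi0 | case: ifP].
have -> : \sum_j \sum_l \sum_a (t * p a l + psi a (u' j) * (if psi a (u l) <= t then p a l else 0)) =
    \sum_a (M%:R * t + M%:R * (c' a * \sum_(l | psi a (u l) <= t) p a l)).
  under eq_bigr do rewrite exchange_big /=.
  rewrite exchange_big /=; apply: eq_bigr => a _.
  under eq_bigr do rewrite big_split /= -!mulr_sumr p1 mulr1.
  rewrite big_split /= sumr_const card_ord -[t *+ M]mulr_natl -mulr_suml; congr (_ + _).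
  have -> : \sum_(j < M) psi a (u' j) = M%:R * c' a by rewrite /c' mulrC divfK // gt_eqF.
  by rewrite -mulrA [in RHS]big_mkcond.
apply: le_trans (_ : \sum_(a : A) M%:R * (2 * t + tau / (2 * nA)) <= _).
  apply: ler_sum => a _; rewrite -mulrDr ler_pM2l //.
  have ps : \sum_(l | psi a (u l) <= t) p a l <= 1.
    by rewrite -(p1 a) [leRHS](bigID (fun l => psi a (u l) <= t)) /= lerDl sumr_ge0.
  have ps0 : 0 <= \sum_(l | psi a (u l) <= t) p a l by exact: sumr_ge0.
  have cps : c a * \sum_(l | psi a (u l) <= t) p a l <= t.
    rewrite mulr_sumr; apply: le_trans (_ : \sum_(l < L) t / L%:R <= _).
      rewrite big_mkcond; apply: ler_sum => l _; case: ifP => [h|_]; last by rewrite divr_ge0 ?ler0n.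
      by rewrite cp ler_pM2r ?invr_gt0.
    by rewrite sumr_const card_ord -[leLHS]mulr_natr divfK // gt_eqF.
  have := cc a; rewrite ler_norml => /andP[cca _].
  have d0 : 0 <= tau / (2 * nA) by rewrite divr_ge0 ?(ltW tau0) // mulr_ge0 ?(ltW nA0).
  have : c' a * \sum_(l | psi a (u l) <= t) p a l <= (c a + tau / (2 * nA)) * \sum_(l | psi a (u l) <= t) p a l.
    by apply: ler_wpM2r => //; move: cca; lra.
  have : tau / (2 * nA) * \sum_(l | psi a (u l) <= t) p a l <= tau / (2 * nA) by rewrite -[leRHS]mulr1 ler_wpM2l.
  by move: cps; rewrite mulrDl; lra.
rewrite sumr_const -[leLHS]mulr_natr cardA.
have -> : M%:R * (2 * t + tau / (2 * nA)) * nA = (2 * (nA * t) + tau / 2) * M%:R by field; rewrite gt_eqF.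
by rewrite ler_pM2r //; move: small; rewrite -/t; lra.
Qed.

End matching.

Lemma finite_lower (R : realType) (I : finType) (g : I -> R) : (forall i, 0 < g i) ->
  exists2 d, 0 < d & forall i, d <= g i.
Proof.
move=> g0; have s0 : 0 <= \sum_i (g i)^-1 by apply: sumr_ge0 => i _; rewrite invr_ge0 ltW.
have h0 : 0 < 1 + \sum_i (g i)^-1 by rewrite ltr_pwDl.
exists (1 + \sum_i (g i)^-1)^-1; first by rewrite invr_gt0.
move=> i; rewrite -[leRHS]invrK lef_pV2 ?posrE ?invr_gt0 // (bigD1 i) //= addrCA lerDl.
by rewrite addr_ge0 // sumr_ge0 // => j _; rewrite invr_ge0 ltW.
Qed.

Lemma cchar1 (R : realType) (X : topologicalZmodType) : cchar ((fun=> 1) : X -> R[i]).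
Proof.
split=> [x|x y|e e0]; [exact: normc1 | by rewrite mulr1 |].
apply: filterS filterT => x _; change (normc (1 - 1 : R[i]) <= e).
by have /eqP -> : normc (1 - 1 : R[i]) == 0; [rewrite normc_eq0 subrr | exact: ltW].
Qed.

(** Outside the neighbourhood given by uniform continuity, every point is moved away from 1 by some
    character; compactness leaves finitely many. Entries of the cover that carry no character are
    replaced by the trivial one. *)
Lemma control_chars (R : realType) (X : topologicalZmodType) n (f : 'I_n -> X -> R) (e : R) :
  compact [set: X] -> metrizable R X -> (forall i, continuous (f i)) -> 0 < e ->
  exists s (chi : 'I_s -> X -> R[i]) d, [/\ 0 < d, forall i, cchar (chi i) &
    forall x x', (forall i, normc (chi i x - chi i x') < d) -> forall i, `|f i x - f i x'| <= e].
Proof.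
move=> cX mX cf e0.
have /choice [W WP] : forall i, exists W, nbhs (0 : X) W /\ forall x w, W w -> `|f i (x + w) - f i x| <= e.
  by move=> i; have [W nW h] := unif_cont cX (cf i) e0; exists W.
have nW : nbhs (0 : X) [set w | forall i, W i w].
  have all (s : seq 'I_n) : nbhs (0 : X) [set w | forall i, i \in s -> W i w].
    elim: s => [|i s IH]; first by apply: filterS filterT.
    by apply: filterS (filterI (proj1 (WP i)) IH) => w [/= h1 h2] j; rewrite inE => /orP[/eqP ->|/h2].
  by apply: filterS (all (enum 'I_n)) => w h i; apply: h; rewrite mem_enum.
pose good (p : (X -> R[i]) * R) := cchar p.1 /\ 0 < p.2.
pose U (j : option ((X -> R[i]) * R)) : set X := match j with
  None => [set w | forall i, W i w] | Some p => [set w | good p /\ p.2 < normc (p.1 w - 1)] end.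
have [|s sP] := @compact_subcover X setT _ U cX.
  move=> x _; have [->|x0] := eqVneq x 0; first by exists None.
  have [chi ce ex] := characters_separate cX mX x0.
  have d0 : 0 < normc (chi x - 1) by rewrite lt_neqAle normc_ge0 andbT eq_sym normc_eq0 subr_eq0.
  have d4 : 0 < normc (chi x - 1) / 4 by rewrite divr_gt0.
  exists (Some (chi, normc (chi x - 1) / 4)).
  apply: filterS (cchar_cont x ce d4) => z /= h; split; first by split.
  have := le_normcD (chi x - chi z) (chi z - 1).
  by rewrite addrA subrK [normc (chi x - chi z)]normcB /=; move: h d0; lra.
pose pr j : (X -> R[i]) * R := if nth None s j is Some p then if `[< good p >] then p else (fun=> 1, 1) else (fun=> 1, 1).
have prP j : good (pr j).
  rewrite /pr; case: (nth None s j) => [p|]; last by split=> //; exact: cchar1.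
  by case: ifP => [/asboolP //|_]; split=> //; exact: cchar1.
have [d d0 dP] := @finite_lower R _ (fun j : 'I_(size s) => (pr j).2) (fun j => proj2 (prP j)).
exists (size s), (fun j => (pr j).1), d; split=> // [i|x x' near i]; first exact: (proj1 (prP i)).
have [[p|] js] := sP (x - x') I; last first.
  by move=> /= h; have := proj2 (WP i) x' (x - x') (h i); rewrite [x' + _]addrC subrK.
have [j jlt jE] : exists2 j, (j < size s)%N & nth None s j = Some p.
  elim: (s) js => //= a t IH [->|/IH [j jt jE]]; first by exists 0%N.
  by exists j.+1.
move=> [gp far]; have := near (Ordinal jlt); have := dP (Ordinal jlt).
rewrite /pr /= jE asboolT // cchar_dist; last exact: (proj1 gp).
by move=> h1 h2; have := lt_trans far (lt_le_trans h2 h1); rewrite ltxx.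
Qed.

Lemma iter_mul A (f : A -> A) m n x : iter m (iter n f) x = iter (m * n) f x.
Proof. by elim: m => //= m ->; rewrite mulSn iterD. Qed.

(** [C j] is the image of [X] under the product of [T^(i!) - 1] for [i] up to [j]; the chain stops
    at [K], with [Y = C K]. As every [m] divides all later factorials, [T^m - 1] is onto [Y].
    Applying [(T^(K!) - 1)^K] sends [x] into [Y]; lifting the result inside [Y] and subtracting
    leaves [v]. *)
Lemma dcc_decomposition (X : topologicalZmodType) (T T' : {additive X -> X}) : cancel T T' -> cancel T' T ->
  continuous T -> compact [set: X] -> hausdorff_space X -> dcc T ->
  exists K (Y : set X), [/\ subgrp Y, compact Y, forall x, Y (T x) <-> Y x,
    forall m y, (0 < m)%N -> Y y -> exists2 x, Y x & iter m T x - x = y &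
    forall x, exists y v, [/\ Y y, x = y + v & iter K (dif (iter K`! T)) v = 0]].
Proof.
move=> TK T'K cT cX hX D.
pose C := fix C j := if j is j.+1 then dif (iter j.+1`! T) @` C j else [set: X].
have Csub j : subgrp (C j).
  elim: j => [|j [C0 CB]] //=; split; first by exists 0; rewrite ?raddf0.
  by move=> _ _ [x Cx <-] [y Cy <-]; exists (x - y); [exact: CB | rewrite raddfB].
have Ccpt j : compact (C j).
  elim: j => [|j IH] //=; apply: continuous_compact IH; apply: continuous_subspaceT.
  by apply: continuous_subf => [|x]; [exact: iter_continuous | exact: cvg_id].
have difT n x : dif (iter n T) (T x) = T (dif (iter n T) x).
  by rewrite /dif raddfB /= -iterS iterSr.
have CT j x : C j (T x) <-> C j x.
  elim: j x => [|j IH] x //=; split=> [[z Cz zx]|[z Cz <-]]; last by exists (T z); [exact/IH | rewrite difT].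
  by exists (T' z); [apply/IH; rewrite T'K | apply: (can_inj TK); rewrite -difT T'K].
have CTn j n x : C j x -> C j (iter n T x) by elim: n => //= n IH /IH h; apply/CT.
have Cdec j : C j.+1 `<=` C j.
  by move=> _ [z Cz <-]; apply: (proj2 (Csub j)) => //; exact: CTn.
have [||||K KP] := D C.
- by move=> k; exact: Csub.
- by move=> k; exact: compact_closed.
- move=> k; apply/seteqP; split=> [_ [x Cx <-]|x Cx]; first exact/CT.
  by exists (T' x); [apply/CT; rewrite T'K | rewrite T'K].
- exact: Cdec.
have difM n q x : dif (iter (q * n) T) x = dif (iter n T) (\sum_(i < q) iter i (iter n T) x).
  have -> : dif (iter (q * n) T) x = dif (iter q (iter n T)) x by rewrite /dif iter_mul.
  rewrite dif_iter raddf_sum; apply: eq_bigr => i _.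
  by rewrite -(iter_dif_comm (iter n T) 1).
have CMn j n q x : C j x -> C j (\sum_(i < q) iter i (iter n T) x).
  by move=> Cx; apply: subgrp_sum => // i _; rewrite iter_mul; exact: CTn.
have surj m y : (0 < m)%N -> C K y -> exists2 x, C K x & iter m T x - x = y.
  move=> m0 Cy; have : C (m + K).+1 y by rewrite KP // leqW // leq_addl.
  move=> [x Cx' xy]; have Cx : C K x by rewrite -(KP (m + K)%N) // leq_addl.
  move: xy {Cx'}.
  have /dvdnP[q ->] : (m %| (m + K).+1`!)%N by rewrite dvdn_fact // m0 leqW // leq_addr.
  by rewrite difM => <-; exists (\sum_(i < q) iter i (iter m T) x) => //; exact: CMn.
exists K, (C K); split=> // x.
have down j : (j <= K)%N -> C j (iter j (dif (iter K`! T)) x).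
  elim: j => // j IH jK; rewrite iterS; have Cj := IH (ltnW jK).
  have /dvdnP[q qE] : (j.+1`! %| K`!)%N.
    rewrite -(subnKC jK); elim: (K - j.+1)%N => [|i IHi]; first by rewrite addn0.
    by rewrite addnS factS dvdn_mull.
  move: (iter j _ x) Cj => z Cz; rewrite qE difM.
  by exists (\sum_(i < q) iter i (iter j.+1`! T) z) => //; exact: CMn.
have up j z : C K z -> exists2 y, C K y & iter j (dif (iter K`! T)) y = z.
  elim: j z => [|j IH] z Cz; first by exists z.
  have [w Cw <-] := surj _ _ (fact_gt0 K) Cz; have [y Cy yw] := IH w Cw.
  by exists y; rewrite // iterS yw.
have [y Cy yE] := up K _ (down K (leqnn K)).
by exists y, (x - y); split; rewrite // ?raddfB /= ?yE ?subrr // addrC subrK.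
Qed.

(** * Orbit averages of glued points *)

Lemma sum_le_bound (R : realType) (F : nat -> R) B m : (forall t, `|F t| <= B) -> `|\sum_(t < m) F t| <= B * m%:R.
Proof.
move=> hF; apply: le_trans (ler_norm_sum _ _ _) _.
apply: le_trans (_ : \sum_(t < m) B <= _); first by apply: ler_sum => t _.
by rewrite sumr_const card_ord -[leLHS]mulr_natr.
Qed.

Lemma block_sum (R : realType) (g : nat -> R) B b b' M N : (forall t, `|g t| <= B) -> (b <= b')%N -> (M * b' <= N)%N ->
  `|\sum_(t < N) g t - \sum_(j < M) \sum_(t < b) g (j * b' + t)%N| <= B * (N%:R - (M * b)%:R).
Proof.
move=> gB bb' MbN; have B0 : 0 <= B := le_trans (normr_ge0 _) (gB 0%N).
have -> : \sum_(t < N) g t = \sum_(j < M) \sum_(t < b') g (j * b' + t)%N + \sum_(t < N - M * b') g (M * b' + t)%N.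
  by rewrite -(sum_blocks M b' (N - M * b') g) subnKC.
have -> : \sum_(j < M) \sum_(t < b') g (j * b' + t)%N =
    \sum_(j < M) \sum_(t < b) g (j * b' + t)%N + \sum_(j < M) \sum_(t < b' - b) g (j * b' + (b + t))%N.
  rewrite -big_split; apply: eq_bigr => j _ /=.
  transitivity (\sum_(t < b + (b' - b)) g (j * b' + t)%N); first by rewrite subnKC.
  by rewrite big_split_ord.
have canc (x y z : R) : x + y + z - x = y + z by ring.
rewrite canc.
apply: le_trans (ler_normD _ _) _; apply: le_trans (lerD (_ : _ <= B * (M * (b' - b))%:R) (sum_le_bound (F := fun t => g (M * b' + t)%N) _ _)) _.
- apply: le_trans (ler_norm_sum _ _ _) _; apply: le_trans (_ : \sum_(j < M) B * (b' - b)%:R <= _).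
    by apply: ler_sum => j _; apply: (sum_le_bound (F := fun t => g (j * b' + (b + t))%N)).
  by rewrite sumr_const card_ord -[leLHS]mulr_natr natrM mulrAC mulrA.
- by [].
have le1 : (M * b <= M * b')%N by rewrite leq_mul2l bb' orbT.
rewrite -mulrDr; apply: ler_wpM2l => //; rewrite -natrD -natrB; last exact: leq_trans MbN.
by rewrite ler_nat mulnBr; move: le1 MbN; move: (M * b)%N (M * b')%N => x y; lia.
Qed.

(** [b], [b'] and the length per block are as [K1 * K1], [K1.+1 * K1] and [K1.+1 * K1.+1]: the gaps
    between blocks and the final gap all have relative size [1 / K1.+1]. *)
Lemma glue_block K1 b1 : (0 < K1)%N -> (0 < b1)%N ->
  [/\ (K1 * K1 * b1 < K1.+1 * K1 * b1)%N, (b1 <= K1.+1 * K1 * b1)%N &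
     (K1.+1 * K1 * b1 <= K1.+1 * (K1.+1 * K1 * b1 - K1 * K1 * b1))%N].
Proof.
move=> K1_gt0 b1_gt0; have e : (K1.+1 * K1 * b1 = K1 * K1 * b1 + K1 * b1)%N by rewrite mulSn mulnDl addnC.
have p : (0 < K1 * b1)%N by rewrite muln_gt0 K1_gt0.
split; first by rewrite e -[X in (X < _)%N]addn0 ltn_add2l.
  by rewrite e (leq_trans _ (leq_addl _ _)) // leq_pmull.
by rewrite {2}e addKn mulnA.
Qed.

Lemma glue_length K1 b1 M N : (M * (K1.+1 * K1.+1 * b1) < N)%N ->
  (N <= K1.+1 * (N - M * (K1.+1 * K1 * b1)))%N /\ (M * (K1.+1 * K1 * b1) <= N)%N.
Proof.
have -> : (M * (K1.+1 * K1.+1 * b1) = M * b1 * K1.+1 * K1.+1)%N by ring.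
have -> : (M * (K1.+1 * K1 * b1) = M * b1 * K1.+1 * K1)%N by ring.
move: (M * b1 * K1.+1)%N => x; rewrite mulnS => lt.
have [d ->] : exists d, N = (x + x * K1 + d)%N by exists (N - (x + x * K1))%N; rewrite subnKC // ltnW.
split; last by rewrite addnAC leq_addl.
rewrite addnAC addnK mulSn mulnDr leq_add2l.
by rewrite mulnC leq_addr.
Qed.

Lemma glue_gap K1 b1 M N h : (N <= M * (K1.+1 * K1.+1 * b1) + h)%N ->
  (M * (K1.+1 * K1.+1 * b1) < N)%N -> (K1.+1 * N <= 2 * N + K1.+1 * (M * (K1 * K1 * b1) + h))%N.
Proof.
have -> : (M * (K1.+1 * K1.+1 * b1) = M * b1 * (K1.+1 * K1.+1))%N by ring.
have -> : (M * (K1 * K1 * b1) = M * b1 * (K1 * K1))%N by ring.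
move: (M * b1)%N => x le lt.
have le2 : (2 * (x * (K1.+1 * K1.+1)) <= 2 * N)%N by rewrite leq_mul2l ltnW.
have le3 : (K1.+1 * N <= K1.+1 * (x * (K1.+1 * K1.+1) + h))%N by rewrite leq_mul2l le orbT.
apply: leq_trans le3 _; apply: leq_trans (leq_add le2 (leqnn _)).
move: {le lt le2 N} h => h; nia.
Qed.

Section glue_average.
Variables (R : realType) (X : topologicalZmodType) (S S' : {additive X -> X}).
Hypotheses (SK : cancel S S') (S'K : cancel S' S) (cS : continuous S) (cS' : continuous S').
Hypothesis hX : hausdorff_space X.
Variable Y : set X.
Hypotheses (sY : subgrp Y) (cY : compact Y) (SY : forall x, Y (S x) <-> Y x).
Hypothesis SYm : forall m y, (0 < m)%N -> Y y -> exists2 x, Y x & iter m S x - x = y.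
Variables (s : nat) (e : 'I_s -> X -> R[i]).
Hypotheses (ce : forall k, cchar (e k))
  (sepe : forall y, Y y -> (forall k m, e k (iter m S y) = 1 /\ e k (iter m S' y) = 1) -> y = 0).
Variables (n : nat) (f : 'I_n -> X -> R) (B eps d : R).
Hypotheses (fB : forall i x, `|f i x| <= B) (B0 : 0 <= B) (eps0 : 0 < eps) (d0 : 0 < d).
Hypothesis control : forall x x', (forall k, normc (e k x - e k x') < d) -> forall i, `|f i x - f i x'| <= eps.

(** The [Y]-components are glued, while [v'] is a periodic point given in advance; blocks where its
    orbit fails to follow [vs] are only counted in the error. [b] and [b'] come before [P], since
    the [v'] used later is found after them. *)
Lemma glue_average : exists b b', [/\ (0 < b)%N, (b <= b')%N, b'%:R - b%:R <= eps * b'%:R :> R &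
  forall P, (0 < P)%N -> exists M0, forall M, (M0 <= M)%N -> exists N, [/\ (0 < N)%N, (P %| N)%N &
    forall (ys vs : nat -> X) v', (forall j, Y (ys j)) -> iter N S v' = v' ->
    exists p, [/\ Y p, iter N S p = p & forall i,
      `|(\sum_(t < N) f i (iter t S (p + v'))) / N%:R -
        (\sum_(j < M) (\sum_(t < b) f i (iter t S (ys j + vs j))) / b%:R) / M%:R| <= 3 * eps +
        2 * B * (#|[pred j : 'I_M | [exists t : 'I_b, exists k, (d / 2 <= normc (e k (iter (j * b' + t) S v')
           - e k (iter t S (vs j))))%R]]|%:R / M%:R)]]].
Proof.
have d2 : 0 < d / 2 by rewrite divr_gt0.
(* [q] makes the badly shadowed coordinates cost at most [eps]; [K1] does so for the uncovered
   times, a proportion of about [2 / K0], and keeps [b' - b] below [eps * b']. *)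
pose q := (Num.bound (2 * B * s%:R / eps)).+1.
pose K1 := (Num.bound (8 * B / eps) + Num.bound eps^-1).+1; pose K0 := K1.+1.
have sep' y : Y y -> (forall k m, restrict sY (ce k) (iter m S y) = 1 /\ restrict sY (ce k) (iter m S' y) = 1) -> y = 0.
  move=> Yy h; apply: sepe => // k m; have [h1 h2] := h k m.
  have SY' x : Y (S' x) <-> Y x by rewrite -SY S'K.
  rewrite !restrictE in h1 h2 *; first by [].
  - by elim: (m) => //= j IH; apply/SY'.
  - by elim: (m) => //= j IH; apply/SY.
have [b0 gl] := glue SK S'K cS cS' hX sY cY SY SYm sep' K0 d2 (ltn0Sn _ : (0 < q)%N).
have K1_gt0 : (0 < K1)%N by []. 
have K1a : (Num.bound (8 * B / eps) <= K0)%N by rewrite /K0 /K1 -addnS leqW // leq_addr.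
have K1b : (Num.bound eps^-1 <= K0)%N by rewrite /K0 /K1 -addSn leqW // leq_addl.
pose b1 := b0.+1; have b1_gt0 : (0 < b1)%N by [].
pose b := (K1 * K1 * b1)%N; pose b' := (K1.+1 * K1 * b1)%N.
have [bb' b1b' bK] := glue_block K1_gt0 b1_gt0; rewrite -/b -/b' -/K0 in bb' b1b' bK.
have b0b' : (b0 <= b')%N by exact: ltnW.
have bpos : (0 < b)%N by rewrite !muln_gt0 K1_gt0 b1_gt0.
have K0R : (0 : R) < K0%:R by rewrite ltr0n.
exists b, b'; split; rewrite ?(ltnW bb') //.
  have -> : b'%:R - b%:R = K0%:R^-1 * b'%:R :> R.
    rewrite /b /b' !natrM /K0 -natr1; field; by rewrite natr1 pnatr_eq0.
  apply: ler_wpM2r; rewrite ?ler0n // -[eps]invrK lef_pV2 ?posrE ?invr_gt0 //.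
  apply: ltW; apply: lt_le_trans (archi_boundP _) _; first by rewrite invr_ge0 ltW.
  by rewrite ler_nat.
move=> P P0; have [N0 [h glN]] := gl b b' b0b' bb' bK P P0.
pose M1 := Num.bound (4 * B * h%:R / eps).
exists (N0 + M1).+1 => M MM; pose N1 := (M * (K1.+1 * K1.+1 * b1))%N.
have MN1 : (M <= N1)%N by rewrite leq_pmulr // !muln_gt0 b1_gt0.
have [|N [PN /andP[N1N NN1] glM]] := glN N1; first by apply: leq_trans MN1; apply: leq_trans MM; rewrite leqW // leq_addr.
have [NK MbN] := glue_length N1N; rewrite -/b' -/K0 in NK MbN.
have N0' : (0 < N)%N by exact: leq_ltn_trans N1N.
exists N; split=> // ys vs v' Yys per.
have [p [Yp pp cnt]] := glM M ys NK Yys.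
exists p; split=> // i.
set far := [pred j : 'I_M | _].
have NR : (0 : R) < N%:R by rewrite ltr0n.
have MR : (0 : R) < M%:R by rewrite ltr0n; apply: leq_trans MM.
have bR : (0 : R) < b%:R by rewrite ltr0n.
pose g t := f i (iter t S (p + v')); pose g2 (j : 'I_M) t := f i (iter t S (ys j + vs j)).
pose A := \sum_(j < M) \sum_(t < b) g (j * b' + t)%N; pose A2 := \sum_(j < M) \sum_(t < b) g2 j t.
have rest : `|\sum_(t < N) g t - A| <= B * (N%:R - (M * b)%:R).
  by apply: block_sum (ltnW bb') MbN => t; exact: fB.
pose bad := [pred z : 'I_M * 'I_b * 'I_s | (d / 2 <= normc (restrict sY (ce z.2) (iter (z.1.1 * b' + z.1.2) S p)
        - restrict sY (ce z.2) (iter z.1.2 S (ys z.1.1))))%R].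
have Yit m y : Y y -> Y (iter m S y) by elim: m => //= m IH /IH ?; apply/SY.
have one (j : 'I_M) (t : 'I_b) : `|g (j * b' + t)%N - g2 j t| <= eps + 2 * B * (\sum_(k < s) (bad (j, t, k))%:R + (far j)%:R).
  have big : 2 * B <= 2 * B * (\sum_(k < s) (bad (j, t, k))%:R + (far j)%:R) ->
      `|g (j * b' + t)%N - g2 j t| <= eps + 2 * B * (\sum_(k < s) (bad (j, t, k))%:R + (far j)%:R).
    move=> h1; apply: le_trans (ler_normB _ _) _.
    by have := fB i (iter (j * b' + t) S (p + v')); have := fB i (iter t S (ys j + vs j)); move: eps0; rewrite /g /g2; lra.
  have sum0 : 0 <= \sum_(k < s) (bad (j, t, k))%:R :> R by apply: sumr_ge0 => k _; exact: ler0n.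
  have [fj|/negP nfar] := pselect (is_true (far j)).
    by apply: big; rewrite -[leLHS]mulr1; apply: ler_wpM2l; [rewrite mulr_ge0 | rewrite fj lerDr].
  have [/existsP[k bk]|nbad] := boolP [exists k, bad (j, t, k)].
    apply: big; rewrite -[leLHS]mulr1; apply: ler_wpM2l; first by rewrite mulr_ge0.
    rewrite (bigD1 k) // bk -addrA lerDl addr_ge0 ?ler0n // sumr_ge0 // => k' _; exact: ler0n.
  apply: le_trans (_ : eps <= _); last by rewrite lerDl mulr_ge0 ?mulr_ge0 ?addr_ge0 ?ler0n.
  apply: control => k; have [e1 eD _] := ce k.
  rewrite !raddfD !eD.
  have ngood : normc (e k (iter (j * b' + t) S p) - e k (iter t S (ys j))) < d / 2.
    move/existsPn/(_ k): nbad => nb.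
    rewrite ltNge -(restrictE sY (ce k) (Yit (j * b' + t)%N _ Yp)) -(restrictE sY (ce k) (Yit t _ (Yys j))); exact: nb.
  have nf : normc (e k (iter (j * b' + t) S v') - e k (iter t S (vs j))) < d / 2.
    by move: nfar; rewrite /far /= => /existsPn/(_ t)/existsPn/(_ k); rewrite -ltNge.
  have -> : e k (iter (j * b' + t) S p) * e k (iter (j * b' + t) S v') - e k (iter t S (ys j)) * e k (iter t S (vs j)) =
     (e k (iter (j * b' + t) S p) - e k (iter t S (ys j))) * e k (iter (j * b' + t) S v') +
     e k (iter t S (ys j)) * (e k (iter (j * b' + t) S v') - e k (iter t S (vs j))) by ring.
  by apply: le_lt_trans (le_normcD _ _) _; rewrite !normcM !e1; move: ngood nf; lra.
have nbad : \sum_(j < M) \sum_(t < b) \sum_(k < s) (bad (j, t, k))%:R = #|bad|%:R :> R.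
  rewrite pair_bigA pair_bigA -sum1_card natr_sum [RHS]big_mkcond; apply: eq_bigr => -[[j t] k] _.
  by change ((bad (j, t, k))%:R = (if bad (j, t, k) then 1%:R else 0 : R)); case: (bad _).
have nfar : \sum_(j < M) \sum_(t < b) (far j)%:R = b%:R * #|far|%:R :> R.
  transitivity (\sum_(j < M) b%:R * (far j)%:R : R).
    by apply: eq_bigr => j _; rewrite sumr_const card_ord -[LHS]mulr_natl.
  rewrite -mulr_sumr -sum1_card natr_sum [in RHS]big_mkcond; congr (_ * _); apply: eq_bigr => j _.
  by change ((far j)%:R = (if far j then 1%:R else 0 : R)); case: (far _).
have AA2 : `|A - A2| <= eps * (M * b)%:R + 2 * B * (#|bad|%:R + b%:R * #|far|%:R).
  rewrite /A /A2 -sumrB; apply: le_trans (ler_norm_sum _ _ _) _.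
  apply: le_trans (_ : \sum_(j < M) \sum_(t < b) (eps + 2 * B * (\sum_(k < s) (bad (j, t, k))%:R + (far j)%:R)) <= _).
    apply: ler_sum => j _; rewrite -sumrB; apply: le_trans (ler_norm_sum _ _ _) _.
    by apply: ler_sum => t _; exact: one.
  under eq_bigr do rewrite big_split -mulr_sumr big_split /= sumr_const card_ord.
  rewrite big_split /= sumr_const card_ord -mulr_sumr big_split /= nbad nfar.
  by rewrite -mulrnA -[eps *+ _]mulr_natr mulnC.
have qbad : 2 * B * #|bad|%:R <= eps * (M * b)%:R.
  have c1 : q%:R * #|bad|%:R <= (M * b)%:R * s%:R :> R.
    by rewrite -!natrM ler_nat; move: cnt; rewrite !card_prod !card_ord.
  have qs : 2 * B * s%:R <= eps * q%:R.
    rewrite [leRHS]mulrC -ler_pdivrMr //; apply: ltW; apply: lt_le_trans (archi_boundP _) _.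
      by rewrite divr_ge0 ?(ltW eps0) // !mulr_ge0.
    by rewrite ler_nat.
  have q0 : (0 : R) < q%:R by rewrite ltr0n.
  rewrite -(ler_pM2l q0).
  have -> : q%:R * (2 * B * #|bad|%:R) = 2 * B * (q%:R * #|bad|%:R) by ring.
  apply: le_trans (_ : 2 * B * ((M * b)%:R * s%:R) <= _); first by apply: ler_wpM2l => //; rewrite mulr_ge0.
  have -> : 2 * B * ((M * b)%:R * s%:R) = (M * b)%:R * (2 * B * s%:R) by ring.
  have -> : q%:R * (eps * (M * b)%:R) = (M * b)%:R * (eps * q%:R) by ring.
  by apply: ler_wpM2l.
have gap : 2 * B * (N%:R - (M * b)%:R) <= eps * N%:R.
  have g1 : K0%:R * (N%:R - (M * b)%:R - h%:R) <= 2 * N%:R :> R.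
    have : (K0 * N <= 2 * N + K0 * (M * b + h))%N by exact: glue_gap NN1 N1N.
    by rewrite -(ler_nat R) natrD [(K0 * N)%:R]natrM [(2 * N)%:R]natrM [(K0 * _)%:R]natrM natrD; lra.
  have g2' : 8 * B <= eps * K0%:R.
    rewrite [leRHS]mulrC -ler_pdivrMr //; apply: ltW; apply: lt_le_trans (archi_boundP _) _.
      by rewrite divr_ge0 ?(ltW eps0) // mulr_ge0.
    by rewrite ler_nat.
  have g3 : 4 * B * h%:R <= eps * N%:R.
    rewrite [leRHS]mulrC -ler_pdivrMr //; apply: ltW; apply: lt_le_trans (archi_boundP _) _.
      by rewrite divr_ge0 ?(ltW eps0) // !mulr_ge0.
    by rewrite ler_nat; apply: leq_trans (ltnW N1N); apply: leq_trans MN1; apply: leq_trans MM; rewrite leqW // leq_addl.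
  rewrite -(ler_pM2l K0R).
  have : 2 * B * (K0%:R * (N%:R - (M * b)%:R - h%:R)) <= 2 * B * (2 * N%:R) by apply: ler_wpM2l => //; rewrite mulr_ge0.
  have : 8 * B * N%:R <= eps * K0%:R * N%:R by apply: ler_wpM2r.
  have : K0%:R * (4 * B * h%:R) <= K0%:R * (eps * N%:R) by rewrite ler_pM2l.
  by lra.
have MbN' : (M * b <= N)%N by apply: leq_trans MbN; rewrite leq_mul2l (ltnW bb') orbT.
have Mb0 : (0 : R) < (M * b)%:R by rewrite natrM mulr_gt0.
pose alpha := A2 / (M * b)%:R.
have aB : `|alpha| <= B.
  rewrite /alpha normrM normfV [`|(M * b)%:R|]ger0_norm ?ler0n // ler_pdivrMr // /A2.
  apply: le_trans (ler_norm_sum _ _ _) _; apply: le_trans (_ : \sum_(j < M) \sum_(t < b) B <= _).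
    by apply: ler_sum => j _; apply: le_trans (ler_norm_sum _ _ _) _; apply: ler_sum => t _; exact: fB.
  by under eq_bigr do rewrite sumr_const card_ord; rewrite sumr_const card_ord -mulrnA -[leLHS]mulr_natr mulnC.
have -> : (\sum_(j < M) (\sum_(t < b) f i (iter t S (ys j + vs j))) / b%:R) / M%:R = alpha.
  by rewrite -mulr_suml /alpha natrM invfM mulrA -mulrA [_^-1 * _]mulrC mulrA.
set far' := 2 * B * (#|far|%:R / M%:R).
have farN : 2 * B * (b%:R * #|far|%:R) <= far' * N%:R.
  have -> : 2 * B * (b%:R * #|far|%:R) = far' * (M * b)%:R.
    by rewrite /far' natrM; field; rewrite gt_eqF.
  apply: ler_wpM2l; last by rewrite ler_nat.
  by rewrite /far' mulr_ge0 // ?mulr_ge0 // ?invr_ge0 ?ler0n.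
have -> : (\sum_(t < N) f i (iter t S (p + v'))) / N%:R - alpha = (\sum_(t < N) g t - N%:R * alpha) / N%:R.
  by rewrite mulrBl [N%:R * alpha]mulrC mulfK // gt_eqF.
rewrite normrM normfV [`|N%:R|]ger0_norm ?ler0n // ler_pdivrMr //.
have A2E : A2 = alpha * (M * b)%:R by rewrite /alpha divfK // gt_eqF.
have -> : \sum_(t < N) g t - N%:R * alpha = (\sum_(t < N) g t - A) + (A - A2) - (N%:R - (M * b)%:R) * alpha.
  by rewrite A2E; ring.
have dN : 0 <= N%:R - (M * b)%:R :> R by rewrite subr_ge0 ler_nat.
have al : `|(N%:R - (M * b)%:R) * alpha| <= (N%:R - (M * b)%:R) * B.
  by rewrite normrM ger0_norm //; apply: ler_wpM2l.
apply: le_trans (ler_normB _ _) _; have := ler_normD (\sum_(t < N) g t - A) (A - A2).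
have Mbe : eps * (M * b)%:R <= eps * N%:R by rewrite ler_pM2l // ler_nat.
by move: rest AA2 qbad gap farN al Mbe; rewrite !mulrDr !mulrDl; lra.
Qed.

End glue_average.

(** * Pointwise approximation by periodic orbits *)

Section cchar_mono.
Variables (R : realType) (X : topologicalZmodType).

Lemma subgrpT : subgrp [set: X].
Proof. by []. Qed.

Lemma dual_cchar (chi : dual R [set: X]) : cchar chi.
Proof.
have [h1 _ h3 h4] := dualP chi; split=> // [x y|d d0]; first exact: h3.
by apply: filterS (h4 d d0) => x /= h; exact: h.
Qed.

Lemma cchar_mono (I : finType) (m : nat) (e : I -> X -> R[i]) (h : {ffun I -> 'I_(2 * m).+1}) :
  (forall i, cchar (e i)) -> cchar (fun x => mono h (e ^~ x)).
Proof.
move=> ce; pose chi : dual R [set: X] := \sum_i restrict subgrpT (ce i) *~ ((h i)%:Z - m%:Z).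
have -> : (fun x => mono h (e ^~ x)) = chi; last exact: dual_cchar.
apply/funext => x; rewrite /chi dual_sumE /mono -prodf_div; apply: eq_bigr => i _.
by rewrite dualMzE restrictE.
Qed.

End cchar_mono.

Definition bavg (R : realType) (A : Type) (f : A -> R) (S : A -> A) N x := (\sum_(t < N) f (iter t S x)) / N%:R.

Lemma bavg_bound (R : realType) (A : Type) (f : A -> R) S N x B : (forall y, `|f y| <= B) -> `|bavg f S N x| <= B.
Proof.
move=> fB; have B0 : 0 <= B := le_trans (normr_ge0 _) (fB x).
rewrite /bavg normrM normfV [`|N%:R|]ger0_norm ?ler0n //.
case: N => [|N]; first by rewrite invr0 mulr0.
rewrite ler_pdivrMr ?ltr0n //; exact: (sum_le_bound (F := fun t => f (iter t S x))).
Qed.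

Lemma block_avg (R : realType) (A : Type) (f : A -> R) (S : A -> A) B b b' L N x : (forall y, `|f y| <= B) ->
  (0 < b)%N -> (0 < L)%N -> (b <= b')%N -> (L * b' <= N)%N ->
  `|bavg f S N x - (\sum_(l < L) bavg f S b (iter (l * b') S x)) / L%:R| * N%:R <= 2 * B * (N%:R - (L * b)%:R).
Proof.
move=> fB b0 L0 bb' LN; have B0 : 0 <= B := le_trans (normr_ge0 _) (fB x).
have le1 : (L * b <= L * b')%N by rewrite leq_mul2l bb' orbT.
have N0 : (0 < N)%N by apply: leq_trans LN; rewrite muln_gt0 L0 (leq_trans b0).
have [NR LR bR] : [/\ (0 : R) < N%:R, (0 : R) < L%:R & (0 : R) < b%:R] by rewrite !ltr0n.
set al := _ / L%:R; pose g t := f (iter t S x).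
have alE : al * (L * b)%:R = \sum_(l < L) \sum_(t < b) g (l * b' + t)%N.
  rewrite /al natrM mulrA divfK ?gt_eqF // mulr_suml; apply: eq_bigr => l _.
  by rewrite /bavg divfK ?gt_eqF //; apply: eq_bigr => t _; rewrite /g addnC iterD.
have alB : `|al| <= B.
  rewrite /al normrM normfV [`|L%:R|]ger0_norm ?ler0n // ler_pdivrMr //.
  apply: le_trans (ler_norm_sum _ _ _) _; apply: le_trans (_ : \sum_(l < L) B <= _).
    by apply: ler_sum => l _; exact: bavg_bound.
  by rewrite sumr_const card_ord -[leLHS]mulr_natr.
have := block_sum (g := g) (fun t => fB _) bb' LN; rewrite -alE => h.
have dN : 0 <= N%:R - (L * b)%:R :> R by rewrite subr_ge0 ler_nat (leq_trans le1).
rewrite -[N%:R in leLHS]ger0_norm ?ler0n // -normrM mulrBl /bavg divfK ?gt_eqF //.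
have -> : \sum_(t < N) f (iter t S x) - al * N%:R = (\sum_(t < N) g t - al * (L * b)%:R) - al * (N%:R - (L * b)%:R).
  by rewrite mulrBr; ring.
apply: le_trans (ler_normB _ _) _; rewrite normrM [`|N%:R - _|]ger0_norm //.
have : `|al| * (N%:R - (L * b)%:R) <= B * (N%:R - (L * b)%:R) by apply: ler_wpM2r.
by move: h; lra.
Qed.

Lemma iter_fixM (A : Type) (f : A -> A) w P c : iter P f w = w -> iter (c * P) f w = w.
Proof. by move=> h; rewrite -iter_mul; elim: c => //= c ->. Qed.

Section pointwise.
Variables (R : realType) (X : topologicalZmodType) (S S' : {additive X -> X}).
Hypotheses (cX : compact [set: X]) (SK : cancel S S') (S'K : cancel S' S) (cS : continuous S) (cS' : continuous S').
Hypothesis hX : hausdorff_space X.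
Variable Y : set X.
Hypotheses (sY : subgrp Y) (cY : compact Y) (SY : forall x, Y (S x) <-> Y x).
Hypothesis SYm : forall m y, (0 < m)%N -> Y y -> exists2 x, Y x & iter m S x - x = y.
Variables (s : nat) (e : 'I_s -> X -> R[i]).
Hypotheses (ce : forall k, cchar (e k))
  (sepe : forall x, (forall k m, e k (iter m S x) = 1 /\ e k (iter m S' x) = 1) -> x = 0).
Variables (n : nat) (f : 'I_n -> X -> R) (B eps d : R).
Hypotheses (fB : forall i x, `|f i x| <= B) (B1 : 1 <= B) (eps0 : 0 < eps) (d0 : 0 < d).
Hypothesis control : forall x x', (forall k, normc (e k x - e k x') < d) -> forall i, `|f i x - f i x'| <= eps.
Variables (k : nat) (y v : X).
Hypotheses (Yy : Y y) (nil : iter k (dif S) v = 0).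

(** The matching decides which of the [L] blocks of the orbit of [y + v] is copied at each of the
    [M1] blocks of the twin [w]. The error consists of [3 * eps] from gluing, [6 * B * eps] from
    mismatched blocks, [3 * B * eps] from the weights and [4 * B * eps] from cutting into blocks. *)
Lemma pointwise_unipotent : exists n0, forall N, (n0 <= N)%N -> exists x' P, [/\ (0 < P)%N, iter P S x' = x' &
  forall i, `|bavg (f i) S N (y + v) - bavg (f i) S P x'| <= (3 + 13 * B) * eps].
Proof.
have B0 : 0 <= B by apply: le_trans B1.
have d2 : 0 < d / 2 by rewrite divr_gt0.
have [b [b' [b_gt0 bb' gapb gl]]] := glue_average SK S'K cS cS' hX sY cY SY SYm ce
  (fun x _ => sepe (x := x)) fB B0 eps0 d0 control.
have b'_gt0 : (0 < b')%N by exact: leq_trans bb'.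
pose U : {additive X -> X} := iter b' S.
have cU : continuous U by exact: iter_continuous.
have nilU : iter k (dif U) v = 0 by exact: dif_pow.
have [q [g [cg sepg]]] := unipotent_separating k SK S'K cS b'_gt0 ce sepe.
pose I : finType := ('I_b * 'I_s)%type.
pose E (z : I) x := e z.2 (iter z.1 S x).
have cE z : cchar (E z).
  by apply: (@cchar_comp R X (e z.2) (iter z.1 S)) => //; [move=> a c; rewrite raddfD | exact: iter_continuous].
have [m [dl [dl0 match_]]] := @matching R I (d / 2) eps d2 eps0.
pose F : finType := {ffun I -> 'I_(2 * m).+1}.
have dl2 : 0 < dl / 2 by rewrite divr_gt0.
have [w [P [N0 [z [P0 Pw tw]]]]] := periodic_twin cX hX cU nilU cg sepg
  (fun i : 'I_#|F| => cchar_mono (enum_val i) cE) dl2.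
(* A multiple of the period of [w], so that the twin's block at position [j] depends only on [j]
   modulo [M1]. *)
pose M1 := (P * N0.+1)%N.
have M1_gt0 : (0 < M1)%N by rewrite muln_gt0 P0.
have N0M1 : (N0 <= M1)%N by apply: leq_trans (leq_pmull _ P0); exact: leqW.
exists (b' * N0.+1 + Num.bound (b'%:R / eps))%N => N NN.
pose L := (N %/ b')%N.
have N0L : (N0.+1 <= L)%N by rewrite leq_divRL // mulnC; apply: leq_trans NN; exact: leq_addr.
have L0 : (0 < L)%N by exact: leq_trans N0L.
have LN : (L * b' <= N)%N by exact: leq_trunc_div.
pose u (l : 'I_L) (i : I) := E i (iter l U v); pose u' (j : 'I_M1) (i : I) := E i (iter j U w).
have E1 i x : normc (E i x) = 1 by have [h _ _] := cE i.
have [LR MR] : (0 : R) < L%:R /\ (0 : R) < M1%:R by rewrite !ltr0n.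
have [|W [W0 W1 Wcol Wfar]] := match_ L M1 u u' L0 M1_gt0 (fun l i => E1 i _) (fun l i => E1 i _).
  move=> h; have [h1 _] := tw (enum_rank h) L (ltnW N0L); have [_ h2] := tw (enum_rank h) M1 N0M1.
  rewrite enum_rankK in h1 h2.
  have dv (K : nat) (a : R[i]) : (0 < K)%N -> normc (a - K%:R * z (enum_rank h)) <= dl / 2 * K%:R ->
      normc (a / K%:R - z (enum_rank h)) <= dl / 2.
    move=> K0 le; have KR : (K%:R : R[i]) != 0 by rewrite pnatr_eq0 -lt0n.
    have -> : a / K%:R - z (enum_rank h) = (a - K%:R * z (enum_rank h)) / K%:R by field.
    by rewrite normcM normcV normc_nat ler_pdivrMr ?ltr0n.
  have := le_normcD ((\sum_l mono h (u l)) / L%:R - z (enum_rank h)) (z (enum_rank h) - (\sum_j mono h (u' j)) / M1%:R).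
  rewrite addrA subrK [normc (z _ - _)]normcB.
  by have := dv L _ L0 h1; have := dv M1 _ M1_gt0 h2; lra.
have b'P : (0 < b' * P)%N by rewrite muln_gt0 b'_gt0.
have [M0 glM] := gl (b' * P)%N b'P.
(* Every block of the twin is repeated [Rr] times; the rounding errors of [quantize] are then at
   most a proportion [eps]. *)
pose Rr := (M0 + Num.bound (L%:R / eps)).+1.
have RR : (0 : R) < Rr%:R by rewrite ltr0n.
have Leps : L%:R <= eps * Rr%:R.
  rewrite [leRHS]mulrC -ler_pdivrMr //; apply: ltW; apply: lt_le_trans (archi_boundP _) _.
    by rewrite divr_ge0 ?ler0n // ltW.
  by rewrite ler_nat /Rr leqW // leq_addl.
have /choice [ss ssP] := fun j => quantize Rr L0 (W0 j) (W1 j).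
pose M := (Rr * M1)%N.
have M0M : (M0 <= M)%N by apply: leq_trans (leq_pmulr _ M1_gt0); rewrite /Rr leqW // leq_addr.
have [N' [N'0 /dvdnP[c N'E] glN]] := glM M M0M.
(* Position [j] is repetition [j %/ M1] of the twin block [j %% M1], and [sel j] is the block of the
   original orbit copied there. *)
pose jm j : 'I_M1 := Ordinal (ltn_pmod j M1_gt0).
pose jr j : 'I_Rr := Ordinal (ltn_pmod (j %/ M1) (ltn0Sn _ : (0 < Rr)%N)).
pose sel j : 'I_L := ss (jm j) (jr j).
have perw : iter N' S w = w.
  by rewrite N'E; apply: iter_fixM; rewrite mulnC -iter_mul.
have Ysel j : Y (iter (sel j * b') S y) by elim: (sel j * b')%N => //= t IH; apply/SY.
have [p [Yp pp pP]] := glN (fun j => iter (sel j * b') S y) (fun j => iter (sel j * b') S v) w Ysel perw.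
exists (p + w), N'; split=> // [|i]; first by rewrite raddfD /= pp perw.
have := pP i; set far := [pred j : 'I_M | _] => h1.
pose hb (l : 'I_L) := bavg (f i) S b (iter (l * b') S (y + v)).
have hbB l : `|hb l| <= B by exact: bavg_bound.
pose farp (j : 'I_M1) (l : 'I_L) := [exists i0, (d / 2 <= normc (u l i0 - u' j i0))%R].
have sumM (G : 'I_M1 -> 'I_L -> R) : \sum_(j < M) G (jm j) (sel j) = \sum_j \sum_r G j (ss j r).
  rewrite exchange_big /= /M -[(Rr * M1)%N]addn0 (sum_blocks Rr M1 0 (fun j => G (jm j) (sel j))) big_ord0 addr0.
  apply: eq_bigr => r _; apply: eq_bigr => j _.
  have -> : jm (r * M1 + j)%N = j by apply: val_inj; rewrite /= modnMDl modn_small.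
  by congr (G j (ss _ _)); apply: val_inj; rewrite /= ?modnMDl ?divnMDl // ?divn_small ?addn0 ?modn_small.
have farE (j : 'I_M) : far j = farp (jm j) (sel j).
  have uj (t : 'I_b) k' : e k' (iter (j * b' + t) S w) = u' (jm j) (t, k').
    rewrite /u' /E /= addnC iterD -iter_mul {1}(divn_eq j M1) addnC [iter _ (iter b' S) w]iterD.
    by rewrite -[iter b' S]/(U : X -> X) [iter _ U w]iter_fixM //= /M1 mulnC iter_fixM.
  have vj (t : 'I_b) k' : e k' (iter t S (iter (sel j * b') S v)) = u (sel j) (t, k') by rewrite /u /E /= iter_mul.
  apply/existsP/existsP => [[t /existsP[k' h']]|[[t k'] h']].
    by exists (t, k'); rewrite normcB -vj -uj.
  by exists t; apply/existsP; exists k'; rewrite normcB uj vj.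
have MRE : M%:R = Rr%:R * M1%:R :> R by rewrite /M natrM.
have T1 : `|\sum_(j < M) hb (sel j) - Rr%:R * \sum_j \sum_l W j l * hb l| <= 2 * B * L%:R * M1%:R.
  rewrite (sumM (fun _ l => hb l)) mulr_sumr -sumrB; apply: le_trans (ler_norm_sum _ _ _) _.
  apply: le_trans (_ : \sum_(j < M1) 2 * B * L%:R <= _); first by apply: ler_sum => j _; exact: ssP.
  by rewrite sumr_const card_ord -[leLHS]mulr_natr.
have T2 : `|Rr%:R * (\sum_j \sum_l W j l * hb l) - M%:R * ((\sum_l hb l) / L%:R)| <= M%:R * (eps * B).
  have -> : Rr%:R * (\sum_j \sum_l W j l * hb l) - M%:R * ((\sum_l hb l) / L%:R) =
     M%:R * \sum_l ((\sum_j W j l) / M1%:R - 1 / L%:R) * hb l.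
    rewrite exchange_big /= MRE -!mulrA -mulrBr; congr (_ * _).
    rewrite mulr_suml mulr_sumr -sumrB mulr_sumr; apply: eq_bigr => l _.
    by rewrite -mulr_suml mulrBl mulrBr; congr (_ - _); [field; rewrite gt_eqF | rewrite mul1r [L%:R^-1 * _]mulrC].
  rewrite normrM ger0_norm ?ler0n //; apply: ler_wpM2l; first exact: ler0n.
  apply: le_trans (ler_norm_sum _ _ _) _; apply: le_trans (_ : (\sum_l `|(\sum_j W j l) / M1%:R - 1 / L%:R|) * B <= _).
    by rewrite mulr_suml; apply: ler_sum => l _; rewrite normrM; apply: ler_wpM2l.
  by apply: ler_wpM2r.
have T3 : #|far|%:R <= M%:R * eps + 2 * L%:R * M1%:R :> R.
  have -> : #|far|%:R = \sum_(j < M) (farp (jm j) (sel j))%:R :> R.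
    rewrite -sum1_card natr_sum big_mkcond; apply: eq_bigr => j _; rewrite -farE.
    by change ((if far j then 1%:R else 0 : R) = (far j)%:R); case: (far j).
  rewrite (sumM (fun j l => (farp j l)%:R)).
  apply: le_trans (_ : \sum_j (Rr%:R * \sum_(l | farp j l) W j l + 2 * L%:R) <= _).
    apply: ler_sum => j _; have := ssP j 1 (fun l => (farp j l)%:R) _.
    have -> : \sum_l W j l * (farp j l)%:R = \sum_(l | farp j l) W j l.
      by rewrite [RHS]big_mkcond; apply: eq_bigr => l _; case: (farp j l); rewrite ?mulr1 ?mulr0.
    have bd l : `|(farp j l)%:R : R| <= 1 by case: (farp j l); rewrite ?normr1 ?normr0.
    by move=> /(_ bd); rewrite ler_norml mulr1 => /andP[_]; rewrite lerBlDl addrC.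
  rewrite big_split /= sumr_const card_ord -mulr_sumr -[_ *+ M1]mulr_natr lerD2r MRE -mulrA ler_pM2l //.
  by rewrite mulrC.
have T4 := @block_avg R X (f i) S B b b' L N (y + v) (fB i) b_gt0 L0 bb' LN.
have NR : (0 : R) < N%:R by rewrite ltr0n; apply: leq_trans LN; rewrite muln_gt0 L0.
have gapN : N%:R - (L * b)%:R <= 2 * eps * N%:R.
  have NE : (N%:R : R) = L%:R * b'%:R + (N %% b')%:R by rewrite {1}(divn_eq N b') natrD natrM.
  have r1 : (N %% b')%:R <= b'%:R :> R by rewrite ler_nat ltnW // ltn_pmod.
  have r2 : b'%:R <= eps * N%:R.
    rewrite [leRHS]mulrC -ler_pdivrMr //; apply: ltW; apply: lt_le_trans (archi_boundP _) _.
      by rewrite divr_ge0 ?ler0n // ltW.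
    by rewrite ler_nat (leq_trans _ NN) // leq_addl.
  have r3 : L%:R * (b'%:R - b%:R) <= L%:R * (eps * b'%:R) by apply: ler_wpM2l; rewrite ?ler0n.
  have r4 : L%:R * b'%:R <= N%:R :> R by rewrite -natrM ler_nat.
  have r5 : eps * (L%:R * b'%:R) <= eps * N%:R by rewrite ler_pM2l.
  by rewrite natrM; move: NE r1 r2 r3 r5; rewrite mulrBr [L%:R * (eps * _)]mulrCA; lra.
pose al := (\sum_l hb l) / L%:R.
have D4 : `|bavg (f i) S N (y + v) - al| <= 4 * B * eps.
  rewrite -(ler_pM2r NR); apply: le_trans T4 _.
  have : 2 * B * (N%:R - (L * b)%:R) <= 2 * B * (2 * eps * N%:R) by apply: ler_wpM2l => //; rewrite mulr_ge0.
  by lra.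
have MR' : (0 : R) < M%:R by rewrite MRE mulr_gt0.
have LM1 : L%:R * M1%:R <= eps * M%:R.
  by rewrite MRE mulrA; apply: ler_wpM2r; rewrite ?ler0n.
pose av := (\sum_(j < M) hb (sel j)) / M%:R.
have D1 : `|av - al| <= 3 * B * eps.
  have -> : av - al = (\sum_(j < M) hb (sel j) - M%:R * al) / M%:R by rewrite /av; field; rewrite gt_eqF.
  rewrite normrM normfV [`|M%:R|]ger0_norm ?ler0n // ler_pdivrMr //.
  have := ler_normD (\sum_(j < M) hb (sel j) - Rr%:R * \sum_j \sum_l W j l * hb l) (Rr%:R * (\sum_j \sum_l W j l * hb l) - M%:R * al).
  rewrite addrA subrK; have : 2 * B * (L%:R * M1%:R) <= 2 * B * (eps * M%:R) by apply: ler_wpM2l => //; rewrite mulr_ge0.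
  by move: T1 T2; rewrite -/al; lra.
have D2 : #|far|%:R / M%:R <= 3 * eps :> R by rewrite ler_pdivrMr //; move: T3 LM1; lra.
have D3 : 2 * B * (#|far|%:R / M%:R) <= 2 * B * (3 * eps) by apply: ler_wpM2l => //; rewrite mulr_ge0.
have avE : (\sum_(j < M) (\sum_(t < b) f i (iter t S (iter (sel j * b') S y + iter (sel j * b') S v))) / b%:R) / M%:R = av.
  by rewrite /av; congr (_ / _); apply: eq_bigr => j _; rewrite /hb /bavg -raddfD.
rewrite avE in h1.
have := ler_normD (bavg (f i) S N (y + v) - al) (al - av); rewrite addrA subrK [`|al - av|]distrC.
have := ler_normD (bavg (f i) S N (y + v) - av) (av - bavg (f i) S N' (p + w)); rewrite addrA subrK.
rewrite [`|av - _|]distrC; move: h1 D1 D3 D4; rewrite -/(bavg (f i) S N' (p + w)) => *.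
have e1 : 0 <= B * eps by rewrite mulr_ge0 // ltW.
by move: eps0; lra.
Qed.

End pointwise.

Lemma continuous_bounded (R : realType) (X : topologicalZmodType) (f : X -> R) : compact [set: X] -> continuous f ->
  exists2 B : nat, (0 < B)%N & forall x, `|f x| <= B%:R.
Proof.
move=> cX cf; have [|s sP] := @compact_subcover X setT nat (fun m => [set z | `|f z| <= m%:R]) cX.
  move=> x _; exists (Num.bound (`|f x| + 1)).
  have h : nbhs x [set z | `|f x - f z| < 1] := cf x _ (nbhsx_ballx (f x) 1 ltr01).
  apply: filterS h => z /= lt; have := archi_boundP (_ : 0 <= `|f x| + 1); rewrite addr_ge0 // => /(_ isT).
  by have := ler_normB (f x) (f x - f z); rewrite opprB addrC subrK; lra.
exists (\max_(m <- s) m).+1 => // x; have [m ms fm] := sP x I.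
apply: le_trans fm _; rewrite ler_nat leqW //.
elim: s ms {sP} => //= a s IH; rewrite big_cons => -[->|/IH h]; [exact: leq_maxl | exact: leq_trans h (leq_maxr _ _)].
Qed.

Lemma bavg_blocks (R : realType) (A : Type) (f : A -> R) (T : A -> A) (q L : nat) x : (0 < q)%N ->
  (\sum_(l < L) bavg f T q (iter (l * q) T x)) / L%:R = (\sum_(r < q) bavg (fun y => f (iter r T y)) (iter q T) L x) / q%:R.
Proof.
move=> q0; rewrite /bavg -!mulr_suml exchange_big /= mulrAC; congr (_ / _ / _).
by apply: eq_bigr => r _; apply: eq_bigr => l _; rewrite iter_mul.
Qed.

(** The decomposition is unipotent for [T^q] only. The result for [T^q] is applied to the functions
    [f i] composed with [T^r], [r < q], and the averages along [T] are reassembled from them. *)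
Lemma pointwise_periodic (R : realType) (X : topologicalZmodType) (T T' : {additive X -> X}) n (f : 'I_n -> X -> R) (eps : R) x :
  cancel T T' -> cancel T' T -> continuous T -> continuous T' -> compact [set: X] -> metrizable R X -> hausdorff_space X ->
  dcc T -> (forall i, continuous (f i)) -> 0 < eps ->
  exists n0, forall N, (n0 <= N)%N -> exists x' P, [/\ (0 < P)%N, iter P T x' = x' &
    forall i, `|bavg (f i) T N x - bavg (f i) T P x'| <= eps].
Proof.
move=> TK T'K cT cT' cX mX hX D cf eps0.
have [K [Y [sY cY YT surj dec]]] := dcc_decomposition TK T'K cT cX hX D.
have [y [v [Yy -> nil]]] := dec x.
set q := K`! in nil; have q0 : (0 < q)%N by exact: fact_gt0.
pose S : {additive X -> X} := iter q T; pose S' : {additive X -> X} := iter q T'.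
have TT' m z : iter m T (iter m T' z) = z by elim: m z => // m IH z; rewrite iterSr iterS T'K IH.
have T'T m z : iter m T' (iter m T z) = z by elim: m z => // m IH z; rewrite iterSr iterS TK IH.
have SY z : Y (S z) <-> Y z by rewrite /S; elim: (q) => //= m IH; rewrite YT.
have SYm m z : (0 < m)%N -> Y z -> exists2 x, Y x & iter m S x - x = z.
  by move=> m0 Yz; have [|u Yu uE] := surj (m * q)%N z _ Yz; [rewrite muln_gt0 m0 | exists u; rewrite ?iter_mul].
have /choice [Bf BfP] : forall i, exists B : nat, (0 < B)%N /\ forall x, `|f i x| <= B%:R.
  by move=> i; have [B h1 h2] := continuous_bounded cX (cf i); exists B.
pose B : R := 1 + \sum_i (Bf i)%:R.
have fB i z : `|f i z| <= B.
  apply: le_trans (proj2 (BfP i) z) _; rewrite /B (bigD1 i) //= addrCA lerDl addr_ge0 // sumr_ge0 // => j _; exact: ler0n.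
have B1 : 1 <= B by rewrite lerDl sumr_ge0 // => j _; exact: ler0n.
have cB : 0 < 3 + 13 * B by move: B1; lra.
pose eps1 := eps / 2 / (3 + 13 * B); have eps10 : 0 < eps1 by rewrite divr_gt0 // divr_gt0.
have [s0 [e0 [ce0 sep0]]] := finite_separating TK T'K cT cT' cX mX D.
pose I2 : finType := ('I_n * 'I_q)%type.
pose f2 (i : 'I_#|I2|) z := f (enum_val i : I2).1 (iter (enum_val i : I2).2 T z).
have cf2 i : continuous (f2 i).
  by move=> z; apply: (@continuous_comp _ _ _ (iter (enum_val i : I2).2 T)); [exact: iter_continuous | exact: cf].
have [s1 [chi [d [d0 cchi control]]]] := control_chars cX mX cf2 eps10.
pose J : finType := (('I_s0 * 'I_q.+1) + 'I_s1)%type.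
pose e (j : 'I_#|J|) z := match (enum_val j : J) with inl p => e0 p.1 (iter p.2 T z) | inr i => chi i z end.
have ce j : cchar (e j).
  rewrite /e; case: (enum_val j) => [p|i]; last exact: cchi.
  by apply: (@cchar_comp R X (e0 p.1) (iter p.2 T)) => //; [move=> a b; rewrite raddfD | exact: iter_continuous].
have sepe z : (forall j m, e j (iter m S z) = 1 /\ e j (iter m S' z) = 1) -> z = 0.
  move=> h; apply: sep0 => i m.
  have key r u : (r <= q)%N -> (forall j, e j u = 1) -> e0 i (iter r T u) = 1.
    by move=> rq hu; have := hu (enum_rank (inl (i, Ordinal (rq : (r < q.+1)%N)) : J)); rewrite /e enum_rankK.
  split.
    rewrite (divn_eq m q) addnC iterD -iter_mul; apply: key => [|j]; first by rewrite ltnW // ltn_pmod.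
    exact: (proj1 (h j _)).
  have h' j := proj2 (h j (m %/ q).+1); have := key (q - m %% q)%N _ (leq_subr _ _) h'.
  rewrite /S' /= -[iter q T' _]/(iter (m %/ q).+1 (iter q T') z) iter_mul.
  have -> : ((m %/ q).+1 * q = (q - m %% q) + m)%N.
    by have := divn_eq m q; have := ltn_pmod m q0; rewrite mulSn; lia.
  by rewrite iterD TT'.
have control' z z' : (forall j, normc (e j z - e j z') < d) -> forall i, `|f2 i z - f2 i z'| <= eps1.
  by move=> h; apply: control => i; have := h (enum_rank (inr i : J)); rewrite /e enum_rankK.
have [n0 n0P] := pointwise_unipotent cX (T'T q : cancel S S') (TT' q : cancel S' S) (iter_continuous cT) (iter_continuous cT')
   hX sY cY SY SYm ce sepe (fun i z => fB _ _) B1 eps10 d0 control' Yy nil.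
exists (q * n0.+1 + Num.bound (4 * B * q%:R / eps))%N => N NN.
pose L := (N %/ q)%N.
have n0L : (n0.+1 <= L)%N by rewrite leq_divRL // mulnC; apply: leq_trans NN; exact: leq_addr.
have L0 : (0 < L)%N by exact: leq_trans n0L.
have LN : (L * q <= N)%N by exact: leq_trunc_div.
have [x' [P [P0 per px]]] := n0P L (ltnW n0L).
exists x', (P * q)%N; split=> [||i]; [by rewrite muln_gt0 P0 | by rewrite -iter_mul | ].
have qR : (0 : R) < q%:R by rewrite ltr0n.
have NR : (0 : R) < N%:R by rewrite ltr0n; apply: leq_trans LN; rewrite muln_gt0 L0.
have E1 := @block_avg R X (f i) T B q q L N (y + v) (fB i) q0 L0 (leqnn q) LN.
have E2 := @block_avg R X (f i) T B q q P (P * q) x' (fB i) q0 P0 (leqnn q) (leqnn (P * q)).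
have PqR : (0 : R) < (P * q)%:R by rewrite ltr0n muln_gt0 P0.
rewrite subrr mulr0 pmulr_lle0 // normr_le0 subr_eq0 in E2.
rewrite (eqP E2) bavg_blocks //; rewrite bavg_blocks // in E1.
have D1 : `|(\sum_(r < q) bavg (fun y => f i (iter r T y)) (iter q T) L (y + v)) / q%:R -
    (\sum_(r < q) bavg (fun y => f i (iter r T y)) (iter q T) P x') / q%:R| <= eps / 2.
  rewrite -mulrBl -sumrB normrM normfV [`|q%:R|]ger0_norm ?ler0n // ler_pdivrMr //.
  apply: le_trans (ler_norm_sum _ _ _) _; apply: le_trans (_ : \sum_(r < q) eps / 2 <= _).
    apply: ler_sum => r _; have := px (enum_rank ((i, r) : I2)); rewrite /f2 enum_rankK.
    by rewrite /eps1 mulrC divfK // gt_eqF.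
  by rewrite sumr_const card_ord -[leLHS]mulr_natr.
have B0 : 0 <= B by apply: le_trans B1.
have gapN : N%:R - (L * q)%:R <= q%:R :> R.
  by rewrite {1}(divn_eq N q) natrD addrC addKr ler_nat ltnW // ltn_pmod.
have small : 4 * B * q%:R <= eps * N%:R.
  rewrite [leRHS]mulrC -ler_pdivrMr //; apply: ltW; apply: lt_le_trans (archi_boundP _) _.
    by rewrite divr_ge0 ?(ltW eps0) // !mulr_ge0.
  by rewrite ler_nat (leq_trans _ NN) // leq_addl.
have D2 : `|bavg (f i) T N (y + v) - (\sum_(r < q) bavg (fun y => f i (iter r T y)) (iter q T) L (y + v)) / q%:R| <= eps / 2.
  rewrite -(ler_pM2r NR); apply: le_trans E1 _.
  have : 2 * B * (N%:R - (L * q)%:R) <= 2 * B * q%:R by apply: ler_wpM2l => //; rewrite mulr_ge0.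
  by move: small; lra.
set a1 := bavg _ _ _ _ in D2 *; set a2 := _ / q%:R in D1 D2; set a3 := _ / q%:R in D1 *.
by have := ler_normD (a1 - a2) (a2 - a3); rewrite addrA subrK; move: D1 D2; lra.
Qed.

(** * Measures *)

Section bounded_measurable.
Context d (T : measurableType d) (R : realType) (P : probability T R).
Implicit Types (g : T -> R) (A : set T).

Definition bmeas g := measurable_fun setT g /\ exists B, forall x, `|g x| <= B.

Lemma bmeas_int g : bmeas g -> P.-integrable setT (EFin \o g).
Proof.
move=> [mg [B gB]]; apply: measurable_bounded_integrable => //; first by apply: le_lt_trans (probability_le1 P measurableT) _; rewrite ltry.
by exists B; split; [exact: num_real | move=> M BM x _; exact: le_trans (gB x) (ltW BM)].
Qed.

Lemma bmeasD g g' : bmeas g -> bmeas g' -> bmeas (fun x => g x + g' x).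
Proof.
move=> [mg [B gB]] [mg' [B' gB']]; split; first exact: measurable_funD.
by exists (B + B') => x; apply: le_trans (ler_normD _ _) _; exact: lerD.
Qed.

Lemma bmeas_cst r : bmeas (fun=> r).
Proof. by split; [exact: measurable_cst | exists `|r|]. Qed.

Lemma bmeasZ r g : bmeas g -> bmeas (fun x => r * g x).
Proof.
move=> [mg [B gB]]; split; first by apply: measurable_funM.
by exists (`|r| * B) => x; rewrite normrM; exact: ler_wpM2l.
Qed.

Lemma bmeas_norm g : bmeas g -> bmeas (fun x => `|g x|).
Proof.
move=> [mg [B gB]]; split; first exact: measurableT_comp.
by exists B => x; rewrite normr_id.
Qed.

Lemma bmeas_indic A : measurable A -> bmeas (\1_A).
Proof.
move=> mA; split; first exact: measurable_indic.
by exists 1 => x; rewrite indicE; case: (x \in A); rewrite ?normr1 ?normr0.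
Qed.

Lemma bmeas_sum (I : Type) (s : seq I) (F : I -> T -> R) : (forall i, bmeas (F i)) ->
  bmeas (fun x => \sum_(i <- s) F i x) /\
  Rintegral P setT (fun x => \sum_(i <- s) F i x) = \sum_(i <- s) Rintegral P setT (F i).
Proof.
move=> mF; elim: s => [|i s [b IH]].
  have -> : (fun x => \sum_(i <- [::]) F i x) = (fun=> 0) by apply/funext => x; rewrite big_nil.
  by split; [exact: bmeas_cst | rewrite big_nil Rintegral_cst // mul0r].
have -> : (fun x => \sum_(j <- i :: s) F j x) = (fun x => F i x + \sum_(j <- s) F j x).
  by apply/funext => x; rewrite big_cons.
split; first exact: bmeasD.
by rewrite big_cons -IH RintegralD //; exact: bmeas_int.
Qed.

Lemma Rintegral_indic A : measurable A -> Rintegral P setT (\1_A) = fine (P A).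
Proof. by move=> mA; rewrite /Rintegral integral_indic // setIT. Qed.

Variables (I : finType) (c : T -> I).
Hypothesis mc : forall k, measurable (c @^-1` [set k]).

Lemma step_integral (s : I -> R) : bmeas (s \o c) /\
  Rintegral P setT (s \o c) = \sum_k s k * fine (P (c @^-1` [set k])).
Proof.
have e : s \o c = (fun x => \sum_(k <- index_enum I) s k * \1_(c @^-1` [set k]) x).
  apply/funext => x /=; rewrite (bigD1 (c x)) //= big1 ?addr0 => [|k /eqP kx].
    by rewrite indicE mem_set ?mulr1.
  by rewrite indicE memNset ?mulr0 // => /= h; exact: kx.
rewrite e; have [b ->] := bmeas_sum (index_enum I) (fun k => bmeasZ (s k) (bmeas_indic (mc k))).
split=> //; apply: eq_bigr => k _.
by rewrite RintegralZl //; [rewrite Rintegral_indic | apply: bmeas_int; exact: bmeas_indic].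
Qed.

Lemma cells_mass : \sum_k fine (P (c @^-1` [set k])) = 1.
Proof.
have [_] := step_integral (fun=> 1); have -> : Rintegral P setT ((fun=> 1) \o c) = 1.
  have := Rintegral_cst P measurableT 1; rewrite mul1r => e.
  by rewrite -[RHS]/(fine 1%:E) -(probability_setT P); exact: e.
by move=> ->; apply: eq_bigr => k _; rewrite mul1r.
Qed.

Lemma step_approx g (s : I -> R) (J : pred I) (h B : R) : bmeas g -> 0 <= h ->
  (forall x, `|g x| <= B) -> (forall k, `|s k| <= B) -> (forall x, ~~ J (c x) -> `|g x - s (c x)| <= h) ->
  `|Rintegral P setT g - \sum_k s k * fine (P (c @^-1` [set k]))| <=
     h + 2 * B * \sum_(k | J k) fine (P (c @^-1` [set k])).
Proof.
move=> bg h0 gB sB near; have [bs <-] := step_integral s.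
have B0 : 0 <= B := le_trans (normr_ge0 _) (gB point).
have bd : bmeas (fun x => g x - (s \o c) x).
  have -> : (fun x => g x - (s \o c) x) = (fun x => g x + (-1) * (s \o c) x) by apply/funext => x; rewrite mulN1r.
  by apply: bmeasD => //; exact: bmeasZ.
rewrite -RintegralB //; [|exact: bmeas_int|exact: bmeas_int].
apply: le_trans (le_normr_Rintegral _ (bmeas_int bd)) _ => //.
have [bt tE] := step_integral (fun k => h + 2 * B * (J k)%:R).
apply: le_trans (_ : Rintegral P setT ((fun k => h + 2 * B * (J k)%:R) \o c) <= _).
  apply: le_Rintegral => //; [by apply: bmeas_int; exact: bmeas_norm | exact: bmeas_int |].
  move=> x _ /=; have [Jx|nJ] := boolP (J (c x)).
    by rewrite mulr1; apply: le_trans (ler_normB _ _) _; have := gB x; have := sB (c x); lra.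
  by rewrite mulr0 addr0; exact: near.
rewrite tE; under eq_bigr do rewrite mulrDl.
rewrite big_split /= -mulr_sumr cells_mass mulr1 lerD2l.
rewrite mulr_sumr [leRHS]big_mkcond; apply: ler_sum => k _.
by case: (J k); rewrite ?mulr1 ?mulr0 ?mul0r.
Qed.

End bounded_measurable.

Lemma grid d (T : measurableType d) (R : realType) n (g : 'I_n -> T -> R) (B h : R) :
  (forall i, measurable_fun setT (g i)) -> (forall i x, `|g i x| <= B) -> 0 < h ->
  exists (I : finType) (c : T -> I), (forall k, measurable (c @^-1` [set k])) /\
    forall x y, c x = c y -> forall i, `|g i x - g i y| <= h.
Proof.
move=> mg gB h0; pose t i x := Num.truncn ((g i x + B) / h); pose K := Num.truncn (2 * B / h).
have tP i x : (t i x)%:R <= (g i x + B) / h < (t i x).+1%:R.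
  apply: Num.Theory.truncn_itv; apply: divr_ge0; last exact: ltW.
  by have := gB i x; rewrite ler_norml => /andP[]; lra.
have tK i x : (t i x <= K)%N.
  apply: Num.Theory.le_truncn; rewrite ler_pM2r ?invr_gt0 //.
  by have := gB i x; rewrite ler_norml => /andP[]; lra.
exists {ffun 'I_n -> 'I_K.+1}, (fun x => [ffun i => inord (t i x)]); split=> [k|x y e i].
  have -> : (fun x => [ffun i => inord (t i x)]) @^-1` [set k] =
      \bigcap_(i in [set: 'I_n]) (g i @^-1` `[(k i)%:R * h - B, (k i).+1%:R * h - B[%classic).
    apply/seteqP; split=> x /=.
      move=> <- i _ /=; have := tP i x; rewrite ffunE inordK ?ltnS // in_itv /=.
      by rewrite ler_pdivlMr // ltr_pdivrMr //; case/andP => h1 h2; apply/andP; split; lra.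
    move=> hx; apply/ffunP => i; apply: val_inj; rewrite ffunE /= inordK ?ltnS //.
    have := hx i I; rewrite /= in_itv /= => /andP[h1 h2].
    have : (k i)%:R <= (g i x + B) / h < (k i).+1%:R.
      by rewrite ler_pdivlMr // ltr_pdivrMr //; apply/andP; split; lra.
    by move=> /Num.Theory.truncn_def.
  apply: fin_bigcap_measurable => // i _; rewrite -[X in measurable X]setTI; apply: mg => //.
have et : t i x = t i y.
  have := congr1 (fun f : {ffun 'I_n -> 'I_K.+1} => val (f i)) e.
  by rewrite !ffunE /= !inordK ?ltnS.
have := tP i x; have := tP i y; rewrite et -natr1 !ler_pdivlMr // !ltr_pdivrMr //.
move=> /andP[a1 a2] /andP[b1 b2]; rewrite ler_norml; apply/andP; split; lra.
Qed.

(** A cell is bad at time [N] if it contains no good point. As every point is eventually good, the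
    bad cells have small mass for some large [N]; the others are represented by good points, and the
    bad mass is put on any good point. *)
Lemma sampling d (T : measurableType d) (R : realType) (P : probability T R) n (g : nat -> 'I_n -> T -> R)
    (Good : nat -> T -> Prop) (B h : R) N1 :
  (forall N i, measurable_fun setT (g N i)) -> (forall N i x, `|g N i x| <= B) -> 0 < h ->
  (forall x, exists n0, forall N, (n0 <= N)%N -> Good N x) ->
  exists N p (w : 'I_p -> R) (xs : 'I_p -> T), [/\ (N1 <= N)%N, forall c, 0 <= w c, \sum_c w c = 1,
    forall c, Good N (xs c) & forall i, `|\sum_c w c * g N i (xs c) - Rintegral P setT (g N i)| <= h].
Proof.
move=> mg gB h0 ev.
have h2 : 0 < h / 2 by rewrite divr_gt0.
have /choice [Ic cP] : forall N, exists Ic : {I : finType & T -> I}, (forall k, measurable (projT2 Ic @^-1` [set k])) /\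
    forall x y, projT2 Ic x = projT2 Ic y -> forall i, `|g N i x - g N i y| <= h / 2.
  by move=> N; have [I [c cP]] := grid (mg N) (gB N) h2; exists (existT _ I c).
pose I N := projT1 (Ic N); pose c N : T -> I N := projT2 (Ic N).
pose J N : pred (I N) := fun k => `[< forall x, c N x = k -> ~ Good N x >].
pose Bad N := c N @^-1` [set k | J N k].
have mBad N : measurable (Bad N).
  have -> : Bad N = \bigcup_(k in [set k | J N k]) (c N @^-1` [set k]).
    by apply/seteqP; split=> x /=; [move=> Jx; exists (c N x) | move=> [k Jk ck]; change (is_true (J N (c N x))); have -> : c N x = k by exact: ck].
  apply: fin_bigcup_measurable => [|k _]; first exact: finite_finset.
  exact: (proj1 (cP N)).
have notBad N x : Good N x -> ~ Bad N x.
  by move=> Gx /asboolP /(_ x erefl).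
have dBm N : fine (P (Bad N)) = \sum_(k | J N k) fine (P (c N @^-1` [set k])).
  have [_ e] := step_integral P (proj1 (cP N)) (fun k => (J N k)%:R : R).
  rewrite -Rintegral_indic //; have -> : \1_(Bad N) = (fun k => (J N k)%:R : R) \o c N.
    by apply/funext => x; rewrite indicE /Bad /=; congr (nat_of_bool _)%:R; apply/idP/idP => [/set_mem //|Jx]; exact/mem_set.
  rewrite e [RHS]big_mkcond; apply: eq_bigr => k _; by case: (J N k); rewrite ?mul1r ?mul0r.
have small dl : 0 < dl -> exists2 N, (N1 <= N)%N & fine (P (Bad N)) < dl.
  move=> dl0; apply: contrapT => no.
  (* The points in a bad cell at some time from [m] on decrease to the empty set, so continuity from
     above applies. *)
  pose D m := \bigcup_(N in [set N | (m <= N)%N]) Bad N.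
  have mD m : measurable (D m) by apply: bigcup_measurable => N _; exact: mBad.
  have D0 : \bigcap_m D m = set0.
    apply/seteqP; split=> // x Dx; have [n0 n0P] := ev x.
    by have [N /= n0N bx] := Dx n0 Logic.I; apply: (notBad N x) => //; exact: n0P.
  have cv : P \o D @ \oo --> P (\bigcap_m D m).
    apply: nonincreasing_cvg_mu => //; first by apply: le_lt_trans (probability_le1 P (mD 0%N)) _; rewrite ltry.
      by rewrite D0.
    apply/nonincreasing_seqP => m; apply/subsetPset => x [N /= mN bx].
    by exists N => //=; exact: ltnW.
  rewrite D0 measure0 in cv.
  have ge m : (N1 <= m)%N -> (dl%:E <= P (D m))%E.
    move=> Nm; apply: le_trans (_ : P (Bad m) <= _)%E; last first.
      by apply: le_measure; [rewrite inE; exact: mBad | rewrite inE; exact: mD | move=> x bx; exists m => /=].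
    rewrite -[P (Bad m)]fineK ?fin_num_measure // lee_fin leNgt; apply/negP => lt; apply: no; by exists m.
  have : (dl%:E <= 0)%E.
    rewrite -[X in (_ <= X)%E](cvg_lim (@ereal_hausdorff R) cv).
    by apply: lime_ge; [apply/cvg_ex; exists 0%E; exact: cv | exists N1 => //= m /ge].
  by rewrite lee_fin leNgt dl0.
pose B' : R := Num.max B 1.
have B'1 : 1 <= B' by rewrite le_max lexx orbT.
have gB' N i x : `|g N i x| <= B' by apply: le_trans (gB N i x) _; rewrite le_max lexx.
(* Mass below 1 guarantees a cell that is not bad; the second bound absorbs the error on the bad
   ones. *)
have [|N NN1 lt] := small (Num.min 1 (h / (4 * B'))).
  by rewrite lt_min ltr01 divr_gt0 //; move: B'1; lra.
have [kg nJ] : exists k, ~~ J N k.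
  apply: contrapT => all; have : fine (P (Bad N)) = 1.
    rewrite dBm -[RHS](cells_mass P (proj1 (cP N))); apply: eq_bigl => k; apply/negPn/negP => nk; apply: all; by exists k.
  by move=> e; move: lt; rewrite e lt_min ltxx.
have good k : exists x, Good N x /\ (~~ J N k -> c N x = k).
  have gk k' : ~~ J N k' -> exists x, Good N x /\ c N x = k'.
    move=> /asboolPn; rewrite -existsNE => -[x /not_implyP [cx /contrapT Gx]]; by exists x.
  have [Jk|nk] := boolP (J N k); last by have [x [Gx cx]] := gk k nk; exists x.
  by have [x [Gx _]] := gk kg nJ; exists x.
have /choice [xs xsP] := good.
exists N, #|I N|, (fun j => fine (P (c N @^-1` [set enum_val j]))), (fun j => xs (enum_val j)); split=> //.
- by move=> j; apply: fine_ge0; exact: measure_ge0.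
- by rewrite -(cells_mass P (proj1 (cP N))) [RHS](reindex _ (onW_bij _ (enum_val_bij (I N)))).
- by move=> j; exact: (proj1 (xsP _)).
move=> i; rewrite distrC.
have -> : \sum_(j < #|I N|) fine (P (c N @^-1` [set enum_val j])) * g N i (xs (enum_val j)) =
    \sum_k g N i (xs k) * fine (P (c N @^-1` [set k])).
  by rewrite [RHS](reindex _ (onW_bij _ (enum_val_bij (I N)))); apply: eq_bigr => j _; rewrite mulrC.
have bg : bmeas (g N i) by split=> //; exists B'.
apply: le_trans (step_approx (J := J N) (h := h / 2) (B := B') P (proj1 (cP N)) bg (ltW h2) (gB' N i) (fun k => gB' N i _) _) _.
  by move=> x nx; apply: (proj2 (cP N)); apply/esym; exact: (proj2 (xsP (c N x)) nx).
rewrite -dBm; move: lt; rewrite lt_min => /andP[_]; rewrite ltr_pdivlMr; last by move: B'1; lra.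
by move=> lt; have := lt; lra.
Qed.

(** The integral formula is proved by comparing [g] with step functions on level cells, whose
    integrals are finite sums. *)
Lemma atomic_probability d (T : measurableType d) (R : realType) (I : finType) (a : I -> R) (z : I -> T) :
  (forall i, 0 <= a i) -> \sum_i a i = 1 ->
  exists nu : probability T R, (forall A, nu A = (\sum_i a i * (z i \in A)%:R)%:E) /\
    forall g, bmeas g -> Rintegral nu setT g = \sum_i a i * g (z i).
Proof.
move=> a0 a1.
pose m (k : nat) : {measure set T -> \bar R} :=
  if insub k : option 'I_#|I| is Some j then mscale (NngNum (a0 (enum_val j))) (dirac (z (enum_val j))) else mzero.
pose nu0 := msum m #|I|.
have nuE A : nu0 A = (\sum_i a i * (z i \in A)%:R)%:E.
  rewrite /nu0 /msum [in RHS](reindex _ (onW_bij _ (enum_val_bij I))) -sumEFin; apply: eq_bigr => j _.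
  by rewrite /m valK /= /mscale /= diracE.
have nu1 : nu0 setT = 1%E.
  by rewrite nuE; under eq_bigr do rewrite in_setT mulr1; rewrite a1.
pose nuP := Measure_isProbability.Build _ _ _ nu0 nu1.
pose nu : probability T R := HB.pack nu0 nuP.
exists nu; split=> // g [mg [B gB]]; have B0 : 0 <= B := le_trans (normr_ge0 _) (gB point).
apply/eqP; rewrite -subr_eq0 -normr_le0 leNgt; apply/negP => pos.
set D := `|_| in pos; have h0 : 0 < D / 3 by rewrite divr_gt0.
have [II [c [mc cP]]] := @grid _ T R 1 (fun=> g) B (D / 3) (fun=> mg) (fun=> gB) h0.
have /choice [xs xsP] : forall k, exists y, forall x, c x = k -> c y = k.
  by move=> k; have [[x <-]|no] := pselect (exists x, c x = k); [exists x | exists point => x cx; case: no; exists x].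
have near x : `|g x - g (xs (c x))| <= D / 3.
  by apply: (cP x (xs (c x)) _ ord0); rewrite (xsP (c x) x).
have := step_approx (J := xpred0) nu mc (conj mg (ex_intro _ B gB)) (ltW h0) gB (fun k => gB (xs k)) (fun x _ => near x).
rewrite big_pred0_eq mulr0 addr0.
have -> : \sum_k g (xs k) * fine (nu (c @^-1` [set k])) = \sum_i a i * g (xs (c (z i))).
  under eq_bigr => k _ do rewrite (_ : nu _ = nu0 (c @^-1` [set k])) // nuE /= mulr_sumr.
  rewrite exchange_big; apply: eq_bigr => i _ /=.
  rewrite (bigD1 (c (z i))) //= big1 ?addr0 => [|k /eqP kz]; first by rewrite mem_set // mulr1 mulrC.
  by rewrite memNset ?mulr0 // => /= h; exact: kz.
move=> h1; have h2 : `|\sum_i a i * g (xs (c (z i))) - \sum_i a i * g (z i)| <= D / 3.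
  rewrite -sumrB; apply: le_trans (ler_norm_sum _ _ _) _.
  apply: le_trans (_ : \sum_i a i * (D / 3) <= _); last by rewrite -mulr_suml a1 mul1r.
  by apply: ler_sum => i _; rewrite -mulrBr normrM ger0_norm // distrC; apply: ler_wpM2l.
have := ler_normD (Rintegral nu setT g - \sum_i a i * g (xs (c (z i)))) (\sum_i a i * g (xs (c (z i))) - \sum_i a i * g (z i)).
by rewrite addrA subrK -/D; move: h1 h2 pos; lra.
Qed.

Section borel_facts.
Variables (R : realType) (X : topologicalZmodType).

Lemma borel_open (A : set X) : open A -> measurable (A : set (borel X)).
Proof. by move=> oA; apply: sub_sigma_algebra. Qed.

Lemma continuous_borel (f : X -> R) : continuous f -> measurable_fun [set: borel X] (f : borel X -> R).
Proof.
move=> cf; apply: (measurability (@RGenOpens.G R)) => [|_ [_ [x [y ->] <-]]]; first exact: RGenOpens.measurableE.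
rewrite setTI; apply: borel_open; apply: open_comp => [z _|]; [exact: cf | exact: itv_open].
Qed.

Lemma continuous_borel_map (T : X -> X) (A : set X) : continuous T -> measurable (A : set (borel X)) ->
  measurable (T @^-1` A : set (borel X)).
Proof.
move=> cT mA; have mT : @measurable_fun _ _ (borel X) (borel X) setT T.
  apply: (@measurability _ _ (borel X) (borel X) setT T (@open X : set (set (pt X)))) => // _ [A' oA' <-].
  by rewrite setTI; apply: borel_open; apply: open_comp => // z _; exact: cT.
by rewrite -[X in measurable X]setTI; exact: mT.
Qed.

End borel_facts.

Lemma orbit_shift (R : realType) (A : Type) (F : A -> R) (T : A -> A) P x : iter P T x = x ->
  \sum_(t < P) F (T (iter t T x)) = \sum_(t < P) F (iter t T x).
Proof.
move=> per; apply: (addrI (F x)).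
have := big_ord_recl P (fun t => F (iter t T x)); rewrite /= => <-.
by rewrite big_ord_recr /= per addrC.
Qed.

Section invariant_integrals.
Variables (R : realType) (X : topologicalZmodType).
Hypothesis cX : compact [set: X].

Lemma bmeas_continuous (f : X -> R) : continuous f -> bmeas (f : borel X -> R).
Proof.
move=> cf; split; first exact: continuous_borel.
by have [B _ fB] := continuous_bounded cX cf; exists B%:R.
Qed.

Lemma integral_EFin (f : X -> R) (nu : probability (borel X) R) : continuous f ->
  (\int[nu]_x (f x)%:E = (Rintegral nu [set: borel X] f)%:E)%E.
Proof.
move=> cf; rewrite /Rintegral fineK //; apply: integrable_fin_num => //.
exact: bmeas_int (bmeas_continuous cf).
Qed.

Variables (T : X -> X) (mu : probability (borel X) R) (f : X -> R).
Hypothesis cT : continuous T.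
Hypotheses (imu : invariant T mu) (cf : continuous f).

(** Invariance is known on sets; it passes to [g] through a step function whose cells have the same
    measure before and after pulling back by [T]. *)
Lemma integral_shift (g : X -> R) : continuous g ->
  Rintegral mu [set: borel X] (g \o T) = Rintegral mu [set: borel X] g.
Proof.
move=> cg; have [Bn _ gB] := continuous_bounded cX cg; set B : R := Bn%:R in gB.
apply/eqP; rewrite -subr_eq0 -normr_le0 leNgt; apply/negP => pos.
set D := `|_| in pos; have h0 : 0 < D / 3 by rewrite divr_gt0.
have [I [c [mc cP]]] := @grid _ (borel X) R 1 (fun=> g) B (D / 3) (fun=> continuous_borel cg) (fun=> gB) h0.
have /choice [xs xsP] : forall k, exists y : X, forall x, c x = k -> c y = k.
  by move=> k; have [[x <-]|no] := pselect (exists x, c x = k); [exists x | exists 0 => x cx; case: no; exists x].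
have near x : `|g x - g (xs (c x))| <= D / 3.
  by apply: (cP x (xs (c x)) _ ord0); rewrite (xsP (c x) x).
have cgT : continuous (g \o T) by move=> x; apply: continuous_comp; [exact: cT | exact: cg].
have mc' k : measurable ((c \o T) @^-1` [set k] : set (borel X)).
  exact: (continuous_borel_map cT (mc k)).
have := step_approx (J := xpred0) mu mc (bmeas_continuous cg) (ltW h0) gB (fun k => gB (xs k)) (fun x _ => near x).
have := step_approx (J := xpred0) mu mc' (bmeas_continuous cgT) (ltW h0) (fun x => gB (T x)) (fun k => gB (xs k)) (fun x _ => near (T x)).
rewrite !big_pred0_eq mulr0 addr0.
have -> : \sum_k g (xs k) * fine (mu ((c \o T) @^-1` [set k])) = \sum_k g (xs k) * fine (mu (c @^-1` [set k])).
  by apply: eq_bigr => k _; have := imu (mc k) => <-.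
set S := \sum_k _ => h1 h2.
have := ler_normD (Rintegral mu setT (g \o T) - S) (S - Rintegral mu setT g).
by rewrite addrA subrK -/D [`|S - _|]distrC; move: h1 h2 pos; lra.
Qed.

Lemma integral_iter t : Rintegral mu [set: borel X] (fun x => f (iter t T x)) = Rintegral mu [set: borel X] f.
Proof.
elim: t => // t IH; rewrite -[RHS]IH.
transitivity (Rintegral mu [set: borel X] ((fun x => f (iter t T x)) \o T)).
  by congr Rintegral; apply/funext => x; rewrite /= -iterS iterSr.
apply: integral_shift.
by move=> x; apply: (@continuous_comp _ _ _ (iter t T)); [exact: iter_continuous | exact: cf].
Qed.

Lemma bmeas_bavg N : (0 < N)%N -> bmeas (bavg f T N : borel X -> R) /\
  Rintegral mu [set: borel X] (bavg f T N) = Rintegral mu [set: borel X] f.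
Proof.
move=> N0; pose F (t : 'I_N) := (fun x => f (iter t T x)) : borel X -> R.
have bF t : bmeas (F t).
  by apply: bmeas_continuous => x; apply: (@continuous_comp _ _ _ (iter t T)); [exact: iter_continuous | exact: cf].
have [b e] := bmeas_sum mu (index_enum 'I_N) bF.
have -> : (bavg f T N : borel X -> R) = (fun x => N%:R^-1 * \sum_(t <- index_enum 'I_N) F t x).
  by apply/funext => x; rewrite /bavg mulrC.
split; first exact: bmeasZ.
rewrite RintegralZl //; last exact: bmeas_int.
rewrite e; under eq_bigr do rewrite integral_iter.
rewrite sumr_const card_ord -[X in _ * X]mulr_natl mulKf // pnatr_eq0 -lt0n //.
Qed.

End invariant_integrals.

Section orbit_measures.
Variables (R : realType) (X : topologicalZmodType) (T : X -> X) (p : nat) (w : 'I_p -> R) (xs : 'I_p -> X) (P : 'I_p -> nat).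
Hypotheses (w0 : forall c, 0 <= w c) (w1 : \sum_c w c = 1) (P0 : forall c, (0 < P c)%N)
  (per : forall c, iter (P c) T (xs c) = xs c).

Lemma orbit_measure : exists nu : probability (borel X) R,
  [/\ forall A, nu A = (\sum_c w c * bavg (fun y => (y \in A)%:R) T (P c) (xs c))%:E, invariant T nu, finitely_supported nu &
    forall g : borel X -> R, bmeas g -> Rintegral nu setT g = \sum_c w c * bavg g T (P c) (xs c)].
Proof.
pose I : finType := {c : 'I_p & 'I_(P c)}.
pose a (i : I) := w (tag i) / (P (tag i))%:R; pose z (i : I) : borel X := iter (tagged i) T (xs (tag i)).
have sumI (F : X -> R) : \sum_(i : I) a i * F (z i) = \sum_c w c * bavg F T (P c) (xs c).
  rewrite -(@sig_big_dep _ _ _ _ (fun c => 'I_(P c)) xpredT (fun _ => xpredT)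
    (fun c (t : 'I_(P c)) => w c / (P c)%:R * F (iter t T (xs c)))) /=.
  by apply: eq_bigr => c _; rewrite -mulr_sumr /bavg -mulrA [_^-1 * _]mulrC.
have a0 i : 0 <= a i by rewrite divr_ge0 ?ler0n.
have a1 : \sum_i a i = 1.
  rewrite -w1; transitivity (\sum_(i : I) a i * (fun=> 1) (z i)); first by apply: eq_bigr => i _; rewrite mulr1.
  rewrite (sumI (fun=> 1)); apply: eq_bigr => c _.
  by rewrite /bavg sumr_const card_ord divff ?mulr1 // pnatr_eq0 -lt0n.
have [nu [nuA nug]] := @atomic_probability _ (borel X) R I a z a0 a1.
have nuE A : nu A = (\sum_c w c * bavg (fun y => (y \in A)%:R) T (P c) (xs c))%:E.
  by rewrite nuA (sumI (fun y => (y \in A)%:R)).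
exists nu; split=> //; last by move=> g bg; rewrite nug // sumI.
- move=> A mA; rewrite !nuE; congr (_%:E); apply: eq_bigr => c _; congr (_ * (_ / _)).
  rewrite -[RHS](@orbit_shift _ _ (fun y => (y \in A)%:R) T _ _ (per c)); apply: eq_bigr => t _; congr (nat_of_bool _)%:R.
- exists (z @` setT); split; first by apply: finite_image; exact: finite_finset.
  rewrite nuA; congr (_%:E); rewrite -[RHS]a1; apply: eq_bigr => i _.
  by rewrite mem_set ?mulr1 //; exists i.
Qed.

End orbit_measures.

Lemma periodic_measures_dense (R : realType) (X : topologicalZmodType) (T T' : {additive X -> X}) :
  cancel T T' -> cancel T' T -> continuous T -> continuous T' -> compact [set: X] -> metrizable R X ->
  hausdorff_space X -> dcc T ->
  weak_star_dense_in_MT T (fun nu : probability (borel X) R => finitely_supported nu).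
Proof.
move=> TK T'K cT cT' cX mX hX D mu imu n f cf eps eps0.
have e4 : 0 < eps / 4 by rewrite divr_gt0.
have /choice [Bf BfP] : forall i, exists B : nat, (0 < B)%N /\ forall x, `|f i x| <= B%:R.
  by move=> i; have [B h1 h2] := continuous_bounded cX (cf i); exists B.
pose B : R := \sum_i (Bf i)%:R.
have fB i z : `|f i z| <= B.
  apply: le_trans (proj2 (BfP i) z) _; rewrite /B (bigD1 i) //= lerDl sumr_ge0 // => j _; exact: ler0n.
pose Good N (x : borel X) := exists x' P, [/\ (0 < P)%N, iter P T x' = x' &
    forall i, `|bavg (f i) T N x - bavg (f i) T P x'| <= eps / 4].
pose g N i : borel X -> R := bavg (f i) T N.+1.
have [||N [p [w [xs [N1 w0 w1 Gx sm]]]]] := @sampling _ (borel X) R mu n g (fun N => Good N.+1) B (eps / 4) 1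
    _ (fun N i x => bavg_bound _ _ _ (fB i)) e4 _.
- by move=> N i; have [[h _] _] := bmeas_bavg cX cT imu (cf i) (ltn0Sn N).
- move=> x; have [n0 n0P] := pointwise_periodic x TK T'K cT cT' cX mX hX D cf e4.
  by exists n0 => N NN; apply: n0P; exact: leqW.
have /choice [x' /choice [P xP]] := Gx.
have [nu [_ inu fnu nug]] := orbit_measure w0 w1 (fun c => let: And3 h _ _ := xP c in h) (fun c => let: And3 _ h _ := xP c in h).
exists nu; split=> // i; rewrite !integral_EFin //.
rewrite -EFinB abse_EFin lte_fin nug; last exact: bmeas_continuous.
have := sm i; have [_ ->] := bmeas_bavg cX cT imu (cf i) (ltn0Sn N); rewrite distrC => h1.
have h2 : `|\sum_c w c * g N i (xs c) - \sum_c w c * bavg (f i) T (P c) (x' c)| <= eps / 4.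
  rewrite -sumrB; apply: le_trans (ler_norm_sum _ _ _) _; apply: le_trans (_ : \sum_c w c * (eps / 4) <= _).
    apply: ler_sum => c _; rewrite -mulrBr normrM ger0_norm //; apply: ler_wpM2l => //.
    by have [_ _ h] := xP c; exact: h.
  by rewrite -mulr_suml w1 mul1r.
have := ler_normD (Rintegral mu setT (f i) - \sum_c w c * g N i (xs c)) (\sum_c w c * g N i (xs c) - \sum_c w c * bavg (f i) T (P c) (x' c)).
by rewrite addrA subrK; move: h1 h2 eps0; lra.
Qed.

(** With [Y] the whole group there is no unipotent component and nothing to match: the prescribed
    blocks are sampled points repeated according to their weights, and the uniform measure on one
    periodic orbit is ergodic. *)
Lemma ergodic_periodic_measures_dense (R : realType) (X : topologicalZmodType) (T T' : {additive X -> X}) :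
  cancel T T' -> cancel T' T -> continuous T -> continuous T' -> compact [set: X] -> metrizable R X ->
  hausdorff_space X -> dcc T -> (forall m y, (0 < m)%N -> exists x, iter m T x - x = y) ->
  weak_star_dense_in_MT T (fun nu : probability (borel X) R => finitely_supported nu /\ ergodic T nu).
Proof.
move=> TK T'K cT cT' cX mX hX D surj mu imu n f cf eps eps0.
have e8 : 0 < eps / 8 by rewrite divr_gt0.
have /choice [Bf BfP] : forall i, exists B : nat, (0 < B)%N /\ forall x, `|f i x| <= B%:R.
  by move=> i; have [B h1 h2] := continuous_bounded cX (cf i); exists B.
pose B : R := \sum_i (Bf i)%:R.
have B0 : 0 <= B by apply: sumr_ge0 => i _; exact: ler0n.
have fB i z : `|f i z| <= B.
  apply: le_trans (proj2 (BfP i) z) _; rewrite /B (bigD1 i) //= lerDl sumr_ge0 // => j _; exact: ler0n.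
have [s0 [e0 [ce0 sep0]]] := finite_separating TK T'K cT cT' cX mX D.
have [s1 [chi [d [d0 cchi control]]]] := control_chars cX mX cf e8.
pose J : finType := ('I_s0 + 'I_s1)%type.
pose e (j : 'I_#|J|) z := match (enum_val j : J) with inl i => e0 i z | inr i => chi i z end.
have ce j : cchar (e j) by rewrite /e; case: (enum_val j).
have sepe z : [set: X] z -> (forall j m, e j (iter m T z) = 1 /\ e j (iter m T' z) = 1) -> z = 0.
  by move=> _ h; apply: sep0 => i m; have := h (enum_rank (inl i : J)) m; rewrite /e enum_rankK.
have control' z z' : (forall j, normc (e j z - e j z') < d) -> forall i, `|f i z - f i z'| <= eps / 8.
  by move=> h; apply: control => i; have := h (enum_rank (inr i : J)); rewrite /e enum_rankK.
have TT x : [set: X] (T x) <-> [set: X] x by [].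
have surj' m y : (0 < m)%N -> [set: X] y -> exists2 x, [set: X] x & iter m T x - x = y.
  by move=> m0 _; have [x xy] := surj m y m0; exists x.
have [b [b' [b_gt0 _ _ gl]]] := glue_average TK T'K cT cT' hX (@subgrpT X) cX TT surj' ce sepe fB B0 e8 d0 control'.
(* Every point is good here, since any orbit block can be glued; sampling only discretizes [mu]. *)
have [||_ [p [w [xs [_ w0 w1 _ sm]]]]] := @sampling _ (borel X) R mu n (fun _ i => bavg (f i) T b) (fun _ _ => True) B (eps / 8) 0
    _ (fun N i x => bavg_bound _ _ _ (fB i)) e8 _.
- by move=> N i; have [[h _] _] := bmeas_bavg cX cT imu (cf i) b_gt0.
- by move=> x; exists 0%N.
have p0 : (0 < p)%N.
  by case: (p) w w1 {xs w0 sm} => // w; rewrite big_ord0 => /eqP; rewrite eq_sym oner_eq0.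
have [M0 glM] := gl 1%N isT.
pose M := (M0 + Num.bound (2 * B * p%:R / (eps / 8))).+1.
have [sl slP] := quantize M p0 w0 w1.
have [|N [N0 _ glN]] := glM M; first by rewrite /M leqW // leq_addr.
pose ys j := if insub j is Some jj then xs (sl jj) : X else 0.
have it0 : iter N T 0 = 0 by rewrite raddf0.
have [q [_ per qP]] := glN ys (fun=> 0) 0 (fun=> Logic.I) it0.
have MR : (0 : R) < M%:R by rewrite ltr0n.
have [nu [nuA inu fnu nug]] := orbit_measure (w := fun _ : 'I_1 => 1 : R) (xs := fun=> q) (P := fun=> N)
  (fun=> ler01) (big_ord1 _ _) (fun=> N0) (fun=> per).
exists nu; split=> // [|i].
  split=> // A mA TA; rewrite nuA big_ord1 mul1r /bavg.
  have inA t : (iter t T q \in A) = (q \in A).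
    elim: t => //= t <-; apply/idP/idP => /set_mem h; apply/mem_set; last by rewrite -TA in h.
    by rewrite -TA.
  under eq_bigr do rewrite inA.
  rewrite sumr_const card_ord; case: (q \in A); first by right; rewrite divff // pnatr_eq0 -lt0n.
  by left; rewrite mul0rn mul0r.
rewrite !integral_EFin // -EFinB abse_EFin lte_fin nug; last exact: bmeas_continuous.
rewrite big_ord1 mul1r.
have h1 := sm i; have [_ e1] := bmeas_bavg cX cT imu (cf i) b_gt0; rewrite e1 in h1.
have h2 := slP B (fun c => bavg (f i) T b (xs c)) (fun c => bavg_bound _ _ _ (fB i)).
have := qP i; rewrite addr0.
have -> : #|[pred j : 'I_M | [exists t : 'I_b, exists k, (d / 2 <= normc (e k (iter (j * b' + t) T 0) - e k (iter t T 0)))%R]]| = 0%N.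
  apply: eq_card0 => j; apply/negbTE/negP => /existsP[t /existsP[k]].
  rewrite !raddf0; have /eqP -> : normc (e k 0 - e k 0) == 0 by rewrite normc_eq0 subrr.
  by rewrite leNgt divr_gt0.
rewrite mul0r mulr0 addr0.
have -> : (\sum_(j < M) (\sum_(t < b) f i (iter t T (ys j + 0))) / b%:R) / M%:R = (\sum_(j < M) bavg (f i) T b (xs (sl j))) / M%:R.
  by congr (_ / _); apply: eq_bigr => j _; rewrite /ys valK addr0.
rewrite -/(bavg (f i) T N q) => h3.
have h4 : `|(\sum_(j < M) bavg (f i) T b (xs (sl j))) / M%:R - \sum_c w c * bavg (f i) T b (xs c)| <= eps / 8.
  have -> : (\sum_(j < M) bavg (f i) T b (xs (sl j))) / M%:R - \sum_c w c * bavg (f i) T b (xs c) =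
      (\sum_(j < M) bavg (f i) T b (xs (sl j)) - M%:R * \sum_c w c * bavg (f i) T b (xs c)) / M%:R.
    by rewrite mulrBl [M%:R * _]mulrC mulfK // gt_eqF.
  rewrite normrM normfV [`|M%:R|]ger0_norm ?ler0n // ler_pdivrMr //.
  apply: le_trans h2 _; rewrite [leRHS]mulrC -ler_pdivrMr //; apply: ltW; apply: lt_le_trans (archi_boundP _) _.
    by rewrite divr_ge0 ?(ltW e8) // !mulr_ge0.
  by rewrite ler_nat /M leqW // leq_addl.
set a1 := Rintegral _ _ _ in h1 *; set a2 := \sum_c w c * _ in h1 h4; set a3 := _ / M%:R in h3 h4; set a4 := bavg _ _ _ _ in h3 *.
have := ler_normD (a1 - a2) (a2 - a3); rewrite addrA subrK [`|a1 - a2|]distrC [`|a2 - a3|]distrC.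
have := ler_normD (a1 - a3) (a3 - a4); rewrite addrA subrK [`|a3 - a4|]distrC.
by move: h1 h3 h4 eps0; lra.
Qed.

(** * Haar measure *)

Section haar_content.
Variables (R : realType) (X : topologicalZmodType).
Hypothesis cX : compact [set: X].
Implicit Types (A B C : set X).

Definition content_axiom (m : set X -> R) := [/\ forall A, 0 <= m A, m setT = 1, forall A B, A `<=` B -> m A <= m B &
  forall A B, A `&` B = set0 -> m (A `|` B) = m A + m B].

(** Invariance up to [W]: [B] has to contain [A] translated by [x] with room for two errors, one
    from approximating [x] by [sig] and one from [sig] not being additive. *)
Definition shift_axiom (W : set X) (m : set X -> R) := forall x A B,
  (forall a w w', A a -> W w -> W w' -> B (a + x - w - w')) -> m A <= m B.

(** The measure of a set is its share of the points of an approximating finite group, where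
    translation is a bijection. *)
Lemma frequency W : nbhs (0 : X) W -> exists m, content_axiom m /\ shift_axiom W m.
Proof.
move=> nW; have [d [l [s [sX sW]]]] := approx_group cX nW.
pose Q : finType := {ffun 'I_d -> 'Z_l.+2}.
have Q0 : (0 : R) < #|Q|%:R by rewrite ltr0n; apply/card_gt0P; exists 0.
pose c A := #|[pred q : Q | `[< A (sig s q) >]]|.
exists (fun A => (c A)%:R / #|Q|%:R); split; first split.
- by move=> A; rewrite divr_ge0 ?ler0n.
- rewrite (_ : c setT = #|Q|) ?divff ?gt_eqF //.
  by apply: eq_card => q; rewrite !inE; apply/asboolP.
- move=> A B AB; rewrite ler_pM2r ?invr_gt0 // ler_nat; apply: subset_leq_card; apply/fintype.subsetP => q.
  by move=> h; exact: (asboolT (AB _ (asboolW h))).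
- move=> A B AB; rewrite -mulrDl -natrD; congr (_%:R / _).
  rewrite /c -cardUI [X in (_ + X)%N]eq_card0 ?addn0.
    apply: eq_card => q; apply/idP/orP; first by move=> /asboolW [] h; [left|right]; exact: asboolT.
    by move=> [] /asboolW h; apply: asboolT; [left|right].
  move=> q; apply/negbTE/negP => /andP[/asboolW a /asboolW b].
  by have : (A `&` B) (sig s q) by []; rewrite AB.
move=> x A B h; rewrite ler_pM2r ?invr_gt0 // ler_nat.
have [q0 xq0] := sX x.
rewrite /c -(fintype.card_image (@addIr _ (q0 : Q)) [pred q : Q | `[< A (sig s q) >]]).
apply: subset_leq_card; apply/fintype.subsetP => u /fintype.imageP[q /asboolW Aq ->]; apply: asboolT.
have := h _ _ _ Aq xq0 (sW q q0).
have -> : sig s q + x - (x - sig s q0) - (sig s q + sig s q0 - sig s (q + q0)) = sig s (q + q0) by rewrite -[_ + x - _]addrA subKr subKr.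
by [].
Qed.

Lemma invariant_content : exists m, content_axiom m /\ forall W, nbhs (0 : X) W -> shift_axiom W m.
Proof.
pose D := filter_from [set V : set X | nbhs (0 : X) V] (fun V => [set W : set X | nbhs (0 : X) W /\ W `<=` V]).
have PD : ProperFilter D.
  apply: filter_from_proper; last by move=> V nV; exists V; split.
  apply: filter_from_filter; first by exists setT; exact: filterT.
  move=> V V' nV nV'; exists (V `&` V'); first exact: filterI.
  by move=> W [nW WV]; split; split=> // x /WV [].
have [U [UU DU]] := ultraFilterLemma PD.
have PU : ProperFilter U by exact: ultra_proper.
have UD V : nbhs (0 : X) V -> U [set W : set X | nbhs (0 : X) W /\ W `<=` V] by move=> nV; apply: DU; exists V.
have /choice [fr frP] : forall W, exists m, content_axiom m /\ (nbhs (0 : X) W -> shift_axiom W m).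
  move=> W; have [nW|no] := pselect (nbhs (0 : X) W); first by have [m [h1 h2]] := frequency nW; exists m.
  by have [m [h1 _]] := frequency (filterT : nbhs (0 : X) setT); exists m.
have fr1 W A : `|fr W A| <= 1.
  by have [[h1 h2 h3 _] _] := frP W; rewrite ger0_norm // -h2; exact: h3.
have /choice [m mP] A : exists l : R, fr ^~ A @ U --> l by exact: (@ultra_lim R _ U (fr ^~ A) 1 UU (fr1 ^~ A)).
have near A e : 0 < e -> U [set W | `|m A - fr W A| <= e].
  by move=> e0; move: (mP A) => /cvgrPdist_le /(_ _ e0).
have small (a b : R) : (forall e, 0 < e -> a <= b + e) -> a <= b by move=> h; apply/ler_addgt0Pr.
have le_m A B : U [set W | fr W A <= fr W B] -> m A <= m B.
  move=> UAB; apply: small => e e0; have e2 : 0 < e / 2 by rewrite divr_gt0.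
  have [W [[h1 h2] h3]] := @filter_ex _ U PU _ (filterI (filterI (near A _ e2) (near B _ e2)) UAB).
  by move: h1 h2 h3; rewrite /= !ler_norml => /andP[a1 a2] /andP[b1 b2]; lra.
have eq_m A B C : (forall W, fr W A = fr W B + fr W C) -> m A = m B + m C.
  move=> h; apply/eqP; rewrite -subr_eq0 -normr_le0; apply: small => e e0; rewrite add0r.
  have e3 : 0 < e / 3 by rewrite divr_gt0.
  have [W [[h1 h2] h3]] := @filter_ex _ U PU _ (filterI (filterI (near A _ e3) (near B _ e3)) (near C _ e3)).
  have := h W; move: h1 h2 h3; rewrite /= !ler_norml => /andP[a1 a2] /andP[b1 b2] /andP[c1 c2] E.
  by apply/andP; split; lra.
have m0 : m set0 = 0.
  apply: (addIr (m set0)); rewrite add0r; apply/esym/eq_m => W.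
  by have [[_ _ _ h] _] := frP W; rewrite -h ?setU0 ?setI0.
have mT : m setT = 1.
  apply/eqP; rewrite -subr_eq0 -normr_le0; apply: small => e e0; rewrite add0r.
  have [W h] := @filter_ex _ U PU _ (near setT e e0); have [[_ h2 _ _] _] := frP W.
  by move: h; rewrite /= h2.
have le_all A B : (forall W, fr W A <= fr W B) -> m A <= m B.
  by move=> h; apply: le_m; apply: filterS filterT => W _; exact: h.
exists m; split; first split=> //.
- move=> A; rewrite -m0; apply: le_all => W; have [[_ _ h _] _] := frP W; exact: h.
- by move=> A B AB; apply: le_all => W; have [[_ _ h _] _] := frP W; exact: h.
- by move=> A B AB; apply: eq_m => W; have [[_ _ _ h] _] := frP W; exact: h.
move=> V nV x A B h; apply: le_m; apply: filterS (UD V nV) => W [nW WV] /=.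
by have [_ /(_ nW) hs] := frP W; apply: (hs x) => a w w' Aa /WV Vw /WV Vw'; exact: h.
Qed.

End haar_content.

Section haar_measure.
Variables (R : realType) (X : topologicalZmodType).
Hypotheses (cX : compact [set: X]) (hX : hausdorff_space X).
Variable m : set X -> R.
Hypotheses (cm : content_axiom m) (sm : forall W, nbhs (0%R : X) W -> shift_axiom W m).
Implicit Types (A B C U V : set X).

Local Open Scope ereal_scope.

(** The limit of frequencies is only finitely additive and approximately invariant. Closed sets from
    inside and open sets from outside bring in compactness, which repairs both defects. *)
Definition vol U : \bar R := ereal_sup [set (m C)%:E | C in [set C | closed C /\ C `<=` U]].

Definition outer A : \bar R := ereal_inf [set vol U | U in [set U | open U /\ A `<=` U]].

Lemma le_vol_content C U : closed C -> C `<=` U -> (m C)%:E <= vol U.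
Proof. by move=> cC CU; apply: ereal_sup_ubound; exists C. Qed.

Lemma vol_le U (b : \bar R) : (forall C, closed C -> C `<=` U -> (m C)%:E <= b) -> vol U <= b.
Proof. by move=> h; apply: ge_ereal_sup => _ [C [cC CU] <-]; exact: h. Qed.

Lemma outer_le A U : open U -> A `<=` U -> outer A <= vol U.
Proof. by move=> oU AU; apply: ereal_inf_lbound; exists U. Qed.

Lemma le_outer A (b : \bar R) : (forall U, open U -> A `<=` U -> b <= vol U) -> b <= outer A.
Proof. by move=> h; apply: le_ereal_inf_tmp => _ [U [oU AU] <-]; exact: h. Qed.

Lemma content0 : m set0 = 0%R.
Proof.
have [_ _ _ /(_ set0 set0)] := cm; rewrite setI0 setU0 => /(_ erefl) e.
by apply: (addrI (m set0)); rewrite -e addr0.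
Qed.

Lemma vol_ge0 U : 0 <= vol U.
Proof. by have := @le_vol_content set0 U closed0 (@sub0set _ U); rewrite content0. Qed.

Lemma outer_ge0 A : 0 <= outer A.
Proof. by apply: le_outer => U _ _; exact: vol_ge0. Qed.

Lemma vol_le1 U : vol U <= 1.
Proof. by have [_ m1 mle _] := cm; apply: vol_le => C _ _; rewrite lee_fin -m1; exact: mle. Qed.

Lemma outer_le1 A : outer A <= 1.
Proof. by apply: le_trans (outer_le openT (@subsetT _ A)) (vol_le1 _). Qed.

Lemma outer_mono A B : A `<=` B -> outer A <= outer B.
Proof. by move=> AB; apply: le_outer => U oU BU; apply: outer_le => // x /AB /BU. Qed.

Lemma outer_set0 : outer set0 = 0.
Proof.
apply/eqP; rewrite eq_le outer_ge0 andbT; apply: (@le_trans _ _ (vol set0)); first by apply: outer_le => //; exact: open0.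
by apply: vol_le => C _; rewrite subset0 => ->; rewrite content0.
Qed.

Lemma outer_setT : outer setT = 1.
Proof.
apply/eqP; rewrite eq_le outer_le1 /=; apply: le_outer => U _ TU.
have [_ m1 _ _] := cm; rewrite -m1; exact: le_vol_content closedT TU.
Qed.

Lemma regular_nbhs x U : open U -> U x -> exists K, [/\ closed K, nbhs x K & K `<=` U].
Proof.
move=> oU Ux; have nU : nbhs x U by exact: open_nbhs_nbhs.
have [N nN NU] := nbhs0_sub (nbhs_add0 nU).
exists (closure [set y | N (y - x)%R]); split; [exact: closed_closure | by apply: filterS (nbhs_sub0 x nN); exact: subset_closure |].
move=> y /(_ _ (nbhs_sub0 y nN)) [z [/= zx zy]].
have := NU _ _ zx zy => /=; rewrite (_ : (x + (z - x - (z - y)) = y)%R) //.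
have -> : (z - x - (z - y) = y - x)%R by rewrite opprB addrC addrA subrK.
by rewrite addrC subrK.
Qed.

Lemma content_bigcup (n : nat) (C : nat -> set X) : (m (\bigcup_(i in [set i | (i < n)%N]) C i) <= \sum_(i < n) m (C i))%R.
Proof.
have [m0 _ mle mU] := cm; elim: n => [|n IH].
  by rewrite big_ord0 -content0; apply: mle => x [].
rewrite big_ord_recr /=; apply: le_trans (lerD IH (lexx _)).
set D := \bigcup_(i in [set i | (i < n)%N]) C i.
have e : \bigcup_(i in [set i | (i < n.+1)%N]) C i = D `|` (C n `\` D).
  apply/seteqP; split=> x.
    move=> [i /=]; rewrite ltnS leq_eqVlt => /orP[/eqP -> Cx|lt Cx]; last by left; exists i.
    by have [|nD] := pselect (D x); [left | right].
  by move=> [[i /= lt Cx]|[Cx _]]; [exists i => //=; exact: ltnW | exists n => /=].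
rewrite e mU; last by apply/seteqP; split=> // x [Dx [_ /(_ Dx)]].
by rewrite lerD2l; apply: mle; exact: subDsetl.
Qed.

(** A closed set in the union is covered by finitely many closed neighbourhoods, each inside some
    [U i]; grouping them by [i] reduces the claim to finite subadditivity of the content. *)
Lemma vol_sigma_subadditive (U : nat -> set X) : (forall i, open (U i)) ->
  vol (\bigcup_i U i) <= \sum_(i <oo) vol (U i).
Proof.
move=> oU; apply: vol_le => C cC CU.
have cptC : compact C by apply: (subclosed_compact cC cX).
have [|s sP] := @compact_subcover X C (nat * set X) (fun p => [set y | closed p.2 /\ p.2 `<=` U p.1 /\ p.2 y]) cptC.
  move=> x /CU [i _ Ux]; have [K [cK nK KU]] := regular_nbhs (oU i) Ux.
  by exists (i, K); apply: filterS nK => y Ky.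
have cl (t : seq (nat * set X)) i : closed (\bigcup_(p in [set p : nat * set X | List.In p t /\ p.1 = i /\ closed p.2 /\ p.2 `<=` U p.1]) p.2).
  elim: t => [|p t IH].
    rewrite (_ : \bigcup_(_ in _) _ = set0); first exact: closed0.
    by apply/seteqP; split=> // x [p [[]]].
  have [ok|no] := pselect (p.1 = i /\ closed p.2 /\ p.2 `<=` U p.1).
    rewrite (_ : \bigcup_(_ in _) _ = p.2 `|` \bigcup_(p0 in [set p0 : nat * set X | List.In p0 t /\ p0.1 = i /\ closed p0.2 /\ p0.2 `<=` U p0.1]) p0.2).
      by apply: closedU => //; case: ok => _ [].
    apply/seteqP; split=> x.
      by move=> [p' [/= [<-|ps] h] px]; [left | right; exists p'].
    by move=> [px|[p' [/= ps h] px]]; [exists p => //=; split=> //; left | exists p' => //=; split=> //; right].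
  rewrite (_ : \bigcup_(_ in _) _ = \bigcup_(p0 in [set p0 : nat * set X | List.In p0 t /\ p0.1 = i /\ closed p0.2 /\ p0.2 `<=` U p0.1]) p0.2) //.
  apply/seteqP; split=> x; first by move=> [p' [/= [e|ps] h] px]; [case: no; rewrite e | exists p'].
  by move=> [p' [/= ps h] px]; exists p' => //=; split=> //; right.
pose Ci i := \bigcup_(p in [set p : nat * set X | List.In p s /\ p.1 = i /\ closed p.2 /\ p.2 `<=` U p.1]) p.2.
have cCi i : closed (Ci i) by exact: cl.
pose n := (\max_(p <- s) p.1).+1.
have Cn : C `<=` \bigcup_(i in [set i | (i < n)%N]) Ci i.
  move=> x /sP [p ps [cp [pU px]]]; exists p.1; last by exists p.
  rewrite /= ltnS; elim: (s) ps => //= a t IH; rewrite big_cons => -[->|/IH h]; [exact: leq_maxl | exact: leq_trans h (leq_maxr _ _)].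
have [_ _ mle _] := cm.
apply: le_trans (_ : (\sum_(i < n) m (Ci i))%:E <= _).
  by rewrite lee_fin; apply: le_trans (mle _ _ Cn) (content_bigcup _ _).
apply: le_trans (_ : \sum_(0 <= i < n) vol (U i) <= _); last first.
  by apply: (nneseries_lim_ge n) => i _ _; exact: vol_ge0.
rewrite big_mkord -sumEFin; apply: lee_sum => i _; apply: le_vol_content; first exact: cCi.
by move=> x [p [/= _ [<- [_ pU]]] px]; exact: pU.
Qed.

Lemma outer_sigma_subadditive : sigma_subadditive outer.
Proof.
move=> A; apply/lee_addgt0Pr => e e0.
have /choice [U UP] : forall i, exists U, [/\ open U, A i `<=` U & vol U <= outer (A i) + (e / (2 ^ i.+1)%:R)%:E].
  move=> i; have d0 : (0 < e / (2 ^ i.+1)%:R)%R by rewrite divr_gt0 // ltr0n expn_gt0.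
  have fin : outer (A i) \is a fin_num.
    by rewrite ge0_fin_numE ?outer_ge0 // (le_lt_trans (outer_le1 _)) // ltry.
  have [_ [U [oU AU] <-] lt] := lb_ereal_inf_adherent d0 fin.
  by exists U; split=> //; exact: ltW.
apply: le_trans (_ : vol (\bigcup_i U i) <= _).
  apply: outer_le; first by apply: bigcup_open => i _; have [] := UP i.
  by move=> x [i _ Ax]; exists i => //; have [_ AU _] := UP i; exact: AU.
apply: le_trans (vol_sigma_subadditive (fun i => let: And3 h _ _ := UP i in h)) _.
apply: le_trans (epsilon_trick xpredT (fun i => outer_ge0 (A i)) (ltW e0)).
by apply: lee_nneseries => i _; [move=> _; exact: vol_ge0 | by have [] := UP i].
Qed.

Lemma open_caratheodory U : open U -> forall A, outer (A `&` U) + outer (A `&` ~` U) <= outer A.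
Proof.
move=> oU A; apply: le_outer => V oV AV.
apply: le_trans (_ : vol (V `&` U) + outer (V `&` ~` U) <= _).
  apply: leeD; last by apply: outer_mono; exact: setSI.
  by apply: outer_le; [exact: openI | exact: setSI].
have fin B : outer B \is a fin_num.
  by rewrite ge0_fin_numE ?outer_ge0 // (le_lt_trans (outer_le1 _)) // ltry.
rewrite -leeBrDr //; apply: vol_le => C cC CVU; rewrite leeBrDr //.
rewrite addeC -leeBrDr //; apply: le_trans (_ : vol (V `\` C) <= _).
  apply: outer_le; first by rewrite setDE; apply: openI => //; exact: closed_openC.
  by move=> x [Vx nU]; split=> // /CVU [_ /nU].
apply: vol_le => D cD DVC; rewrite leeBrDr // -EFinD addrC.
have [_ _ _ mU] := cm; rewrite -mU; last by apply/seteqP; split=> // x [Cx /DVC [_ /(_ Cx)]].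
apply: le_vol_content; first exact: closedU.
by move=> x [/CVU [] // | /DVC []].
Qed.

(** A closed subset of the open [U] leaves room for a neighbourhood of 0, which absorbs the errors
    of [shift_axiom]: on open sets the invariance becomes exact. *)
Lemma vol_translate x U : open U -> vol U <= vol [set y | U (y - x)%R].
Proof.
move=> oU; apply: vol_le => C cC CU.
have cptC : compact C by apply: (subclosed_compact cC cX).
have [|s sP] := @compact_subcover X C {p : X * set X | nbhs (0%R : X) p.2 /\ forall w w', p.2 w -> p.2 w' -> U (p.1 + (w + w'))%R}
    (fun p => [set y | (sval p).2 (y - (sval p).1)%R]) cptC.
  move=> a /CU Ua; have nU : nbhs a U by exact: open_nbhs_nbhs.
  have [N nN NU] := nbhs0_add (nbhs_add0 nU).
  by exists (exist (fun p : X * set X => nbhs (0%R : X) p.2 /\ forall w w', p.2 w -> p.2 w' -> U (p.1 + (w + w'))%R) (a, N) (conj nN NU)) => /=; exact: nbhs_sub0.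
have [N nN NU] : exists2 N, nbhs (0%R : X) N & forall a w, C a -> N w -> U (a + w)%R.
  exists [set w | forall p, List.In p s -> (sval p).2 w].
    elim: s {sP} => [|p s IH]; first by apply: filterS filterT => w _ p [].
    have [np _] := svalP p; apply: filterS (filterI np IH) => w [h1 h2] p' /= [<- //|]; exact: h2.
  move=> a w Ca wP; have [p ps ap] := sP a Ca; have [_ h] := svalP p.
  by have := h _ _ ap (wP p ps); rewrite addrA [((sval p).1 + _)%R]addrC subrK.
(* Three errors must fit into [N]: the two of [shift_axiom] and one from taking the closure. *)
have [N' nN' N'N] := nbhs0_sum 3 (nbhs0N nN).
pose D := closure [set z | exists a w w', [/\ C a, N' w, N' w' & z = a + x - w - w']%R].
apply: le_trans (_ : (m D)%:E <= _).
  rewrite lee_fin; apply: (sm nN' (x := x)) => a w w' Ca Nw Nw'.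
  by apply: subset_closure; exists a, w, w'.
apply: le_vol_content; first exact: closed_closure.
move=> y /(_ _ (nbhs_sub0 y nN')) [_ [[a [w [w' [Ca Nw Nw' ->]]]] /= Nz]].
have := N'N (fun i : 'I_3 => if i == 0%N :> nat then w else if i == 1%N :> nat then w' else a + x - w - w' - y)%R.
rewrite !big_ord_recl big_ord0 /= addr0 => h.
have := NU a _ Ca (h _); rewrite !opprD !opprK.
have -> : (- a - x + w + w' + y = w' + (w + (- a + (y - x))))%R by rewrite (ACl (4*(3*(1*(5*2))))).
rewrite [(- w' + _)%R]addKr [(- w + _)%R]addKr [(a + (- a + _))%R]addrA subrr add0r.
by apply; move=> [[|[|[|]]]].
Qed.

Lemma outer_translate x A : outer ((fun y => x + y)%R @^-1` A) = outer A.
Proof.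
have le z B : outer ((fun y => z + y)%R @^-1` B) <= outer B.
  apply: le_outer => U oU BU; apply: le_trans (_ : vol ((fun y => z + y)%R @^-1` U) <= _).
    apply: outer_le; last by move=> y /BU.
    by apply: open_comp => // y _; exact: addl_continuous.
  apply: le_trans (vol_translate z _) _; first by apply: open_comp => // y _; exact: addl_continuous.
  rewrite (_ : [set y | _] = U) //; apply/funext => y /=.
  by rewrite addrC subrK.
apply/eqP; rewrite eq_le le /=; apply: le_trans (le (- x)%R _).
by apply: outer_mono => y Ay /=; rewrite addrA subrr add0r.
Qed.

End haar_measure.

Lemma measure_probability d (T : measurableType d) (R : realType) (nu : {measure set T -> \bar R}) :
  nu setT = 1%E -> exists P : probability T R, forall A, P A = nu A.
Proof.
move=> nu1; pose nu0 := mscale (NngNum (@ler01 R)) nu.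
have nuE A : nu0 A = nu A by rewrite /nu0 /mscale /= mul1e.
have nu01 : nu0 setT = 1%E by rewrite nuE.
pose nuP := Measure_isProbability.Build _ _ _ nu0 nu01.
by pose P : probability T R := HB.pack nu0 nuP; exists P.
Qed.

Lemma haar_exists (R : realType) (X : topologicalZmodType) : compact [set: X] -> hausdorff_space X ->
  exists m : probability (borel X) R, haar m.
Proof.
move=> cX hX; have [m [cm sm]] := @invariant_content R X cX.
pose mu0 : set (pt X) -> \bar R := outer m.
pose mu : {outer_measure set (pt X) -> \bar R} := HB.pack mu0 (isOuterMeasure.Build R (pt X) mu0 (outer_set0 cm)
  (outer_ge0 cm) (fun A B => @outer_mono R X m A B) (outer_sigma_subadditive cX cm)).
have bm (A : set (borel X)) : measurable A -> caratheodory_measurable mu A.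
  apply: smallest_sub => [|U oU]; last first.
    by apply: le_caratheodory_measurable => B; exact: (open_caratheodory cm).
  split; first exact: caratheodory_measurable_set0.
    by move=> B mB; rewrite setTD; exact: caratheodory_measurable_setC.
  by move=> B mB; exact: caratheodory_measurable_bigcup.
have sa : semi_sigma_additive (mu0 : set (borel X) -> \bar R).
  by move=> A mA tA mU; apply: (@caratheodory_measure_sigma_additive R (pt X) mu) => // [i|]; exact: bm.
pose nuM := isMeasure.Build _ (borel X) R mu0 (outer_set0 cm) (outer_ge0 cm) sa.
have [nu0 nuE] : exists nu0 : {measure set (borel X) -> \bar R}, forall A, nu0 A = outer m A.
  by pose nu0 : {measure set (borel X) -> \bar R} := HB.pack mu0 nuM; exists nu0.
have nu1 : nu0 setT = 1%E by rewrite nuE outer_setT.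
have [nu nuE1] := measure_probability nu1.
by exists nu => x A mA; rewrite !nuE1; apply: etrans (nuE _) _; apply: etrans (esym (nuE _)); apply: outer_translate.
Qed.

(** Finitely many translates of [U] cover the group, so [U] cannot have measure 0. *)
Lemma haar_open_neq0 (R : realType) (X : topologicalZmodType) (m : probability (borel X) R) (U : set X) x :
  compact [set: X] -> haar m -> open U -> U x -> m U <> 0%E.
Proof.
move=> cX hm oU Ux mU0.
pose D i := (fun y : X => x - i + y) @^-1` U.
have oD i : open (D i) by apply: open_comp => // y _; exact: addl_continuous.
have [|s sP] := @compact_subcover X setT X D cX.
  by move=> y _; exists y; apply: open_nbhs_nbhs; split; [exact: oD | rewrite /D /= subrK].
have all0 (t : seq X) : measurable ([set y | exists2 i, List.In i t & D i y] : set (borel X)) /\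
    m [set y | exists2 i, List.In i t & D i y] = 0%E.
  elim: t => [|a t [mt t0]].
    by rewrite (_ : [set y | _] = set0) ?measure0 //; apply/seteqP; split=> // y [].
  rewrite (_ : [set y | _] = D a `|` [set y | exists2 i, List.In i t & D i y]); last first.
    apply/seteqP; split=> y; first by move=> [i /= [<-|ti] Diy]; [left | right; exists i].
    by move=> [Dy|[i ti Dy]]; [exists a => //; left | exists i => //; right].
  have mD : measurable (D a : set (borel X)) by exact: borel_open.
  split; first exact: measurableU.
  by rewrite measureU0 //; apply: etrans mU0; apply: hm; exact: borel_open.
have [_] := all0 s; rewrite (_ : [set y | _] = setT) => [h|]; first by have := probability_setT m; rewrite h => /eqP; rewrite eq_sym onee_eq0.
by apply/seteqP; split=> // y _; exact: sP.
Qed.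

(** * Ergodicity of Haar measure makes [T^n - 1] surjective *)

Section ergodic_haar.
Variables (R : realType) (X : topologicalZmodType) (T : {additive X -> X}) (mu : probability (borel X) R).
Hypotheses (cX : compact [set: X]) (hX : hausdorff_space X) (cT : continuous T) (hm : haar mu) (em : ergodic T mu).

(** On the quotient by the image [Z] of [T^n - 1] the map [T] has finite order. If [Z] is proper,
    the finitely many preimages of a small neighbourhood of 0 there form an invariant open set that
    misses a neighbourhood of [y], so its measure is neither 0 nor 1. *)
Lemma ergodic_surjective n y : (0 < n)%N -> exists x, iter n T x - x = y.
Proof.
move=> n0; apply: contrapT => noy.
have cti i : continuous (iter i T).
  by elim: i => [|i IH] x //=; apply: (@continuous_comp _ _ _ (iter i T) T); [exact: IH | exact: cT].
have iB i a b : iter i T (a - b) = iter i T a - iter i T b by elim: i => //= i ->; rewrite raddfB.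
have iD i a b : iter i T (a + b) = iter i T a + iter i T b by elim: i => //= i ->; rewrite raddfD.
pose Z := (fun x => iter n T x - x) @` [set: X].
have cZ : closed Z.
  apply: compact_closed => //; apply: continuous_compact => //; apply: continuous_subspaceT => x.
  by apply: continuous_subf => u; [exact: cti | exact: cvg_id].
have ZB a b : Z a -> Z b -> Z (a - b).
  move=> [u _ <-] [v _ <-]; exists (u - v) => //=.
  by rewrite iB !opprB addrACA [RHS]addrACA [- u - _]addrC.
have Z0 : Z 0 by exists 0 => //=; rewrite subr0; elim: (n) => //= k ->; rewrite raddf0.
have ZD a b : Z a -> Z b -> Z (a + b).
  by move=> za zb; rewrite -[b]opprK; apply: (ZB) => //; rewrite -[- b]add0r; exact: ZB.
have ZT i a : Z a -> Z (iter i T a).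
  by move=> [u _ <-]; exists (iter i T u) => //=; rewrite iB -!iterD addnC.
have Zn a : Z (iter n T a - a) by exists a.
have nZ i : (i <= n)%N -> ~ Z (iter i T y).
  move=> le /(ZT (n - i)%N); rewrite -iterD subnK // => zy; apply: noy.
  by have [x _ e] := ZB _ _ zy (Zn y); exists x; apply: etrans e _; exact: subKr.
have [M nM MP] : exists2 M, nbhs (0 : X) M & forall i a b, (i < n)%N -> M a -> M b -> ~ Z (iter i T y + (a - b)).
  have : (n <= n)%N by []; elim: {1 3}(n) => [|k IH] le; first by exists setT => //; exact: filterT.
  have [M nM MP] := IH (ltnW le).
  have nN : nbhs (iter k T y) (~` Z) by apply: open_nbhs_nbhs; split; [exact: closed_openC | apply: nZ; exact: ltnW].
  have [N nN0 NP] := nbhs0_sub (nbhs_add0 nN).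
  exists (M `&` N); first exact: filterI.
  by move=> i a b; rewrite ltnS leq_eqVlt => /orP[/eqP ->|lt] [Ma Na] [Mb Nb]; [exact: NP | exact: MP].
pose W := interior M.
have oW : open W by exact: open_interior.
have W0 : W 0 by exact: nM.
have WM a : W a -> M a by move=> /interior_subset.
(* The points that some [T^i], [i < n], sends into [W] modulo [Z]; invariance holds because
   [T^n x - x] lies in [Z]. *)
pose U := \bigcup_(p in [set p : nat * X | (p.1 < n)%N /\ Z p.2]) ((fun x => iter p.1 T x + p.2) @^-1` W).
have oU : open U.
  apply: bigcup_open => p _; apply: open_comp => // x _.
  apply: (@continuous_comp _ _ _ (iter p.1 T) (fun t => t + p.2)); first exact: cti.
  by rewrite (_ : (fun t => _) = (fun t => p.2 + t)); [exact: addl_continuous | apply/funext => v; rewrite addrC].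
have TU : T @^-1` U = U.
  apply/seteqP; split=> x.
    move=> [[i z] [/= lt Zz]]; rewrite -iterSr => Wx; have [lt1|ge1] := ltnP i.+1 n; first by exists (i.+1, z).
    have e : i.+1 = n by apply/eqP; rewrite eqn_leq lt ge1.
    exists (0%N, iter n T x - x + z) => /=; first by split=> //; exact: ZD.
    by rewrite addrA [x + _]addrC subrK -e.
  move=> [[[|i] z] [/= lt Zz]] Wx; last by exists (i, z); [split=> //; exact: ltnW | rewrite /= -iterSr].
  exists (n.-1, z - (iter n T x - x)) => /=; first by split; [rewrite prednK | exact: ZB].
  by rewrite -iterSr prednK // opprB addrCA [iter n T x + _]addrC subrK addrC.
have mU : measurable (U : set (borel X)) by exact: borel_open.
have U0 : U 0.
  by exists (0%N, 0) => //=; rewrite addr0.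
have mU1 : mu U = 1%E by have [/(haar_open_neq0 cX hm oU U0)|] := em mU TU.
have nN : nbhs (0 : X) [set t | forall i, (i < n)%N -> W (iter i T t)].
  elim: (n) => [|k IH]; first by apply: filterS filterT.
  have nk : nbhs (0 : X) (iter k T @^-1` W).
    apply: open_nbhs_nbhs; split; first by apply: open_comp => // x _; exact: cti.
    by rewrite /= -[X in iter k T X](subrr 0) iB subrr.
  by apply: filterS (filterI IH nk) => t [h1 h2] i; rewrite ltnS leq_eqVlt => /orP[/eqP ->|/h1].
pose V := interior [set x | [set t | forall i, (i < n)%N -> W (iter i T t)] (x - y)].
have oV : open V by exact: open_interior.
have Vy : V y by exact: nbhs_sub0.
have VU : V `&` U = set0.
  apply/seteqP; split=> // x [/interior_subset h [[i z] [/= lt Zz] Wx]].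
  apply: (MP i (iter i T (x - y)) _ lt (WM _ (h _ lt)) (WM _ Wx)).
  have -> : iter i T y + (iter i T (x - y) - (iter i T x + z)) = 0 - z; last exact: ZB.
  by rewrite iB opprD addrA addrA [iter i T y + _]addrC subrK subrr.
have mV : measurable (V : set (borel X)) by exact: borel_open.
have : (mu V + mu U <= 1)%E.
  apply: le_trans (probability_le1 mu (measurableU _ _ mV mU)); rewrite le_eqVlt; apply/orP; left.
  by apply/eqP; exact: esym (measureU mu mV mU VU).
rewrite mU1 -leeBrDr // subee // => le0.
apply: (haar_open_neq0 cX hm oV Vy); apply/eqP; rewrite eq_le le0 /=; exact: measure_ge0.
Qed.

End ergodic_haar.

Lemma continuous_can (X Y : topologicalType) (f : X -> Y) (g : Y -> X) : compact [set: X] -> hausdorff_space Y ->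
  cancel f g -> cancel g f -> continuous f -> continuous g.
Proof.
move=> cX hY fK gK cf; apply/continuousP => U oU.
rewrite (_ : g @^-1` U = ~` (f @` ~` U)).
  apply: closed_openC; apply: compact_closed => //; apply: continuous_compact; first exact: continuous_subspaceT.
  by apply: subclosed_compact cX _ => //; exact: open_closedC.
apply/seteqP; split=> y /=; first by move=> Ugy [x nUx e]; apply: nUx; rewrite -(fK x) e.
by move=> h; apply: contrapT => nU; apply: h; exists (g y).
Qed.

Theorem theorem1p1 (R : realType) (X : topologicalZmodType) (T : X -> X) :
  compact [set: X] -> metrizable R X ->
  cont_automorphism T -> dcc T ->
  weak_star_dense_in_MT T (fun nu : probability (borel X) R => finitely_supported nu) /\
  ((forall m : probability (borel X) R, haar m -> ergodic T m) ->
   weak_star_dense_in_MT T (fun nu : probability (borel X) R => finitely_supported nu /\ ergodic T nu)).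
Proof.
move=> cX mX [TD [T' TK T'K] cT] dT; have hX := metrizable_hausdorff mX.
have T0 : T 0 = 0 by apply: (addrI (T 0)); rewrite -TD !addr0.
have TB : zmod_morphism T.
  by move=> x y; rewrite TD; congr (_ + _); apply: (addrI (T y)); rewrite -TD !subrr.
have T'B : zmod_morphism T' by move=> x y; apply: (can_inj TK); rewrite TB !T'K.
pose Ta : {additive X -> X} := HB.pack T (GRing.isZmodMorphism.Build _ _ T TB).
pose Ta' : {additive X -> X} := HB.pack T' (GRing.isZmodMorphism.Build _ _ T' T'B).
have cT' : continuous T' by exact: continuous_can cX hX TK T'K cT.
split; first exact: (@periodic_measures_dense R X Ta Ta').
move=> eT; apply: (@ergodic_periodic_measures_dense R X Ta Ta') => // n y n0.
(* The hypothesis speaks of every Haar probability, so one must be produced before it can be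
   applied. *)
have [m hm] := @haar_exists R X cX hX.
exact: (@ergodic_surjective R X Ta m cX hX cT hm (eT m hm) n y n0).
Qed.
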